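(* Let $A$ be a Banach algebra (over $\mathbb{C}$, possibly nonunital) whose weak homological bidimension $\mathrm{db}_w A$ is finite. Then $A$ is $HP^\bullet$-rigid: whenever $\{A_t\}_{t\in J}$ is a smooth one-parameter deformation of algebras over an open interval $J\ni 0$ with $A_0=A$, there is a subinterval $J'\subseteq J$ containing $0$ such that $HP^\bullet(A_t)\cong HP^\bullet(A_0)$ for all $t\in J'$.
   Context: **Spaces.** All locally convex spaces are complete, Hausdorff and over $\mathbb{C}$; $\widehat\otimes$ is the completed projective tensor product. For an open interval $J\subseteq\mathbb{R}$ and a locally convex space $X$, $C^\infty(J,X)$ is the space of smooth $X$-valued functions with the topology of uniform convergence of all derivatives on compact subsets of $J$; $\epsilon_t(x)=x(t)$ is evaluation at $t$. **Deformations.** A smooth family of continuous linear maps from $X$ to $Y$ is a collection $\{F_t:X\to Y\}_{t\in J}$ for which there is a continuous linear map $\widetilde F:X\to C^\infty(J,Y)$ with $F_t=\epsilon_t\circ\widetilde F$ for all $t$. A smooth one-parameter deformation of algebras with underlying space $X$ is a smooth family $\{m_t:X\widehat\otimes X\to X\}_{t\in J}$ with each $m_t$ associative; $A_t=(X,m_t)$. **Weak bidimension.** For a Banach $A$-bimodule $M$, $H^\bullet(A,M)$ is the continuous Hochschild cohomology, i.e. the cohomology of $C^n(A,M)=\mathrm{Hom}(A^{\widehat\otimes n},M)$ (continuous linear maps) with $$(\delta D)(a_1,\dots,a_{n+1})=a_1D(a_2,\dots,a_{n+1})+\sum_{j=1}^n(-1)^jD(a_1,\dots,a_ja_{j+1},\dots,a_{n+1})+(-1)^{n+1}D(a_1,\dots,a_n)a_{n+1}.$$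 The Banach dual $M^*$ is an $A$-bimodule via $(a\cdot\phi\cdot b)(m)=\phi(bma)$. Then $\mathrm{db}_wA=\inf\{n\ge0: H^{n+1}(A,M^* )=0\text{ for all Banach }A\text{-bimodules }M\}$ ($\inf\emptyset=\infty$). **Periodic cyclic cohomology.** Let $A_+=A\oplus\mathbb{C}e$ be the unitization with new unit $e$ (formed even if $A$ is unital). Put $C_0(A)=A$, $C_n(A)=A_+\widehat\otimes A^{\widehat\otimes n}$ for $n\ge1$, and $C^n(A)=C_n(A)^*$ (continuous dual). Define $b:C^n(A)\to C^{n+1}(A)$ and $B:C^{n}(A)\to C^{n-1}(A)$ by $$b\phi(a_0,\dots,a_{n+1})=\sum_{j=0}^{n}(-1)^j\phi(a_0,\dots,a_ja_{j+1},\dots,a_{n+1})+(-1)^{n+1}\phi(a_{n+1}a_0,a_1,\dots,a_{n}),$$ $$B\phi(a_0,\dots,a_{n-1})=\sum_{j=0}^{n-1}(-1)^{j(n-1)}\phi(e,a_j,\dots,a_{n-1},a_0,\dots,a_{j-1})\ (a_0\in A),\qquad B\phi(e,a_1,\dots,a_{n-1})=0.$$ $HP^0(A)$ and $HP^1(A)$ are the even and odd cohomology of the $\mathbb{Z}/2$-graded complex $\bigoplus_n C^{2n}(A)\oplus\bigoplus_nC^{2n+1}(A)$ with differential $b+B$. *)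

(* Defs.v *)
From HB Require Import structures.
From mathcomp Require Import all_boot all_order all_algebra.
From mathcomp Require Import complex ring.
From mathcomp Require Import boolp classical_sets functions interval_inference.
From mathcomp Require Import reals ereal prodnormedzmodule.
From mathcomp Require Import topology normedtype.

Set Implicit Arguments.
Unset Strict Implicit.
Unset Printing Implicit Defensive.

Import Order.TTheory GRing.Theory Num.Theory.
Import numFieldNormedType.Exports.

Local Open Scope classical_set_scope.
Local Open Scope ring_scope.
Local Open Scope complex_scope.

Record submodule (K : fieldType) (V : lmodType K) := Submodule {
  submodule_pred :> {pred V};
  submodule_closedP : submod_closed submodule_pred }.

HB.instance Definition _ K V (S : @submodule K V) :=
  GRing.isSubmodClosed.Build K V (submodule_pred S)
    (GRing.submod_closed_semi (submodule_closedP S)).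
HB.instance Definition _ K V (S : @submodule K V) :=
  GRing.isOppClosed.Build V (submodule_pred S)
    (GRing.zmod_closedN (GRing.submod_closedB (submodule_closedP S))).

Definition subm (K : fieldType) (V : lmodType K) (S : submodule V) :=
  {v : V | v \in submodule_pred S}.

Definition subm_mk (K : fieldType) (V : lmodType K) (S : submodule V) (v : V)
  (vS : v \in submodule_pred S) : subm S := exist _ v vS.

HB.instance Definition _ K V (S : @submodule K V) := SubChoice.on (subm S).
HB.instance Definition _ K V (S : @submodule K V) :=
  [SubChoice_isSubLmodule of subm S by <:].

Section SubmoduleOfFunctions.
Variables (K : fieldType) (T : Type) (V : lmodType K) (S : @submodule K (T -> V)).
Implicit Types f g : subm S.

Lemma subm_funD f g t : val (f + g) t = val f t + val g t.
Proof. by rewrite raddfD. Qed.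

Lemma subm_funZ c f t : val (c *: f) t = c *: val f t.
Proof. by rewrite linearZ. Qed.

End SubmoduleOfFunctions.

Lemma subm_fun2P (K : fieldType) (T U : Type) (V : lmodType K)
    (S : @submodule K (T -> U -> V)) c (f g : subm S) t u :
  val (c *: f + g) t u = c *: val f t u + val g t u.
Proof. by rewrite linearP. Qed.

Lemma scale_add3 (K : comNzRingType) (V : lmodType K) (c s : K)
    (x x' y y' z z' : V) :
  (c *: x + x') + (c *: y + y') + s *: (c *: z + z') =
  c *: (x + y + s *: z) + (x' + y' + s *: z').
Proof.
by rewrite !scalerDr !scalerA [c * s]mulrC (addrACA (c *: x)) (addrACA (c *: x + _)).
Qed.

Lemma scale_add_sum (K : comNzRingType) (V : lmodType K) (I : finType)
    (c : K) (s : I -> K) (x y : I -> V) :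
  \sum_i s i *: (c *: x i + y i) =
  c *: (\sum_i s i *: x i) + \sum_i s i *: y i.
Proof.
rewrite scaler_sumr -big_split; apply: eq_bigr => i _ /=.
by rewrite scalerDr !scalerA [_ * c]mulrC.
Qed.

Lemma scale_addD (K : comNzRingType) (V : lmodType K) (c d : K) (x x' y y' : V) :
  c *: (d *: x + y) + (d *: x' + y') = d *: (c *: x + x') + (c *: y + y').
Proof. by rewrite !scalerDr !scalerA [c * d]mulrC addrACA. Qed.

Section Quotient.
Variables (K : fieldType) (V : lmodType K) (S : submodule V).

Definition qrel (v w : V) : bool := (v - w) \in submodule_pred S.

Lemma qrel_refl : reflexive qrel.
Proof. by move=> v; rewrite /qrel subrr rpred0. Qed.

Lemma qrel_sym : symmetric qrel.
Proof. by move=> v w; rewrite /qrel -opprB rpredN. Qed.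

Lemma qrel_trans : transitive qrel.
Proof.
by move=> w v u vw wu; rewrite /qrel -(subrK w v) -addrA rpredD.
Qed.

Definition qequiv := EquivRel qrel qrel_refl qrel_sym qrel_trans.

Definition quotm : Type := {eq_quot qequiv}%qT.

HB.instance Definition _ := Choice.on quotm.
HB.instance Definition _ := Quotient.on quotm.

Definition qpi (v : V) : quotm := (\pi_quotm v)%qT.

Lemma qpiP v w : qpi v = qpi w <-> (v - w) \in submodule_pred S.
Proof.
split; first by move/eqmodP.
by move=> h; apply/eqmodP.
Qed.

Lemma qrepr_sub v : (repr (qpi v) - v) \in submodule_pred S.
Proof. by apply/qpiP; rewrite /qpi reprK. Qed.

Definition qadd (x y : quotm) := qpi (repr x + repr y).
Definition qopp (x : quotm) := qpi (- repr x).
Definition qscale (a : K) (x : quotm) := qpi (a *: repr x).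

Lemma qpiD v w : qadd (qpi v) (qpi w) = qpi (v + w).
Proof. by apply/qpiP; rewrite opprD addrACA rpredD ?qrepr_sub. Qed.

Lemma qpiN v : qopp (qpi v) = qpi (- v).
Proof. by apply/qpiP; rewrite -opprD rpredN qrepr_sub. Qed.

Lemma qpiZ a v : qscale a (qpi v) = qpi (a *: v).
Proof. by apply/qpiP; rewrite -scalerBr rpredZ ?qrepr_sub. Qed.

Lemma qpi_surj (x : quotm) : exists v, x = qpi v.
Proof. by exists (repr x); rewrite /qpi reprK. Qed.

Lemma qaddA : associative qadd.
Proof.
move=> x y z; case: (qpi_surj x) (qpi_surj y) (qpi_surj z) => [u ->] [v ->] [w ->].
by rewrite !qpiD addrA.
Qed.

Lemma qaddC : commutative qadd.
Proof.
by move=> x y; case: (qpi_surj x) (qpi_surj y) => [u ->] [v ->]; rewrite !qpiD addrC.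
Qed.

Lemma qadd0 : left_id (qpi 0) qadd.
Proof. by move=> x; have [u ->] := qpi_surj x; rewrite !qpiD add0r. Qed.

Lemma qaddN : left_inverse (qpi 0) qopp qadd.
Proof. by move=> x; have [u ->] := qpi_surj x; rewrite qpiN !qpiD addNr. Qed.

HB.instance Definition _ := GRing.isZmodule.Build quotm qaddA qaddC qadd0 qaddN.

Lemma qscaleA a b x : qscale a (qscale b x) = qscale (a * b) x.
Proof. by have [u ->] := qpi_surj x; rewrite !qpiZ scalerA. Qed.

Lemma qscale1 : left_id 1 qscale.
Proof. by move=> x; have [u ->] := qpi_surj x; rewrite !qpiZ scale1r. Qed.

Lemma qscaleDr : right_distributive qscale +%R.
Proof.
move=> a x y; case: (qpi_surj x) (qpi_surj y) => [u ->] [v ->].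
by rewrite -[RHS]/(qadd _ _) -[qpi u + qpi v]/(qadd _ _) !(qpiZ, qpiD) scalerDr.
Qed.

Lemma qscaleDl x : {morph qscale^~ x : a b / a + b}.
Proof.
move=> a b; have [u ->] := qpi_surj x.
by rewrite -[RHS]/(qadd _ _) !(qpiZ, qpiD) scalerDl.
Qed.

HB.instance Definition _ := GRing.Zmodule_isLmodule.Build K quotm
  qscaleA qscale1 qscaleDr qscaleDl.

End Quotient.

Section Cohomology.
Variables (K : fieldType) (U V W : lmodType K).
Variables (f : {linear U -> V}) (g : {linear V -> W}).

Lemma ker_closed : submod_closed [pred v | g v == 0].
Proof.
split=> [|a u v]; rewrite !inE ?raddf0 // => /eqP gu /eqP gv.
by rewrite linearP gu gv scaler0 addr0.
Qed.

Definition kerm := Submodule ker_closed.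

Lemma im_closed :
  submod_closed [pred v : subm kerm | `[< exists u, val v = f u >]].
Proof.
split=> [|a v w]; rewrite !inE; first by exists 0; rewrite !raddf0.
move=> [u uv] [u' uw]; exists (a *: u + u').
have -> : val (a *: v + w) = a *: val v + val w by [].
by rewrite linearP uv uw.
Qed.

Definition imm := Submodule im_closed.

(* ker g / (im f :&: ker g); the intersection is im f when g \o f = 0. *)
Definition cohomology : lmodType K := quotm imm.

End Cohomology.

Definition lin_iso (K : fieldType) (U V : lmodType K) : Prop :=
  exists f : {linear U -> V}, bijective f.

Section DirectSum.
Variables (K : fieldType) (V : nat -> lmodType K).

Definition dprod : Type := forall n, V n.

HB.instance Definition _ := gen_eqMixin dprod.
HB.instance Definition _ := gen_choiceMixin dprod.

Definition dprod_add (x y : dprod) : dprod := fun n => x n + y n.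
Definition dprod_opp (x : dprod) : dprod := fun n => - x n.
Definition dprod_zero : dprod := fun n => 0.
Definition dprod_scale (a : K) (x : dprod) : dprod := fun n => a *: x n.

Lemma dprod_addA : associative dprod_add.
Proof. by move=> x y z; apply: functional_extensionality_dep => n; exact: addrA. Qed.
Lemma dprod_addC : commutative dprod_add.
Proof. by move=> x y; apply: functional_extensionality_dep => n; exact: addrC. Qed.
Lemma dprod_add0 : left_id dprod_zero dprod_add.
Proof. by move=> x; apply: functional_extensionality_dep => n; exact: add0r. Qed.
Lemma dprod_addN : left_inverse dprod_zero dprod_opp dprod_add.
Proof. by move=> x; apply: functional_extensionality_dep => n; exact: addNr. Qed.

HB.instance Definition _ := GRing.isZmodule.Build dprod
  dprod_addA dprod_addC dprod_add0 dprod_addN.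

Lemma dprod_scaleA a b x :
  dprod_scale a (dprod_scale b x) = dprod_scale (a * b) x.
Proof. by apply: functional_extensionality_dep => n; exact: scalerA. Qed.
Lemma dprod_scale1 : left_id 1 dprod_scale.
Proof. by move=> x; apply: functional_extensionality_dep => n; exact: scale1r. Qed.
Lemma dprod_scaleDr : right_distributive dprod_scale +%R.
Proof. by move=> a x y; apply: functional_extensionality_dep => n; exact: scalerDr. Qed.
Lemma dprod_scaleDl x : {morph dprod_scale^~ x : a b / a + b}.
Proof. by move=> a b; apply: functional_extensionality_dep => n; exact: scalerDl. Qed.

HB.instance Definition _ := GRing.Zmodule_isLmodule.Build K dprod
  dprod_scaleA dprod_scale1 dprod_scaleDr dprod_scaleDl.

Lemma finsupp_closed : submod_closed
  [pred x : dprod | `[< exists N, forall n, (N <= n)%N -> x n = 0 >]].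
Proof.
split=> [|a x y]; rewrite !inE; first by exists 0%N.
move=> [N hx] [M hy]; exists (maxn N M) => n.
rewrite geq_max => /andP[Nn Mn].
have -> : (a *: x + y) n = a *: x n + y n by [].
by rewrite hx // hy // scaler0 addr0.
Qed.

Definition dsum : lmodType K := subm (Submodule finsupp_closed).

Lemma subm_dprodP c (x y : dsum) n : val (c *: x + y) n = c *: val x n + val y n.
Proof. by []. Qed.

End DirectSum.

Section Multilinear.
Variable C : numFieldType.

Definition bounded_bilinear (U V W : normedModType C) (f : U -> V -> W) :=
  [/\ forall v, linear (f^~ v), forall u, linear (f u) &
      exists k : C, forall u v, `|f u v| <= k * `|u| * `|v|].

Definition upd (T : Type) n (a : 'I_n -> T) (i : 'I_n) (x : T) : 'I_n -> T :=
  fun j => if j == i then x else a j.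

Definition multilinear (X M : normedModType C) n (D : ('I_n -> X) -> M) :=
  forall a i, linear (fun x => D (upd a i x)).

(* For Banach X and M, the bounded n-linear maps are exactly the continuous
   linear maps from the n-fold completed projective tensor power of X to M. *)
Definition bounded_multilinear (X M : normedModType C) n
    (D : ('I_n -> X) -> M) :=
  multilinear D /\
  exists k : C, forall a, `|D a| <= k * \prod_(i < n) `|a i|.

Lemma bound_ge0 (T : Type) (f : T -> C) (g : T -> C) (k : C) :
  (forall t, 0 <= f t) -> (forall t, 0 <= g t) ->
  (forall t, f t <= k * g t) -> forall t, f t <= `|k| * g t.
Proof.
move=> f0 g0 fkg t; apply: le_trans (fkg t) _.
have kg0 : 0 <= k * g t by apply: le_trans (f0 t) (fkg t).
by rewrite -(ger0_norm kg0) normrM (ger0_norm (g0 t)).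
Qed.

Lemma bounded_bilinear_bound (U V W : normedModType C) (f : U -> V -> W) :
  bounded_bilinear f ->
  exists2 k : C, 0 <= k & forall u v, `|f u v| <= k * (`|u| * `|v|).
Proof.
move=> [_ _ [k fk]]; exists `|k| => // u v.
apply: (@bound_ge0 (U * V)%type (fun p => `|f p.1 p.2|)
  (fun p => `|p.1| * `|p.2|) k _ _ _ (u, v)) => [//|p|p].
- by rewrite mulr_ge0.
- by rewrite mulrA.
Qed.

Lemma prod_norm_ge0 (X : normedModType C) n (a : 'I_n -> X) :
  0 <= \prod_(i < n) `|a i|.
Proof. by apply: prodr_ge0. Qed.

Lemma bounded_multilinear_bound (X M : normedModType C) n
    (D : ('I_n -> X) -> M) : bounded_multilinear D ->
  exists2 k : C, 0 <= k & forall a, `|D a| <= k * \prod_(i < n) `|a i|.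
Proof.
move=> [_ [k Dk]]; exists `|k| => // a.
apply: (@bound_ge0 _ (fun a => `|D a|) (fun a => \prod_(i < n) `|a i|) k) => // b.
exact: prod_norm_ge0.
Qed.

Lemma bounded_multilinear_closed (X M : normedModType C) n :
  submod_closed [pred D : ('I_n -> X) -> M | `[< bounded_multilinear D >]].
Proof.
split=> [|c D E]; rewrite !inE.
  split=> [a i d x y|]; first by rewrite scaler0 addr0.
  by exists 0 => a; rewrite normr0 mul0r.
move=> hD hE; split=> [a i d x y|].
  have -> z : (c *: D + E) z = c *: D z + E z by [].
  by rewrite hD.1 hE.1 !scalerDr !scalerA [c * d]mulrC addrACA.
have [k k0 Dk] := bounded_multilinear_bound hD.
have [l l0 El] := bounded_multilinear_bound hE.
exists (`|c| * k + l) => a; apply: le_trans (ler_normD _ _) _.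
rewrite mulrDl lerD // normrZ -mulrA ler_wpM2l //.
Qed.

Section Updates.
Variables (X : normedModType C) (n : nat).
Implicit Types a b : 'I_n.+1 -> X.

Lemma upd_eq T m (a : 'I_m -> T) i x : upd a i x i = x.
Proof. by rewrite /upd eqxx. Qed.

Lemma upd_neq T m (a : 'I_m -> T) i j x : j != i -> upd a i x j = a j.
Proof. by rewrite /upd => /negPf ->. Qed.

Lemma updK T m (a : 'I_m -> T) i x y : upd (upd a i x) i y = upd a i y.
Proof. by apply/funext => j; rewrite /upd; case: eqP. Qed.

Lemma updC T m (a : 'I_m -> T) i j x y : i != j ->
  upd (upd a i x) j y = upd (upd a j y) i x.
Proof.
move=> ij; apply/funext => k; rewrite /upd; case: (k =P j) => // ->.
by rewrite eq_sym (negPf ij).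
Qed.

Lemma upd_lift_same a k x : upd a k x \o lift k = a \o lift k.
Proof. by apply/funext => j; rewrite /= /upd eq_sym (negPf (neq_lift k j)). Qed.

Lemma upd_lift a k i x :
  upd a (lift k i) x \o lift k = upd (a \o lift k) i x.
Proof. by apply/funext => j; rewrite /= /upd (inj_eq lift_inj). Qed.

Lemma prod_norm_lift a k :
  \prod_(i < n.+1) `|a i| = `|a k| * \prod_(i < n) `|a (lift k i)|.
Proof. by rewrite (bigD1_ord k). Qed.

End Updates.

Record algebra (X : completeNormedModType C) := Algebra {
  amul :> X -> X -> X;
  amulP : bounded_bilinear amul;
  amulA : associative amul }.

Definition banach_algebra (X : completeNormedModType C) (A : algebra X) :=
  forall a b, `|A a b| <= `|a| * `|b|.

Record bimodule (X : completeNormedModType C) (A : algebra X)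
    (M : normedModType C) := Bimodule {
  lact : X -> M -> M;
  ract : M -> X -> M;
  lactP : bounded_bilinear lact;
  ractP : bounded_bilinear ract;
  lactA : forall a b m, lact a (lact b m) = lact (A a b) m;
  ractA : forall a b m, ract (ract m a) b = ract m (A a b);
  lractA : forall a b m, lact a (ract m b) = ract (lact a m) b }.

(* (a_0, ..., a_n) |-> (a_0, ..., a_j a_(j+1), ..., a_n) *)
Definition mul_at (X : Type) (mul : X -> X -> X) n (j : 'I_n)
    (a : 'I_n.+1 -> X) : 'I_n -> X :=
  fun i => if (i < j)%N then a (lift ord_max i)
           else if i == j then mul (a (lift ord_max j)) (a (lift ord0 j))
           else a (lift ord0 i).

Lemma mul_atE (X : Type) (mul : X -> X -> X) n (j : 'I_n) (a : 'I_n.+1 -> X) :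
  let k := lift ord_max j in
  mul_at mul j a = upd (a \o lift k) j (mul (a k) (a (lift k j))).
Proof.
move=> k; apply/funext => i; rewrite /mul_at /upd /= -/k.
have kj : k = j :> nat by rewrite /k lift_max.
clearbody k.
have -> : lift k j = lift ord0 j.
  by apply: val_inj; rewrite /= kj /bump leqnn leq0n.
have [->|ij] := eqVneq i j; first by rewrite ltnn.
case: ltnP => ji; congr a; apply: val_inj.
- by rewrite [LHS]lift_max /= /bump kj leqNgt ji.
- by rewrite /= /bump kj leq0n ji.
Qed.

Section Faces.
Variables (X M : normedModType C) (n : nat).

Lemma drop_multilinear (N : normedModType C) (g : X -> M -> N)
    (D : ('I_n -> X) -> M) k :
  (forall m, linear (g^~ m)) -> (forall x, linear (g x)) -> multilinear D ->
  multilinear (fun a : 'I_n.+1 -> X => g (a k) (D (a \o lift k))).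
Proof.
move=> g1 g2 lD a i; have [j ->|->] := unliftP k i; move=> c x y.
  by rewrite !upd_lift lD !upd_neq ?neq_lift // g2.
by rewrite !upd_lift_same !upd_eq g1.
Qed.

Lemma mul_at_multilinear (A : X -> X -> X) (D : ('I_n -> X) -> M) j :
  bounded_bilinear A -> multilinear D ->
  multilinear (fun a => D (mul_at A j a)).
Proof.
move=> [A1 A2 _] lD a i c x y; rewrite !mul_atE; set k := lift ord_max j.
have [l ->|->] := unliftP k i; last first.
  have ej z : upd a k z (lift k j) = a (lift k j).
    by rewrite upd_neq // eq_sym neq_lift.
  by rewrite !upd_lift_same !upd_eq !ej A1 lD.
rewrite !upd_lift; have ek z : upd a (lift k l) z k = a k.
  by rewrite upd_neq // neq_lift.
rewrite !ek; have [->|lj] := eqVneq l j.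
  by rewrite !updK !upd_eq A2 lD.
have el z : upd a (lift k l) z (lift k j) = a (lift k j).
  by rewrite upd_neq // (inj_eq lift_inj) eq_sym.
by rewrite !el !(updC _ _ _ lj) lD.
Qed.

Lemma mul_at_bound (A : X -> X -> X) j : bounded_bilinear A ->
  exists2 k : C, 0 <= k & forall a : 'I_n.+1 -> X,
  \prod_(i < n) `|mul_at A j a i| <= k * \prod_(i < n.+1) `|a i|.
Proof.
move=> hA; have [k k0 Ak] := bounded_bilinear_bound hA.
exists k => // a; rewrite mul_atE; set l := lift ord_max j.
rewrite (prod_norm_lift a l) (bigD1 j) //= upd_eq.
rewrite (eq_bigr (fun i => `|a (lift l i)|)); last first.
  by move=> i ij; rewrite upd_neq.
rewrite [X in _ <= _ * (_ * X)](bigD1 j) //= !mulrA.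
by rewrite ler_wpM2r ?prodr_ge0 // -mulrA.
Qed.

End Faces.

Section Hochschild.
Variables (X : completeNormedModType C) (A : algebra X).
Variables (M : normedModType C) (B : bimodule A M).

Definition hcochain (n : nat) : lmodType C :=
  subm (Submodule (@bounded_multilinear_closed X M n)).

Lemma hcochainP n (D : hcochain n) : bounded_multilinear (val D).
Proof. by have := valP D; rewrite inE. Qed.

Definition hdelta_fun n (D : ('I_n -> X) -> M) (a : 'I_n.+1 -> X) : M :=
  lact B (a ord0) (D (a \o lift ord0))
  + \sum_(j < n) (-1) ^+ j.+1 *: D (mul_at A j a)
  + (-1) ^+ n.+1 *: ract B (D (a \o lift ord_max)) (a ord_max).

Lemma drop_bounded (N : normedModType C) n (g : X -> M -> N)
    (D : ('I_n -> X) -> M) k : bounded_bilinear g -> bounded_multilinear D ->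
  bounded_multilinear (fun a : 'I_n.+1 -> X => g (a k) (D (a \o lift k))).
Proof.
move=> hg hD; split.
  by case: hg hD => g1 g2 _ [lD _]; exact: (drop_multilinear k g1 g2 lD).
have [c c0 gc] := bounded_bilinear_bound hg.
have [d d0 Dd] := bounded_multilinear_bound hD.
exists (c * d) => a; apply: le_trans (gc _ _) _.
rewrite (prod_norm_lift a k) -mulrA ler_wpM2l // mulrCA ler_wpM2l //.
Qed.

Lemma mul_at_bounded n (D : ('I_n -> X) -> M) j : bounded_multilinear D ->
  bounded_multilinear (fun a => D (mul_at A j a)).
Proof.
move=> hD; split; first exact: (mul_at_multilinear j (amulP A) hD.1).
have [d d0 Dd] := bounded_multilinear_bound hD.
have [k k0 hk] := mul_at_bound j (amulP A).
exists (d * k) => a; apply: le_trans (Dd _) _.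
by rewrite -mulrA ler_wpM2l.
Qed.

Lemma bounded_bilinear_sym (U V W : normedModType C) (f : U -> V -> W) :
  bounded_bilinear f -> bounded_bilinear (fun v u => f u v).
Proof.
by move=> [f1 f2 [k fk]]; split=> //; exists k => u v; rewrite mulrAC.
Qed.

Lemma hdelta_subproof n (D : hcochain n) : hdelta_fun (val D) \in
  submodule_pred (Submodule (@bounded_multilinear_closed X M n.+1)).
Proof.
have hD := hcochainP D.
rewrite [hdelta_fun _](_ : _ =
   (fun a => lact B (a ord0) (val D (a \o lift ord0)))
   + \sum_(j < n) (-1) ^+ j.+1 *: (fun a => val D (mul_at A j a))
   + (-1) ^+ n.+1 *: (fun a => ract B (val D (a \o lift ord_max)) (a ord_max))).
  rewrite !rpredD ?rpredZ ?rpred_sum //.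
  - by rewrite inE; exact: (drop_bounded ord0 (lactP B) hD).
  - by move=> j _; rewrite rpredZ // inE; exact: mul_at_bounded.
  - by rewrite inE; exact: (drop_bounded ord_max (bounded_bilinear_sym (ractP B)) hD).
by apply/funext => a; rewrite /hdelta_fun !fctE fct_sumE.
Qed.

Definition hdelta_val n (D : hcochain n) : hcochain n.+1 :=
  subm_mk (hdelta_subproof D).

Lemma hdelta_valE n (D : hcochain n) a : val (hdelta_val D) a = hdelta_fun (val D) a.
Proof. by []. Qed.

Lemma hdelta_linear n : linear (@hdelta_val n).
Proof.
move=> c D E; apply: val_inj; apply/funext => a.
have [_ l2 _] := lactP B; have [r1 _ _] := ractP B.
have e m (F G : hcochain m) z : val (c *: F + G) z = c *: val F z + val G z.
  by rewrite subm_funD subm_funZ.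
rewrite e !hdelta_valE /hdelta_fun.
have -> : \sum_(j < n) (-1) ^+ j.+1 *: val (c *: D + E) (mul_at A j a) =
    c *: (\sum_(j < n) (-1) ^+ j.+1 *: val D (mul_at A j a))
    + \sum_(j < n) (-1) ^+ j.+1 *: val E (mul_at A j a).
  by rewrite -scale_add_sum; apply: eq_bigr => j _; rewrite e.
by rewrite !e l2 r1 scale_add3.
Qed.

HB.instance Definition _ n := GRing.isLinear.Build C (hcochain n) (hcochain n.+1)
  *:%R (@hdelta_val n) (@hdelta_linear n).

Definition hdelta n : {linear hcochain n -> hcochain n.+1} := @hdelta_val n.

(* H^(n+1)(A, M) *)
Definition hcohomologyS n : lmodType C := cohomology (hdelta n) (hdelta n.+1).

End Hochschild.

Section Cyclic.
Variable X : completeNormedModType C.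

(* The unitization; the adjoined unit e is (0, 1). *)
Definition aplus : normedModType C := (X * C^o)%type.

(* C_n = lead n (x) X^(x)n, so that C_0 = A and C_n = A_+ (x) A^(x)n if n > 0. *)
Definition lead (n : nat) : normedModType C :=
  match n with 0%N => X | _.+1 => aplus end.

(* In degree 0 this is the quotient map A_+ -> A_+ / C e = A. *)
Definition to_lead n : aplus -> lead n :=
  match n with 0%N => fst | _.+1 => id end.

(* The projection A_+ -> A along C e, and the identity of A in degree 0. *)
Definition from_lead n : lead n -> X :=
  match n with 0%N => id | _.+1 => fst end.

Definition bounded_cochain n (phi : lead n -> ('I_n -> X) -> C^o) :=
  [/\ forall a, linear (phi^~ a), forall x, multilinear (phi x) &
      exists k : C, forall x a, `|phi x a| <= k * `|x| * \prod_(i < n) `|a i|].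

Lemma bounded_cochain_bound n (phi : lead n -> ('I_n -> X) -> C^o) :
  bounded_cochain phi -> exists2 k : C, 0 <= k &
  forall x a, `|phi x a| <= k * (`|x| * \prod_(i < n) `|a i|).
Proof.
move=> [_ _ [k hk]]; exists `|k| => // x a.
have p0 (p : lead n * ('I_n -> X)) : 0 <= `|p.1| * \prod_(i < n) `|p.2 i|.
  by rewrite mulr_ge0 // prod_norm_ge0.
have hp (p : lead n * ('I_n -> X)) :
    `|phi p.1 p.2| <= k * (`|p.1| * \prod_(i < n) `|p.2 i|).
  by rewrite mulrA.
exact: (bound_ge0 (fun p => normr_ge0 (phi p.1 p.2)) p0 hp (x, a)).
Qed.

Lemma bounded_cochain_closed n :
  submod_closed [pred phi : lead n -> ('I_n -> X) -> C^o |
                  `[< bounded_cochain phi >]].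
Proof.
split=> [|c D E]; rewrite !inE.
  split=> [a d x y|x a i d u v|]; first by rewrite scaler0 addr0.
    by rewrite scaler0 addr0.
  by exists 0 => x a; rewrite normr0 !mul0r.
move=> hD hE.
have [k k0 Dk] := bounded_cochain_bound hD.
have [l l0 El] := bounded_cochain_bound hE.
have e x a : (c *: D + E) x a = c *: D x a + E x a by [].
case: hD hE => D1 D2 _ [E1 E2 _].
split=> [a d x y|x a i d u v|].
- by rewrite !e D1 E1 scale_addD.
- by rewrite !e D2 E2 scale_addD.
exists (`|c| * k + l) => x a; rewrite e; apply: le_trans (ler_normD _ _) _.
by rewrite -mulrA mulrDl lerD // normrZ -mulrA ler_wpM2l.
Qed.

Definition cochain n : lmodType C := subm (Submodule (@bounded_cochain_closed n)).

Lemma cochainP n (phi : cochain n) : bounded_cochain (val phi).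
Proof. by have := valP phi; rewrite inE. Qed.

Lemma cochain_valP n c (phi psi : cochain n) x a :
  val (c *: phi + psi) x a = c *: val phi x a + val psi x a.
Proof. exact: subm_fun2P. Qed.

Lemma to_lead_linear n : linear (@to_lead n).
Proof. by case: n. Qed.

Lemma from_lead_linear n : linear (@from_lead n).
Proof. by case: n. Qed.

Lemma aplus_norm1 (x : aplus) : `|x.1| <= `|x|.
Proof. by rewrite prod_normE num_le_max lexx. Qed.

Lemma aplus_norm2 (x : aplus) : `|x.2| <= `|x|.
Proof. by rewrite prod_normE num_le_max lexx orbT. Qed.

Lemma aplus_inl_norm (x : X) : `|(x, 0) : aplus| = `|x|.
Proof.
by apply: le_anti; rewrite (aplus_norm1 (x, 0)) andbT prod_normE num_ge_max /= lexx normr0 /=.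
Qed.

Lemma to_lead_norm n x : `|@to_lead n x| <= `|x|.
Proof. by case: n => [|n] //=; exact: aplus_norm1. Qed.

Lemma from_lead_norm n x : `|@from_lead n x| <= `|x|.
Proof. by case: n x => [|n] x //=; exact: aplus_norm1. Qed.

Definition cons_arg n (x : X) (a : 'I_n -> X) : 'I_n.+1 -> X :=
  fun i => oapp a x (unlift ord0 i).

(* (a_0, ..., a_n) |-> (a_j, ..., a_n, a_0, ..., a_(j-1)); the sum of the
   indices is taken modulo n.+1. *)
Definition rot_arg n (j : 'I_n.+1) (a : 'I_n.+1 -> X) : 'I_n.+1 -> X :=
  fun i => a (i + j).

Lemma upd_cons0 n x y (a : 'I_n -> X) :
  upd (cons_arg x a) ord0 y = cons_arg y a.
Proof.
apply/funext => i; rewrite /upd /cons_arg; have [j ->|->] := unliftP ord0 i.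
  by rewrite eq_sym (negPf (neq_lift _ _)).
by rewrite eqxx.
Qed.

Lemma upd_cons n x y (a : 'I_n -> X) i :
  upd (cons_arg x a) (lift ord0 i) y = cons_arg x (upd a i y).
Proof.
apply/funext => k; rewrite /upd /cons_arg; have [j ->|->] := unliftP ord0 k.
  by rewrite (inj_eq lift_inj).
by rewrite (negPf (neq_lift _ _)).
Qed.

Lemma rot_upd n j (a : 'I_n.+1 -> X) i y :
  rot_arg j (upd a i y) = upd (rot_arg j a) (i - j) y.
Proof.
by apply/funext => k; rewrite /rot_arg /upd [k == _]eq_sym subr_eq eq_sym.
Qed.

Lemma rot_cons_norm n j x (a : 'I_n -> X) :
  \prod_(i < n.+1) `|rot_arg j (cons_arg x a) i| = `|x| * \prod_(i < n) `|a i|.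
Proof.
rewrite /rot_arg (reindex_inj (addIr (- j))) /=.
under eq_bigr do rewrite subrK.
rewrite big_ord_recl /cons_arg unlift_none /=; congr (_ * _).
by apply: eq_bigr => i _; rewrite liftK.
Qed.

Lemma rot_bounded n j (h : lead n -> X) (F : ('I_n.+1 -> X) -> C^o) :
  linear h -> (forall x, `|h x| <= `|x|) -> bounded_multilinear F ->
  bounded_cochain (fun x a => F (rot_arg j (cons_arg (h x) a))).
Proof.
move=> lh hh hF; have [lF _] := hF; split=> [a c x y|x a i c u v|].
- have e z : rot_arg j (cons_arg z a) =
      upd (rot_arg j (cons_arg 0 a)) (ord0 - j) z.
    by rewrite -rot_upd upd_cons0.
  by rewrite (e (h (c *: x + y))) (e (h x)) (e (h y)) lh lF.
- have e z : rot_arg j (cons_arg (h x) (upd a i z)) =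
      upd (rot_arg j (cons_arg (h x) a)) (lift ord0 i - j) z.
    by rewrite -rot_upd upd_cons.
  by rewrite !e lF.
have [k k0 Fk] := bounded_multilinear_bound hF.
exists k => x a; apply: le_trans (Fk _) _.
by rewrite rot_cons_norm -mulrA ler_wpM2l // ler_wpM2r // prod_norm_ge0.
Qed.

Lemma drop_cochain n (g : aplus -> X -> lead n) k phi :
  bounded_bilinear g -> bounded_cochain phi ->
  @bounded_cochain n.+1 (fun x a => phi (g x (a k)) (a \o lift k)).
Proof.
move=> hg hphi; have [c c0 gc] := bounded_bilinear_bound hg.
have [d d0 phid] := bounded_cochain_bound hphi.
case: hg hphi => g1 g2 _ [p1 p2 _]; split=> [a z x y|x a i z u v|].
- by rewrite g1 p1.
- have [j ->|->] := unliftP k i.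
    by rewrite !upd_lift !upd_neq ?neq_lift // p2.
  by rewrite !upd_lift_same !upd_eq g2 p1.
exists (d * c) => x a; apply: le_trans (phid _ _) _.
rewrite (prod_norm_lift a k) -!mulrA ler_wpM2l // !mulrA.
by rewrite ler_wpM2r ?prod_norm_ge0 // -mulrA gc.
Qed.

Variable A : algebra X.

Lemma mul_at_cochain n (h : aplus -> lead n) j phi :
  linear h -> (forall x, `|h x| <= `|x|) -> bounded_cochain phi ->
  @bounded_cochain n.+1 (fun x a => phi (h x) (mul_at A j a)).
Proof.
move=> lh hh hphi; have [d d0 phid] := bounded_cochain_bound hphi.
case: hphi => p1 p2 _; have [k k0 hk] := mul_at_bound j (amulP A).
split=> [a z x y|x|]; first by rewrite lh p1.
  exact: (mul_at_multilinear j (amulP A) (p2 (h x))).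
exists (d * k) => x a; apply: le_trans (phid _ _) _.
rewrite -!mulrA ler_wpM2l // mulrCA ler_pM // prod_norm_ge0 //.
Qed.

(* The products of A_+ with A, which take their values in A. *)
Definition plus_mulr (x : aplus) (a : X) : X := A x.1 a + x.2 *: a.
Definition plus_mull (a : X) (x : aplus) : X := A a x.1 + x.2 *: a.

Definition b_fun n (phi : lead n -> ('I_n -> X) -> C^o)
    (x : lead n.+1) (a : 'I_n.+1 -> X) : C^o :=
  phi (to_lead n (plus_mulr x (a ord0), 0)) (a \o lift ord0)
  + \sum_(j < n) (-1) ^+ j.+1 *: phi (to_lead n x) (mul_at A j a)
  + (-1) ^+ n.+1 *:
      phi (to_lead n (plus_mull (a ord_max) x, 0)) (a \o lift ord_max).

(* There is no B on C^0; its target C^(-1) is zero. *)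
Definition B_fun n (phi : lead n.+1 -> ('I_n.+1 -> X) -> C^o)
    (x : lead n) (a : 'I_n -> X) : C^o :=
  \sum_(j < n.+1) (-1) ^+ (j * n) *:
    phi ((0, 1) : aplus) (rot_arg j (cons_arg (from_lead x) a)).

Lemma plus_bilinear n (g : aplus -> X -> X) :
  (forall v, linear (g^~ v)) -> (forall u, linear (g u)) ->
  (exists k : C, forall u v, `|g u v| <= k * `|u| * `|v|) ->
  bounded_bilinear (fun x a => to_lead n (g x a, 0)).
Proof.
move=> g1 g2 [k gk].
have inl c (u v : X) : ((c *: u + v, 0) : aplus) = c *: ((u, 0) : aplus) + (v, 0).
  by congr pair; rewrite /= scaler0 addr0.
split=> [v c x y|u c x y|].
- by rewrite g1 inl to_lead_linear.
- by rewrite g2 inl to_lead_linear.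
exists k => u v; apply: le_trans (to_lead_norm _ _) _.
by rewrite aplus_inl_norm.
Qed.

Lemma plus_mulr_bounded n :
  bounded_bilinear (fun x a => to_lead n (plus_mulr x a, 0)).
Proof.
have [A1 A2 _] := amulP A; have [k k0 Ak] := bounded_bilinear_bound (amulP A).
apply: plus_bilinear => [v c x y|u c x y|]; rewrite /plus_mulr /=.
- by rewrite A1 scalerDl -scalerA scalerDr addrACA.
- by rewrite A2 !scalerDr !scalerA [c * _]mulrC addrACA.
exists (k + 1) => u v; apply: le_trans (ler_normD _ _) _.
rewrite !mulrDl mul1r lerD //.
  apply: le_trans (Ak _ _) _; rewrite -mulrA ler_wpM2l // ler_wpM2r //.
  exact: aplus_norm1.
by rewrite normrZ ler_wpM2r // aplus_norm2.
Qed.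

Lemma plus_mull_bounded n :
  bounded_bilinear (fun x a => to_lead n (plus_mull a x, 0)).
Proof.
have [A1 A2 _] := amulP A; have [k k0 Ak] := bounded_bilinear_bound (amulP A).
apply: plus_bilinear => [v c x y|u c x y|]; rewrite /plus_mull /=.
- by rewrite A2 scalerDl -scalerA scalerDr addrACA.
- by rewrite A1 !scalerDr !scalerA [c * _]mulrC addrACA.
exists (k + 1) => u v; apply: le_trans (ler_normD _ _) _.
rewrite !mulrDl mul1r lerD //.
  apply: le_trans (Ak _ _) _; rewrite -mulrA ler_wpM2l // mulrC ler_wpM2r //.
  exact: aplus_norm1.
by rewrite normrZ ler_wpM2r // aplus_norm2.
Qed.

Lemma b_subproof n (phi : cochain n) : b_fun (val phi) \in
  submodule_pred (Submodule (@bounded_cochain_closed n.+1)).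
Proof.
have hphi := cochainP phi.
rewrite [b_fun _](_ : _ =
   (fun x a => val phi (to_lead n (plus_mulr x (a ord0), 0)) (a \o lift ord0))
   + \sum_(j < n) (-1) ^+ j.+1 *: (fun x a => val phi (to_lead n x) (mul_at A j a))
   + (-1) ^+ n.+1 *: (fun x a =>
       val phi (to_lead n (plus_mull (a ord_max) x, 0)) (a \o lift ord_max))).
  rewrite !rpredD ?rpredZ ?rpred_sum //.
  - by rewrite inE; exact: (drop_cochain ord0 (plus_mulr_bounded n) hphi).
  - move=> j _; rewrite rpredZ // inE.
    exact: (mul_at_cochain j (@to_lead_linear n) (@to_lead_norm n) hphi).
  - by rewrite inE; exact: (drop_cochain ord_max (plus_mull_bounded n) hphi).
by apply/funext => x; apply/funext => a; rewrite /b_fun !fctE !fct_sumE.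
Qed.

Lemma B_subproof n (phi : cochain n.+1) : B_fun (val phi) \in
  submodule_pred (Submodule (@bounded_cochain_closed n)).
Proof.
have hphi := cochainP phi.
have he : bounded_multilinear (val phi ((0, 1) : aplus)).
  have [k k0 phik] := bounded_cochain_bound hphi.
  case: hphi => p1 p2 _; split; first exact: p2.
  exists (k * `|(0, 1) : aplus|) => a; rewrite -mulrA; exact: phik.
rewrite [B_fun _](_ : _ = \sum_(j < n.+1) (-1) ^+ (j * n) *:
    (fun x a => val phi ((0, 1) : aplus) (rot_arg j (cons_arg (from_lead x) a)))).
  rewrite rpred_sum // => j _; rewrite rpredZ // inE.
  exact: (rot_bounded j (@from_lead_linear n) (@from_lead_norm n) he).
by apply/funext => x; apply/funext => a; rewrite /B_fun !fct_sumE.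
Qed.

Definition b_val n (phi : cochain n) : cochain n.+1 := subm_mk (b_subproof phi).
Definition B_val n (phi : cochain n.+1) : cochain n := subm_mk (B_subproof phi).

Lemma b_valE n (phi : cochain n) x a : val (b_val phi) x a = b_fun (val phi) x a.
Proof. by []. Qed.

Lemma B_valE n (phi : cochain n.+1) x a : val (B_val phi) x a = B_fun (val phi) x a.
Proof. by []. Qed.

Lemma b_linear n : linear (@b_val n).
Proof.
move=> c D E; apply: val_inj; apply/funext => x; apply/funext => a.
rewrite cochain_valP !b_valE /b_fun.
have -> : \sum_(j < n) (-1) ^+ j.+1 *:
      val (c *: D + E) (to_lead n x) (mul_at A j a) =
    c *: (\sum_(j < n) (-1) ^+ j.+1 *: val D (to_lead n x) (mul_at A j a))
    + \sum_(j < n) (-1) ^+ j.+1 *: val E (to_lead n x) (mul_at A j a).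
  by rewrite -scale_add_sum; apply: eq_bigr => j _; rewrite cochain_valP.
by rewrite !cochain_valP scale_add3.
Qed.

Lemma B_linear n : linear (@B_val n).
Proof.
move=> c D E; apply: val_inj; apply/funext => x; apply/funext => a.
rewrite cochain_valP !B_valE /B_fun -scale_add_sum.
by apply: eq_bigr => j _; rewrite cochain_valP.
Qed.

HB.instance Definition _ n := GRing.isLinear.Build C (cochain n) (cochain n.+1)
  *:%R (@b_val n) (@b_linear n).
HB.instance Definition _ n := GRing.isLinear.Build C (cochain n.+1) (cochain n)
  *:%R (@B_val n) (@B_linear n).

Definition cyc_b n : {linear cochain n -> cochain n.+1} := @b_val n.
Definition cyc_B n : {linear cochain n.+1 -> cochain n} := @B_val n.

Definition even_cochain (n : nat) : lmodType C := cochain n.*2.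
Definition odd_cochain (n : nat) : lmodType C := cochain n.*2.+1.

Definition CP0 : lmodType C := dsum even_cochain.
Definition CP1 : lmodType C := dsum odd_cochain.

Definition d0_fun (phi : CP0) : dprod odd_cochain :=
  fun n => cyc_b n.*2 (val phi n) + cyc_B n.*2.+1 (val phi n.+1).

Definition d1_fun (phi : CP1) : dprod even_cochain :=
  fun n => match n with
  | 0%N => cyc_B 0 (val phi 0%N)
  | m.+1 => cyc_b m.*2.+1 (val phi m) + cyc_B m.*2.+2 (val phi m.+1)
  end.

Lemma d0_subproof phi :
  d0_fun phi \in submodule_pred (Submodule (finsupp_closed odd_cochain)).
Proof.
rewrite inE; have := valP phi; rewrite inE => -[N hN].
by exists N => n Nn; rewrite /d0_fun !hN ?(leqW Nn) // !raddf0 addr0.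
Qed.

Lemma d1_subproof phi :
  d1_fun phi \in submodule_pred (Submodule (finsupp_closed even_cochain)).
Proof.
rewrite inE; have := valP phi; rewrite inE => -[N hN].
exists N.+1 => -[|n] // Nn.
rewrite -[LHS]/(cyc_b n.*2.+1 (val phi n) + cyc_B n.*2.+2 (val phi n.+1)).
by rewrite (hN n Nn) (hN n.+1 (leqW Nn)) !raddf0 addr0.
Qed.

Definition d0_val phi : CP1 := subm_mk (d0_subproof phi).
Definition d1_val phi : CP0 := subm_mk (d1_subproof phi).

Lemma d0_linear : linear d0_val.
Proof.
move=> c D E; apply: val_inj; apply: functional_extensionality_dep => n.
rewrite subm_dprodP /= /d0_fun !subm_dprodP !linearP.
by rewrite scalerDr addrACA.
Qed.

Lemma d1_linear : linear d1_val.
Proof.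
move=> c D E; apply: val_inj; apply: functional_extensionality_dep => n.
rewrite subm_dprodP /= /d1_fun; case: n => [|n]; rewrite !subm_dprodP !linearP //.
by rewrite scalerDr addrACA.
Qed.

HB.instance Definition _ := GRing.isLinear.Build C CP0 CP1 *:%R d0_val d0_linear.
HB.instance Definition _ := GRing.isLinear.Build C CP1 CP0 *:%R d1_val d1_linear.

Definition d0 : {linear CP0 -> CP1} := d0_val.
Definition d1 : {linear CP1 -> CP0} := d1_val.

Definition HP0 : lmodType C := cohomology d1 d0.
Definition HP1 : lmodType C := cohomology d0 d1.

End Cyclic.

End Multilinear.

Section Complex.
Variable R : realType.
Local Notation C := R[i].

Section Dual.
Variable M : normedModType C.

Definition is_dual (phi : M -> C^o) :=
  linear phi /\ exists k : C, forall m, `|phi m| <= k * `|m|.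

Lemma dual_closed : submod_closed [pred phi : M -> C^o | `[< is_dual phi >]].
Proof.
split=> [|c D E]; rewrite !inE.
  split=> [d x y|]; first by rewrite scaler0 addr0.
  by exists 0 => a; rewrite normr0 mul0r.
move=> [lD [k Dk]] [lE [l El]]; split=> [d x y|].
  have -> z : (c *: D + E) z = c *: D z + E z by [].
  by rewrite lD lE !scalerDr !scalerA [c * d]mulrC addrACA.
exists (`|c| * k + l) => a; apply: le_trans (ler_normD _ _) _.
by rewrite mulrDl lerD // normrZ -mulrA ler_wpM2l.
Qed.

Definition dual := subm (Submodule dual_closed).
HB.instance Definition _ := GRing.Lmodule.on dual.

Lemma dualP (phi : dual) : is_dual (val phi).
Proof. by have := valP phi; rewrite inE. Qed.

Lemma dualDE (phi psi : dual) m : val (phi + psi) m = val phi m + val psi m.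
Proof. exact: subm_funD. Qed.

Lemma dualZE c (phi : dual) m : val (c *: phi) m = c *: val phi m.
Proof. exact: subm_funZ. Qed.

Definition opnorm (phi : dual) : C :=
  (sup [set r : R | exists2 m : M, `|m| <= 1 & `|val phi m| = r%:C])%:C.

Lemma dual0 (phi : dual) : val phi 0 = 0.
Proof.
have [lphi _] := dualP phi.
by have := lphi (-1) 0 0; rewrite scaler0 addr0 scaleN1r addNr.
Qed.

Lemma dualZ (phi : dual) c m : val phi (c *: m) = c *: val phi m.
Proof.
have [lphi _] := dualP phi.
by have := lphi c m 0; rewrite dual0 !addr0.
Qed.

Lemma norm_real (T : normedModType C) (x : T) : exists2 r : R, 0 <= r & `|x| = r%:C.
Proof.
have : 0 <= `|x| by [].
case: (`|x|) => a b; rewrite lecE /= => /andP[/eqP -> a0].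
by exists a.
Qed.

Lemma opnorm_has_sup (phi : dual) :
  has_sup [set r : R | exists2 m : M, `|m| <= 1 & `|val phi m| = r%:C].
Proof.
split; first by exists 0; exists 0; rewrite ?normr0 // dual0 normr0.
have [_ [k phik]] := dualP phi.
have [r r0 kr] := norm_real (k : C^o).
exists r => s [m m1 sm]; rewrite -lecR -sm -kr.
apply: le_trans (_ : `|k| * `|m| <= _); last by rewrite ler_piMr.
exact: (@bound_ge0 _ _ (fun m => `|val phi m|) (fun m => `|m|) k).
Qed.

Lemma opnorm_le (phi : dual) c : 0 <= c ->
  (forall m, `|val phi m| <= c * `|m|) -> opnorm phi <= c.
Proof.
move=> c0 phic; have [r r0 cr] := norm_real (c : C^o).
rewrite -(ger0_norm c0) cr lecR; apply: ge_sup.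
  by case: (opnorm_has_sup phi).
move=> s [m m1 sm]; rewrite -lecR -sm -cr (ger0_norm c0).
by apply: le_trans (phic m) _; rewrite ler_piMr.
Qed.

Lemma opnorm_ge0 (phi : dual) : 0 <= opnorm phi.
Proof.
rewrite -[0]/(0%:C) lecR; apply: sup_ubound; first by case: (opnorm_has_sup phi).
by exists 0; rewrite ?normr0 // dual0 normr0.
Qed.

Lemma opnorm_ge (phi : dual) m : `|val phi m| <= opnorm phi * `|m|.
Proof.
have [->|m0] := eqVneq m 0; first by rewrite dual0 !normr0 mulr0.
have nm0 : 0 < `|m| by rewrite normr_gt0.
rewrite -ler_pdivrMr //.
have [r r0 er] := norm_real (val phi (`|m|^-1 *: m)).
have e : `|val phi m| / `|m| = r%:C.
  by rewrite -er dualZ normrZ normfV normr_id mulrC.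
rewrite e lecR; apply: sup_ubound; first by case: (opnorm_has_sup phi).
exists (`|m|^-1 *: m); last by [].
by rewrite normrZ normfV normr_id mulVf // gt_eqF.
Qed.

Lemma opnormD (phi psi : dual) : opnorm (phi + psi) <= opnorm phi + opnorm psi.
Proof.
apply: opnorm_le => [|m]; first by rewrite addr_ge0 ?opnorm_ge0.
rewrite dualDE; apply: le_trans (ler_normD _ _) _.
by rewrite mulrDl lerD // opnorm_ge.
Qed.

Lemma opnormZ_le c (phi : dual) : opnorm (c *: phi) <= `|c| * opnorm phi.
Proof.
apply: opnorm_le => [|m]; first by rewrite mulr_ge0 ?opnorm_ge0.
by rewrite dualZE normrZ -mulrA ler_wpM2l // opnorm_ge.
Qed.

Lemma opnorm_eq0 (phi : dual) : opnorm phi = 0 -> phi = 0.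
Proof.
move=> h; apply: val_inj; apply/funext => m; apply/normr0_eq0/eqP.
by rewrite eq_le normr_ge0 andbT; have := opnorm_ge phi m; rewrite h mul0r.
Qed.

Lemma opnormZ c (phi : dual) : opnorm (c *: phi) = `|c| * opnorm phi.
Proof.
apply: le_anti; rewrite opnormZ_le /=.
have [->|c0] := eqVneq c 0; first by rewrite normr0 mul0r opnorm_ge0.
have nc0 : 0 < `|c| by rewrite normr_gt0.
rewrite -{1}[phi]scale1r -(mulVf c0) -scalerA.
apply: le_trans (ler_wpM2l (ltW nc0) (opnormZ_le _ _)) _.
by rewrite normfV mulrA divff ?mul1r // gt_eqF.
Qed.

HB.instance Definition _ :=
  Lmodule_isNormed.Build C dual opnormD opnormZ opnorm_eq0.

End Dual.

Section DualBimodule.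
Variables (X : completeNormedModType C) (A : algebra X).
Variables (M : normedModType C) (B : bimodule A M).

(* (a . phi . b) (m) = phi (b m a) *)
Definition dual_lact_fun (a : X) (phi : dual M) : M -> C^o :=
  fun m => val phi (ract B m a).
Definition dual_ract_fun (phi : dual M) (b : X) : M -> C^o :=
  fun m => val phi (lact B b m).

Lemma is_dual_comp (phi : dual M) (g : M -> M) (k : C) :
  linear g -> 0 <= k -> (forall m, `|g m| <= k * `|m|) ->
  is_dual (fun m => val phi (g m)).
Proof.
move=> lg k0 gk; split=> [c x y|].
  by rewrite lg (dualP phi).1.
exists (opnorm phi * k) => m; apply: le_trans (opnorm_ge _ _) _.
by rewrite -mulrA ler_wpM2l // opnorm_ge0.
Qed.

Lemma dual_lact_subproof a phi :
  dual_lact_fun a phi \in submodule_pred (Submodule (@dual_closed M)).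
Proof.
rewrite inE; have [l1 l2 _] := ractP B.
have [k k0 hk] := bounded_bilinear_bound (ractP B).
apply: (@is_dual_comp phi (ract B ^~ a) (k * `|a|)) => // [|m].
  by rewrite mulr_ge0.
by rewrite -mulrA [`|a| * _]mulrC.
Qed.

Lemma dual_ract_subproof phi b :
  dual_ract_fun phi b \in submodule_pred (Submodule (@dual_closed M)).
Proof.
rewrite inE; have [l1 l2 _] := lactP B.
have [k k0 hk] := bounded_bilinear_bound (lactP B).
apply: (@is_dual_comp phi (lact B b) (k * `|b|)) => // [|m].
  by rewrite mulr_ge0.
by rewrite -mulrA.
Qed.

Definition dual_lact a phi : dual M := subm_mk (dual_lact_subproof a phi).
Definition dual_ract phi b : dual M := subm_mk (dual_ract_subproof phi b).

Lemma dual_lactP : bounded_bilinear dual_lact.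
Proof.
have [l1 l2 _] := ractP B; have [k k0 hk] := bounded_bilinear_bound (ractP B).
split=> [phi c x y|a c phi psi|].
- apply: val_inj; apply/funext => m.
  rewrite dualDE dualZE /=.
  by rewrite /dual_lact_fun l2 (dualP phi).1.
- by apply: val_inj; apply/funext => m; rewrite dualDE dualZE /= /dual_lact_fun dualDE dualZE.
exists k => a phi; apply: opnorm_le => [|m].
  by rewrite mulr_ge0 ?opnorm_ge0 // mulr_ge0.
apply: le_trans (opnorm_ge phi (ract B m a)) _.
rewrite [leRHS](_ : _ = opnorm phi * (k * (`|m| * `|a|))).
  by rewrite ler_wpM2l // opnorm_ge0.
by rewrite -[`|phi|]/(opnorm phi); ring.
Qed.

Lemma dual_ractP : bounded_bilinear dual_ract.
Proof.
have [l1 l2 _] := lactP B; have [k k0 hk] := bounded_bilinear_bound (lactP B).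
split=> [a c phi psi|phi c x y|].
- by apply: val_inj; apply/funext => m; rewrite dualDE dualZE /= /dual_ract_fun dualDE dualZE.
- apply: val_inj; apply/funext => m.
  rewrite dualDE dualZE /=.
  by rewrite /dual_ract_fun l1 (dualP phi).1.
exists k => phi a; apply: opnorm_le => [|m].
  by rewrite mulr_ge0 // mulr_ge0 ?opnorm_ge0.
apply: le_trans (opnorm_ge phi (lact B a m)) _.
rewrite [leRHS](_ : _ = opnorm phi * (k * (`|a| * `|m|))).
  by rewrite ler_wpM2l // opnorm_ge0.
by rewrite -[`|phi|]/(opnorm phi); ring.
Qed.

Lemma dual_lactA a b phi : dual_lact a (dual_lact b phi) = dual_lact (A a b) phi.
Proof.
by apply: val_inj; apply/funext => m; rewrite /= /dual_lact_fun /= /dual_lact_fun ractA.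
Qed.

Lemma dual_ractA a b phi : dual_ract (dual_ract phi a) b = dual_ract phi (A a b).
Proof.
by apply: val_inj; apply/funext => m; rewrite /= /dual_ract_fun /= /dual_ract_fun lactA.
Qed.

Lemma dual_lractA a b phi :
  dual_lact a (dual_ract phi b) = dual_ract (dual_lact a phi) b.
Proof.
apply: val_inj; apply/funext => m.
by rewrite /= /dual_ract_fun /dual_lact_fun /= /dual_ract_fun /dual_lact_fun lractA.
Qed.

Definition dual_bimodule : bimodule A (dual M) :=
  Bimodule dual_lactP dual_ractP dual_lactA dual_ractA dual_lractA.

End DualBimodule.

Definition weak_bidim (X : completeNormedModType C) (A : algebra X) : \bar R :=
  ereal_inf [set n%:R%:E | n in
    [set n | forall (M : completeNormedModType C) (B : bimodule A M)
               (c : hcohomologyS (dual_bimodule B) n), c = 0]].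

Definition diff_quotient (Y : normedModType C) (f : R -> Y) (t h : R) : Y :=
  (h^-1)%:C *: (f (t + h) - f t).

Definition rderive (Y : normedModType C) (f : R -> Y) (t : R) : Y :=
  lim (diff_quotient f t h @[h --> 0^']).

Definition smooth_on (Y : normedModType C) (J : set R) (f : R -> Y) :=
  forall k t, J t -> cvg (diff_quotient (iter k (@rderive Y) f) t h @[h --> 0^']).

(* x |-> F ^~ x is a map from E to C^oo(J, Y) which is continuous for the
   topology of uniform convergence of all derivatives on the compact subsets
   of J. *)
Definition smooth_family (E : topologicalType) (Y : normedModType C)
    (J : set R) (F : R -> E -> Y) :=
  (forall x, smooth_on J (F ^~ x)) /\
  forall k : nat, continuous ((fun x => iter k (@rderive Y) (F ^~ x)) :
    E -> {family (fun K => compact K /\ K `<=` J), R -> Y}).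

Definition open_interval (J : set R) := open J /\ is_interval J.

(* Continuous linear maps out of X (x) X are jointly continuous bilinear maps.
   Only the members A_ t with t in J are constrained. *)
Definition smooth_deformation (X : completeNormedModType C) (J : set R)
    (A_ : R -> algebra X) :=
  smooth_family J (fun t (p : X * X) => A_ t p.1 p.2).

Definition HP_iso (X : completeNormedModType C) (A B : algebra X) :=
  lin_iso (HP0 A) (HP0 B) /\ lin_iso (HP1 A) (HP1 B).

Definition HP_rigid (X : completeNormedModType C) (A : algebra X) :=
  forall (J : set R) (A_ : R -> algebra X),
  open_interval J -> J 0 -> smooth_deformation J A_ ->
  (forall a b, A_ 0 a b = A a b) ->
  exists J' : set R, [/\ open_interval J', J' 0, J' `<=` J &
    forall t, J' t -> HP_iso (A_ t) (A_ 0)].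

End Complex.

(* Main.v *)
Require Import Defs.
From HB Require Import structures.
From mathcomp Require Import all_boot all_order all_algebra.
From mathcomp Require Import complex ring lra zify.
From mathcomp Require Import boolp classical_sets functions interval_inference.
From mathcomp Require Import reals ereal prodnormedzmodule.
From mathcomp Require Import topology normedtype sequences.

Set Implicit Arguments.
Unset Strict Implicit.
Unset Printing Implicit Defensive.

Import Order.TTheory GRing.Theory Num.Theory.
Import numFieldNormedType.Exports.

Local Open Scope classical_set_scope.
Local Open Scope ring_scope.
Local Open Scope complex_scope.

(** The theorem is parallel transport for the Gauss-Manin connection on periodic cyclic cohomology,
    carried out on a complex of bounded degree.

    For two products m_s and m_t on the same space, contraction with the 2-cochain e = m_t - m_s
    gives an operator H_st on cochains ([step]). A Cartan homotopy formula shows that 1 + H_st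
    intertwines the differentials b + B of A_s and A_t up to terms of second order in e
    ([cartan11_split], [cartan11_comm], [cartan12], [cartan21], [cartan22], collected in
    [step_defect1], [step_defect2] and [step_chain]). Products of such operators along finer and
    finer subdivisions of the interval from 0 to t should converge to an isomorphism of complexes.
    The obstacle is that H_st raises the degree by two and that its bounds grow with the degree.
    Finite weak bidimension removes it.

    Suppose the cohomology in degree n = N + 1 vanishes for all dual coefficients. Let V be the dual
    of the bimodule of noncommutative n-forms. The universal cocycle, which sends w to dw_1 ...
    dw_n, takes values in the dual of V ([univ_bimodule], [delta_univ]), so it has a primitive D. By
    naturality D contracts the Hochschild complex of every bimodule in degrees at least n
    ([delta_gop], [delta_hop]). As a normed space V does not depend on the product, so a Neumann
    series deforms D into primitives D_t for all small t, bounded and Lipschitz in t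
    ([perturbed_primitive], [universal_primitive]).

    Consequently HP of A_t is computed by the complex T_t of cochains of degree at most n whose
    boundary has degree at most n ([reduction]). The contraction built from D_t yields a chain map
    p_t, homotopic to the identity in the degrees that matter, which retracts cochains of slightly
    larger degree onto T_t. The operator F_st = p_t (1 + H_st) maps T_s to T_t, is the identity for
    s = t, and is multiplicative and compatible with the differentials up to second order in the
    step length. The sewing lemma ([sewing]) turns such a family into isomorphisms between T_0 and
    T_t ([truncated_isomorphisms], [truncated_complexes]), and [cohomology_iso] carries them over to
    HP.

    Smoothness of the deformation enters through a uniform bound and a Lipschitz estimate for the
    products near 0 ([smooth_bounds]). Cochains of all degrees are handled together as functions on
    words ([HC]), which avoids casts between degrees. *)

(** * Real-valued norms and limits of geometric sequences *)

Section Norm.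
Variable R : realType.
Local Notation C := R[i].

(** The norm of a space over [R[i]] is itself an element of [R[i]], real and nonnegative; its real
    part lets the estimates live in [R]. *)
Definition nrm (T : normedModType C) (x : T) : R := complex.Re `|x|.
Definition cn (z : C) : R := nrm (z : C^o).

Section NormMod.
Variable T : normedModType C.
Implicit Types x y : T.

Lemma nrmE x : `|x| = (nrm x)%:C.
Proof. by have [r _ e] := norm_real x; rewrite /nrm e. Qed.

Lemma nrm_le x y (K : R) : `|x| <= K%:C * `|y| <-> nrm x <= K * nrm y.
Proof. by rewrite !nrmE -[_%:C * _]rmorphM lecR. Qed.

Lemma nrm_ge0 x : 0 <= nrm x.
Proof. by rewrite -lecR -nrmE; exact: normr_ge0. Qed.

Lemma nrm0 : nrm (0 : T) = 0.
Proof. by rewrite /nrm normr0. Qed.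

Lemma nrm0_eq0 x : nrm x = 0 -> x = 0.
Proof. by move=> h; apply/normr0_eq0; rewrite nrmE h. Qed.

Lemma nrmD x y : nrm (x + y) <= nrm x + nrm y.
Proof. by rewrite -lecR rmorphD /= -!nrmE ler_normD. Qed.

Lemma nrmN x : nrm (- x) = nrm x.
Proof. by rewrite /nrm normrN. Qed.

Lemma nrmB x y : nrm (x - y) <= nrm x + nrm y.
Proof. by rewrite -(nrmN y) nrmD. Qed.

Lemma nrmBC x y : nrm (x - y) = nrm (y - x).
Proof. by rewrite -nrmN opprB. Qed.

Lemma nrmZ (a : C) x : nrm (a *: x) = cn a * nrm x.
Proof.
by apply: complexI; rewrite rmorphM /= -!nrmE normrZ.
Qed.

End NormMod.

Lemma cnE (z : C) : `|z| = (cn z)%:C.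
Proof. exact: (nrmE (z : C^o)). Qed.
Lemma cn_ge0 z : 0 <= cn z. Proof. exact: nrm_ge0. Qed.
Lemma cn0 : cn 0 = 0. Proof. exact: nrm0. Qed.
Lemma cn0_eq0 z : cn z = 0 -> z = 0. Proof. exact: nrm0_eq0. Qed.
Lemma cnD y z : cn (y + z) <= cn y + cn z. Proof. exact: nrmD. Qed.
Lemma cnN z : cn (- z) = cn z. Proof. exact: nrmN. Qed.
Lemma cnB y z : cn (y - z) <= cn y + cn z. Proof. exact: nrmB. Qed.
Lemma cnBC y z : cn (y - z) = cn (z - y). Proof. exact: nrmBC. Qed.
Lemma cnM y z : cn (y * z) = cn y * cn z. Proof. exact: (nrmZ y (z : C^o)). Qed.
Lemma cn1 : cn 1 = 1.
Proof. by apply: complexI; rewrite -cnE normr1. Qed.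
Lemma cnX z n : cn (z ^+ n) = cn z ^+ n.
Proof. by elim: n => [|n IH]; rewrite ?expr0 ?cn1 // !exprS cnM IH. Qed.
Lemma cn_sign n : cn ((-1) ^+ n) = 1.
Proof. by rewrite cnX cnN cn1 expr1n. Qed.
Lemma cn_signM n z : cn ((-1) ^+ n * z) = cn z.
Proof. by rewrite cnM cn_sign mul1r. Qed.
Lemma cn_real (r : R) : cn r%:C = `|r|.
Proof. by rewrite /cn /nrm normc_def /= expr0n addr0 sqrtr_sqr. Qed.

Lemma cn_sum (I : Type) (r : seq I) (P : pred I) (F : I -> C) :
  cn (\sum_(i <- r | P i) F i) <= \sum_(i <- r | P i) cn (F i).
Proof.
elim/big_rec2: _ => [|i y z _ h]; first by rewrite cn0.
by apply: le_trans (cnD _ _) _; rewrite lerD2l.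
Qed.

Lemma cn_sum_le n (F : nat -> C) (B : R) :
  (forall i, (i < n)%N -> cn (F i) <= B) -> cn (\sum_(i < n) F i) <= n%:R * B.
Proof.
move=> h; apply: le_trans (cn_sum _ _ _) _.
apply: le_trans (_ : \sum_(i < n) B <= _).
  by apply: ler_sum => i _; exact: h.
by rewrite sumr_const card_ord mulr_natl.
Qed.

Lemma Re_le_cn (z : C) : `|complex.Re z| <= cn z.
Proof.
rewrite /cn /nrm normc_def /= -sqrtr_sqr ler_sqrt ?lerDl ?sqr_ge0 //.
by rewrite addr_ge0 ?sqr_ge0.
Qed.

Lemma Im_le_cn (z : C) : `|complex.Im z| <= cn z.
Proof.
rewrite /cn /nrm normc_def /= -sqrtr_sqr ler_sqrt ?lerDr ?sqr_ge0 //.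
by rewrite addr_ge0 ?sqr_ge0.
Qed.

Lemma cn_le_ReIm (z : C) : cn z <= `|complex.Re z| + `|complex.Im z|.
Proof.
rewrite {1}[z]complexE; apply: le_trans (cnD _ _) _.
rewrite cnM !cn_real [X in _ + X * _](_ : _ = 1) ?mul1r //.
by rewrite /cn /nrm normc_def /= expr0n add0r expr1n sqrtr1.
Qed.

(** With [e n] the tail of the geometric series, the intervals of radius [e n] around [u n] are
    nested, and the limit is the supremum of their left ends. The explicit error is kept because
    linearity and boundedness of limits of forms are read off from it. *)
Lemma real_geometric_limit (q B : R) (u : nat -> R) : 0 <= q < 1 ->
  (forall n, `|u n.+1 - u n| <= B * q ^+ n) ->
  exists l, forall n, `|l - u n| <= B / (1 - q) * q ^+ n.
Proof.
move=> /andP[q0 q1] hu; pose e n := B / (1 - q) * q ^+ n.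
have q10 : 1 - q != 0 by rewrite subr_eq0 eq_sym lt_eqF.
have eS n : e n - e n.+1 = B * q ^+ n.
  by rewrite /e exprS; field.
have B0 : 0 <= B by have := hu 0%N; rewrite expr0 mulr1; apply: le_trans.
have e0 n : 0 <= e n.
  by rewrite /e mulr_ge0 ?exprn_ge0 // divr_ge0 // subr_ge0 ltW.
have mono m n : (n <= m)%N -> `|u m - u n| <= e n - e m.
  elim: m => [|m IH]; first by rewrite leqn0 => /eqP ->; rewrite !subrr normr0.
  rewrite leq_eqVlt => /orP[/eqP ->|]; first by rewrite !subrr normr0.
  rewrite ltnS => /IH h; have := hu m; rewrite -eS => hm.
  have -> : u m.+1 - u n = (u m.+1 - u m) + (u m - u n) by ring.
  apply: le_trans (ler_normD _ _) _; lra.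
have close m n : `|u m - u n| <= e n + e m.
  case: (leqP n m) => [/mono h|/ltnW /mono]; first by have := e0 m; lra.
  by rewrite distrC => h; have := e0 n; lra.
pose S : set R := [set x | exists n, x = u n - e n].
have Sub m : ubound S (u m + e m).
  by move=> _ [n ->]; have := close n m; rewrite ler_norml => /andP[]; lra.
have Sn : S !=set0 by exists (u 0%N - e 0%N); exists 0%N.
exists (sup S) => n; rewrite -/(e n) ler_norml; apply/andP; split.
  have : u n - e n <= sup S by apply: ub_le_sup; [exists (u 0%N + e 0%N)|exists n].
  by lra.
have : sup S <= u n + e n by apply: ge_sup.
by lra.
Qed.

Lemma geometric_limit (q B : R) (u : nat -> C) : 0 <= q < 1 ->
  (forall n, cn (u n.+1 - u n) <= B * q ^+ n) ->
  exists l, forall n, cn (l - u n) <= 2 * B / (1 - q) * q ^+ n.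
Proof.
move=> hq hu.
have [n|a ha] := @real_geometric_limit q B (fun n => complex.Re (u n)) hq.
  by apply: le_trans (hu n); rewrite -raddfB Re_le_cn.
have [n|b hb] := @real_geometric_limit q B (fun n => complex.Im (u n)) hq.
  by apply: le_trans (hu n); rewrite -raddfB Im_le_cn.
exists (a +i* b) => n; apply: le_trans (cn_le_ReIm _) _.
rewrite !raddfB /=; have := ha n; have := hb n; lra.
Qed.

End Norm.

(** * Words and the product of two adjacent letters *)

Section Merge.
Variable T : Type.
Implicit Types (mu nu : T -> T -> T) (w s : seq T).

(** An index past the end leaves the word unchanged, so [mrg] is total and identities such as [mrgC]
    hold without a bound on the length. *)
Fixpoint mrg mu i w {struct w} : seq T :=
  match w with
  | [::] => [::]
  | a :: w' =>
    match i with
    | 0%N => if w' is b :: w'' then mu a b :: w'' else w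
    | j.+1 => a :: mrg mu j w'
    end
  end.

Lemma size_mrg mu i w : (i.+1 < size w)%N -> size (mrg mu i w) = (size w).-1.
Proof.
elim: w i => [|a w IH] [|i] //=; first by case: w {IH}.
by rewrite ltnS => h; rewrite IH //; case: w h IH.
Qed.

Lemma mrg_out mu i w : (size w <= i.+1)%N -> mrg mu i w = w.
Proof.
elim: w i => [|a w IH] [|i] //=; first by case: w {IH}.
by rewrite ltnS => h; rewrite IH.
Qed.

Lemma mrg_cat mu s w i : mrg mu (size s + i) (s ++ w) = s ++ mrg mu i w.
Proof. by elim: s => //= a s ->. Qed.

Lemma mrg_catl mu s w i : (i.+1 < size s)%N -> mrg mu i (s ++ w) = mrg mu i s ++ w.
Proof.
elim: s i => [|a s IH] [|i] //=; first by case: s {IH}.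
by rewrite ltnS => h; rewrite IH.
Qed.

Lemma mrgC mu nu i p w : (i.+2 <= p)%N ->
  mrg mu i (mrg nu p w) = mrg nu p.-1 (mrg mu i w).
Proof.
elim: w i p => [//|a w IH] [|i] [|[|p]] //= h.
  by case: w {IH} => [|b []].
by rewrite IH.
Qed.

Lemma mrgA mu i w : associative mu -> (i.+2 < size w)%N ->
  mrg mu i (mrg mu i w) = mrg mu i (mrg mu i.+1 w).
Proof.
move=> A; elim: w i => [|a w IH] [|i] //=.
  by case: w {IH} => [|b [|c w]] //= _; rewrite A.
by rewrite ltnS => h; rewrite IH.
Qed.

Lemma rotr1_mrg mu i w : (i.+2 < size w)%N ->
  rotr 1 (mrg mu i w) = mrg mu i.+1 (rotr 1 w).
Proof.
case/lastP: w => // s a; rewrite size_rcons ltnS => h.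
by rewrite rotr1_rcons -cats1 mrg_catl // cats1 rotr1_rcons.
Qed.

(** Two rotations bring the last two letters to the front, so up to rotation the last face is a
    first face. *)
Lemma rotr1_mrg_last mu w : (1 < size w)%N ->
  rotr 1 (mrg mu (size w).-2 w) = mrg mu 0 (rotr 1 (rotr 1 w)).
Proof.
case/lastP: w => // s b; case/lastP: s => // s a _.
rewrite !size_rcons /= rotr1_rcons -rcons_cons rotr1_rcons /=.
by rewrite -!cats1 -catA -[X in mrg _ X]addn0 mrg_cat /= cats1 rotr1_rcons.
Qed.

End Merge.

(** * The operators of cyclic cohomology on forms on words *)

Section Words.
Variables (K : comNzRingType) (X : lmodType K).
Implicit Types (f g : seq X -> K) (w s : seq X) (mu nu d e : X -> X -> X).

Definition mlin f := forall s1 s2 a x y,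
  f (s1 ++ (a *: x + y) :: s2) = a * f (s1 ++ x :: s2) + f (s1 ++ y :: s2).

Definition dd mu i f : seq X -> K := fun w => f (mrg mu i w).
(** [La] is the signed cyclic operator λ, [bp] the operator b', [bs] the cyclic coboundary b and
    [Na] the norm N, the sum of the powers of λ. In [bs] the wrap-around face is [La] of the face at
    0; it is absent on words of one letter. *)
Definition La f : seq X -> K := fun w => (-1) ^+ (size w).-1 * f (rotr 1 w).
Definition bp mu f : seq X -> K :=
  fun w => \sum_(i < (size w).-1) (-1) ^+ i * f (mrg mu i w).
Definition bs mu f : seq X -> K :=
  fun w => bp mu f w + (if (1 < size w)%N then La (dd mu 0 f) w else 0).
Definition Na f : seq X -> K := fun w => \sum_(k < size w) iter k La f w.

Lemma iter_La_ext m k f g w : (forall w, size w = m -> f w = g w) ->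
  size w = m -> iter k La f w = iter k La g w.
Proof.
move=> fg; elim: k w => [|k IH] w wm /=; first exact: fg.
by rewrite /La IH // size_rotr.
Qed.

Lemma iter_LaZ k a f w : iter k La (fun w => a * f w) w = a * iter k La f w.
Proof. by elim: k w => //= k IH w; rewrite /La IH mulrCA. Qed.

Lemma iter_LaD k f g w :
  iter k La (fun w => f w + g w) w = iter k La f w + iter k La g w.
Proof. by elim: k w => //= k IH w; rewrite /La IH mulrDr. Qed.

Lemma iter_LaN k f w : iter k La (fun w => - f w) w = - iter k La f w.
Proof. by elim: k w => //= k IH w; rewrite /La IH mulrN. Qed.

Lemma iter_La_sum k n (F : nat -> seq X -> K) w :
  iter k La (fun w => \sum_(i < n) F i w) w = \sum_(i < n) iter k La (F i) w.
Proof. by elim: k w => //= k IH w; rewrite /La IH mulr_sumr. Qed.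

Lemma iter_La_rot k f w :
  iter k La f w = (-1) ^+ (k * (size w).-1) * f (iter k (rotr 1) w).
Proof.
elim: k f w => [|k IH] f w; first by rewrite mul0n expr0 mul1r.
rewrite iterS /La IH size_rotr mulrA -exprD mulSn; congr (_ * f _).
by rewrite -iterSr.
Qed.

Lemma iter_La_size f w : iter (size w) La f w = f w.
Proof.
rewrite iter_La_rot.
have -> : iter (size w) (rotr 1) w = w.
  have rotE k : (k <= size w)%N -> iter k (rot 1) w = rot k w.
    elim: k => [_|k IH h]; first by rewrite rot0.
    by rewrite iterS IH ?(ltnW h) // -rotS.
  have rotrK k s : iter k (rotr 1) (iter k (rot 1) s) = s.
    by elim: k s => // k IH s; rewrite iterSr [X in rotr 1 X]iterS rotK.
  by rewrite -{2}[w]rot_size -rotE // rotrK.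
have : ~~ odd (size w * (size w).-1) by case: (size w) => // n; rewrite oddM /=; case: (odd n).
by rewrite -signr_odd => /negPf ->; rewrite expr0 mul1r.
Qed.

Lemma dd_La mu p f w : (p.+2 < size w)%N ->
  dd mu p (La f) w = - La (dd mu p.+1 f) w.
Proof.
move=> h; rewrite /dd /La rotr1_mrg // size_mrg ?(ltnW h) //.
by case: (size w) h => // -[|m] //= _; rewrite exprS; ring.
Qed.

Lemma dd_La_last mu f w : (1 < size w)%N ->
  dd mu (size w).-2 (La f) w = (-1) ^+ (size w) * La (La (dd mu 0 f)) w.
Proof.
move=> h; rewrite /dd /La rotr1_mrg_last // size_mrg ?size_rotr; last first.
  by case: (size w) h => // -[].
case: (size w) h => // -[|m] //= _.
have uu : (-1) ^+ m * (-1) ^+ m = 1 :> K by rewrite -expr2 sqrr_sign.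
by rewrite -[LHS]mul1r -{1}uu !exprS; ring.
Qed.

Lemma dd_iter_La mu k p f w : ((p + k).+1 < size w)%N ->
  dd mu p (iter k La f) w = (-1) ^+ k * iter k La (dd mu (p + k) f) w.
Proof.
elim: k p f w => [|k IH] p f w h; first by rewrite addn0 expr0 mul1r.
rewrite iterSr IH; last lia.
rewrite exprS -mulrA mulN1r -mulrN iterSr -iter_LaN; congr (_ * _).
apply: (@iter_La_ext (size w)) => // w' e; rewrite dd_La ?addnS //; lia.
Qed.

(** Moving a face past λ shifts its index by one and changes the sign ([dd_La]); the last face
    becomes instead the face at 0 with two powers of λ ([dd_La_last]). After [k] passages the faces
    that have not wrapped around carry λ^k and the others λ^(k+1). *)
Lemma bs_iter_La mu k f w : (k.+1 < size w)%N ->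
  bs mu (iter k La f) w =
  \sum_(k <= p < (size w).-1) (-1) ^+ p * iter k La (dd mu p f) w +
  \sum_(0 <= q < k.+1) (-1) ^+ q * iter k.+1 La (dd mu q f) w.
Proof.
elim: k f => [|k IH] f h.
  by rewrite /bs h /bp big_mkord big_nat1 expr0 mul1r.
rewrite iterSr IH; last lia.
rewrite (@big_cat_nat _ _ _ (size w).-2) /=; [|lia|lia].
rewrite [X in _ + X + _](_ : _ = iter k.+2 La (dd mu 0 f) w); last first.
  have -> : (size w).-1 = (size w).-2.+1 by lia.
  rewrite big_nat1 (@iter_La_ext (size w) k _
    (fun w' => (-1) ^+ (size w) * La (La (dd mu 0 f)) w')) //; last first.
    by move=> w' e; rewrite -e dd_La_last ?e //; lia.
  rewrite iter_LaZ mulrA -exprD -!iterSr [X in _ ^+ X](_ : _ = (size w).-2 * 2 + 2)%N.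
    by rewrite exprD exprM sqrr_sign sqrrN expr1n !mul1r.
  by lia.
rewrite -addrA; congr (_ + _).
  rewrite [in RHS](_ : (size w).-1 = (size w).-2.+1); last lia.
  rewrite big_add1 /=; apply: eq_big_nat => p hp.
  rewrite exprS -mulrA mulN1r -mulrN -[La (iter k La _)]/(iter k.+1 La _).
  rewrite iterSr -iter_LaN; congr (_ * _).
  apply: (@iter_La_ext (size w)) => // w' e; rewrite dd_La //; lia.
rewrite [RHS]big_nat_recl // expr0 mul1r; congr (_ + _).
apply: eq_big_nat => q hq.
rewrite exprS -mulrA mulN1r -mulrN.
rewrite -[La (La (iter k La _))]/(iter k.+2 La _) iterSr -iter_LaN.
rewrite -[La (iter k La _)]/(iter k.+1 La _); congr (_ * _).
apply: (@iter_La_ext (size w)) => // w' e; rewrite dd_La //; lia.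
Qed.

End Words.

Arguments La {K X} f w.

(** * The Cartan homotopy formula for a change of product *)

Section Cartan.
Variables (K : comNzRingType) (X : lmodType K).
Implicit Types (f g : seq X -> K) (w s : seq X) (mu nu d e : X -> X -> X).

Lemma signMM n (x : K) : (-1) ^+ n * ((-1) ^+ n * x) = x.
Proof. by rewrite mulrA -expr2 sqrr_sign mul1r. Qed.

(** Row [k.+1] is cut at the diagonal: its right part is the first inner sum of index [k.+1], its
    left part the second inner sum of index [k]. The pieces fill a rectangle, with the left part of
    row [i] left over. *)
Lemma triangle_sum i b (x : nat -> nat -> K) : (i <= b)%N ->
  \sum_(0 <= k < i) (\sum_(k <= p < b) x k p + \sum_(0 <= q < k.+1) x k.+1 q)
  = \sum_(0 <= k < i) \sum_(0 <= p < b) x k p + \sum_(0 <= q < i) x i q.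
Proof.
elim: i => [|i IH] ib; first by rewrite !big_geq // addr0.
rewrite !big_nat_recr //= IH ?(ltnW ib) // (@big_cat_nat _ _ _ i 0 b) //=.
  by ring.
exact: ltnW.
Qed.

Lemma bs_ext m mu f g w : (forall w, size w = m -> f w = g w) ->
  size w = m.+1 -> (0 < m)%N -> bs mu f w = bs mu g w.
Proof.
move=> fg wm m0; rewrite /bs /bp /La /dd wm ltnS m0 /=; congr (_ + _ * _).
  by apply: eq_bigr => i _; rewrite fg // size_mrg ?wm //; have := ltn_ord i; lia.
by rewrite fg // size_mrg ?size_rotr ?wm //; lia.
Qed.

Lemma bs_sum mu n (F : nat -> seq X -> K) w :
  bs mu (fun w => \sum_(0 <= i < n) F i w) w = \sum_(0 <= i < n) bs mu (F i) w.
Proof.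
rewrite /bs big_split /= /bp exchange_big /=; congr (_ + _).
  by apply: eq_bigr => i _; rewrite mulr_sumr.
by case: ifP => _; [rewrite /La /dd mulr_sumr | rewrite big1].
Qed.

Lemma bsZ mu a f w : bs mu (fun w => a * f w) w = a * bs mu f w.
Proof.
rewrite /bs mulrDr /bp mulr_sumr; congr (_ + _).
  by apply: eq_bigr => i _; rewrite mulrCA.
by case: ifP => _; rewrite ?mulr0 // /La /dd mulrCA.
Qed.

Lemma Na_La f w : Na (La f) w = Na f w.
Proof.
apply/eqP; rewrite -subr_eq0 /Na -sumrB; apply/eqP.
rewrite -(big_mkord xpredT (fun k => iter k La (La f) w - iter k La f w)).
rewrite (eq_bigr (fun k => iter k.+1 La f w - iter k La f w)); last first.
  by move=> k _; rewrite -iterSr.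
by rewrite telescope_sumr //= iter_La_size subrr.
Qed.

Lemma La_Na f w : La (Na f) w = Na f w.
Proof.
rewrite -[RHS]Na_La /La /Na size_rotr mulr_sumr; apply: eq_bigr => k _.
by rewrite -[_ * _]/(iter k.+1 La f w) iterSr.
Qed.

(** The identity b N = N b': by [bs_iter_La] the faces of the rotated forms make up the two
    triangles of [triangle_sum], and the rectangle they fill is N b'. *)
Lemma bs_Na mu f w : (0 < size w)%N -> bs mu (Na f) w = Na (bp mu f) w.
Proof.
move=> w0; have [n wn] : exists n, size w = n.+1 by case: (size w) w0 => // n; exists n.
have -> : Na (bp mu f) w = \sum_(0 <= k < n.+1) \sum_(0 <= p < n)
    (-1) ^+ p * iter k La (dd mu p f) w.
  rewrite /Na wn big_mkord; apply: eq_bigr => k _; rewrite big_mkord.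
  rewrite (@iter_La_ext _ _ n.+1 k _
    (fun w => \sum_(p < n) (-1) ^+ p * dd mu p f w)) //; last first.
    by move=> w' e; rewrite /bp e.
  rewrite (iter_La_sum k n (fun p w => (-1) ^+ p * dd mu p f w)).
  by apply: eq_bigr => p _; rewrite iter_LaZ.
case: n wn => [|n] wn.
  by rewrite /bs /bp wn /= big_ord0 addr0 big1_seq // => i _; rewrite big_geq.
rewrite (@bs_ext n.+1 _ _ (fun w => \sum_(0 <= k < n.+1) iter k La f w)) //; last first.
  by move=> w' e; rewrite /Na e big_mkord.
rewrite bs_sum [RHS]big_nat_recr //= -triangle_sum //.
apply: eq_big_nat => k /andP[_ kn]; by rewrite bs_iter_La ?wn.
Qed.

(** The six words differ only in the letter that replaces three neighbours, so linearity in this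
    slot carries the relation from [X] to [f]. *)
Lemma mlin_mrg3 f w d e i :
  mlin f -> (i.+2 < size w)%N ->
  (forall a b c, e (d a b) c - e a (d b c) + d (e a b) c - d a (e b c) =
                 e a (e b c) - e (e a b) c) ->
  f (mrg e i (mrg d i w)) - f (mrg e i (mrg d i.+1 w))
  + f (mrg d i (mrg e i w)) - f (mrg d i (mrg e i.+1 w)) =
  f (mrg e i (mrg e i.+1 w)) - f (mrg e i (mrg e i w)).
Proof.
move=> lf h rel.
have [s [a [b [c [t [-> si]]]]]] : exists s a b c t, w = s ++ [:: a, b, c & t] /\ size s = i.
  exists (take i w), (nth 0 w i), (nth 0 w i.+1), (nth 0 w i.+2), (drop i.+3 w).
  split; last by rewrite size_take; case: ltnP => //; lia.
  by rewrite -!drop_nth ?cat_take_drop //; lia.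
have e0 mu' s' : mrg mu' i (s ++ s') = s ++ mrg mu' 0 s' by rewrite -{1}si -[size s]addn0 mrg_cat.
have e1 mu' s' : mrg mu' i.+1 (s ++ s') = s ++ mrg mu' 1 s' by rewrite -{1}si -addn1 mrg_cat.
rewrite !e1 !e0 /=.
have fD x y : f (s ++ (x + y) :: t) = f (s ++ x :: t) + f (s ++ y :: t).
  by rewrite -[x]scale1r lf mul1r scale1r.
have f0 : f (s ++ 0 :: t) = 0 by apply: (addrI (f (s ++ 0 :: t))); rewrite -fD !addr0.
have fN x : f (s ++ (- x) :: t) = - f (s ++ x :: t).
  by apply: (addrI (f (s ++ x :: t))); rewrite -fD !subrr.
by rewrite -!fN -!fD rel.
Qed.

(** The three components of contraction with the 2-cochain [e]. A cochain is split into a first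
    component, whose leading entry lies in the algebra, and a second one, whose leading entry is the
    adjoined unit; the two digits are source and target. [H11] evaluates at a_0 e(a_1, a_2) and
    [H12] at e(a_1, a_2) in the leading slot; [H21] is the cyclic correction that keeps the
    degree. *)
Definition H11 d e f : seq X -> K :=
  fun w => if (2 < size w)%N then - f (mrg d 0 (mrg e 1 w)) else 0.
Definition H12 e f : seq X -> K :=
  fun w => if (1 < size w)%N then - f (mrg e 0 w) else 0.
Definition H21 e f : seq X -> K :=
  fun w => \sum_(0 <= i < (size w).-1) \sum_(0 <= k < i)
             (-1) ^+ i * iter k La (dd e i f) w.
(** Up to sign the right-hand side of the relation in [mlin_mrg3]. It contains [e] twice, so it is
    negligible to first order. *)
Definition rr e i f : seq X -> K :=
  fun w => f (mrg e i (mrg e i w)) - f (mrg e i (mrg e i.+1 w)).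

(** Applying 1 - λ telescopes the inner sum of [H21]. Its end [k = 0] gives b' formed with [e], and
    its end [k = i] is cancelled by [H12] after N. *)
Lemma cartan22 e f w :
  H12 e (Na f) w - (H21 e f w - La (H21 e f) w) = - bp e f w.
Proof.
have -> : H21 e f w - La (H21 e f) w = bp e f w -
    \sum_(0 <= i < (size w).-1) (-1) ^+ i * iter i La (dd e i f) w.
  rewrite /La /H21 size_rotr mulr_sumr -sumrB.
  rewrite /bp -(big_mkord xpredT (fun i => (-1) ^+ i * f (mrg e i w))) -sumrB.
  apply: eq_bigr => i _; rewrite mulr_sumr -sumrB.
  rewrite (eq_bigr (fun k => - ((-1) ^+ i * iter k.+1 La (dd e i f) w -
      (-1) ^+ i * iter k La (dd e i f) w))); last first.
    by move=> k _; rewrite opprB mulrCA -/(La _ _).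
  by rewrite sumrN telescope_sumr //= opprB.
have -> : H12 e (Na f) w = -
    \sum_(0 <= i < (size w).-1) (-1) ^+ i * iter i La (dd e i f) w.
  rewrite /H12; case: ifP => h; last by rewrite big_geq ?oppr0 //; lia.
  congr (- _); rewrite /Na size_mrg // big_mkord; apply: eq_bigr => k _.
  rewrite -[LHS]/(dd e 0 (iter k La f) w) dd_iter_La add0n //.
  by have := ltn_ord k; lia.
by ring.
Qed.

(** The combinatorial core of [cartan21]. [G k p i] and [G' k i p] stand for λ^k applied to the two
    orders of composing a face of [d] at [p] with a face of [e] at [i]. Away from the diagonal the
    orders are exchanged; on the diagonal the cocycle relation leaves [r]. *)
Lemma cartan_sum n (G G' : nat -> nat -> nat -> K) (r : nat -> nat -> K) :
  (forall k i p, (i.+2 <= p)%N -> G' k i p = G k p.-1 i) ->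
  (forall k i p, (p < i)%N -> G' k i p = G k p i.+1) ->
  (forall k i, (i < n)%N ->
     G' k i i - G' k i i.+1 + G k i i - G k i i.+1 = - r k i) ->
  \sum_(0 <= k < n) G k k k.+1
  + \sum_(0 <= i < n.+1) \sum_(0 <= k < i) \sum_(0 <= p < n) (-1) ^+ (i + p) * G k p i
  + \sum_(0 <= i < n) \sum_(0 <= k < i) (-1) ^+ i *
      (\sum_(k <= p < n.+1) (-1) ^+ p * G' k i p
       + \sum_(0 <= q < k.+1) (-1) ^+ q * G' k.+1 i q)
  + \sum_(0 <= i < n) \sum_(0 <= k < i) r k i = 0.
Proof.
move=> G1 G2 G3.
have third i : (i < n)%N ->
  \sum_(0 <= k < i) (-1) ^+ i *
      (\sum_(k <= p < n.+1) (-1) ^+ p * G' k i p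
       + \sum_(0 <= q < k.+1) (-1) ^+ q * G' k.+1 i q) =
  (-1) ^+ i * (\sum_(0 <= k < i.+1) \sum_(0 <= p < i.+1) (-1) ^+ p * G k p i.+1)
  - G i i i.+1
  - (-1) ^+ i * (\sum_(0 <= k < i) \sum_(i <= p < n) (-1) ^+ p * G k p i)
  - \sum_(0 <= k < i) r k i.
  move=> ik; rewrite -mulr_sumr.
  rewrite (triangle_sum (b := n.+1) (fun k p => (-1) ^+ p * G' k i p)); last lia.
  (* The row is cut at [p = i] and [p = i.+1]: the part below is rewritten by [G2], the part above
     by [G1], and the two entries in between by [G3]. *)
  have inner k : \sum_(0 <= p < n.+1) (-1) ^+ p * G' k i p =
      \sum_(0 <= p < i.+1) (-1) ^+ p * G k p i.+1
      - \sum_(i <= p < n) (-1) ^+ p * G k p i - (-1) ^+ i * r k i.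
    rewrite (@big_cat_nat _ _ _ i 0 n.+1) //=; last lia.
    rewrite [X in _ + X = _]big_ltn; last lia.
    rewrite [X in _ + (_ + X) = _]big_ltn; last lia.
    rewrite [X in _ + (_ + (_ + X))](_ : _ = - \sum_(i.+1 <= p < n) (-1) ^+ p * G k p i); last first.
      rewrite -(prednK (leq_ltn_trans (leq0n i) ik)) big_add1 /= -sumrN.
      apply: eq_big_nat => p /andP[ip _]; rewrite G1 /=; last by rewrite !ltnS.
      by rewrite !exprS; ring.
    rewrite [X in X + _](_ : _ = \sum_(0 <= p < i) (-1) ^+ p * G k p i.+1); last first.
      by apply: eq_big_nat => p /andP[_ pi]; rewrite G2.
    rewrite [X in _ = X - _ - _]big_nat_recr //= [X in _ = _ - X - _]big_ltn //.
    have := G3 k i ik; move: (G' k i i) (G' k i i.+1) => u v h.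
    have -> : r k i = - (u - v + G k i i - G k i i.+1) by rewrite h opprK.
    by rewrite exprS; ring.
  under eq_bigr do rewrite inner.
  rewrite !sumrB mulrDr 2!mulrBr [X in _ - X + _]mulr_sumr.
  under [X in _ - X + _]eq_bigr do rewrite signMM.
  rewrite [X in _ = _ * X - _ - _ - _]big_nat_recr //= [X in _ = _ * (_ + X) - _ - _ - _]big_nat_recr //=.
  rewrite !mulrDr signMM.
  have -> : \sum_(0 <= q < i) (-1) ^+ q * G' i i q = \sum_(0 <= q < i) (-1) ^+ q * G i q i.+1.
    by apply: eq_big_nat => q /andP[_ qi]; rewrite G2.
  by ring.
rewrite (eq_big_nat _ _ (fun i hi => third i (proj2 (elimT andP hi)))).
rewrite !sumrB.
have second : \sum_(0 <= i < n.+1) \sum_(0 <= k < i) \sum_(0 <= p < n) (-1) ^+ (i + p) * G k p i =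
  - \sum_(0 <= i < n) (-1) ^+ i * (\sum_(0 <= k < i.+1) \sum_(0 <= p < i.+1) (-1) ^+ p * G k p i.+1)
  + \sum_(0 <= i < n) (-1) ^+ i * (\sum_(0 <= k < i) \sum_(i <= p < n) (-1) ^+ p * G k p i).
  have split i : (i <= n)%N -> \sum_(0 <= k < i) \sum_(0 <= p < n) (-1) ^+ (i + p) * G k p i =
      (-1) ^+ i * (\sum_(0 <= k < i) \sum_(0 <= p < i) (-1) ^+ p * G k p i)
      + (-1) ^+ i * (\sum_(0 <= k < i) \sum_(i <= p < n) (-1) ^+ p * G k p i).
    move=> ni; rewrite -mulrDr -big_split /= mulr_sumr; apply: eq_bigr => k _.
    rewrite -big_cat_nat //= mulr_sumr; apply: eq_bigr => p _.
    by rewrite exprD mulrA.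
  rewrite (eq_big_nat _ _ (F2 := fun i => (-1) ^+ i * (\sum_(0 <= k < i) \sum_(0 <= p < i) (-1) ^+ p * G k p i)
      + (-1) ^+ i * (\sum_(0 <= k < i) \sum_(i <= p < n) (-1) ^+ p * G k p i))); last first.
    by move=> i /andP[_ ni]; exact: split.
  rewrite big_split /=; congr (_ + _).
    rewrite big_nat_recl //= [X in _ * X + _]big_geq // mulr0 add0r -sumrN.
    by apply: eq_bigr => i _; rewrite exprS; ring.
  rewrite big_nat_recr //= [X in _ + _ * X](_ : _ = 0) ?mulr0 ?addr0 //.
  by rewrite big1 // => k _; rewrite big_geq.
rewrite second; ring.
Qed.

Definition bilin mu := forall a x y z,
  mu (a *: x + y) z = a *: mu x z + mu y z /\
  mu z (a *: x + y) = a *: mu z x + mu z y.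

Lemma mlin_dd mu i f : bilin mu -> mlin f -> mlin (dd mu i f).
Proof.
move=> lmu lf s1 s2 a x y; rewrite /dd.
suff: forall p, f (p ++ mrg mu i (s1 ++ (a *: x + y) :: s2)) =
  a * f (p ++ mrg mu i (s1 ++ x :: s2)) + f (p ++ mrg mu i (s1 ++ y :: s2)).
  by move=> /(_ [::]).
elim: s1 i => [|b s1 IH] [|i] p /=.
- case: s2 => [|c s2] /=; first by rewrite lf.
  by rewrite (proj1 (lmu _ _ _ _)) lf.
- by rewrite lf.
- case: s1 {IH} => [|c s1] /=; first by rewrite (proj2 (lmu _ _ _ _)) lf.
  have catE v : p ++ mu b c :: s1 ++ v :: s2 = (p ++ mu b c :: s1) ++ v :: s2.
    by rewrite -catA.
  by rewrite !catE lf.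
- by have := IH i (rcons p b); rewrite !cat_rcons.
Qed.

Section Deform.
Variables (d e : X -> X -> X).
Hypotheses (dA : associative d) (dl : bilin d).
(** The Maurer-Cartan equation, which holds when both [d] and [d + e] are associative: [e] is a
    Hochschild 2-cocycle for [d] up to terms quadratic in [e]. *)
Hypothesis cocycle : forall a b c,
  e (d a b) c - e a (d b c) + d (e a b) c - d a (e b c) =
  e a (e b c) - e (e a b) c.

Lemma iter_rr k i f w : iter k La (rr e i f) w =
  iter k La (dd e i (dd e i f)) w - iter k La (dd e i.+1 (dd e i f)) w.
Proof. by rewrite -iter_LaN -iter_LaD. Qed.

Lemma mlin_rel f i w : mlin f -> (i.+2 < size w)%N ->
  dd d i (dd e i f) w - dd d i.+1 (dd e i f) w
  + dd e i (dd d i f) w - dd e i.+1 (dd d i f) w = - rr e i f w.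
Proof. by move=> lf h; rewrite /rr opprB; exact: (mlin_mrg3 lf h cocycle). Qed.

(** The component from unit to algebra of the commutator with b + B. The two products change to
    first order only the diagonal components of b + B, so here just second-order terms may
    survive. *)
Lemma cartan21 f w : mlin f ->
  H11 d e (Na f) w - H21 e (bp d f) w - bs d (H21 e f) w =
  \sum_(0 <= i < (size w).-2) \sum_(0 <= k < i) iter k La (rr e i f) w.
Proof.
move=> lf; case: (ltnP (size w) 2) => h.
  have -> : bs d (H21 e f) w = 0.
    by rewrite /bs /bp; case: (size w) h => [|[|]] //= _; rewrite big_ord0 addr0.
  rewrite /H11 [in LHS]/H21 ifF; last lia.
  by case: (size w) h => [|[|]] //= _; rewrite !big_geq // !subr0.
have [n wn] : exists n, size w = n.+2 by case: (size w) h => [|[|n]] //; exists n.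
pose G k p i := iter k La (dd e i (dd d p f)) w.
pose G' k i p := iter k La (dd d p (dd e i f)) w.
have G1 k i p : (i.+2 <= p)%N -> G' k i p = G k p.-1 i.
  move=> ip; apply: (@iter_La_ext _ _ (size w)) => // w' _.
  by rewrite /dd mrgC.
have G2 k i p : (p < i)%N -> G' k i p = G k p i.+1.
  move=> pi; apply: (@iter_La_ext _ _ (size w)) => // w' _.
  by rewrite /dd [in RHS]mrgC.
have G3 k i : (i < n)%N -> G' k i i - G' k i i.+1 + G k i i - G k i i.+1 =
    - iter k La (rr e i f) w.
  move=> ni; rewrite /G /G' -!iter_LaN -!iter_LaD.
  apply: (@iter_La_ext _ _ (size w)) => // w' ew.
  by rewrite mlin_rel // ew wn.
have := cartan_sum G1 G2 G3; rewrite wn /=.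
have -> : H11 d e (Na f) w = - \sum_(0 <= k < n) G k k k.+1.
  rewrite /H11 wn; case: ltnP => hn; last by rewrite big_geq ?oppr0 //; lia.
  have s1 : size (mrg e 1 w) = n.+1 by rewrite size_mrg wn.
  rewrite /Na size_mrg s1 //= big_mkord; congr (- _); apply: eq_bigr => k _.
  have kn := ltn_ord k.
  rewrite -[LHS]/(dd d 0 (iter k La f) (mrg e 1 w)) dd_iter_La add0n; last by rewrite s1; lia.
  rewrite -[X in _ * X]/(dd e 1 (iter k La (dd d k f)) w) dd_iter_La; last by rewrite wn; lia.
  by rewrite signMM add1n.
have -> : H21 e (bp d f) w =
    \sum_(0 <= i < n.+1) \sum_(0 <= k < i) \sum_(0 <= p < n) (-1) ^+ (i + p) * G k p i.
  rewrite /H21 wn /=; apply: eq_big_nat => i /andP[_ hi]; apply: eq_bigr => k _.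
  rewrite (@iter_La_ext _ _ n.+2 k _
    (fun w => \sum_(p < n) (-1) ^+ p * dd e i (dd d p f) w)) //; last first.
    by move=> w' ew; rewrite /dd /bp size_mrg ew.
  rewrite (iter_La_sum k n (fun p w => (-1) ^+ p * dd e i (dd d p f) w)).
  rewrite mulr_sumr big_mkord; apply: eq_bigr => p _.
  by rewrite iter_LaZ exprD mulrA.
have -> : bs d (H21 e f) w = \sum_(0 <= i < n) \sum_(0 <= k < i) (-1) ^+ i *
      (\sum_(k <= p < n.+1) (-1) ^+ p * G' k i p
       + \sum_(0 <= q < k.+1) (-1) ^+ q * G' k.+1 i q).
  rewrite (@bs_ext n.+1 _ _ (fun w => \sum_(0 <= i < n) \sum_(0 <= k < i)
             (-1) ^+ i * iter k La (dd e i f) w)) //; last first.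
    by move=> w' ew; rewrite /H21 ew.
  rewrite bs_sum; apply: eq_big_nat => i /andP[_ hi].
  rewrite bs_sum; apply: eq_big_nat => k /andP[_ hk].
  by rewrite bsZ bs_iter_La wn //; lia.
move: (\sum_(0 <= k < n) G k k k.+1) (\sum_(0 <= i < n.+1) _) => u v.
move: (\sum_(0 <= i < n) \sum_(0 <= k < i) _ * _) => x.
move: (\sum_(0 <= i < n) _) => y E.
by rewrite -[RHS]subr0 -E; ring.
Qed.

(** The faces away from the first three letters cancel between [H12] after b and b' after [H12], the
    wrap-around face cancels against λ applied to [H11], and the cocycle relation on the first three
    letters leaves [rr]. *)
Lemma cartan12 f w : mlin f ->
  H12 e (bs d f) w - (H11 d e f w - La (H11 d e f) w) + bp d (H12 e f) w =
  if (2 < size w)%N then rr e 0 f w else 0.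
Proof.
move=> lf; case: (ltnP 2 (size w)) => h; last first.
  have -> : La (H11 d e f) w = 0 by rewrite /La /H11 size_rotr ltnNge h mulr0.
  have -> : bp d (H12 e f) w = 0.
    rewrite /bp big1 // => i _; rewrite /H12 size_mrg; last by have := ltn_ord i; lia.
    by rewrite ifF ?mulr0 //; lia.
  rewrite /H11 ltnNge h /= /H12; case: ifP => h1; last by rewrite subrr addr0 subr0.
  rewrite /bs /bp size_mrg //; have -> : size w = 2 by lia.
  by rewrite /= big_ord0; ring.
have [n wn] : exists n, size w = n.+3 by case: (size w) h => [|[|[|n]]] //; exists n.
have -> : H12 e (bs d f) w =
    - (f (mrg d 0 (mrg e 0 w)) + \sum_(1 <= p < n.+1) (-1) ^+ p * f (mrg d p (mrg e 0 w)))
    + La (dd e 1 (dd d 0 f)) w.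
  rewrite /H12 /bs /bp size_mrg wn //=.
  rewrite -(big_mkord xpredT (fun p => (-1) ^+ p * f (mrg d p (mrg e 0 w)))).
  rewrite big_ltn // expr0 mul1r opprD.
  by rewrite -[X in _ - X = _]/(dd e 0 (La (dd d 0 f)) w) dd_La ?wn // opprK.
have -> : La (H11 d e f) w = - La (dd e 1 (dd d 0 f)) w.
  by rewrite /La /H11 size_rotr wn /= mulrN.
have -> : bp d (H12 e f) w = - f (mrg e 0 (mrg d 0 w)) + f (mrg e 0 (mrg d 1 w))
    + \sum_(1 <= p < n.+1) (-1) ^+ p * f (mrg d p (mrg e 0 w)).
  rewrite /bp wn /= -(big_mkord xpredT (fun p => (-1) ^+ p * H12 e f (mrg d p w))).
  rewrite (eq_big_nat _ _ (F2 := fun p => (-1) ^+ p * - f (mrg e 0 (mrg d p w)))); last first.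
    by move=> p /andP[_ hp]; rewrite /H12 size_mrg wn.
  rewrite big_ltn // big_ltn // big_add1 /= expr0 expr1 mul1r mulN1r opprK addrA.
  congr (_ + _); apply: eq_big_nat => p /andP[p1 _].
  by rewrite mrgC // exprS; ring.
have := mlin_rel lf h; rewrite /dd /H11 h => E.
by rewrite -[rr e 0 f w]opprK -E; ring.
Qed.

(** An identity in [e] alone. [H21] applied to f - λ f telescopes up to rotations of the face at 0,
    and N after [H12] supplies these; the result is the first-order change of b. *)
Lemma cartan11_split f w :
  H21 e (fun w => f w - La f w) w - Na (H12 e f) w = bs e f w.
Proof.
case: (ltnP 1 (size w)) => h; last first.
  have -> : Na (H12 e f) w = 0.
    rewrite /Na big1 // => k _.
    rewrite (@iter_La_ext _ _ (size w) k _ (fun=> 0)) //.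
      by rewrite iter_La_rot mulr0.
    by move=> w' ew; rewrite /H12 ew ltnNge h.
  rewrite /bs ltnNge h /= /H21 /bp.
  have -> : (size w).-1 = 0%N by lia.
  by rewrite big_geq // big_ord0 subrr addr0.
have [n wn] : exists n, size w = n.+2 by case: (size w) h => [|[|n]] //; exists n.
pose x k i := iter k La (dd e i f) w.
have -> : Na (H12 e f) w = - \sum_(0 <= k < n.+2) x k 0%N.
  rewrite /Na wn big_mkord -sumrN; apply: eq_bigr => k _.
  rewrite -iter_LaN; apply: (@iter_La_ext _ _ (size w)) => // w' ew.
  by rewrite /H12 ew wn.
have -> : H21 e (fun w => f w - La f w) w =
    \sum_(0 <= i < n.+1) \sum_(0 <= k < i) (-1) ^+ i * x k i
    + \sum_(0 <= i < n) \sum_(0 <= k < i) (-1) ^+ i * x k.+1 i.+1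
    - \sum_(0 <= k < n) x k.+2 0%N.
  rewrite /H21 wn /=.
  rewrite (eq_bigr (fun i => \sum_(0 <= k < i) (-1) ^+ i * x k i -
     \sum_(0 <= k < i) (-1) ^+ i * iter k La (dd e i (La f)) w)); last first.
    move=> i _; rewrite -sumrB; apply: eq_bigr => k _.
    by rewrite /x -mulrBr -iter_LaN -iter_LaD.
  rewrite sumrB -addrA; congr (_ + _).
  rewrite big_nat_recr //= opprD; congr (_ + _).
    rewrite -sumrN; apply: eq_big_nat => i /andP[_ hi].
    rewrite -sumrN; apply: eq_bigr => k _; rewrite -mulrN /x iterSr -iter_LaN.
    congr (_ * _); apply: (@iter_La_ext _ _ (size w)) => // w' ew.
    by rewrite dd_La ?opprK // ew wn.
  congr (- _); apply: eq_bigr => k _; rewrite /x.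
  rewrite (@iter_La_ext _ _ (size w) k _
    (fun w' => (-1) ^+ n * La (La (dd e 0 f)) w')) //; last first.
    move=> w' ew; have := @dd_La_last _ _ e f w'; rewrite ew wn /= => -> //.
    by rewrite !exprS !mulrA mulrN1 opprK mul1r.
  by rewrite iter_LaZ signMM -!iterSr.
have -> : \sum_(0 <= i < n) \sum_(0 <= k < i) (-1) ^+ i * x k.+1 i.+1 =
   - \sum_(0 <= i < n.+1) (\sum_(0 <= k < i) (-1) ^+ i * x k i)
   + \sum_(1 <= i < n.+1) (-1) ^+ i * x 0%N i.
  rewrite [X in - X + _]big_ltn // [X in - (X + _) + _]big_geq // add0r.
  rewrite !big_add1 /= -sumrN -big_split /=; apply: eq_bigr => i _.
  rewrite [X in _ = - X + _]big_ltn // big_add1 /= opprD addrAC addNr add0r.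
  by rewrite -sumrN; apply: eq_bigr => k _; rewrite exprS; ring.
rewrite [X in _ - - X]big_ltn // [X in _ - - (_ + X)]big_ltn // !big_add1 /=.
have -> : bs e f w = x 0%N 0%N + \sum_(0 <= i < n) (-1) ^+ i.+1 * x 0%N i.+1 + x 1%N 0%N.
  rewrite /bs h /bp wn /= -(big_mkord xpredT (fun i => (-1) ^+ i * x 0%N i)).
  by rewrite big_ltn // big_add1 /= expr0 mul1r.
by ring.
Qed.

(** The faces beyond the first four letters cancel in pairs. The remaining ones are the cocycle
    relation at the second letter, applied to [dd d 0 f], with associativity of [d] absorbing the
    products with the first letter. *)
Lemma cartan11_comm f w : mlin f ->
  H11 d e (bs d f) w - bs d (H11 d e f) w =
  if (3 < size w)%N then rr e 1 (dd d 0 f) w else 0.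
Proof.
move=> lf; case: (ltnP 3 (size w)) => h; last first.
  have -> : bs d (H11 d e f) w = 0.
    rewrite /bs /bp big1 => [|i _]; last first.
      rewrite /H11 size_mrg; last by have := ltn_ord i; lia.
      by rewrite ifF ?mulr0 //; lia.
    case: ifP => h1; last by rewrite addr0.
    rewrite /La /dd /H11 size_mrg ?size_rotr // ifF ?mulr0 ?addr0 //; lia.
  rewrite /H11; case: ifP => h2; last by rewrite subrr.
  rewrite /bs /bp size_mrg ?size_mrg //; try lia.
  have -> : size w = 3 by lia.
  by rewrite /= big_ord0; ring.
have [n wn] : exists n, size w = n.+4 by case: (size w) h => [|[|[|[|n]]]] //; exists n.
have s1 : size (mrg e 1 w) = n.+3 by rewrite size_mrg wn.
have s2 : size (mrg d 0 (mrg e 1 w)) = n.+2 by rewrite size_mrg s1.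
pose S := \sum_(1 <= q < n.+1) (-1) ^+ q * f (mrg d q (mrg d 0 (mrg e 1 w))).
have -> : H11 d e (bs d f) w = - (f (mrg d 0 (mrg d 0 (mrg e 1 w))) + S)
    - La (dd d 0 f) (mrg d 0 (mrg e 1 w)).
  rewrite /H11 wn /= /bs s2 /= /bp s2 /= opprD; congr (- _ - _).
  rewrite -(big_mkord xpredT (fun p => (-1) ^+ p * f (mrg d p (mrg d 0 (mrg e 1 w))))).
  by rewrite big_ltn // expr0 mul1r.
have -> : bs d (H11 d e f) w = - f (mrg d 0 (mrg e 1 (mrg d 0 w)))
    + f (mrg d 0 (mrg e 1 (mrg d 1 w))) - f (mrg d 0 (mrg e 1 (mrg d 2 w))) - S
    + La (dd d 0 (H11 d e f)) w.
  rewrite /bs wn /=; congr (_ + _).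
  rewrite /bp wn /= -(big_mkord xpredT (fun p => (-1) ^+ p * H11 d e f (mrg d p w))).
  rewrite (eq_big_nat _ _ (F2 := fun p => (-1) ^+ p * - f (mrg d 0 (mrg e 1 (mrg d p w))))); last first.
    by move=> p /andP[_ hp]; rewrite /H11 size_mrg wn.
  rewrite big_ltn // big_ltn // big_ltn // 2!big_add1 /=.
  have -> : \sum_(1 <= i < n.+1) (-1) ^+ i.+2 * - f (mrg d 0 (mrg e 1 (mrg d i.+2 w))) = - S.
    rewrite -sumrN; apply: eq_big_nat => p /andP[p1 _].
    by rewrite (@mrgC _ e) // (@mrgC _ d d 0) // !exprS; ring.
  by rewrite !exprS expr0; ring.
have -> : La (dd d 0 (H11 d e f)) w = - La (dd d 0 f) (mrg d 0 (mrg e 1 w)).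
  rewrite /La /dd s2 /H11 size_mrg size_rotr wn //= mulrN.
  rewrite !exprS !mulrA mulN1r opprK mul1r; congr (- (_ * f _)).
  rewrite !rotr1_mrg ?s1 ?wn // -(@mrgC _ d e 0 2) // mrgA //.
  by rewrite size_mrg size_rotr wn.
have := @mlin_rel (dd d 0 f) 1%N w (mlin_dd _ dl lf); rewrite wn => /(_ isT) E.
rewrite -[rr e 1 _ w]opprK -E /dd -(@mrgC _ d e 0 2) // !(mrgA dA) ?s1 ?size_mrg ?wn //.
by ring.
Qed.

End Deform.
End Cartan.

(** * Bounded multilinear forms with coefficients, and their faces *)

Section Forms.
Variables (R : realType) (X : completeNormedModType R[i]).
Local Notation C := R[i].

Definition wt (w : seq X) : R := \prod_(x <- w) nrm x.

Lemma wt_ge0 w : 0 <= wt w.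
Proof. by rewrite /wt; elim/big_ind: _ => // [x y|x _]; [exact: mulr_ge0|exact: nrm_ge0]. Qed.

Lemma wt_nil : wt [::] = 1. Proof. by rewrite /wt big_nil. Qed.
Lemma wt_cons x w : wt (x :: w) = nrm x * wt w. Proof. by rewrite /wt big_cons. Qed.
Lemma wt_cat w s : wt (w ++ s) = wt w * wt s. Proof. by rewrite /wt big_cat. Qed.
Lemma wt_rcons w x : wt (rcons w x) = wt w * nrm x.
Proof. by rewrite -cats1 wt_cat wt_cons wt_nil mulr1. Qed.
Lemma wt_rot k w : wt (rot k w) = wt w.
Proof. by rewrite /rot wt_cat mulrC -wt_cat cat_take_drop. Qed.
Lemma wt_rotr k w : wt (rotr k w) = wt w. Proof. exact: wt_rot. Qed.

Definition bmul (mu : X -> X -> X) (k : R) :=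
  forall a b, nrm (mu a b) <= k * (nrm a * nrm b).

Lemma wt_mrg mu k i w : bmul mu k -> (i.+1 < size w)%N ->
  wt (mrg mu i w) <= k * wt w.
Proof.
move=> hk; elim: w i => [|a w IH] [|i] //=.
  case: w {IH} => // b w _; rewrite !wt_cons !mulrA ler_wpM2r ?wt_ge0 //.
  by rewrite -mulrA.
rewrite ltnS => h; rewrite !wt_cons mulrCA ler_wpM2l ?nrm_ge0 //; exact: IH.
Qed.

Section Coefficients.
Variable M : normedModType C.
Implicit Types psi : seq X -> M -> C^o.

Definition bnd psi n (K : R) :=
  forall w m, size w = n -> cn (psi w m) <= K * (wt w * nrm m).

(** A family of cochains, one in every degree, with values in the dual of [M]: the word holds the
    arguments and [m] is the point at which the value is taken. The bound may depend on the
    degree. *)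
Definition good psi :=
  [/\ forall m, mlin (psi^~ m : seq X -> C),
      forall w a m m', psi w (a *: m + m') = a * psi w m + psi w m' &
      forall n, exists K, bnd psi n K].

Lemma bnd_ge0 psi n K : bnd psi n K -> exists2 L, 0 <= L & bnd psi n L.
Proof.
move=> h; exists (Num.max K 0); first by rewrite le_max lexx orbT.
move=> w m wn; apply: le_trans (h w m wn) _.
by rewrite ler_wpM2r ?mulr_ge0 ?wt_ge0 ?nrm_ge0 // le_max lexx.
Qed.

Lemma bnd_le psi n K L : K <= L -> bnd psi n K -> bnd psi n L.
Proof.
move=> KL h w m wn; apply: le_trans (h w m wn) _.
by rewrite ler_wpM2r ?mulr_ge0 ?wt_ge0 ?nrm_ge0.
Qed.

Lemma bndD psi phi n K L : bnd psi n K -> bnd phi n L ->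
  bnd (fun w m => psi w m + phi w m) n (K + L).
Proof.
move=> h1 h2 w m wn; apply: le_trans (cnD _ _) _.
by rewrite mulrDl lerD ?h1 ?h2.
Qed.

Lemma bndZ a psi n K : bnd psi n K -> bnd (fun w m => a * psi w m) n (cn a * K).
Proof. by move=> h w m wn; rewrite cnM -mulrA ler_wpM2l ?cn_ge0 ?h. Qed.

Lemma good_closed : submod_closed [pred psi | `[< good psi >]].
Proof.
split=> [|c D E]; rewrite !inE.
  split=> [m s1 s2 a x y|w a m m'|n]; first by rewrite mulr0 addr0.
    by rewrite mulr0 addr0.
  by exists 0 => w m _; rewrite cn0 mul0r.
move=> [D1 D2 D3] [E1 E2 E3].
have e w m : (c *: D + E) w m = c * D w m + E w m by [].
split=> [m s1 s2 a x y|w a m m'|n].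
- by rewrite !e D1 E1; ring.
- by rewrite !e D2 E2; ring.
have [K hK] := D3 n; have [L hL] := E3 n.
exists (cn c * K + L) => w m wn; rewrite e.
exact: (bndD (bndZ c hK) hL).
Qed.

Definition HC : lmodType C := subm (Submodule good_closed).

Lemma HCP (psi : HC) : good (val psi).
Proof. by have := valP psi; rewrite inE. Qed.

Lemma mkHC_subproof psi : good psi -> psi \in submodule_pred (Submodule good_closed).
Proof. by rewrite inE. Qed.

Definition mkHC psi (h : good psi) : HC := subm_mk (mkHC_subproof h).

Lemma HC_ext (psi phi : HC) : (forall w m, val psi w m = val phi w m) -> psi = phi.
Proof. by move=> h; apply: val_inj; apply/funext => w; apply/funext => m. Qed.

Lemma HCE c (psi phi : HC) w m :
  val (c *: psi + phi) w m = c * val psi w m + val phi w m.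
Proof. exact: subm_fun2P. Qed.
Lemma HCD (psi phi : HC) w m : val (psi + phi) w m = val psi w m + val phi w m.
Proof. by rewrite -[psi]scale1r HCE mul1r scale1r. Qed.
Lemma HC0 w m : val (0 : HC) w m = 0.
Proof. by rewrite raddf0. Qed.
Lemma HCZ c (psi : HC) w m : val (c *: psi) w m = c * val psi w m.
Proof. by rewrite -[c *: psi]addr0 HCE HC0 addr0. Qed.
Lemma HCN (psi : HC) w m : val (- psi) w m = - val psi w m.
Proof. by rewrite -scaleN1r HCZ mulN1r. Qed.
Lemma HCB (psi phi : HC) w m : val (psi - phi) w m = val psi w m - val phi w m.
Proof. by rewrite HCD HCN. Qed.

Lemma HC_mod0 (psi : HC) w : val psi w 0 = 0.
Proof.
have [_ l _] := HCP psi; have := l w 1 0 0; rewrite scale1r mul1r addr0 => h.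
by apply: (addrI (val psi w 0)); rewrite -h addr0.
Qed.

Lemma HC_modZ (psi : HC) w a m : val psi w (a *: m) = a * val psi w m.
Proof. by have [_ l _] := HCP psi; have := l w a m 0; rewrite HC_mod0 !addr0. Qed.

Lemma HC_modD (psi : HC) w m n : val psi w (m + n) = val psi w m + val psi w n.
Proof. by have [_ l _] := HCP psi; have := l w 1 m n; rewrite scale1r mul1r. Qed.

Lemma HC_modB (psi : HC) w m n : val psi w (m - n) = val psi w m - val psi w n.
Proof. by rewrite -[- n]scaleN1r HC_modD HC_modZ mulN1r. Qed.

End Coefficients.

Lemma alg_bilin (A : algebra X) : bilin A.
Proof. by have [l1 l2 _] := amulP A; move=> a x y z; rewrite l1 l2. Qed.

Lemma bilinear_nrm (U V W : normedModType C) (g : U -> V -> W) :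
  bounded_bilinear g ->
  exists2 k : R, 0 <= k & forall u v, nrm (g u v) <= k * (nrm u * nrm v).
Proof.
move=> /bounded_bilinear_bound[k k0 hk]; exists (cn k) => [|u v]; first exact: cn_ge0.
have e : k * (`|u| * `|v|) = (cn k * (nrm u * nrm v))%:C.
  by rewrite !rmorphM /= -cnE -!nrmE ger0_norm.
by have := hk u v; rewrite e nrmE lecR.
Qed.

Section Faces.
Variables (A : algebra X) (M : normedModType C) (B : bimodule A M).
Implicit Types (w : seq X) (m : M).

(** Faces of the cyclic tensor m ⊗ a_1 ⊗ ... ⊗ a_n. The first letter acts on [m] from the right and
    the last one from the left, because the actions on the dual are transposed. *)
Definition face j (p : seq X * M) : seq X * M :=
  if j == 0%N then (behead p.1, ract B p.2 (head 0 p.1))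
  else if j == size p.1 then (take (size p.1).-1 p.1, lact B (last 0 p.1) p.2)
  else (mrg A j.-1 p.1, p.2).

Lemma size_face j p : (0 < size p.1)%N -> (j <= size p.1)%N ->
  size (face j p).1 = (size p.1).-1.
Proof.
rewrite /face => p0 jp; case: eqP => /= [_|j0]; first by rewrite size_behead.
case: eqP => /= [_|jn]; first by rewrite size_take; case: ltnP => //; lia.
by rewrite size_mrg //; lia.
Qed.

Lemma face0 a w m : face 0 (a :: w, m) = (w, ract B m a).
Proof. by []. Qed.

Lemma face_last n z w m : size w = n -> face n.+1 (rcons w z, m) = (w, lact B z m).
Proof.
move=> <-; rewrite /face /= size_rcons eqxx /= -cats1 take_size_cat //.
by rewrite last_cat.
Qed.

Lemma face_mid j w m : (j.+1 < size w)%N -> face j.+1 (w, m) = (mrg A j w, m).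
Proof. by move=> h; rewrite /face /= ltn_eqF. Qed.

Lemma mrg_rcons2 n mu w (y z : X) : size w = n ->
  mrg mu n (rcons (rcons w y) z) = rcons w (mu y z).
Proof. by move=> <-; rewrite -!cats1 -catA -[size w]addn0 mrg_cat. Qed.

Lemma mrg_rcons mu i w (z : X) : (i.+1 < size w)%N ->
  mrg mu i (rcons w z) = rcons (mrg mu i w) z.
Proof. by move=> h; rewrite -!cats1 mrg_catl. Qed.

(** The simplicial identities. Each case is a module axiom or associativity; [lractA] serves the
    first face against the last. *)
Lemma face_face i j p : (1 < size p.1)%N -> (i < j)%N -> (j <= size p.1)%N ->
  face i (face j p) = face j.-1 (face i p).
Proof.
case: p => w m /= w1; case: j => // j ij jw.
have [ej|nj] := eqVneq j.+1 (size w).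
  case/lastP: w w1 jw ej => // w z; rewrite size_rcons => w1 jw [ej].
  rewrite (face_last _ _ (esym ej)) /=.
  case: i ij => [|i] ij.
    case: w w1 ej {jw} => // a w _ /= ej.
    rewrite !face0 ej.
    by rewrite (face_last _ _ erefl) lractA.
  case/lastP: w w1 ej {jw} => // w y _; rewrite size_rcons => ej.
  have [ei|ni] := eqVneq i (size w).
    rewrite (face_last _ _ (esym ei)) face_mid ?size_rcons ?ei //.
    by rewrite mrg_rcons2 // ej (face_last _ _ erefl) lactA.
  have iw : (i < size w)%N by lia.
  rewrite !face_mid ?size_rcons //; try lia.
  by rewrite (@mrg_rcons A i (rcons w y)) ?size_rcons // ej face_last // size_mrg ?size_rcons.
have {}jw : (j.+1 < size w)%N by rewrite ltn_neqAle nj.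
rewrite face_mid //=.
case: i ij => [|i] ij.
  case: w w1 jw {nj} => // a [|b w] // _ jw.
  case: j ij jw => [|j] _ jw; first by rewrite /= !face0 ractA.
  by rewrite /= !face0 face_mid.
rewrite !face_mid ?size_mrg //; try lia.
case: j ij jw {nj} => // j ij jw; rewrite face_mid; last by rewrite size_mrg; lia.
congr pair; have [e|ne] := eqVneq i j; last by rewrite mrgC //; lia.
by rewrite e mrgA //; exact: amulA.
Qed.

End Faces.

End Forms.

(** * The Hochschild coboundary on words *)

Section SquareZero.
Variable K : comNzRingType.

(** The map (i, j) ↦ (j - 1, i) exchanges the terms with [i < j] and those with [i >= j], and it
    reverses the sign. *)
Lemma alternating_faces n (F : nat -> nat -> K) :
  (forall i j, (i < j)%N -> (j <= n.+1)%N -> F i j = F j.-1 i) ->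
  \sum_(0 <= j < n.+2) \sum_(0 <= i < n.+1) (-1) ^+ (i + j) * F i j = 0.
Proof.
move=> hF.
rewrite (eq_big_nat _ _ (F2 := fun j =>
  \sum_(0 <= i < n.+1 | (i < j)%N) (-1) ^+ (i + j) * F i j +
  \sum_(0 <= i < n.+1 | ~~ (i < j)%N) (-1) ^+ (i + j) * F i j)); last first.
  by move=> j _; rewrite (bigID (fun i => (i < j)%N)).
rewrite big_split /= big_nat_recl // [X in X + _ + _]big1 // add0r.
rewrite [X in _ + X]big_nat_recr //= [X in _ + (_ + X)]big_seq_cond.
rewrite [X in _ + (_ + X)]big1 ?addr0; last first.
  by move=> i; rewrite mem_index_iota => /andP[/andP[_ ->]].
rewrite [X in _ + X](exchange_big_dep_nat xpredT) //= -big_split big1_seq //=.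
move=> j; rewrite mem_index_iota => hj.
rewrite big_seq_cond [X in _ + X]big_seq_cond.
rewrite (eq_bigl (fun i => (i \in index_iota 0 n.+1) && ~~ (j < i)%N)); last first.
  by move=> i /=; rewrite -leqNgt ltnS.
rewrite -big_split big1 //= => i /andP[hi ij].
rewrite (hF i j.+1) //=; try lia.
by rewrite addnS exprS addnC; ring.
Qed.

End SquareZero.

Section FaceBounds.
Variables (R : realType) (X : completeNormedModType R[i]).
Local Notation C := R[i].
Variables (A : algebra X) (M : normedModType C) (B : bimodule A M).
Implicit Types psi : seq X -> M -> C^o.

(* A common bound for the product and the two actions. *)
Definition bimod_bound (k : R) :=
  [/\ 0 <= k, bmul A k, forall a m, nrm (lact B a m) <= k * (nrm a * nrm m)
    & forall m a, nrm (ract B m a) <= k * (nrm m * nrm a)].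

Lemma bimod_bound_ex : exists k, bimod_bound k.
Proof.
have [k1 k10 h1] := bilinear_nrm (amulP A).
have [k2 k20 h2] := bilinear_nrm (lactP B).
have [k3 k30 h3] := bilinear_nrm (ractP B).
exists (k1 + k2 + k3); split=> [|a b|a m|m a]; first by rewrite !addr_ge0.
- by apply: le_trans (h1 a b) _; rewrite ler_wpM2r ?mulr_ge0 ?nrm_ge0 //; lra.
- by apply: le_trans (h2 a m) _; rewrite ler_wpM2r ?mulr_ge0 ?nrm_ge0 //; lra.
- by apply: le_trans (h3 m a) _; rewrite ler_wpM2r ?mulr_ge0 ?nrm_ge0 //; lra.
Qed.

Lemma face_bound k j p : bimod_bound k -> (0 < size p.1)%N -> (j <= size p.1)%N ->
  wt (face B j p).1 * nrm (face B j p).2 <= k * (wt p.1 * nrm p.2).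
Proof.
move=> [k0 hA hl hr]; case: p => w m /= w0.
case: j => [|j] jw.
  case: w w0 {jw} => // a w _; rewrite face0 /= wt_cons.
  apply: le_trans (ler_wpM2l (wt_ge0 _) (hr m a)) _.
  by rewrite le_eqVlt; apply/orP; left; apply/eqP; ring.
have [ej|nj] := eqVneq j.+1 (size w).
  case/lastP: w w0 jw ej => // w z; rewrite size_rcons => _ _ [ej].
  rewrite (face_last _ _ _ (esym ej)) /= wt_rcons.
  apply: le_trans (ler_wpM2l (wt_ge0 _) (hl z m)) _.
  by rewrite le_eqVlt; apply/orP; left; apply/eqP; ring.
have {}jw : (j.+1 < size w)%N by rewrite ltn_neqAle nj.
by rewrite face_mid //= mulrA ler_wpM2r ?nrm_ge0 //; exact: wt_mrg.
Qed.

Definition fpsi psi j w m := psi (face B j (w, m)).1 (face B j (w, m)).2.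

Lemma fpsi_bnd k psi n K j : bimod_bound k -> 0 <= K -> bnd psi n K ->
  (j <= n.+1)%N -> bnd (fpsi psi j) n.+1 (k * K).
Proof.
move=> hk K0 hp jn w m wn.
apply: le_trans (hp _ _ _) _; first by rewrite size_face //= wn.
rewrite [k * K]mulrC -mulrA ler_wpM2l //.
by apply: (@face_bound k j (w, m)) => //=; rewrite wn.
Qed.

Lemma fpsi_mlin psi j m : good psi -> mlin (fpsi psi j ^~ m : seq X -> C).
Proof.
move=> [p1 p2 _] s1 s2 c x y; rewrite /fpsi.
have [l1 l2 _] := lactP B; have [r1 r2 _] := ractP B.
case: j => [|j].
  case: s1 => [|a s1]; rewrite ?cat0s ?cat_cons !face0 /=; first by rewrite r2 p2.
  by rewrite p1.
have sE z : size (s1 ++ z :: s2) = (size s1 + size s2).+1 by rewrite size_cat /= addnS.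
have [ej|nj] := eqVneq j (size s1 + size s2)%N.
  case/lastP: s2 sE ej => [|s2 b] sE ej.
    by rewrite !cats1 !face_last ?ej ?addn0 //= l1 p2.
  rewrite -!rcons_cons -!rcons_cat !face_last /= ?p1 //;
  by rewrite ej size_cat /= size_rcons addnS.
case: (leqP (size s1 + size s2) j) => jw.
  have fout z : face B j.+1 (s1 ++ z :: s2, m) = (s1 ++ z :: s2, m).
    rewrite /face /= sE eqSS (negPf nj) mrg_out // sE; lia.
  by rewrite !fout /= p1.
rewrite !face_mid ?sE /= ?ltnS //.
exact: (mlin_dd j (alg_bilin A) (p1 m)).
Qed.

Lemma face2_lin j w c m m' : (face B j (w, c *: m + m')).2 =
  c *: (face B j (w, m)).2 + (face B j (w, m')).2.
Proof.
have [l1 l2 _] := lactP B; have [r1 r2 _] := ractP B.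
by rewrite /face /=; case: ifP => _ /=; [rewrite r1|case: ifP => _ /=; rewrite ?l2].
Qed.

Lemma face1_const j w m m' : (face B j (w, m)).1 = (face B j (w, m')).1.
Proof. by rewrite /face /=; case: ifP => _ //; case: ifP. Qed.

Lemma fpsi_modlin psi j w c m m' : good psi ->
  fpsi psi j w (c *: m + m') = c * fpsi psi j w m + fpsi psi j w m'.
Proof.
move=> [_ p2 _]; rewrite /fpsi face2_lin p2.
by rewrite (face1_const j w _ m) (face1_const j w m' m).
Qed.

Definition delta_fun psi w m : C^o :=
  if size w is n.+1 then \sum_(0 <= j < n.+2) (-1) ^+ j * fpsi psi j w m else 0.

Lemma delta_bnd k psi n K : bimod_bound k -> 0 <= K -> bnd psi n K ->
  bnd (delta_fun psi) n.+1 (n.+2%:R * (k * K)).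
Proof.
move=> hk K0 hp w m wn; rewrite /delta_fun wn big_mkord.
rewrite -[leRHS]mulrA.
apply: (cn_sum_le (F := fun j => (-1) ^+ j * fpsi psi j w m)) => j jn.
by rewrite cn_signM (fpsi_bnd hk K0 hp).
Qed.

Lemma delta_good psi : good psi -> good (delta_fun psi).
Proof.
move=> hp; split=> [m s1 s2 c x y|w c m m'|[|n]].
- rewrite /delta_fun !size_cat /= !addnS mulr_sumr -big_split.
  by apply: eq_bigr => j _; rewrite fpsi_mlin //=; ring.
- rewrite /delta_fun; case: (size w) => [|n]; first by rewrite mulr0 addr0.
  rewrite mulr_sumr -big_split.
  by apply: eq_bigr => j _; rewrite fpsi_modlin //=; ring.
- exists 0 => w m /size0nil ->; by rewrite /delta_fun /= cn0 mul0r.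
have [k hk] := bimod_bound_ex; have [_ _ /(_ n)[K hK]] := hp.
have [L L0 hL] := bnd_ge0 hK.
by exists (n.+2%:R * (k * L)); exact: delta_bnd.
Qed.

Definition delta (psi : HC X M) : HC X M := mkHC (delta_good (HCP psi)).

Lemma deltaE (psi : HC X M) w m : val (delta psi) w m = delta_fun (val psi) w m.
Proof. by []. Qed.

Lemma delta_linear : linear delta.
Proof.
move=> c psi phi; apply: HC_ext => w m; rewrite HCE !deltaE /delta_fun.
case: (size w) => [|n]; first by rewrite mulr0 addr0.
rewrite mulr_sumr -big_split; apply: eq_bigr => j _.
by rewrite /fpsi HCE /=; ring.
Qed.
HB.instance Definition _ := GRing.isLinear.Build C (HC X M) (HC X M) *:%R delta delta_linear.

Lemma delta_delta (psi : HC X M) : delta (delta psi) = 0.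
Proof.
apply: HC_ext => w m; rewrite HC0 deltaE /delta_fun.
case e : (size w) => [//|n].
have face_size j : (j < n.+2)%N -> size (face B j (w, m)).1 = n.
  by move=> jn; rewrite size_face //= e.
case: n e face_size => [|n] e face_size.
  rewrite big1_seq // => j; rewrite mem_index_iota => /andP[_ jn].
  by rewrite /fpsi deltaE /delta_fun face_size // mulr0.
transitivity (\sum_(0 <= j < n.+3) \sum_(0 <= i < n.+2) (-1) ^+ (i + j) *
  val psi (face B i (face B j (w, m))).1 (face B i (face B j (w, m))).2).
  apply: eq_big_nat => j /andP[_ jn].
  rewrite /fpsi deltaE /delta_fun face_size // mulr_sumr; apply: eq_bigr => i _.
  by rewrite exprD /fpsi -surjective_pairing mulrA [_ * (-1) ^+ j]mulrC.
apply: (@alternating_faces _ n.+1 (fun i j =>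
  val psi (face B i (face B j (w, m))).1 (face B i (face B j (w, m))).2)).
by move=> i j ij jn; rewrite face_face //= e.
Qed.

End FaceBounds.

(** * Completeness of the spaces of forms of a fixed degree *)

Section Geometric.
Variable R : realType.
Local Notation C := R[i].

Lemma geometric_small (q B e : R) : 0 <= q < 1 -> 0 < e ->
  exists n, B * q ^+ n < e.
Proof.
move=> /andP[q0 q1] e0; have qn : `|q| < 1 by rewrite ger0_norm.
have B1 : 0 < `|B| + 1 by rewrite ltr_wpDl.
have [N _ /(_ N (leqnn N)) /=] : \forall n \near \oo, `|0 - q ^+ n| < e / (`|B| + 1).
  by have /cvgrPdist_lt := cvg_expr qn; apply; rewrite divr_gt0.
rewrite sub0r normrN ger0_norm ?exprn_ge0 // ltr_pdivlMr // => h.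
exists N; apply: le_lt_trans h; rewrite mulrC ler_wpM2l ?exprn_ge0 //.
by have := ler_norm B; lra.
Qed.

Lemma le0_geometric (q B r : R) : 0 <= q < 1 -> (forall n, r <= B * q ^+ n) -> r <= 0.
Proof.
move=> hq h; rewrite leNgt; apply/negP => r0.
by have [n] := geometric_small B hq r0; rewrite ltNge h.
Qed.

(** A Cauchy filter contains balls of radius 2^-(n+1). Consecutive balls meet, so their centres form
    a geometric sequence, and its limit is the limit of the filter. *)
Lemma complete_of_geometric (T : normedModType C) :
  (forall u : nat -> T, (forall n, nrm (u n.+1 - u n) <= 2^-1 ^+ n) ->
     exists l B, forall n, nrm (l - u n) <= B * 2^-1 ^+ n) ->
  forall F : set_system T, ProperFilter F -> cauchy F -> cvg F.
Proof.
move=> hT F FF /cauchyP hF.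
pose r n : R := 2^-1 * 2^-1 ^+ n.
have r0 n : 0 < r n by rewrite mulr_gt0 ?exprn_gt0 ?invr_gt0.
have /choice[u hu] : forall n, exists x, F (ball x (r n)%:C).
  by move=> n; apply: hF; rewrite -[0]/(0%:C) ltcR.
have ballE (x y : T) (s : R) : ball x s%:C y -> nrm (x - y) < s.
  by rewrite -ball_normE /ball_ /= nrmE ltcR.
have [n|l [B hl]] := hT u.
  have [y [/ballE h1 /ballE h2]] := filter_ex (filterI (hu n) (hu n.+1)).
  have -> : u n.+1 - u n = (u n.+1 - y) - (u n - y).
    by rewrite opprB addrA subrK.
  apply: le_trans (nrmB _ _) _; move: h1 h2; rewrite /r exprS.
  have := exprn_gt0 n (_ : 0 < 2^-1 :> R); rewrite invr_gt0 ltr0n => /(_ isT).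
  by move: (_ ^+ n) (nrm _) (nrm _) => t a b; lra.
apply/cvg_ex; exists l; apply/cvgrPdist_lt => e e0.
have [s s0 es] : exists2 s : R, 0 < s & e = s%:C.
  exists (cn e); last by rewrite -cnE gtr0_norm.
  by rewrite -ltcR -cnE gtr0_norm.
have hq : 0 <= (2^-1 : R) < 1 by apply/andP; split; lra.
have [n hn] := geometric_small (B + 2^-1) hq s0.
apply: filterS (hu n) => y /ballE hy.
rewrite nrmE es ltcR; apply: le_lt_trans hn.
have -> : l - y = (l - u n) + (u n - y) by rewrite addrA subrK.
apply: le_trans (nrmD _ _) _; rewrite mulrDl lerD //; exact: ltW.
Qed.

End Geometric.

Section FixedLength.
Variables (R : realType) (X : completeNormedModType R[i]).
Local Notation C := R[i].
Variables (M : normedModType C) (n : nat).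

Lemma fixed_length_closed : submod_closed
  [pred v : seq X -> M -> C^o | `[< good v /\ forall w m, size w != n -> v w m = 0 >]].
Proof.
have [g0 g1] := @good_closed R X M.
split=> [|c v v']; rewrite !inE.
  by split=> //; move: g0; rewrite inE.
move=> [h1 h2] [h3 h4]; split.
  by have := g1 c v v'; rewrite !inE => /(_ h1 h3).
move=> w m wn; have -> : (c *: v + v') w m = c * v w m + v' w m by [].
by rewrite h2 // h4 // mulr0 addr0.
Qed.

(** The Banach space of bounded [n]-linear forms with values in the dual of [M], realised as the
    forms on words that vanish on all other lengths. *)
Definition FL := subm (Submodule fixed_length_closed).
HB.instance Definition _ := GRing.Lmodule.on FL.
Implicit Types v : FL.

Definition ev v : seq X -> M -> C^o := val v.

Lemma FLP v : good (ev v) /\ forall w m, size w != n -> ev v w m = 0.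
Proof. by have := valP v; rewrite inE. Qed.

Lemma ev_out v w m : size w != n -> ev v w m = 0.
Proof. by case: (FLP v) => _; apply. Qed.

Lemma FL_ext v v' : (forall w m, size w = n -> ev v w m = ev v' w m) -> v = v'.
Proof.
move=> h; apply: val_inj; apply/funext => w; apply/funext => m.
suff: ev v w m = ev v' w m by [].
by have [|wn] := eqVneq (size w) n; [exact: h|rewrite !ev_out].
Qed.

Lemma evE c v v' w m : ev (c *: v + v') w m = c * ev v w m + ev v' w m.
Proof. exact: subm_fun2P. Qed.
Lemma ev0 w m : ev 0 w m = 0.
Proof. by []. Qed.
Lemma evD v v' w m : ev (v + v') w m = ev v w m + ev v' w m.
Proof. by rewrite -[v]scale1r evE mul1r scale1r. Qed.
Lemma evZ c v w m : ev (c *: v) w m = c * ev v w m.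
Proof. by rewrite -[c *: v]addr0 evE ev0 addr0. Qed.
Lemma evB v v' w m : ev (v - v') w m = ev v w m - ev v' w m.
Proof. by rewrite evD -scaleN1r evZ mulN1r. Qed.

(** The value 0 is added so that the supremum is over a nonempty set even when every weight
    vanishes. *)
Definition FLnorm v : R := sup [set r | exists w m,
  [/\ size w = n, wt w * nrm m != 0 & r = cn (ev v w m) / (wt w * nrm m)] \/ r = 0].

Lemma ev_bnd v : exists2 K, 0 <= K & bnd (ev v) n K.
Proof. by have [[_ _ h] _] := FLP v; have [K hK] := h n; exact: bnd_ge0 hK. Qed.

Lemma FLnorm_set v K : 0 <= K -> bnd (ev v) n K ->
  ubound [set r | exists w m,
  [/\ size w = n, wt w * nrm m != 0 & r = cn (ev v w m) / (wt w * nrm m)] \/ r = 0] K.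
Proof.
move=> K0 hK _ [w [m [[wn p0 ->]|->]]] //.
have p1 : 0 < wt w * nrm m by rewrite lt_def p0 mulr_ge0 ?wt_ge0 ?nrm_ge0.
by rewrite ler_pdivrMr // hK.
Qed.

Lemma FLnorm_le v K : 0 <= K -> bnd (ev v) n K -> FLnorm v <= K.
Proof.
move=> K0 hK; apply: ge_sup; last exact: FLnorm_set.
by exists 0; exists [::], 0; right.
Qed.

Lemma FLnorm_has_sup v : has_sup [set r | exists w m,
  [/\ size w = n, wt w * nrm m != 0 & r = cn (ev v w m) / (wt w * nrm m)] \/ r = 0].
Proof.
have [K K0 hK] := ev_bnd v; split; first by exists 0; exists [::], 0; right.
by exists K; exact: FLnorm_set.
Qed.

Lemma FLnorm_ge0 v : 0 <= FLnorm v.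
Proof.
apply: sup_ubound; first by case: (FLnorm_has_sup v).
by exists [::], 0; right.
Qed.

Lemma FLnorm_bnd v : bnd (ev v) n (FLnorm v).
Proof.
move=> w m wn; have [p0|p0] := eqVneq (wt w * nrm m) 0.
  have [K K0 hK] := ev_bnd v.
  by have := hK w m wn; rewrite p0 !mulr0.
have p1 : 0 < wt w * nrm m by rewrite lt_def p0 mulr_ge0 ?wt_ge0 ?nrm_ge0.
rewrite -ler_pdivrMr //; apply: sup_ubound; first by case: (FLnorm_has_sup v).
by exists w, m; left.
Qed.

Definition FLnormC v : C := (FLnorm v)%:C.

Lemma FLnormD v v' : FLnormC (v + v') <= FLnormC v + FLnormC v'.
Proof.
rewrite /FLnormC -[_%:C + _]rmorphD lecR; apply: FLnorm_le.
  by rewrite addr_ge0 ?FLnorm_ge0.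
move=> w m wn; rewrite evD.
exact: (bndD (@FLnorm_bnd v) (@FLnorm_bnd v')).
Qed.

Lemma FLnormZ_le c v : FLnorm (c *: v) <= cn c * FLnorm v.
Proof.
apply: FLnorm_le; first by rewrite mulr_ge0 ?cn_ge0 ?FLnorm_ge0.
by move=> w m wn; rewrite evZ; exact: (bndZ c (@FLnorm_bnd v)).
Qed.

Lemma FLnormZ c v : FLnormC (c *: v) = `|c| * FLnormC v.
Proof.
rewrite /FLnormC cnE -[_%:C * _]rmorphM; congr (_%:C); apply: le_anti; rewrite FLnormZ_le /=.
have [->|c0] := eqVneq c 0; first by rewrite cn0 mul0r FLnorm_ge0.
have cp : 0 < cn c.
  by rewrite lt_def cn_ge0 andbT; apply: contra c0 => /eqP/cn0_eq0 ->.
have := FLnormZ_le c^-1 (c *: v); rewrite scalerA mulVf // scale1r => h.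
have : cn c * FLnorm v <= cn c * (cn c^-1 * FLnorm (c *: v)) by rewrite ler_pM2l.
by rewrite mulrA -cnM divff // cn1 mul1r.
Qed.

Lemma FLnorm_eq0 v : FLnormC v = 0 -> v = 0.
Proof.
move=> /complexI h; apply: FL_ext => w m wn; rewrite ev0; apply: cn0_eq0.
by apply/eqP; rewrite eq_le cn_ge0 andbT; have := @FLnorm_bnd v w m wn; rewrite h mul0r.
Qed.

HB.instance Definition _ :=
  Lmodule_isNormed.Build C FL FLnormD FLnormZ FLnorm_eq0.

Lemma nrm_FL v : nrm v = FLnorm v. Proof. by []. Qed.

Lemma mkFL_subproof (f : seq X -> M -> C^o) : good f ->
  good (fun w m => if size w == n then f w m else 0 : C^o).
Proof.
move=> [f1 f2 f3]; split=> [m s1 s2 a x y|w a m m'|k].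
- by rewrite !size_cat /=; case: ifP => _; [exact: f1|rewrite mulr0 addr0].
- by case: ifP => _; [exact: f2|rewrite mulr0 addr0].
have [K /bnd_ge0[L L0 hL]] := f3 k; exists L => w m wk.
case: ifP => _; first exact: hL.
by rewrite cn0 !mulr_ge0 ?wt_ge0 ?nrm_ge0.
Qed.

Lemma mkFL_subproof2 (f : seq X -> M -> C^o) : good f ->
  (fun w m => if size w == n then f w m else 0 : C^o)
    \in submodule_pred (Submodule fixed_length_closed).
Proof.
move=> h; rewrite inE; split; first exact: mkFL_subproof.
by move=> w m /negPf ->.
Qed.

Definition mkFL (f : seq X -> M -> C^o) (h : good f) : FL := subm_mk (mkFL_subproof2 h).

Lemma ev_mkFL (f : seq X -> M -> C^o) (h : good f) w m :
  ev (mkFL h) w m = if size w == n then f w m else 0.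
Proof. by []. Qed.

(* The pointwise limits of a geometric sequence of good functions. *)
Lemma good_limit (q B : R) (u : nat -> HC X M) (S : nat -> bool) : 0 <= q < 1 -> 
  (forall k w m, S (size w) ->
    cn (val (u k.+1) w m - val (u k) w m) <= B * (wt w * nrm m) * q ^+ k) ->
  exists l : HC X M, (forall w m, ~~ S (size w) -> val l w m = 0) /\
    forall k w m, S (size w) ->
    cn (val l w m - val (u k) w m) <= 2 * B / (1 - q) * (wt w * nrm m) * q ^+ k.
Proof.
move=> hq hu.
have /choice[l0 hl0] : forall p : seq X * M, exists z : C, S (size p.1) ->
    forall k, cn (z - val (u k) p.1 p.2) <=
      2 * B / (1 - q) * (wt p.1 * nrm p.2) * q ^+ k.
  move=> [w m] /=; case Sw : (S (size w)); last by exists 0.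
  have [l hl] := geometric_limit hq (fun k => hu k w m Sw).
  exists l => _ k; apply: le_trans (hl k) _.
  by rewrite le_eqVlt; apply/orP; left; apply/eqP; ring.
pose l w m : C^o := if S (size w) then l0 (w, m) else 0.
have lE w m : S (size w) -> forall k,
    cn (l w m - val (u k) w m) <= 2 * B / (1 - q) * (wt w * nrm m) * q ^+ k.
  by rewrite /l => Sw; rewrite Sw; exact: (hl0 (w, m)).
have lim0 (z : C) (D : R) : (forall k, cn z <= D * q ^+ k) -> z = 0.
  move=> h; apply: cn0_eq0; apply/eqP; rewrite eq_le cn_ge0 andbT.
  exact: le0_geometric hq h.
have lin3 (x y z : seq X * M) a :
    S (size x.1) = S (size z.1) -> S (size y.1) = S (size z.1) ->
    (forall k, val (u k) z.1 z.2 = a * val (u k) x.1 x.2 + val (u k) y.1 y.2) ->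
    l z.1 z.2 = a * l x.1 x.2 + l y.1 y.2.
  move=> Sx Sy huk; case Sz : (S (size z.1)); last first.
    by rewrite /l Sx Sy Sz mulr0 addr0.
  rewrite Sz in Sx Sy; apply/eqP; rewrite -subr_eq0; apply/eqP.
  pose D (p : seq X * M) := 2 * B / (1 - q) * (wt p.1 * nrm p.2).
  apply: (lim0 _ (D z + cn a * D x + D y)) => k.
  have -> : l z.1 z.2 - (a * l x.1 x.2 + l y.1 y.2) =
     (l z.1 z.2 - val (u k) z.1 z.2) - a * (l x.1 x.2 - val (u k) x.1 x.2)
     - (l y.1 y.2 - val (u k) y.1 y.2) by rewrite huk; ring.
  apply: le_trans (cnB _ _) _; rewrite mulrDl lerD //; last exact: lE.
  apply: le_trans (cnB _ _) _; rewrite mulrDl lerD //; first exact: lE.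
  by rewrite cnM -mulrA ler_wpM2l ?cn_ge0 //; exact: lE.
have lgood : good l.
  split=> [m s1 s2 a x y|w a m m'|k].
  - apply: (lin3 (s1 ++ x :: s2, m) (s1 ++ y :: s2, m) (s1 ++ (a *: x + y) :: s2, m) a);
      rewrite /= ?size_cat //= => k.
    by have [h _ _] := HCP (u k); rewrite h.
  - apply: (lin3 (w, m) (w, m') (w, a *: m + m') a) => //= k.
    by have [_ h _] := HCP (u k); rewrite h.
  have [_ _ /(_ k)[K hK]] := HCP (u 0%N).
  have [L L0 hL] := bnd_ge0 hK.
  exists (`|2 * B / (1 - q)| + L) => w m wk; case Sw : (S (size w)); last first.
    rewrite /l Sw cn0 mulr_ge0 ?mulr_ge0 ?wt_ge0 ?nrm_ge0 //.
    by rewrite addr_ge0.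
  have -> : l w m = (l w m - val (u 0%N) w m) + val (u 0%N) w m by rewrite subrK.
  apply: le_trans (cnD _ _) _; rewrite mulrDl lerD ?hL //.
  apply: le_trans (lE w m Sw 0%N) _; rewrite expr0 mulr1.
  by rewrite ler_wpM2r ?mulr_ge0 ?wt_ge0 ?nrm_ge0 ?ler_norm.
exists (mkHC lgood); split=> [w m /negPf Sw|k w m Sw]; first by rewrite /= /l Sw.
exact: lE.
Qed.

Lemma FL_complete (F : set_system FL) : ProperFilter F -> cauchy F -> cvg F.
Proof.
apply: complete_of_geometric => u hu.
have hq : 0 <= (2^-1 : R) < 1 by apply/andP; split; lra.
have [k w m /eqP wn|l [l0 hl]] :=
    @good_limit 2^-1 1 (fun k => mkHC (proj1 (FLP (u k)))) (pred1 n) hq.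
  have := @FLnorm_bnd (u k.+1 - u k) w m wn.
  rewrite evB => h; apply: le_trans h _.
  by rewrite mul1r mulrC ler_wpM2l ?mulr_ge0 ?wt_ge0 ?nrm_ge0.
have lP : val l \in submodule_pred (Submodule fixed_length_closed).
  by rewrite inE; split=> [|w m wn]; [exact: HCP|exact: l0].
exists (subm_mk lP), (2 * 1 / (1 - 2^-1)) => k; rewrite nrm_FL; apply: FLnorm_le.
  by rewrite !mulr_ge0 ?exprn_ge0 ?invr_ge0 //; lra.
move=> w m /eqP wn; rewrite evB; have := hl k w m wn.
by rewrite mulrAC.
Qed.

HB.instance Definition _ := Uniform_isComplete.Build FL FL_complete.

End FixedLength.

(** * The dual of noncommutative n-forms and the universal cocycle *)

Section Bimodules.
Variables (R : realType) (X : completeNormedModType R[i]).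
Local Notation C := R[i].

Lemma bounded_bilinear_of_nrm (U V W : normedModType C) (f : U -> V -> W) (k : R) :
  (forall v, linear (f^~ v)) -> (forall u, linear (f u)) ->
  (forall u v, nrm (f u v) <= k * (nrm u * nrm v)) -> bounded_bilinear f.
Proof.
move=> f1 f2 hk; split=> //; exists k%:C => u v.
rewrite -mulrA !nrmE [leRHS](_ : _ = (k * (nrm u * nrm v))%:C) ?lecR //.
by rewrite !rmorphM.
Qed.

Variable A : algebra X.

Definition alact (a : X) (x : aplus X) : aplus X := (plus_mull A a x, 0).
Definition aract (x : aplus X) (a : X) : aplus X := (plus_mulr A x a, 0).

Lemma alactP : bounded_bilinear alact.
Proof. exact: bounded_bilinear_sym (plus_mull_bounded A 1). Qed.

Lemma aractP : bounded_bilinear aract.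
Proof. exact: (plus_mulr_bounded A 1). Qed.

Lemma algDl x y z : A (x + y) z = A x z + A y z.
Proof. by have [h _] := alg_bilin A 1 x y z; move: h; rewrite !scale1r. Qed.
Lemma algDr x y z : A z (x + y) = A z x + A z y.
Proof. by have [_ h] := alg_bilin A 1 x y z; move: h; rewrite !scale1r. Qed.
Lemma alg0l z : A 0 z = 0.
Proof. by apply: (addrI (A 0 z)); rewrite -algDl !addr0. Qed.
Lemma alg0r z : A z 0 = 0.
Proof. by apply: (addrI (A z 0)); rewrite -algDr !addr0. Qed.
Lemma algZl a x z : A (a *: x) z = a *: A x z.
Proof. by have [h _] := alg_bilin A a x 0 z; move: h; rewrite alg0l !addr0. Qed.
Lemma algZr a x z : A z (a *: x) = a *: A z x.
Proof. by have [_ h] := alg_bilin A a x 0 z; move: h; rewrite alg0r !addr0. Qed.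

Lemma alactA a b x : alact a (alact b x) = alact (A a b) x.
Proof.
congr pair; rewrite /plus_mull /= scale0r addr0 algDr algZr.
by rewrite (amulA A).
Qed.

Lemma aractA a b x : aract (aract x a) b = aract x (A a b).
Proof.
congr pair; rewrite /plus_mulr /= scale0r addr0 algDl algZl.
by rewrite (amulA A).
Qed.

Lemma alractA a b x : alact a (aract x b) = aract (alact a x) b.
Proof.
congr pair; rewrite /plus_mull /plus_mulr /= !scale0r !addr0 algDl algDr algZl algZr.
by rewrite (amulA A).
Qed.

Definition aplus_bimodule : bimodule A (aplus X) :=
  Bimodule alactP aractP alactA aractA alractA.

Local Notation B := aplus_bimodule.
Local Notation P := (aplus X).
Variable n : nat.
Local Notation V := (FL X P n).

Lemma fpsi_good (f : seq X -> P -> C^o) j : good f -> good (fpsi B f j).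
Proof.
move=> hf; split=> [m|w c m m'|k]; first exact: fpsi_mlin.
  exact: fpsi_modlin.
have [f1 f2 f3] := hf; have [K /bnd_ge0[L L0 hL]] := f3 k.
have out : (k < j)%N -> bnd (fpsi B f j) k L.
  move=> kj w m wk; rewrite /fpsi /face /= wk gtn_eqF ?(leq_ltn_trans _ kj) //.
  by rewrite gtn_eqF //= mrg_out ?wk; [exact: hL|lia].
case: (ltnP k j) => kj; first by exists L; exact: out.
clear K L L0 hL out; case: k kj => [|k] kj.
  exists 0 => w m /size0nil ->; move: kj; rewrite leqn0 => /eqP ->.
  rewrite /fpsi /face /=.
  have -> : aract m 0 = 0 by rewrite /aract /plus_mulr alg0r scaler0 addr0.
  have := f2 [::] 1 0 0; rewrite scale1r addr0 mul1r => h.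
  have -> : f [::] 0 = 0 by apply: (addrI (f [::] 0)); rewrite -h addr0.
  by rewrite cn0 mul0r.
have [K' /bnd_ge0[L' L0' hL']] := f3 k.
have [b hb] := bimod_bound_ex B.
by exists (b * L'); exact: fpsi_bnd.
Qed.

Lemma good_rcons (M : normedModType C) (f : seq X -> M -> C^o) a : good f -> good (fun w x => f (rcons w a) x).
Proof.
move=> [f1 f2 f3]; split=> [m s1 s2 c x y|w c m m'|k]; [by rewrite !rcons_cat /= f1|exact: f2|].
have [K hK] := f3 k.+1; exists (K * nrm a) => w m wk.
apply: le_trans (hK _ _ _) _; first by rewrite size_rcons wk.
by rewrite wt_rcons le_eqVlt; apply/orP; left; apply/eqP; ring.
Qed.

Lemma good_sum (M : normedModType C) (I : Type) (r : seq I) (f : I -> seq X -> M -> C^o) (c : I -> C) :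
  (forall i, good (f i)) -> good (fun w m => \sum_(i <- r) c i * f i w m).
Proof.
move=> hf; have [g0 g1] := @good_closed R X M.
elim: r => [|i r IH].
  rewrite (_ : (fun _ _ => _) = 0); first by move: g0; rewrite inE.
  by apply/funext => w; apply/funext => m; rewrite big_nil.
rewrite (_ : (fun _ _ => _) = c i *: f i + (fun w m => \sum_(j <- r) c j * f j w m)).
  have := g1 (c i) (f i) (fun w m => \sum_(j <- r) c j * f j w m).
  by rewrite !inE => /(_ (hf i) IH).
by apply/funext => w; apply/funext => m; rewrite big_cons.
Qed.

(** [V] is the dual of the bimodule of noncommutative n-forms: [ev v w x] is the value of [v] on x
    dw_1 ... dw_n. The left action is (a v)(ω) = v(ω a), and the sum expands ω a by the Leibniz
    rule. The right action is (v a)(ω) = v(a ω), which multiplies [x] alone. *)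
Definition ul_fun (a : X) (v : V) w x : C^o :=
  \sum_(0 <= j < n.+1) ((-1) ^+ n * (-1) ^+ j) * fpsi B (ev v) j (rcons w a) x.

Lemma ul_good a v : good (ul_fun a v).
Proof.
apply: (@good_sum _ _ _ (fun j w x => fpsi B (ev v) j (rcons w a) x)
  (fun j => (-1) ^+ n * (-1) ^+ j)) => j.
by apply: good_rcons; apply: fpsi_good; case: (FLP v).
Qed.

Definition ul a v : V := mkFL n (ul_good a v).

Lemma ulE a v w x : size w = n -> ev (ul a v) w x =
  \sum_(0 <= j < n.+1) ((-1) ^+ n * (-1) ^+ j) * fpsi B (ev v) j (rcons w a) x.
Proof. by move=> wn; rewrite ev_mkFL wn eqxx. Qed.

Lemma ur_good (v : V) a : good (fun w x => ev v w (alact a x)).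
Proof.
have [[v1 v2 v3] _] := FLP v; have [l1 l2 _] := alactP.
have [k k0 hk] := bilinear_nrm alactP.
split=> [m|w c m m'|j]; first exact: v1.
  by rewrite l2 v2.
have [K /bnd_ge0[L L0 hL]] := v3 j.
exists (L * (k * nrm a)) => w m wj; apply: le_trans (hL _ _ wj) _.
rewrite -mulrA ler_wpM2l // mulrCA ler_wpM2l ?wt_ge0 //.
by apply: le_trans (hk _ _) _; rewrite mulrA.
Qed.

Definition ur v a : V := mkFL n (ur_good v a).

Lemma urE v a w x : size w = n -> ev (ur v a) w x = ev v w (alact a x).
Proof. by move=> wn; rewrite ev_mkFL wn eqxx. Qed.

Lemma ul_bound k a v : bimod_bound B k ->
  nrm (ul a v) <= n.+1%:R * k * (nrm a * nrm v).
Proof.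
move=> hk; have k0 : 0 <= k by case: hk.
rewrite !nrm_FL; apply: FLnorm_le.
  by rewrite !mulr_ge0 ?ler0n ?nrm_ge0 ?FLnorm_ge0.
move=> w x wn; rewrite ulE // big_mkord.
apply: le_trans (@cn_sum_le _ n.+1
  (fun j => ((-1) ^+ n * (-1) ^+ j) * fpsi B (ev v) j (rcons w a) x)
  (k * FLnorm v * (wt (rcons w a) * nrm x)) _) _.
  move=> j jn; rewrite cnM cnM !cn_sign !mul1r.
  apply: (fpsi_bnd hk (FLnorm_ge0 v) (@FLnorm_bnd _ _ _ _ v) (ltnW jn)).
  by rewrite size_rcons wn.
by rewrite wt_rcons le_eqVlt; apply/orP; left; apply/eqP; ring.
Qed.

Lemma ur_bound k a v : bimod_bound B k -> nrm (ur v a) <= k * (nrm v * nrm a).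
Proof.
move=> [k0 _ hl _]; rewrite !nrm_FL; apply: FLnorm_le.
  by rewrite !mulr_ge0 ?nrm_ge0 ?FLnorm_ge0.
move=> w x wn; rewrite urE //; apply: le_trans (@FLnorm_bnd _ _ _ _ v w _ wn) _.
apply: le_trans (_ : FLnorm v * (wt w * (k * (nrm a * nrm x))) <= _).
  by rewrite ler_wpM2l ?FLnorm_ge0 // ler_wpM2l ?wt_ge0 //; exact: hl.
by rewrite le_eqVlt; apply/orP; left; apply/eqP; ring.
Qed.

Lemma ulP : bounded_bilinear ul.
Proof.
have [k hk] := bimod_bound_ex B.
apply: (@bounded_bilinear_of_nrm _ _ _ _ (n.+1%:R * k)) => [v c a b|a c v v'|a v].
- apply: FL_ext => w x wn; rewrite evE !ulE // mulr_sumr -big_split.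
  apply: eq_bigr => j _; have := fpsi_mlin B j x (proj1 (FLP v)) w [::] c a b.
  by rewrite !cats1 => -> /=; ring.
- apply: FL_ext => w x wn; rewrite evE !ulE // mulr_sumr -big_split.
  by apply: eq_bigr => j _; rewrite /fpsi evE /=; ring.
- exact: ul_bound.
Qed.

Lemma urP : bounded_bilinear ur.
Proof.
have [k hk] := bimod_bound_ex B; have [l1 l2 _] := alactP.
apply: (@bounded_bilinear_of_nrm _ _ _ _ k) => [a c v v'|v c a b|v a].
- apply: FL_ext => w x wn; rewrite [LHS]urE // [RHS]evE [LHS]evE.
  by congr (_ * _ + _); rewrite urE.
- have [[_ v2 _] _] := FLP v.
  by apply: FL_ext => w x wn; rewrite [RHS]evE !urE // l1 v2.
- exact: ur_bound.
Qed.

Lemma urA a b v : ur (ur v a) b = ur v (A a b).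
Proof. by apply: FL_ext => w x wn; rewrite !urE // alactA. Qed.

Lemma ulrA a b v : ul a (ur v b) = ur (ul a v) b.
Proof.
apply: FL_ext => w x wn; rewrite urE // !ulE //; apply: eq_big_nat => j /andP[_ jn].
congr (_ * _); rewrite /fpsi.
have s1 : size (face B j (rcons w a, x)).1 = n.
  by rewrite size_face /= size_rcons wn // ltnW.
rewrite urE //; case: j jn s1 => [|j] jn s1.
  by case: w wn s1 => [|c w] _ _; rewrite ?rcons_cons !face0 /= alractA.
by rewrite !face_mid ?size_rcons ?wn.
Qed.

(** The alternating double sum over the faces of the word w a b vanishes. Its last column, in which
    [a] and [b] are multiplied, is the left action of the product, and the other columns are the
    iterated action. *)
Lemma ulA a b v : ul a (ul b v) = ul (A a b) v.
Proof.
apply: FL_ext => w x wn; rewrite !ulE //.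
pose p := (rcons (rcons w a) b, x).
pose F i j := ev v (face B i (face B j p)).1 (face B i (face B j p)).2.
have sz : size p.1 = n.+2 by rewrite !size_rcons wn.
have := @alternating_faces _ n F; rewrite big_nat_recr //=.
have hF i j : (i < j)%N -> (j <= n.+1)%N -> F i j = F j.-1 i.
  by move=> ij jn; rewrite /F face_face ?sz //; lia.
move=> /(_ hF) E.
have -> : \sum_(0 <= j < n.+1) ((-1) ^+ n * (-1) ^+ j) * fpsi B (ev v) j (rcons w (A a b)) x
   = (-1) ^+ n * \sum_(0 <= j < n.+1) (-1) ^+ j * F j n.+1.
  rewrite mulr_sumr; apply: eq_bigr => j _; rewrite -mulrA; congr (_ * (_ * _)).
  by rewrite /F /p face_mid ?size_rcons ?wn // mrg_rcons2.
have -> : \sum_(0 <= j < n.+1) ((-1) ^+ n * (-1) ^+ j) * fpsi B (ev (ul b v)) j (rcons w a) x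
   = \sum_(0 <= j < n.+1) \sum_(0 <= i < n.+1) (-1) ^+ (i + j) * F i j.
  apply: eq_big_nat => j /andP[_ jn]; rewrite {1}/fpsi ulE; last first.
    by rewrite size_face /= size_rcons wn // ltnW.
  rewrite mulr_sumr; apply: eq_bigr => i _.
  have e : face B j p = (rcons (face B j (rcons w a, x)).1 b, (face B j (rcons w a, x)).2).
    case: j jn => [|j] jn.
      by rewrite /p; case: (w) => [|c w']; rewrite ?rcons_cons !face0.
    rewrite /p !face_mid ?size_rcons ?wn //=; last exact: ltnW jn.
    by rewrite mrg_rcons // size_rcons wn.
  rewrite /F e /fpsi exprD; set u := ev v _ _.
  by rewrite -{2}[u](signMM n); ring.
move/eqP: E; rewrite addr_eq0 => /eqP ->.
rewrite mulr_sumr -sumrN; apply: eq_bigr => i _.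
by rewrite exprD exprS; ring.
Qed.

Definition univ_bimodule : bimodule A V := Bimodule ulP urP ulA urA ulrA.

Definition unit_e : P := (0, 1).

Lemma univ_good : good (fun w (v : V) => ev v w unit_e).
Proof.
split=> [v|w c v v'|k].
- by have [[h _ _] _] := FLP v; exact: h.
- exact: evE.
exists (nrm unit_e) => w v wk.
have [e|ne] := eqVneq (size w) n; last first.
  by rewrite ev_out // cn0 mulr_ge0 ?nrm_ge0 // mulr_ge0 ?wt_ge0 ?nrm_ge0.
apply: le_trans (@FLnorm_bnd _ _ _ _ v w unit_e e) _.
by rewrite -nrm_FL le_eqVlt; apply/orP; left; apply/eqP; ring.
Qed.

(** The cochain w ↦ dw_1 ... dw_n, where a form is viewed as a functional on [V]. Its formula does
    not involve the product of the algebra. *)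
Definition univ : HC X V := mkHC univ_good.

Lemma univE w v : val univ w v = ev v w unit_e. Proof. by []. Qed.

(** By the definition of the left action, the last face cancels the sum of all the others. *)
Lemma delta_univ w v : size w = n.+1 -> val (delta univ_bimodule univ) w v = 0.
Proof.
case/lastP: w => // w a; rewrite size_rcons => -[wn].
rewrite deltaE /delta_fun size_rcons wn big_nat_recr //=.
rewrite [X in _ + _ * X]/fpsi face_last //= ulE //.
rewrite (eq_big_nat _ _ (F2 := fun j => (-1) ^+ j * fpsi B (ev v) j (rcons w a) unit_e)).
  rewrite mulr_sumr -big_split big1 //= => j _.
  by rewrite exprS -!mulrA !mulN1r signMM subrr.
move=> j /andP[_ jn]; congr (_ * _); rewrite /fpsi.
case: j jn => [|j] jn; last by rewrite !face_mid ?size_rcons ?wn.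
(* At the unit, multiplication by [b] from the left and from the right agree; this turns the right
   action on [v] into the face at 0. *)
have key b w' : size w' = n -> ev (ur v b) w' unit_e = ev v w' (aract unit_e b).
  move=> w'n; rewrite urE //; congr (ev v w' _).
  by rewrite /alact /aract /plus_mull /plus_mulr /= alg0r alg0l.
case: w wn => [|b w] wn; rewrite ?rcons_cons !face0 /= key //.
by move: wn; rewrite size_rcons.
Qed.

End Bimodules.

(** * Vanishing Hochschild cohomology expressed on words *)

Section Conversion.
Variables (R : realType) (X : completeNormedModType R[i]).
Local Notation C := R[i].
Implicit Types (w : seq X).

Lemma codom_nth n w : size w = n -> codom (fun i : 'I_n => nth 0 w i) = w.
Proof.
move=> wn; apply: (@eq_from_nth _ 0); first by rewrite size_codom card_ord.
move=> i; rewrite size_codom card_ord => hi.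
by rewrite (nth_map (Ordinal hi)) ?size_enum_ord // nth_enum_ord.
Qed.

Lemma nth_codom n (a : 'I_n -> X) (i : 'I_n) : nth 0 (codom a) i = a i.
Proof.
by rewrite (nth_map i) ?size_enum_ord // nth_ord_enum.
Qed.

Lemma codom_ext n (a : 'I_n -> X) w : size w = n ->
  (forall i : 'I_n, nth 0 w i = a i) -> codom a = w.
Proof.
move=> wn h; rewrite -[RHS](codom_nth wn); congr codom.
by apply/funext => i; rewrite h.
Qed.

Lemma size_codomI n (a : 'I_n -> X) : size (codom a) = n.
Proof. by rewrite size_codom card_ord. Qed.

Lemma codom_upd n (a : 'I_n -> X) i x :
  codom (upd a i x) = take i (codom a) ++ x :: drop i.+1 (codom a).
Proof.
have sz : size (take i (codom a) ++ x :: drop i.+1 (codom a)) = n.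
  rewrite size_cat /= size_take size_drop size_codomI ltn_ord.
  by have := ltn_ord i; lia.
apply: codom_ext => // j.
rewrite nth_cat size_take size_codomI ltn_ord /upd.
have [->|ne] := eqVneq j i; first by rewrite ltnn subnn.
case: ltnP => h; first by rewrite nth_take // nth_codom.
have ij : (i < j)%N by rewrite ltn_neqAle h andbT eq_sym.
rewrite -[(j - i)%N]prednK ?subn_gt0 //= nth_drop -nth_codom; congr nth; lia.
Qed.

Lemma prod_codom n (a : 'I_n -> X) : \prod_(i < n) `|a i| = (wt (codom a))%:C.
Proof.
rewrite /wt rmorph_prod /codom /image_mem big_map big_enum.
by apply: eq_bigr => i _; rewrite nrmE.
Qed.

Lemma codom_lift0 n (a : 'I_n.+1 -> X) : codom (a \o lift ord0) = behead (codom a).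
Proof.
apply: codom_ext => [|i]; first by rewrite size_behead size_codomI.
by rewrite /= nth_behead -(nth_codom a (lift ord0 i)).
Qed.

Lemma codom_lift_max n (a : 'I_n.+1 -> X) : codom (a \o lift ord_max) = take n (codom a).
Proof.
apply: codom_ext => [|i]; first by rewrite size_take size_codomI ltnSn.
by rewrite /= nth_take // -(nth_codom a (lift ord_max i)) lift_max.
Qed.

Lemma nth_mrg (mu : X -> X -> X) j w i : (j.+1 < size w)%N ->
  nth 0 (mrg mu j w) i = if (i < j)%N then nth 0 w i
    else if i == j then mu (nth 0 w j) (nth 0 w j.+1) else nth 0 w i.+1.
Proof.
elim: w j i => [|a w IH] [|j] [|i] //=.
- by case: w {IH}.
- by case: w {IH}.
- by rewrite ltnS => h; rewrite IH.
Qed.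

Lemma codom_mul_at (mu : X -> X -> X) n (j : 'I_n) (a : 'I_n.+1 -> X) :
  codom (mul_at mu j a) = mrg mu j (codom a).
Proof.
have jn : (j.+1 < size (codom a))%N by rewrite size_codomI ltnS ltn_ord.
apply: codom_ext => [|i]; first by rewrite size_mrg // size_codomI.
rewrite nth_mrg // /mul_at.
rewrite -(nth_codom a (lift ord_max i)) -(nth_codom a (lift ord0 i)).
rewrite -(nth_codom a (lift ord_max j)) -(nth_codom a (lift ord0 j)).
by rewrite !lift_max.
Qed.

Lemma nth_upd n (s1 s2 : seq X) : (size s1 + (size s2).+1)%N = n ->
  exists (c : 'I_n -> X) (j : 'I_n), forall z,
    (fun i : 'I_n => nth 0 (s1 ++ z :: s2) i) = upd c j z.
Proof.
move=> e; have hi : (size s1 < n)%N by lia.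
exists (fun i : 'I_n => nth 0 (s1 ++ 0 :: s2) i), (Ordinal hi) => z.
apply/funext => i; rewrite /upd; case: eqP => [->|ne] /=.
  by rewrite nth_cat ltnn subnn.
rewrite !nth_cat; case: ltnP => // h.
have : (0 < i - size s1)%N.
  rewrite subn_gt0 ltn_neqAle h andbT; apply/eqP => e'.
  by apply: ne; apply: val_inj.
by case: (i - size s1)%N.
Qed.

Section Dual.
Variables (A : algebra X) (M : normedModType C) (B : bimodule A M).

Lemma dual_sum (I : Type) (r : seq I) (F : I -> dual M) m :
  val (\sum_(i <- r) F i) m = \sum_(i <- r) val (F i) m.
Proof.
by elim: r => [|i r IH]; rewrite ?big_nil // !big_cons dualDE IH.
Qed.

Lemma dl_subproof (psi : HC X M) w :
  val psi w \in submodule_pred (Submodule (@dual_closed R M)).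
Proof.
rewrite inE; have [_ p2 p3] := HCP psi; split=> [c x y|]; first exact: p2.
have [K hK] := p3 (size w); exists (K * wt w)%:C => m.
by have := hK w m erefl; rewrite mulrA cnE nrmE -[_%:C * _]rmorphM lecR.
Qed.

Definition dl (psi : HC X M) w : dual M := subm_mk (dl_subproof psi w).

Lemma toH_subproof n (psi : HC X M) : (fun a : 'I_n -> X => dl psi (codom a))
  \in submodule_pred (Submodule (@bounded_multilinear_closed C X (dual M) n)).
Proof.
rewrite inE; have [p1 _ p3] := HCP psi; split=> [a i c x y|].
  apply: val_inj; apply/funext => m; rewrite dualDE dualZE /= !codom_upd.
  exact: p1.
have [K /bnd_ge0[L L0 hL]] := p3 n; exists L%:C => a.
rewrite prod_codom; apply: opnorm_le => [|m].
  by rewrite -[_%:C * _]rmorphM -[0]/(0%:C) lecR mulr_ge0 ?wt_ge0.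
have := hL (codom a) m (size_codomI a).
by rewrite mulrA cnE nrmE -!rmorphM lecR.
Qed.

Definition toH n (psi : HC X M) : hcochain X (dual M) n := subm_mk (toH_subproof n psi).

Lemma hcochain_ext n (D E : hcochain X (dual M) n) :
  (forall a m, val (val D a) m = val (val E a) m) -> D = E.
Proof.
move=> h; apply: val_inj; apply/funext => a.
by apply: val_inj; apply/funext => m; exact: h.
Qed.

Lemma toHE n (psi : HC X M) a m : val (val (toH n psi) a) m = val psi (codom a) m.
Proof. by []. Qed.

Lemma hdelta_toH n (psi : HC X M) a m :
  val (val (hdelta (dual_bimodule B) n (toH n psi)) a) m = val (delta B psi) (codom a) m.
Proof.
rewrite deltaE /delta_fun size_codomI.
have -> : val (hdelta (dual_bimodule B) n (toH n psi)) a =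
  hdelta_fun (dual_bimodule B) (val (toH n psi)) a by exact: hdelta_valE.
rewrite /hdelta_fun dualDE dualDE dualZE dual_sum.
under eq_bigr do rewrite dualZE.
rewrite big_nat_recr //= big_nat_recl //= big_mkord expr0 mul1r.
congr (_ + _ + _).
- rewrite /fpsi /face /= -codom_lift0; congr (val psi _ (ract B m _)).
  by rewrite -nth0 -[0%N]/(val (@ord0 n)) nth_codom.
- apply: eq_bigr => j _; congr (_ * _).
  rewrite /fpsi face_mid ?size_codomI ?ltnS ?ltn_ord //.
  by rewrite -[LHS]/(val psi (codom (mul_at A j a)) m) codom_mul_at.
congr (_ * _).
rewrite /fpsi /face /= size_codomI eqxx /= -codom_lift_max; congr (val psi _ (lact B _ m)).
by rewrite -nth_last size_codomI -[n.+1.-1]/(val (@ord_max n)) nth_codom.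
Qed.

Lemma dual_nrm (phi : dual M) m : cn (val phi m) <= nrm phi * nrm m.
Proof.
have := opnorm_ge phi m; rewrite cnE nrmE.
have -> : opnorm phi = (nrm phi)%:C by rewrite -nrmE.
by rewrite -[_%:C * _]rmorphM lecR.
Qed.

Lemma hcochain_nrm n (D : hcochain X (dual M) n) :
  exists K, forall a, nrm (val D a) <= K * wt (codom a).
Proof.
have [r r0 hr] := bounded_multilinear_bound (hcochainP D).
have rE : r = (cn r)%:C by rewrite -cnE ger0_norm.
by exists (cn r) => a; have := hr a; rewrite prod_codom nrmE {1}rE -[_%:C * _]rmorphM lecR.
Qed.

Definition from_ord n (D : ('I_n -> X) -> dual M) w m : C^o :=
  if size w == n then val (D (fun i => nth 0 w i)) m else 0.

Lemma from_ord_mlin n (D : ('I_n -> X) -> dual M) m : multilinear D ->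
  mlin (from_ord D ^~ m : seq X -> C).
Proof.
move=> lD s1 s2 a x y; rewrite /from_ord.
have sE z : size (s1 ++ z :: s2) = (size s1 + (size s2).+1)%N by rewrite size_cat.
rewrite !sE; case: ifP => [/eqP e|_]; last by rewrite mulr0 addr0.
have [c [i E]] := nth_upd e; rewrite (E (a *: x + y)) (E x) (E y).
by rewrite (lD c i a x y) dualDE dualZE.
Qed.

Lemma from_ord_good n (D : ('I_n -> X) -> dual M) K : multilinear D ->
  (forall a, nrm (D a) <= K * wt (codom a)) -> good (from_ord D).
Proof.
move=> lD hK; split=> [m|w c m m'|k]; first exact: from_ord_mlin.
  rewrite /from_ord; case: ifP => _; last by rewrite mulr0 addr0.
  by have [l _] := dualP (D (fun i => nth 0 w i)); rewrite l.
rewrite /from_ord.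
exists `|K| => w m wk; case: eqP => [e|_]; last first.
  by rewrite cn0 mulr_ge0 // mulr_ge0 ?wt_ge0 ?nrm_ge0.
apply: le_trans (dual_nrm _ _) _; rewrite mulrA ler_wpM2r ?nrm_ge0 //.
apply: le_trans (hK _) _; rewrite codom_nth // ler_wpM2r ?wt_ge0 //.
exact: ler_norm.
Qed.

Lemma fromH_good n (D : hcochain X (dual M) n) : good (from_ord (val D)).
Proof.
have [K hK] := hcochain_nrm D; have [lD _] := hcochainP D.
exact: from_ord_good lD hK.
Qed.

(** The slice of [psi] on words of length [n.+1] is a Hochschild cocycle with values in the dual of
    [M]; a primitive of it is extended by 0 to the words of other lengths. *)
Lemma exact_words n :
  (forall c : hcohomologyS (dual_bimodule B) n, c = 0) ->
  forall psi : HC X M, (forall w m, size w = n.+2 -> val (delta B psi) w m = 0) ->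
  exists D : HC X M, forall w m, size w = n.+1 -> val (delta B D) w m = val psi w m.
Proof.
move=> hex psi hpsi.
have k0 : hdelta (dual_bimodule B) n.+1 (toH n.+1 psi) = 0 :> hcochain X (dual M) n.+2.
  apply: hcochain_ext => a m; rewrite hdelta_toH hpsi ?size_codomI //.
have kpsi : toH n.+1 psi \in submodule_pred (kerm (hdelta (dual_bimodule B) n.+1)).
  by rewrite inE k0.
have /qpiP := hex (qpi _ (subm_mk kpsi)).
rewrite subr0 inE => -[D hD].
exists (mkHC (fromH_good D)) => w m wn.
have E : toH n (mkHC (fromH_good D)) = D.
  apply: hcochain_ext => a m'; rewrite toHE /= /from_ord size_codomI eqxx; congr (val (val D _) m').
  by apply/funext => i; rewrite nth_codom.
have := hdelta_toH (mkHC (fromH_good D)) (fun i : 'I_n.+1 => nth 0 w i) m.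
rewrite E codom_nth // => <-.
have -> : hdelta (dual_bimodule B) n D = toH n.+1 psi by rewrite -hD.
by rewrite toHE codom_nth.
Qed.

End Dual.

End Conversion.

(** * A primitive of the universal cocycle contracts every Hochschild complex in high degrees *)

Section FaceCat.
Variables (R : realType) (X : completeNormedModType R[i]).
Local Notation C := R[i].
Variables (A : algebra X) (M : normedModType C) (B : bimodule A M).

Lemma face_cat s t p m : (p < size t)%N ->
  face B (size s + p.+1)%N (s ++ t, m) =
  (s ++ (face B p.+1 (t, m)).1, (face B p.+1 (t, m)).2).
Proof.
move=> pt; have [e|ne] := eqVneq p.+1 (size t).
  case/lastP: t pt e => // t z; rewrite size_rcons => _ [e].
  rewrite (face_last _ _ _ (esym e)) -rcons_cat.
  rewrite addnS face_last //.
  by rewrite size_cat e.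
have {}pt : (p.+1 < size t)%N by rewrite ltn_neqAle ne.
by rewrite addnS !face_mid ?size_cat ?mrg_cat //; lia.
Qed.

Lemma face_catl s t i m : (i < size s)%N ->
  face B i (s ++ t, m) = ((face B i (s, m)).1 ++ t, (face B i (s, m)).2).
Proof.
case: i => [|i] h; first by case: s h.
by rewrite !face_mid ?size_cat ?mrg_catl //; lia.
Qed.

Definition mact m (x : aplus X) : M := ract B m x.1 + x.2 *: m.

Lemma mact_e m : mact m (unit_e X) = m.
Proof.
rewrite /mact /= scale1r; have [_ r2 _] := ractP B.
suff -> : ract B m 0 = 0 by rewrite add0r.
by have := r2 m (-1) 0 0; rewrite scaler0 addr0 scaleN1r addNr.
Qed.

Lemma mact_linr m c x y : mact m (c *: x + y) = c *: mact m x + mact m y.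
Proof.
have [_ r2 _] := ractP B.
by rewrite /mact /= r2 scalerDl -scalerA scalerDr addrACA.
Qed.

Lemma mact_linl c m m' x : mact (c *: m + m') x = c *: mact m x + mact m' x.
Proof.
have [r1 _ _] := ractP B.
rewrite /mact r1 !scalerDr addrACA; congr (_ + _ + (_ + _)).
by rewrite !scalerA mulrC.
Qed.

Lemma ractD m x y : ract B m (x + y) = ract B m x + ract B m y.
Proof. by have [_ r _] := ractP B; have := r m 1 x y; rewrite !scale1r. Qed.
Lemma ract0 m : ract B m 0 = 0.
Proof. by apply: (addrI (ract B m 0)); rewrite -ractD !addr0. Qed.
Lemma ractZ m c x : ract B m (c *: x) = c *: ract B m x.
Proof. by have [_ r _] := ractP B; have := r m c x 0; rewrite ract0 !addr0. Qed.
Lemma ractDl m m' x : ract B (m + m') x = ract B m x + ract B m' x.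
Proof. by have [r _ _] := ractP B; have := r x 1 m m'; rewrite !scale1r. Qed.
Lemma ract0l x : ract B 0 x = 0.
Proof. by apply: (addrI (ract B 0 x)); rewrite -ractDl !addr0. Qed.
Lemma ractZl m c x : ract B (c *: m) x = c *: ract B m x.
Proof. by have [r _ _] := ractP B; have := r x c m 0; rewrite ract0l !addr0. Qed.
Lemma lactD a m m' : lact B a (m + m') = lact B a m + lact B a m'.
Proof. by have [_ l _] := lactP B; have := l a 1 m m'; rewrite !scale1r. Qed.
Lemma lact0 a : lact B a 0 = 0.
Proof. by apply: (addrI (lact B a 0)); rewrite -lactD !addr0. Qed.
Lemma lactZ a c m : lact B a (c *: m) = c *: lact B a m.
Proof. by have [_ l _] := lactP B; have := l a c m 0; rewrite lact0 !addr0. Qed.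

Lemma mact_alact m a x : mact m (alact A a x) = mact (ract B m a) x.
Proof.
by rewrite /mact /alact /plus_mull /= scale0r addr0 ractD ractZ ractA.
Qed.

Lemma mact_aract m a x : mact m (aract A x a) = ract B (mact m x) a.
Proof.
by rewrite /mact /aract /plus_mulr /= scale0r addr0 ractD ractZ ractDl ractZl ractA.
Qed.

Lemma mact_face p z b m x : (face B p.+1 (z :: b, mact m x)).2 =
  mact (face B p.+1 (z :: b, m)).2 x.
Proof.
rewrite /face /=; case: ifP => _ //=.
by rewrite /mact lactD lactZ lractA.
Qed.

Lemma mact_bound k m x : bimod_bound B k -> nrm (mact m x) <= (k + 1) * (nrm m * nrm x).
Proof.
move=> [k0 _ _ hr]; rewrite /mact mulrDl mul1r.
have n1 : nrm x.1 <= nrm x by have := aplus_norm1 x; rewrite !nrmE lecR.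
have n2 : cn x.2 <= nrm x by have := aplus_norm2 x; rewrite !nrmE lecR.
apply: le_trans (nrmD _ _) _; rewrite lerD //.
  apply: le_trans (hr _ _) _; rewrite ler_wpM2l // ler_wpM2l ?nrm_ge0 //.
by rewrite nrmZ mulrC ler_wpM2l ?nrm_ge0.
Qed.

End FaceCat.

Section Contraction.
Variables (R : realType) (X : completeNormedModType R[i]).
Local Notation C := R[i].
Variables (A : algebra X) (N : nat).
Local Notation n := N.+1.
Local Notation V := (FL X (aplus X) n).
Variable D : HC X V.
Variables (M : normedModType C) (B : bimodule A M).

Lemma Phi_good (psi : HC X M) b m : good (fun y x => val psi (y ++ b) (mact B m x)).
Proof.
have [p1 p2 p3] := HCP psi; split=> [x s1 s2 a y z|w c x y|j].
- by rewrite -!catA /= p1.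
- by rewrite mact_linr p2.
have [K /bnd_ge0[L L0 hL]] := p3 (j + size b)%N.
have [k hk] := bimod_bound_ex B.
exists (L * (wt b * ((k + 1) * nrm m))) => w x wj.
apply: le_trans (hL _ _ _) _; first by rewrite size_cat wj.
rewrite wt_cat.
rewrite [leRHS](_ : _ = L * (wt w * wt b * ((k + 1) * (nrm m * nrm x)))); last by ring.
by rewrite ler_wpM2l // ler_wpM2l ?mulr_ge0 ?wt_ge0 //; exact: mact_bound.
Qed.

(** With the tail [b] and the coefficient [m] fixed, [psi] becomes the functional x dy_1 ... dy_n ↦
    psi(y b)(m x) on n-forms, that is, an element of [V]. *)
Definition Phi psi b m : V := mkFL n (Phi_good psi b m).

Lemma PhiE psi b m y x : size y = n -> ev (Phi psi b m) y x = val psi (y ++ b) (mact B m x).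
Proof. by move=> yn; rewrite ev_mkFL yn eqxx. Qed.

Lemma Phi_bound k psi b m K : bimod_bound B k -> 0 <= K -> bnd (val psi) (n + size b)%N K ->
  nrm (Phi psi b m) <= (k + 1) * K * (wt b * nrm m).
Proof.
move=> hk K0 hK; have k0 : 0 <= k by case: hk.
rewrite nrm_FL; apply: FLnorm_le.
  by rewrite !mulr_ge0 ?wt_ge0 ?nrm_ge0 // addr_ge0.
move=> y x yn; rewrite PhiE //; apply: le_trans (hK _ _ _) _.
  by rewrite size_cat yn.
rewrite wt_cat [leRHS](_ : _ = K * (wt y * wt b * ((k + 1) * (nrm m * nrm x)))); last by ring.
rewrite ler_wpM2l // ler_wpM2l ?mulr_ge0 ?wt_ge0 //; exact: mact_bound.
Qed.

(** The universal cocycle at the first [n] letters, evaluated on [Phi], returns [psi]; putting its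
    primitive [D] at the first [N] letters instead lowers the degree by one. *)
Definition g_fun (psi : HC X M) w m : C^o := val D (take N w) (Phi psi (drop N w) m).

Lemma g_bnd k KD psi j K : bimod_bound B k -> 0 <= KD -> bnd (val D) (minn N j) KD ->
  0 <= K -> bnd (val psi) (n + (j - N))%N K -> bnd (g_fun psi) j (KD * ((k + 1) * K)).
Proof.
move=> hk KD0 hD K0 hK w m wj; rewrite /g_fun.
apply: le_trans (hD _ _ _) _; first by rewrite size_take_min wj.
rewrite -mulrA ler_wpM2l //.
apply: le_trans (_ : wt (take N w) * ((k + 1) * K * (wt (drop N w) * nrm m)) <= _).
  by rewrite ler_wpM2l ?wt_ge0 //; apply: Phi_bound => //; rewrite size_drop wj.
by rewrite -{3}[w](cat_take_drop N) wt_cat le_eqVlt; apply/orP; left; apply/eqP; ring.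
Qed.

Lemma g_good psi : good (g_fun psi).
Proof.
have [p1 p2 p3] := HCP psi; have [D1 D2 D3] := HCP D.
split=> [m s1 s2 a x y|w c m m'|j].
- rewrite /g_fun !take_cat !drop_cat; case: ltnP => h.
    rewrite -D2; congr (val D _ _); apply: FL_ext => u z un.
    by rewrite [RHS]evE !(PhiE psi) // !catA p1.
  by case: (N - size s1)%N => [|q]; rewrite ?take0 ?drop0 /= ?D1 // -D2 ?cats0;
    congr (val D _ _); apply: FL_ext => u z un; rewrite [RHS]evE !(PhiE psi) // p1.
- rewrite /g_fun -D2; congr (val D _ _); apply: FL_ext => u z un.
  by rewrite [RHS]evE !(PhiE psi) // mact_linl p2.
have [KD /bnd_ge0[LD LD0 hLD]] := D3 (minn N j).
have [K /bnd_ge0[L L0 hL]] := p3 (n + (j - N))%N.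
have [k hk] := bimod_bound_ex B.
by exists (LD * ((k + 1) * L)); exact: g_bnd.
Qed.

Definition gop psi : HC X M := mkHC (g_good psi).

Lemma gopE psi w m : val (gop psi) w m = val D (take N w) (Phi psi (drop N w) m).
Proof. by []. Qed.

Lemma Phi_linear (c : C) (psi phi : HC X M) b m :
  Phi (c *: psi + phi) b m = c *: Phi psi b m + Phi phi b m.
Proof.
apply: FL_ext => u z un.
rewrite [RHS]evE (PhiE psi b m z un) (PhiE phi b m z un).
rewrite (PhiE (c *: psi + phi) b m z un).
exact: HCE.
Qed.

Lemma gop_linear : linear gop.
Proof.
move=> c psi phi; apply: HC_ext => w m.
by rewrite HCE !gopE Phi_linear HC_modD HC_modZ.
Qed.
HB.instance Definition _ := GRing.isLinear.Build C (HC X M) (HC X M) *:%R gop gop_linear.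

Hypothesis hD : forall w v, size w = n ->
  val (delta (univ_bimodule A n) D) w v = ev v w (unit_e X).

(** Write w = u z b with [u] of length [N]. The first [n] faces of [w] are those of the coboundary
    of [D] at u z. The remaining ones act on z b, and the cocycle equation of [psi] identifies their
    sum with the left action of [z] on [Phi]. So the total is the coboundary of [D] at u z,
    evaluated on [Phi psi b m], which is psi(w)(m). *)
Lemma delta_gop (psi : HC X M) k w m :
  (forall w' m', size w' = k.+1 -> val (delta B psi) w' m' = 0) ->
  size w = k -> (n <= k)%N -> val (delta B (gop psi)) w m = val psi w m.
Proof.
move=> hpsi wk nk.
have [u [z [b [ew uN]]]] : exists u z b, w = u ++ z :: b /\ size u = N.
  exists (take N w), (nth 0 w N), (drop N.+1 w).
  by rewrite size_take wk nk -drop_nth ?wk // cat_take_drop.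
have kE : k = (n + size b)%N by rewrite -wk ew size_cat uN /= addnS.
have [_ D2 _] := HCP D.
pose v := Phi psi b m.
have un : size (rcons u z) = n by rewrite size_rcons uN.
have -> : val psi w m = val (delta (univ_bimodule A n) D) (rcons u z) v.
  by rewrite hD // PhiE // mact_e ew cat_rcons.
rewrite !deltaE /delta_fun un wk kE addSn.
rewrite [in LHS](_ : (N + size b).+2 = (n + (size b).+1)%N); last lia.
rewrite (@big_cat_nat _ _ _ n) //=; last exact: leq_addr.
rewrite [RHS]big_nat_recr //=; congr (_ + _).
  apply: eq_big_nat => i /andP[_ iN]; congr (_ * _).
  have iu : (i < size (rcons u z))%N by rewrite un.
  rewrite /fpsi ew -cat_rcons face_catl //= /g_fun.
  have si : size (face B i (rcons u z, m)).1 = N.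
    by rewrite size_face /= ?un // ltnW.
  rewrite take_size_cat // drop_size_cat //.
  case: i iN iu si => [|i] iN iu si.
    case: u uN un iu si {ew} => [|y u] uN un iu si; rewrite ?rcons_cons !face0 /=.
      congr (val D _ _); apply: FL_ext => y' x y'n.
      by rewrite urE // !PhiE // mact_alact.
    congr (val D _ _); apply: FL_ext => y' x y'n.
    by rewrite urE // !PhiE // mact_alact.
  by rewrite !face_mid ?un.
rewrite [X in _ = _ * X]/fpsi (face_last _ _ _ uN) /=.
have gf p : (p <= size b)%N -> fpsi B (g_fun psi) (n + p)%N w m =
    val D u (Phi psi (face B p.+1 (z :: b, m)).1 (face B p.+1 (z :: b, m)).2).
  move=> pb; rewrite /fpsi ew [(n + p)%N](_ : _ = (size u + p.+1)%N) ?face_cat ?uN ?addnS //.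
  by rewrite /g_fun /= take_size_cat // drop_size_cat.
rewrite -{1}[n]add0n big_addn.
have -> : (n + (size b).+1 - n = (size b).+1)%N by lia.
have Dsum (F : nat -> V) (c : nat -> C) q : \sum_(0 <= p < q) c p * val D u (F p) =
    val D u (\sum_(0 <= p < q) c p *: F p).
  elim: q => [|q IH]; first by rewrite !big_geq // HC_mod0.
  by rewrite !big_nat_recr //= IH HC_modD HC_modZ.
rewrite (eq_big_nat _ _ (F2 := fun p => (-1) ^+ (n + p) *
  val D u (Phi psi (face B p.+1 (z :: b, m)).1 (face B p.+1 (z :: b, m)).2))); last first.
  by move=> p /andP[_ pb]; rewrite [(p + n)%N]addnC gf.
rewrite Dsum -HC_modZ; congr (val D u _); apply: FL_ext => y x yn.
rewrite evZ ulE //.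
have -> : ev (\sum_(0 <= p < (size b).+1) (-1) ^+ (n + p) *:
    Phi psi (face B p.+1 (z :: b, m)).1 (face B p.+1 (z :: b, m)).2) y x =
  \sum_(0 <= p < (size b).+1) (-1) ^+ (n + p) *
    fpsi B (val psi) (n + p.+1)%N (y ++ z :: b) (mact B m x).
  have evS (F : nat -> V) q : ev (\sum_(0 <= p < q) F p) y x = \sum_(0 <= p < q) ev (F p) y x.
    elim: q => [|q IH]; first by rewrite !big_geq.
    by rewrite !big_nat_recr //= evD IH.
  rewrite evS; apply: eq_big_nat => p /andP[_ pb]; rewrite evZ; congr (_ * _).
  rewrite (PhiE psi _ _ _ yn) /fpsi [(n + p.+1)%N](_ : _ = (size y + p.+1)%N); last by rewrite yn.
  rewrite face_cat //= mact_face.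
  by rewrite (face1_const B p.+1 (z :: b) m (mact B m x)).
have yz : size (y ++ z :: b) = k.+1 by rewrite size_cat yn kE /= addnS.
have := hpsi _ (mact B m x) yz; rewrite deltaE /delta_fun yz kE.
rewrite (_ : (N.+1 + size b).+2 = (n.+1 + (size b).+1)%N); last lia.
rewrite (@big_cat_nat _ _ _ n.+1) //=; last exact: leq_addr.
rewrite -{2}[n.+1]add0n big_addn addKn => E.
have -> : (-1) ^+ n * \sum_(0 <= j < N.+2)
     (-1) ^+ n * (-1) ^+ j * fpsi (aplus_bimodule A) (ev v) j (rcons y z) x =
   \sum_(0 <= i < N.+2) (-1) ^+ i * fpsi B (val psi) i (y ++ z :: b) (mact B m x).
  rewrite mulr_sumr; apply: eq_big_nat => j /andP[_ jn].
  rewrite -[(-1) ^+ n * _ * _]mulrA signMM; congr (_ * _).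
  have yzn : size (rcons y z) = n.+1 by rewrite size_rcons yn.
  have sj : size (face (aplus_bimodule A) j (rcons y z, x)).1 = n.
    by rewrite size_face /= yzn // ltnW.
  rewrite /fpsi (PhiE psi b m _ sj) -cat_rcons face_catl ?yzn //=.
  case: j jn sj => [|j] jn sj; last by rewrite !face_mid ?yzn.
  case: y yn yz E yzn sj => // a y yn yz E yzn sj.
  by rewrite rcons_cons !face0 /= mact_aract.
(* The cocycle equation for [psi] at y z b trades the faces within y z for those within z b. *)
move/eqP: E; rewrite addr_eq0 => /eqP E; rewrite [RHS]E -sumrN.
apply: eq_big_nat => p _; rewrite -mulNr; congr (_ * _).
  by rewrite [(p + N.+2)%N]addnC [in RHS]addSn [in RHS]exprS mulN1r opprK.
by rewrite addnC addSnnS.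
Qed.

(** Write g for [gop] and δ for [delta]. The operator g inverts δ only on cocycles. Since psi - g δ
    psi is a cocycle in degrees at least [n], δ of [hop] is psi - g δ psi there, while [hop] of δ
    psi is g δ psi; hence the homotopy formula [delta_hop]. *)
Definition hop (psi : HC X M) : HC X M := gop (psi - gop (delta B psi)).

Lemma hop_linear : linear hop.
Proof.
move=> c psi phi; rewrite /hop linearP [gop (c *: _ + _)]linearP.
by rewrite opprD addrACA -scalerBr linearP.
Qed.
HB.instance Definition _ := GRing.isLinear.Build C (HC X M) (HC X M) *:%R hop hop_linear.

Lemma delta_hop (psi : HC X M) w m : (n <= size w)%N ->
  val (delta B (hop psi) + hop (delta B psi)) w m = val psi w m.
Proof.
move=> nw; rewrite {2}/hop delta_delta linear0 subr0 HCD.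
rewrite (@delta_gop _ (size w)) //; first by rewrite HCB subrK.
move=> w' m' w'w; rewrite linearB HCB (@delta_gop _ (size w).+1) ?subrr //.
  by move=> w2 m2 _; rewrite delta_delta HC0.
exact: leqW.
Qed.

End Contraction.

(** * Norm estimates for nearby products *)

Section Close.
Variables (R : realType) (X : completeNormedModType R[i]).
Local Notation C := R[i].

Lemma half01 : 0 <= (2^-1 : R) < 1.
Proof. by apply/andP; split; lra. Qed.

Section Forms.
Variable M : normedModType C.
Implicit Types psi phi e u : HC X M.

Lemma bnd_half_null j psi : (forall K, 0 <= K -> bnd (val psi) j K ->
    bnd (val psi) j (K / 2)) -> forall w m, size w = j -> val psi w m = 0.
Proof.
move=> h w m wj; have [_ _ /(_ j)[K0 /bnd_ge0[K K_ge0 hK]]] := HCP psi.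
have it i : bnd (val psi) j (K * 2^-1 ^+ i).
  elim: i => [|i IH]; first by rewrite expr0 mulr1.
  rewrite exprSr mulrA; apply: h => //; first by rewrite mulr_ge0 ?exprn_ge0.
apply: cn0_eq0; apply/eqP; rewrite eq_le cn_ge0 andbT.
apply: (@le0_geometric _ 2^-1 (K * (wt w * nrm m)) _ half01) => i.
by apply: le_trans (it i w m wj) _; rewrite mulrAC.
Qed.

(** A finite bound exists to start with; replacing K by K / 2 + q repeatedly drives it to the fixed
    point 2 q. *)
Lemma bnd_absorb j psi q : 0 <= q -> (forall K, 0 <= K -> bnd (val psi) j K ->
    bnd (val psi) j (K / 2 + q)) -> bnd (val psi) j (2 * q).
Proof.
move=> q0 h w m wj; have [_ _ /(_ j)[K0 /bnd_ge0[K K_ge0 hK]]] := HCP psi.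
have it i : bnd (val psi) j (2 * q + K * 2^-1 ^+ i).
  elim: i => [|i IH].
    by rewrite expr0 mulr1; apply: bnd_le hK; rewrite lerDr mulr_ge0.
  have -> : 2 * q + K * 2^-1 ^+ i.+1 = (2 * q + K * 2^-1 ^+ i) / 2 + q.
    by rewrite exprSr; field.
  by apply: h => //; rewrite addr_ge0 ?mulr_ge0 ?exprn_ge0.
rewrite -subr_le0.
apply: (@le0_geometric _ 2^-1 (K * (wt w * nrm m)) _ half01) => i.
by rewrite lerBlDl [K * _ * _]mulrAC -mulrDl; exact: it.
Qed.

(** The Neumann series of 1 - k applied to [c]. The contraction is known in degree [j] alone, so the
    limit is taken and the equation holds in that degree. *)
Lemma neumann j (k : {linear HC X M -> HC X M}) (c : HC X M) :
  (forall K psi, 0 <= K -> bnd (val psi) j K -> bnd (val (k psi)) j (K / 2)) ->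
  exists u, forall w m, size w = j -> val u w m = val c w m + val (k u) w m.
Proof.
move=> hk; pose u := fix u i := if i is i'.+1 then c + k (u i') else 0.
have [_ _ /(_ j)[K0 /bnd_ge0[K K_ge0 hK]]] := HCP c.
have step i : bnd (val (u i.+1 - u i)) j (K * 2^-1 ^+ i).
  elim: i => [|i IH].
    by rewrite /= linear0 addr0 subr0 expr0 mulr1.
  have -> : u i.+2 - u i.+1 = k (u i.+1 - u i).
    by rewrite linearB /= opprD addrACA subrr add0r.
  by rewrite exprSr mulrA; apply: hk => //; rewrite mulr_ge0 ?exprn_ge0.
have hq := half01.
have [i w m /eqP wj|l [_ hl]] := @good_limit _ _ _ 2^-1 K u (pred1 j) hq.
  by rewrite -HCB mulrAC; exact: step.
exists l => w m wj; apply/eqP; rewrite -subr_eq0; apply/eqP.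
apply: cn0_eq0; apply/eqP; rewrite eq_le cn_ge0 andbT.
pose K' := 2 * K / (1 - 2^-1).
have K'0 : 0 <= K'.
  have h1 : 0 <= 1 - 2^-1 :> R by have /andP[_ /ltW] := half01; rewrite subr_ge0.
  by rewrite /K' !mulr_ge0 ?invr_ge0.
have hl' i : bnd (val (l - u i)) j (K' * 2^-1 ^+ i).
  by move=> w' m' w'j; rewrite HCB mulrAC; apply: hl; apply/eqP.
apply: (@le0_geometric _ 2^-1 (K' * (wt w * nrm m)) _ hq) => i.
have -> : val l w m - (val c w m + val (k l) w m) =
    val (l - u i.+1) w m - val (k (l - u i)) w m.
  have kE : k (l - u i) = k l - k (u i) by exact: linearB.
  by rewrite kE !HCB -[u i.+1]/(c + k (u i)) HCD; ring.
apply: le_trans (cnB _ _) _.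
have h1 := hl' i.+1 w m wj.
have h2 := hk _ _ (mulr_ge0 K'0 (exprn_ge0 i _)) (hl' i) w m wj.
rewrite -[_ * _ * _ ^+ i]mulrAC.
apply: le_trans (lerD h1 (h2 _)) _; first by lra.
by rewrite exprSr le_eqVlt; apply/orP; left; apply/eqP; field.
Qed.

End Forms.

Section TwoBimodules.
Variables (A A' : algebra X) (M : normedModType C).
Variables (B : bimodule A M) (B' : bimodule A' M).

Definition bimod_close (e : R) :=
  [/\ 0 <= e, bmul (fun a b => A a b - A' a b) e,
      forall a m, nrm (lact B a m - lact B' a m) <= e * (nrm a * nrm m)
    & forall m a, nrm (ract B m a - ract B' m a) <= e * (nrm m * nrm a)].

Lemma mlin_mrgB (f : seq X -> C) (mu nu : X -> X -> X) i w : mlin f ->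
  (i.+1 < size w)%N ->
  f (mrg mu i w) - f (mrg nu i w) = f (mrg (fun a b => mu a b - nu a b) i w).
Proof.
move=> lf h.
suff [s [a [b [t [-> si]]]]] : exists s a b t, w = s ++ a :: b :: t /\ size s = i.
  rewrite -si -[size s]addn0 !mrg_cat /=.
  have -> : mu a b - nu a b = -1 *: nu a b + mu a b by rewrite scaleN1r addrC.
  by rewrite lf; ring.
exists (take i w), (nth 0 w i), (nth 0 w i.+1), (drop i.+2 w).
rewrite -!drop_nth ?cat_take_drop //; last lia.
by rewrite size_take; split=> //; case: ltnP => //; lia.
Qed.

Lemma fpsi_close e psi n K j : bimod_close e -> good psi -> 0 <= K -> bnd psi n K ->
  (j <= n.+1)%N ->
  bnd (fun w m => fpsi B psi j w m - fpsi B' psi j w m) n.+1 (e * K).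
Proof.
move=> [e0 hA hl hr] [p1 p2 _] K0 hK jn w m wn.
have p2B u x y : psi u x - psi u y = psi u (x - y).
  have -> : x - y = -1 *: y + x by rewrite scaleN1r addrC.
  by rewrite p2; ring.
have fin u x (c : R) : size u = n -> nrm x <= e * c -> wt u * c = wt w * nrm m ->
    cn (psi u x) <= e * K * (wt w * nrm m).
  move=> un hx hc; apply: le_trans (hK _ _ un) _; rewrite -hc.
  apply: le_trans (_ : K * (wt u * (e * c)) <= _).
    by rewrite ler_wpM2l // ler_wpM2l ?wt_ge0.
  by rewrite le_eqVlt; apply/orP; left; apply/eqP; ring.
rewrite /fpsi; case: j jn => [|j] jn.
  case: w wn fin => // a w [wn] fin; rewrite !face0 /= p2B.
  by apply: fin (hr m a) _; rewrite // wt_cons; ring.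
have [ej|nj] := eqVneq j n.
  case/lastP: w wn fin => // w z; rewrite size_rcons => -[wn] fin.
  rewrite ej !(face_last _ _ _ wn) /= p2B.
  by apply: fin (hl z m) _; rewrite // wt_rcons; ring.
have h : (j.+1 < size w)%N by rewrite wn ltnS ltn_neqAle nj.
rewrite !face_mid //=.
have := mlin_mrgB A A' (p1 m) h => /= ->.
apply: le_trans (hK _ _ _) _; first by rewrite size_mrg // wn.
rewrite [e * K]mulrC -mulrA ler_wpM2l // mulrA ler_wpM2r ?nrm_ge0 //.
exact: wt_mrg.
Qed.

Lemma delta_close e (psi : HC X M) n K : bimod_close e -> 0 <= K -> bnd (val psi) n K ->
  bnd (val (delta B psi - delta B' psi)) n.+1 (n.+2%:R * (e * K)).
Proof.
move=> he K0 hK w m wn; rewrite HCB !deltaE /delta_fun wn !big_mkord -sumrB -mulrA.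
apply: le_trans (@cn_sum_le _ n.+2 (fun j => (-1) ^+ j * fpsi B (val psi) j w m -
  (-1) ^+ j * fpsi B' (val psi) j w m) (e * K * (wt w * nrm m)) _) _ => //.
move=> j jn; rewrite -mulrBr cn_signM.
exact: (fpsi_close he (HCP psi) K0 hK).
Qed.

End TwoBimodules.

Section Gclose.
Variables (A A' : algebra X) (N : nat) (D D' : HC X (FL X (aplus X) N.+1)).
Variables (M : normedModType C) (B : bimodule A M) (B' : bimodule A' M).

Lemma mact_close e m x : bimod_close B B' e ->
  nrm (mact B m x - mact B' m x) <= e * (nrm m * nrm x).
Proof.
move=> [e0 _ _ hr]; rewrite /mact opprD addrACA subrr addr0; apply: le_trans (hr _ _) _.
rewrite ler_wpM2l // ler_wpM2l ?nrm_ge0 //.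
by have := aplus_norm1 x; rewrite !nrmE lecR.
Qed.

(** Two sources of error: the change of the primitive [D], and the change of the right action hidden
    in [Phi]. *)
Lemma g_close k e KD eD (psi : HC X M) j K : bimod_bound B k -> bimod_close B B' e ->
  0 <= KD -> bnd (val D') N KD -> 0 <= eD -> bnd (val (D - D')) N eD ->
  0 <= K -> bnd (val psi) j.+1 K -> (N <= j)%N ->
  bnd (val (gop D B psi - gop D' B' psi)) j ((eD * (k + 1) + KD * e) * K).
Proof.
move=> hk he KD0 hD' eD0 hD K0 hK Nj w m wj.
have k0 : 0 <= k by case: hk. have e0 : 0 <= e by case: he.
have sN : size (take N w) = N by rewrite size_takel // wj.
have sd : (N.+1 + size (drop N w))%N = j.+1 by rewrite size_drop wj; lia.
rewrite HCB !gopE.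
have -> : val D (take N w) (Phi N B psi (drop N w) m) - val D' (take N w) (Phi N B' psi (drop N w) m)
  = val (D - D') (take N w) (Phi N B psi (drop N w) m)
    + val D' (take N w) (Phi N B psi (drop N w) m - Phi N B' psi (drop N w) m).
  by rewrite HCB HC_modB; ring.
apply: le_trans (cnD _ _) _; rewrite -[X in _ * (X * _)](_ : wt (take N w) * wt (drop N w) = _); last first.
  by rewrite -wt_cat cat_take_drop.
set T := wt (take N w); set S := wt (drop N w).
have T0 : 0 <= T := wt_ge0 _. have S0 : 0 <= S := wt_ge0 _.
have h1 : cn (val (D - D') (take N w) (Phi N B psi (drop N w) m)) <=
    eD * (T * ((k + 1) * K * (S * nrm m))).
  apply: le_trans (hD _ _ sN) _; rewrite ler_wpM2l // ler_wpM2l //.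
  by apply: Phi_bound => //; rewrite sd.
have h2 : cn (val D' (take N w) (Phi N B psi (drop N w) m - Phi N B' psi (drop N w) m)) <=
    KD * (T * (e * K * (S * nrm m))).
  apply: le_trans (hD' _ _ sN) _; rewrite ler_wpM2l // ler_wpM2l //.
  rewrite nrm_FL; apply: FLnorm_le; first by rewrite !mulr_ge0 ?nrm_ge0.
  move=> y x yn; rewrite evB (PhiE B psi _ _ _ yn) (PhiE B' psi _ _ _ yn) -HC_modB.
  apply: le_trans (hK _ _ _) _; first by rewrite size_cat yn sd.
  rewrite wt_cat; apply: le_trans (_ : K * (wt y * S * (e * (nrm m * nrm x))) <= _).
    by rewrite ler_wpM2l // ler_wpM2l ?mulr_ge0 ?wt_ge0 //; exact: mact_close.
  by rewrite le_eqVlt; apply/orP; left; apply/eqP; ring.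
apply: le_trans (lerD h1 h2) _.
by rewrite le_eqVlt; apply/orP; left; apply/eqP; ring.
Qed.

End Gclose.

Section BimoduleBounds.
Variables (A A' : algebra X) (n : nat).

Lemma aplus_bound k : 0 <= k -> bmul A k -> bimod_bound (aplus_bimodule A) (k + 1).
Proof.
move=> k0 hA; have nE (y : X) : nrm ((y, 0) : aplus X) = nrm y by rewrite /nrm aplus_inl_norm.
have key a (x : aplus X) (y : X) : nrm y <= k * (nrm a * nrm x.1) ->
    nrm (y + x.2 *: a) <= (k + 1) * (nrm a * nrm x).
  move=> hy; apply: le_trans (nrmD _ _) _; rewrite mulrDl mul1r lerD //.
    apply: le_trans hy _; rewrite ler_wpM2l // ler_wpM2l ?nrm_ge0 //.
    by have := aplus_norm1 x; rewrite !nrmE lecR.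
  rewrite nrmZ mulrC ler_wpM2l ?nrm_ge0 //.
  by have := aplus_norm2 x; rewrite !nrmE lecR.
split=> [|a b|a x|x a].
- by rewrite addr_ge0.
- apply: le_trans (hA _ _) _; rewrite mulrDl lerDl mul1r mulr_ge0 ?nrm_ge0 //.
- by rewrite /= /alact nE; apply: key.
- rewrite /= /aract nE [nrm x * _]mulrC; apply: key => //.
  by rewrite [nrm a * _]mulrC.
Qed.

Lemma univ_bound k : 0 <= k -> bmul A k ->
  bimod_bound (univ_bimodule A n) (n.+1%:R * (k + 1)).
Proof.
move=> k0 hA; have hb := aplus_bound k0 hA.
have le1 : k + 1 <= n.+1%:R * (k + 1) by rewrite ler_peMl ?addr_ge0 // ler1n.
split=> [|a b|a v|v a].
- by rewrite mulr_ge0 ?addr_ge0.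
- apply: le_trans (hA _ _) _; rewrite ler_wpM2r ?mulr_ge0 ?nrm_ge0 //.
  by apply: le_trans le1; rewrite lerDl.
- exact: ul_bound.
- apply: le_trans (ur_bound a v hb) _.
  by rewrite ler_wpM2r ?mulr_ge0 ?nrm_ge0.
Qed.

Hypothesis e : R.
Hypotheses (e0 : 0 <= e) (hAA : bmul (fun a b => A a b - A' a b) e).

Lemma aplus_close : bimod_close (aplus_bimodule A) (aplus_bimodule A') e.
Proof.
have nE (y z : X) : nrm ((y, 0) - (z, 0) : aplus X) = nrm (y - z).
  by rewrite /nrm -aplus_inl_norm; congr (complex.Re `|_|); congr pair; rewrite subrr.
have n1 (x : aplus X) : nrm x.1 <= nrm x by have := aplus_norm1 x; rewrite !nrmE lecR.
split=> // [a x|x a].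
  rewrite /= /alact nE opprD addrACA subrr addr0; apply: le_trans (hAA _ _) _.
  by rewrite ler_wpM2l // ler_wpM2l ?nrm_ge0.
rewrite /= /aract nE opprD addrACA subrr addr0; apply: le_trans (hAA _ _) _.
by rewrite ler_wpM2l // ler_wpM2r ?nrm_ge0.
Qed.

Lemma univ_close : bimod_close (univ_bimodule A n) (univ_bimodule A' n) (n.+1%:R * e).
Proof.
have hc := aplus_close; have le1 : e <= n.+1%:R * e by rewrite ler_peMl // ler1n.
split=> [||a v|v a].
- by rewrite mulr_ge0.
- move=> a b; apply: le_trans (hAA a b) _; rewrite ler_wpM2r ?mulr_ge0 ?nrm_ge0 //.
- rewrite /= nrm_FL; apply: FLnorm_le; first by rewrite !mulr_ge0 ?nrm_ge0.
  move=> w x wn; rewrite evB !ulE // !big_mkord -sumrB.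
  apply: le_trans (@cn_sum_le _ n.+1 (fun j =>
    (-1) ^+ n * (-1) ^+ j * fpsi (aplus_bimodule A) (ev v) j (rcons w a) x -
    (-1) ^+ n * (-1) ^+ j * fpsi (aplus_bimodule A') (ev v) j (rcons w a) x)
    (e * FLnorm v * (wt (rcons w a) * nrm x)) _) _.
    move=> j jn; rewrite -mulrBr cnM cnM !cn_sign !mul1r.
    apply: (fpsi_close hc (proj1 (FLP v)) (FLnorm_ge0 v) (@FLnorm_bnd _ _ _ _ v) (ltnW jn)).
    by rewrite size_rcons wn.
  by rewrite wt_rcons le_eqVlt; apply/orP; left; apply/eqP; rewrite nrm_FL; ring.
rewrite /= nrm_FL; apply: FLnorm_le; first by rewrite !mulr_ge0 ?nrm_ge0.
move=> w x wn; rewrite evB !urE //.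
have [[_ v2 _] _] := FLP v.
have -> : ev v w (alact A a x) - ev v w (alact A' a x) = ev v w (alact A a x - alact A' a x).
  have -> : alact A a x - alact A' a x = -1 *: alact A' a x + alact A a x.
    by rewrite scaleN1r addrC.
  by rewrite v2; ring.
apply: le_trans (@FLnorm_bnd _ _ _ _ v w _ wn) _; rewrite -nrm_FL.
have [_ _ hl _] := hc.
apply: le_trans (_ : nrm v * (wt w * (e * (nrm a * nrm x))) <= _).
  by rewrite ler_wpM2l ?nrm_ge0 // ler_wpM2l ?wt_ge0 //; exact: hl.
rewrite [leLHS](_ : _ = e * (nrm v * nrm a) * (wt w * nrm x)); last by ring.
by rewrite ler_wpM2r ?mulr_ge0 ?wt_ge0 ?nrm_ge0 // ler_wpM2r ?mulr_ge0 ?nrm_ge0.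
Qed.

End BimoduleBounds.

End Close.

(** * Primitives of the universal cocycle for all nearby products *)

Section Perturb.
Variables (R : realType) (X : completeNormedModType R[i]).
Local Notation C := R[i].

Lemma bndHD (M : normedModType C) (psi phi : HC X M) n K L :
  bnd (val psi) n K -> bnd (val phi) n L -> bnd (val (psi + phi)) n (K + L).
Proof. by move=> h1 h2 w m wn; rewrite HCD; exact: (bndD h1 h2). Qed.

Lemma bndHN (M : normedModType C) (psi : HC X M) n K :
  bnd (val psi) n K -> bnd (val (- psi)) n K.
Proof. by move=> h w m wn; rewrite HCN cnN; exact: h. Qed.

Lemma bndHB (M : normedModType C) (psi phi : HC X M) n K L :
  bnd (val psi) n K -> bnd (val phi) n L -> bnd (val (psi - phi)) n (K + L).
Proof. by move=> h1 h2; apply: bndHD => //; exact: bndHN. Qed.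

Lemma bnd_ext (M : normedModType C) (psi phi : HC X M) n K :
  (forall w m, size w = n -> val psi w m = val phi w m) ->
  bnd (val phi) n K -> bnd (val psi) n K.
Proof. by move=> h hb w m wn; rewrite h //; exact: hb. Qed.

Lemma hop_bnd (A : algebra X) N (D : HC X (FL X (aplus X) N.+1)) M (B : bimodule A M)
    k KD j K (psi : HC X M) : bimod_bound B k -> 0 <= KD -> bnd (val D) N KD ->
  (N <= j)%N -> 0 <= K -> bnd (val psi) j.+1 K ->
  bnd (val (hop D B psi)) j
    (KD * (k + 1) * (1 + KD * (k + 1) * (j.+3%:R * k)) * K).
Proof.
move=> hk KD0 hD Nj K0 hK; have k0 : 0 <= k by case: hk.
have gB q L (phi : HC X M) : (N <= q)%N -> 0 <= L -> bnd (val phi) q.+1 L ->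
    bnd (val (gop D B phi)) q (KD * (k + 1) * L).
  move=> Nq L0 hL; rewrite -mulrA; apply: (g_bnd (j := q) hk KD0 _ L0).
    by rewrite (minn_idPl Nq).
  by rewrite addSn subnKC.
have h1 := delta_bnd hk K0 hK.
have d0 : 0 <= j.+3%:R * (k * K) by rewrite mulr_ge0 // mulr_ge0.
have h2 := gB j.+1 _ (delta B psi) (leqW Nj) d0 h1.
have h3 := bndHB hK h2.
have d1 : 0 <= K + KD * (k + 1) * (j.+3%:R * (k * K)).
  apply: addr_ge0 => //; apply: mulr_ge0 => //; apply: mulr_ge0 => //; exact: addr_ge0.
have := gB j _ _ Nj d1 h3.
by apply: bnd_le; rewrite le_eqVlt; apply/orP; left; apply/eqP; ring.
Qed.

Section Abstract.
Variables (M : normedModType C) (r : R) (N : nat).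
Local Notation n := N.+1.
Local Notation W := (HC X M).
Variables (d : R -> W -> W) (h : W -> W) (c : W).
Hypothesis r0 : 0 < r.
Hypothesis dL : forall t a psi phi, d t (a *: psi + phi) = a *: d t psi + d t phi.
Hypothesis hL : forall a psi phi, h (a *: psi + phi) = a *: h psi + h phi.
Hypothesis d_d : forall t psi, d t (d t psi) = 0.
Hypothesis d_ext : forall t psi phi,
  (forall w m, size w = n -> val psi w m = val phi w m) ->
  forall w m, size w = n.+1 -> val (d t psi) w m = val (d t phi) w m.
Hypothesis h_bnd : forall j, (N <= j)%N -> exists2 Ch, 0 <= Ch & forall K psi, 0 <= K ->
  bnd (val psi) j.+1 K -> bnd (val (h psi)) j (Ch * K).
Hypothesis d_close : forall j, exists2 Cd, 0 <= Cd & forall s t K psi,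
  `|s| <= r -> `|t| <= r -> 0 <= K -> bnd (val psi) j K ->
  bnd (val (d s psi - d t psi)) j.+1 (Cd * `|s - t| * K).
Hypothesis contraction : forall psi w m, (n <= size w)%N ->
  val (d 0 (h psi) + h (d 0 psi)) w m = val psi w m.
Hypothesis c_cocycle : forall t w m, size w = n.+1 -> val (d t c) w m = 0.

Let y t psi := d t (h psi) + h (d t psi).

Let zr : `|0 : R| <= r. Proof. by rewrite normr0 ltW. Qed.

Let hB psi phi : h (psi - phi) = h psi - h phi.
Proof. by rewrite addrC -scaleN1r hL scaleN1r addrC. Qed.
Let h_0 : h 0 = 0.
Proof. by have := hB 0 0; rewrite !subrr. Qed.

Let y_linear t a psi phi : y t (a *: psi + phi) = a *: y t psi + y t phi.
Proof. by rewrite /y hL !dL hL scalerDr addrACA. Qed.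

Let yB t psi phi : y t (psi - phi) = y t psi - y t phi.
Proof. by rewrite addrC -scaleN1r y_linear scaleN1r addrC. Qed.

Let y_close j : (N <= j)%N -> exists2 C1, 0 <= C1 & forall s t K psi,
  `|s| <= r -> `|t| <= r -> 0 <= K -> bnd (val psi) j.+1 K ->
  bnd (val (y s psi - y t psi)) j.+1 (C1 * `|s - t| * K).
Proof.
move=> Nj; have [Ch Ch0 hCh] := h_bnd Nj; have [Ci Ci0 hCi] := h_bnd (leqW Nj).
have [Cd Cd0 hCd] := d_close j; have [Ce Ce0 hCe] := d_close j.+1.
exists (Cd * Ch + Ci * Ce); first by apply: addr_ge0; exact: mulr_ge0.
move=> s t K psi hs ht K0 hK.
have -> : y s psi - y t psi = (d s (h psi) - d t (h psi)) + h (d s psi - d t psi).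
  by rewrite /y hB opprD addrACA.
have h1 := hCd s t _ _ hs ht (mulr_ge0 Ch0 K0) (hCh _ _ K0 hK).
have h2 := hCe s t _ _ hs ht K0 hK.
have d0 : 0 <= Ce * `|s - t| * K by apply: mulr_ge0 => //; exact: mulr_ge0.
have := bndHD h1 (hCi _ _ d0 h2).
by apply: bnd_le; rewrite le_eqVlt; apply/orP; left; apply/eqP; ring.
Qed.

Let delta_y t psi : d t (y t psi) = y t (d t psi).
Proof.
have dD a b : d t (a + b) = d t a + d t b by rewrite -[a]scale1r dL !scale1r.
by rewrite /y dD !d_d h_0 add0r addr0.
Qed.

(** With [h] the contraction at t = 0, the operator [y t] commutes with [d t] and is the identity at
    t = 0 in degrees at least [n], so for small t it is invertible in degrees [n] and [n.+1].
    Solving [y t] u = c in degree [n] makes u a cocycle for [d t], and then [h] u is the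
    primitive. *)
Lemma perturbed_primitive : exists e L (D_ : R -> W),
  [/\ 0 < e <= r, 0 <= L &
   forall t, `|t| <= e ->
   [/\ forall w m, size w = n -> val (d t (D_ t)) w m = val c w m,
       bnd (val (D_ t)) N L &
       forall s, `|s| <= e -> bnd (val (D_ s - D_ t)) N (L * `|s - t|)]].
Proof.
have [C1 C10 hC1] := y_close (leqnn N).
have [C2 C20 hC2] := y_close (leqnSn N).
have [Ch Ch0 hCh] := h_bnd (leqnn N).
have [Ci Ci0 hCi] := h_bnd (leqnSn N).
have S0 : 0 < C1 + C2 + 1 by rewrite ltr_wpDl ?addr_ge0.
(* For [|t| <= e] both Lipschitz constants times [|t|] are at most 1/2, so 1 - [y t] halves norms in
   degrees [n] and [n.+1]. *)
pose e := Num.min r (2 * (C1 + C2 + 1))^-1.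
have e0 : 0 < e.
  by rewrite lt_min r0 invr_gt0 mulr_gt0.
have er : e <= r by rewrite ge_min lexx.
have small t q : `|t| <= e -> 0 <= q -> q <= C1 + C2 + 1 -> q * `|t| <= 2^-1.
  move=> te q0 hq; apply: le_trans (_ : (C1 + C2 + 1) * (2 * (C1 + C2 + 1))^-1 <= _).
    by apply: ler_pM => //; apply: (le_trans te); rewrite ge_min lexx orbT.
  by rewrite invfM mulrCA divff ?mulr1 // gt_eqF.
have half t j Cj K psi : `|t| <= e -> (N <= j)%N -> 0 <= Cj -> Cj <= C1 + C2 + 1 ->
   (forall s t K psi, `|s| <= r -> `|t| <= r -> 0 <= K -> bnd (val psi) j.+1 K ->
     bnd (val (y s psi - y t psi)) j.+1 (Cj * `|s - t| * K)) ->
   0 <= K -> bnd (val psi) j.+1 K -> bnd (val (psi - y t psi)) j.+1 (K / 2).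
  move=> te Nj Cj0 hCj hC K0 hK.
  have := hC 0 t K psi zr (le_trans te er) K0 hK.
  rewrite sub0r normrN => hb.
  apply: (@bnd_ext _ _ (y 0 psi - y t psi)) => [w v wj|].
    by rewrite !HCB /y contraction // wj.
  by apply: bnd_le hb; rewrite [K / 2]mulrC ler_wpM2r // small.
have hC1' : C1 <= C1 + C2 + 1 by rewrite -addrA lerDl addr_ge0.
have hC2' : C2 <= C1 + C2 + 1 by rewrite [C1 + C2]addrC -addrA lerDl addr_ge0.
have half1 t K psi te := @half t N C1 K psi te (leqnn N) C10 hC1' hC1.
have half2 t K psi te := @half t n C2 K psi te (leqnSn N) C20 hC2' hC2.
have /choice[u hu] : forall t, exists u : W, `|t| <= e ->
    forall w v, size w = n -> val (y t u) w v = val c w v.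
  move=> t; have [te|] := boolP (`|t| <= e); last by exists 0.
  pose k := fun psi : W => psi - y t psi.
  have kl : linear k.
    by move=> a psi phi; rewrite /k y_linear scalerBr opprD addrACA.
  pose kL : {linear W -> W} :=
    HB.pack k (GRing.isLinear.Build C (W) (W) *:%R k kl).
  have [K psi K0 hK|u hu] := @neumann _ _ _ n kL c.
    exact: half1.
  have kE : kL u = u - y t u by [].
  exists u => _ w v wn; have := hu w v wn; rewrite kE HCB => E.
  by apply: (addrI (val u w v)); rewrite {1}E; ring.
have [_ _ /(_ n)[K1 /bnd_ge0[Ku Ku0 hKu]]] := HCP c.
have u_bnd t : `|t| <= e -> bnd (val (u t)) n (2 * Ku).
  move=> te; apply: bnd_absorb => // K K0 hK.
  have := bndHD (half1 t K (u t) te K0 hK) hKu.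
  apply: bnd_ext => w v wn; rewrite HCD HCB (hu t te) //; ring.
have u_close s t : `|s| <= e -> `|t| <= e ->
    bnd (val (u s - u t)) n (2 * (C1 * `|s - t| * (2 * Ku))).
  move=> se te; apply: bnd_absorb => [|K K0 hK].
    by rewrite !mulr_ge0.
  have h1 := half1 s K (u s - u t) se K0 hK.
  have h2 := hC1 t s (2 * Ku) (u t) (le_trans te er) (le_trans se er)
    (mulr_ge0 (ler0n _ _) Ku0) (u_bnd t te).
  rewrite distrC in h2; have := bndHD h1 h2; apply: bnd_ext => w v wn.
  rewrite yB.
  by rewrite [RHS]HCD !HCB (hu s se) // (hu t te) //; ring.
(* The primitive is [h (u t)], since [d t] of it is [y t (u t) - h (d t (u t))]; the first summand
   of the constant serves the bound, the second the Lipschitz estimate. *)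
exists e, (Ch * (2 * Ku) + Ch * (2 * (C1 * (2 * Ku)))), (fun t => h (u t)).
split; first by rewrite e0.
  by rewrite addr_ge0 ?mulr_ge0.
move=> t te.
(* [y t] sends [d t (u t)] to [d t c], which vanishes, and it is injective in degree [n.+1]. *)
have du0 w v : size w = n.+1 -> val (d t (u t)) w v = 0.
  apply: bnd_half_null => K K0 hK.
  have := half2 t K (d t (u t)) te K0 hK.
  apply: bnd_ext => w' v' w'n; rewrite HCB -delta_y.
  rewrite (@d_ext t (y t (u t)) c) ?c_cocycle ?subr0 //.
  by move=> w2 m2 w2n; rewrite hu.
split=> [w v wn||s se].
- have := hu t te w v wn; rewrite HCD => <-.
  suff -> : val (h (d t (u t))) w v = 0 by rewrite addr0.
  have z : bnd (val (d t (u t))) n.+1 0.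
    by move=> w' v' w'n; rewrite du0 // cn0 mul0r.
  have := hCi 0 _ (lexx 0) z w v wn; rewrite mulr0 mul0r => hb.
  by apply: cn0_eq0; apply/eqP; rewrite eq_le cn_ge0 hb.
- apply: bnd_le (hCh _ _ (mulr_ge0 (ler0n _ 2) Ku0) (u_bnd t te)).
  by rewrite lerDl !mulr_ge0.
have d0 : 0 <= 2 * (C1 * `|s - t| * (2 * Ku)).
  by apply: mulr_ge0 => //; apply: mulr_ge0; apply: mulr_ge0.
have := hCh _ _ d0 (u_close s t se te).
rewrite hB; apply: bnd_le; rewrite [leRHS]mulrDl -[leLHS]add0r lerD ?mulr_ge0 //.
by rewrite le_eqVlt; apply/orP; left; apply/eqP; ring.
Qed.

End Abstract.

Variables (A_ : R -> algebra X) (r kA c : R) (N : nat).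
Local Notation n := N.+1.
Local Notation V := (FL X (aplus X) n).
Hypotheses (r0 : 0 < r) (kA0 : 0 <= kA) (c0 : 0 <= c).
Hypothesis HA : forall t, `|t| <= r -> bmul (A_ t) kA.
Hypothesis HL : forall s t, `|s| <= r -> `|t| <= r ->
  bmul (fun a b => A_ s a b - A_ t a b) (c * `|s - t|).
Variable D0 : HC X V.
Local Notation U t := (univ_bimodule (A_ t) n).
Hypothesis hD0 : forall w v, size w = n ->
  val (delta (U 0) D0) w v = ev v w (unit_e X).

(** The space [V] and the cochain [univ] are the same for all t and only the actions vary, so
    [perturbed_primitive] applies on one fixed space. *)
Theorem universal_primitive : exists e L (D_ : R -> HC X V),
  [/\ 0 < e <= r, 0 <= L &
   forall t, `|t| <= e ->
   [/\ forall w v, size w = n -> val (delta (U t) (D_ t)) w v = ev v w (unit_e X),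
       bnd (val (D_ t)) N L &
       forall s, `|s| <= e -> bnd (val (D_ s - D_ t)) N (L * `|s - t|)]].
Proof.
have zr : `|0 : R| <= r by rewrite normr0 ltW.
have U_bound := univ_bound n kA0 (HA zr).
apply: (@perturbed_primitive V r N (fun t => delta (U t)) (hop D0 (U 0)) (univ X n)) => //.
- by move=> t a psi phi; exact: linearP.
- by move=> a psi phi; exact: linearP.
- by move=> t psi; exact: delta_delta.
- move=> t psi phi E w m wn; rewrite !deltaE /delta_fun wn.
  apply: eq_big_nat => j /andP[_ jn].
  by rewrite /fpsi E // size_face //= wn.
- move=> j Nj; have [_ _ /(_ N)[K1 /bnd_ge0[KD KD0 hKD]]] := HCP D0.
  have kU0 : 0 <= n.+1%:R * (kA + 1) by case: U_bound.
  eexists; last by move=> K psi K0 hK; exact: hop_bnd U_bound KD0 hKD Nj K0 hK.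
  have p0 : 0 <= KD * (n.+1%:R * (kA + 1) + 1) by apply: mulr_ge0 => //; exact: addr_ge0.
  by apply: mulr_ge0 => //; apply: addr_ge0 => //; apply: mulr_ge0 => //; exact: mulr_ge0.
- move=> j; exists (j.+2%:R * (n.+1%:R * c)).
    by apply: mulr_ge0 => //; exact: mulr_ge0.
  move=> s t K psi hs ht K0 hK.
  have cl : bimod_close (U s) (U t) (n.+1%:R * (c * `|s - t|)).
    by apply: univ_close; [exact: mulr_ge0|exact: HL].
  have := delta_close cl K0 hK.
  by apply: bnd_le; rewrite le_eqVlt; apply/orP; left; apply/eqP; ring.
- by move=> psi w m; exact: (@delta_hop _ _ (A_ 0) N D0 V (U 0) hD0 psi w m).
- by move=> t w m wn; exact: delta_univ.
Qed.

End Perturb.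

(** * The sewing lemma: transport as a limit of products over dyadic subdivisions *)

Section Sewing.
Variables (R : realType) (E : lmodType R[i]).
Local Notation C := R[i].
(** [bd K f] says that a seminorm of [f] is at most [K]. The seminorm used later sees only low
    degrees, so separation and completeness are required on the subspaces [T] alone. *)
Variable bd : R -> E -> Prop.
Hypothesis bd_ge0 : forall K f, bd K f -> 0 <= K.
Hypothesis bd_le : forall K L f, K <= L -> bd K f -> bd L f.
Hypothesis bdD : forall K L f g, bd K f -> bd L g -> bd (K + L) (f + g).
Hypothesis bdN : forall K f, bd K f -> bd K (- f).
Hypothesis bd_ex : forall f, exists K, bd K f.

Variables (T : bool -> R -> E -> Prop) (F : R -> R -> E -> E) (D : R -> E -> E).
Variables (r c cD q : R).
Hypotheses (r0 : 0 < r) (c0 : 0 <= c) (q1 : q < 1) (q0 : 13 / 16 <= q).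
Hypothesis T_lin : forall b s a f g, T b s f -> T b s g -> T b s (a *: f + g).
Hypothesis F_lin : forall s t a f g, F s t (a *: f + g) = a *: F s t f + F s t g.
Hypothesis D_lin : forall s a f g, D s (a *: f + g) = a *: D s f + D s g.
Hypothesis F_T : forall b s t f, `|s| <= r -> `|t| <= r -> T b s f -> T b t (F s t f).
Hypothesis D_T : forall b s f, `|s| <= r -> T b s f -> T (~~ b) s (D s f).
Hypothesis F_id : forall b s f, `|s| <= r -> T b s f -> F s s f = f.
Hypothesis F_bd : forall b s t f K, `|s| <= r -> `|t| <= r -> T b s f -> bd K f ->
  bd ((1 + c * `|s - t|) * K) (F s t f).
Hypothesis F_F : forall b s t u h f K, `|s| <= r -> `|t| <= r -> `|u| <= r ->
  `|s - t| <= h -> `|t - u| <= h -> T b s f -> bd K f ->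
  bd (c * h ^+ 2 * K) (F t u (F s t f) - F s u f).
Hypothesis F_D : forall b s t f K, `|s| <= r -> `|t| <= r -> T b s f -> bd K f ->
  bd (c * `|s - t| ^+ 2 * K) (D t (F s t f) - F s t (D s f)).
Hypothesis D_bd : forall s f K, `|s| <= r -> bd K f -> bd (cD * K) (D s f).
Hypothesis T_complete : forall b s (u : nat -> E) B, `|s| <= r -> (forall n, T b s (u n)) ->
  (forall n, bd (B * q ^+ n) (u n.+1 - u n)) ->
  exists l, T b s l /\ exists B', forall n, bd (B' * q ^+ n) (l - u n).
Hypothesis T_null : forall b s f B, T b s f -> (forall n, bd (B * q ^+ n) f) -> f = 0.

Let qp : 0 <= q. Proof. by apply: le_trans q0; rewrite divr_ge0. Qed.

Let telescope2 (x y z : E) : (x - y) + (y - z) = x - z.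
Proof. by rewrite addrA subrK. Qed.

Let qstep a X n : a <= q -> 0 <= X * q ^+ n -> a * (X * q ^+ n) <= X * q ^+ n.+1.
Proof. by move=> aq X0; rewrite exprSr mulrA [leRHS]mulrC; exact: ler_wpM2r. Qed.

(** The composite of [F] over 2^n equal steps from [s] to [t]. *)
Fixpoint U n s t f := if n is m.+1 then U m ((s + t) / 2) t (U m s ((s + t) / 2) f)
                      else F s t f.

Let T0 b s f : T b s f -> T b s 0.
Proof. by move=> h; have := T_lin (-1) h h; rewrite scaleN1r addNr. Qed.
Let TZ b s a f : T b s f -> T b s (a *: f).
Proof. by move=> h; have := T_lin a h (T0 h); rewrite addr0. Qed.
Let TD b s f g : T b s f -> T b s g -> T b s (f + g).
Proof. by move=> h1 h2; have := T_lin 1 h1 h2; rewrite scale1r. Qed.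
Let TB b s f g : T b s f -> T b s g -> T b s (f - g).
Proof. by move=> h1 h2; apply: TD => //; rewrite -scaleN1r; exact: TZ. Qed.

Let mid_r s t : `|s| <= r -> `|t| <= r -> `|(s + t) / 2| <= r.
Proof.
by rewrite !ler_norml => /andP[? ?] /andP[? ?]; apply/andP; split; lra.
Qed.
Let midl (s t : R) : s - (s + t) / 2 = (s - t) / 2. Proof. by field. Qed.
Let midr (s t : R) : (s + t) / 2 - t = (s - t) / 2. Proof. by field. Qed.
Let half_norm (x : R) : `|x / 2| = `|x| / 2.
Proof. by rewrite normrM normfV (@ger0_norm _ (2 : R)). Qed.

Lemma U_lin n s t a f g : U n s t (a *: f + g) = a *: U n s t f + U n s t g.
Proof. by elim: n s t f g => [|n IH] s t f g /=; [exact: F_lin|rewrite !IH]. Qed.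

Lemma U_sub n s t f g : U n s t (f - g) = U n s t f - U n s t g.
Proof. by rewrite addrC -scaleN1r U_lin scaleN1r addrC. Qed.

Let D_sub s f g : D s (f - g) = D s f - D s g.
Proof. by rewrite addrC -scaleN1r D_lin scaleN1r addrC. Qed.

Lemma U_T n b s t f : `|s| <= r -> `|t| <= r -> T b s f -> T b t (U n s t f).
Proof.
elim: n s t f => [|n IH] s t f sr tr hf /=; first exact: F_T hf.
have mr := mid_r sr tr; exact: (IH _ _ _ mr tr (IH _ _ _ sr mr hf)).
Qed.

(** A substitute for exp (c h): it dominates 1 + c h, and two half steps do not exceed a full one
    because (1 - x / 2)^2 >= 1 - x. This makes the bounds on [U n] independent of [n]. *)
Let G (h : R) := (1 - c * h)^-1.
Let G_bd h : 0 <= h -> c * h <= 3^-1 -> 1 + c * h <= G h.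
Proof.
move=> h0; have : 0 <= c * h by rewrite mulr_ge0.
rewrite /G; move: (c * h) => x x0 x3; rewrite -[leRHS]mul1r ler_pdivlMr; last by lra.
by rewrite mulrDl !mul1r mulrBr mulr1; have := mulr_ge0 x0 x0; lra.
Qed.
Let G_half h : 0 <= h -> c * h <= 3^-1 -> G (h / 2) * G (h / 2) <= G h.
Proof.
move=> h0; have : 0 <= c * h by rewrite mulr_ge0.
rewrite /G mulrA; move: (c * h) => x x0 x3.
have x2 := mulr_ge0 x0 x0; rewrite -invfM lef_pV2 ?posrE.
- rewrite [leRHS](_ : _ = 1 - x + x * x / 4); last by field.
  by lra.
- by lra.
by lra.
Qed.
Let G_le h : 0 <= h -> c * h <= 3^-1 -> 0 <= G h /\ G h <= 3 / 2.
Proof.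
move=> h0; have : 0 <= c * h by rewrite mulr_ge0.
rewrite /G; move: (c * h) => x x0 x3; split; first by rewrite invr_ge0; lra.
by rewrite -[leLHS]mul1r ler_pdivrMr; lra.
Qed.

Let half_ok (h : R) : 0 <= h -> c * h <= 3^-1 -> 0 <= h / 2 /\ c * (h / 2) <= 3^-1.
Proof.
move=> h0; have : 0 <= c * h by rewrite mulr_ge0.
by rewrite mulrA => x0 x3; split; lra.
Qed.

Lemma U_G n b s t f K : `|s| <= r -> `|t| <= r -> c * `|s - t| <= 3^-1 ->
  T b s f -> bd K f -> bd (G `|s - t| * K) (U n s t f).
Proof.
elim: n s t f K => [|n IH] s t f K sr tr hc hf hK.
  apply: bd_le (F_bd sr tr hf hK); rewrite ler_wpM2r ?(bd_ge0 hK) //.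
  exact: G_bd.
have [h0 h3] := half_ok (normr_ge0 _) hc.
have mr := mid_r sr tr.
have h1 := IH s ((s + t) / 2) f K sr mr; rewrite midl half_norm in h1.
have h2 := IH ((s + t) / 2) t _ _ mr tr; rewrite midr half_norm in h2.
apply: bd_le (h2 _ _ h3 (U_T n sr mr hf) (h1 h3 hf hK)).
by rewrite mulrA ler_wpM2r ?(bd_ge0 hK) //; exact: G_half.
Qed.

Lemma U_32 n b s t f K : `|s| <= r -> `|t| <= r -> c * `|s - t| <= 3^-1 ->
  T b s f -> bd K f -> bd (3 / 2 * K) (U n s t f).
Proof.
move=> sr tr hc hf hK; apply: bd_le (U_G n sr tr hc hf hK).
by rewrite ler_wpM2r ?(bd_ge0 hK) //; case: (G_le (normr_ge0 _) hc).
Qed.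

(** Halving the step replaces a quadratic error by two errors of a quarter of its size, each
    amplified once by 3/2: the ratio is 3/4, which is at most [q]. *)
Lemma U_step n b s t f K : `|s| <= r -> `|t| <= r -> c * `|s - t| <= 3^-1 ->
  T b s f -> bd K f -> bd (c * `|s - t| ^+ 2 * K * q ^+ n) (U n.+1 s t f - U n s t f).
Proof.
elim: n s t f K => [|n IH] s t f K sr tr hc hf hK.
  rewrite expr0 mulr1; apply: F_F hf hK => //; first exact: mid_r.
    by rewrite midl half_norm; have := normr_ge0 (s - t); lra.
  by rewrite midr half_norm; have := normr_ge0 (s - t); lra.
have [h0 h3] := half_ok (normr_ge0 _) hc; have mr := mid_r sr tr.
have K0 := bd_ge0 hK.
set m := (s + t) / 2 in mr *.
have sm : `|s - m| = `|s - t| / 2 by rewrite /m midl half_norm.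
have mt : `|m - t| = `|s - t| / 2 by rewrite /m midr half_norm.
have h1 := IH s m f K sr mr; rewrite sm in h1.
have {}h1 := h1 h3 hf hK.
have f1 : T b m (U n.+1 s m f) := U_T n.+1 sr mr hf.
have f2 : T b m (U n s m f) := U_T n sr mr hf.
have b1 := @U_32 n.+1 b s m f K sr mr; rewrite sm in b1; have {}b1 := b1 h3 hf hK.
have h2 := IH m t _ _ mr tr; rewrite mt in h2; have {}h2 := h2 _ _ h3 f1 b1.
have b2 := @U_32 n b m t _ _ mr tr; rewrite mt in b2; have {}b2 := b2 _ _ h3 (TB f1 f2) h1.
have -> : U n.+2 s t f - U n.+1 s t f =
    (U n.+1 m t (U n.+1 s m f) - U n m t (U n.+1 s m f))
    + U n m t (U n.+1 s m f - U n s m f).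
  by rewrite U_sub addrA subrK.
apply: bd_le (bdD h2 b2).
have X0 : 0 <= c * `|s - t| ^+ 2 * K * q ^+ n.
  by rewrite mulr_ge0 ?exprn_ge0 // mulr_ge0 // mulr_ge0 // exprn_ge0.
rewrite [leLHS](_ : _ = 3 / 4 * (c * `|s - t| ^+ 2 * K * q ^+ n)); last by field.
by apply: qstep => //; apply: le_trans q0; lra.
Qed.

Lemma U_D n b s t f K : `|s| <= r -> `|t| <= r -> c * `|s - t| <= 3^-1 ->
  T b s f -> bd K f -> bd (c * `|s - t| ^+ 2 * K * q ^+ n) (D t (U n s t f) - U n s t (D s f)).
Proof.
elim: n s t f K => [|n IH] s t f K sr tr hc hf hK.
  by rewrite expr0 mulr1; apply: F_D hf hK.
have [h0 h3] := half_ok (normr_ge0 _) hc; have mr := mid_r sr tr.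
have K0 := bd_ge0 hK; rewrite /=.
set m := (s + t) / 2 in mr *.
have sm : `|s - m| = `|s - t| / 2 by rewrite /m midl half_norm.
have mt : `|m - t| = `|s - t| / 2 by rewrite /m midr half_norm.
have h1 := IH s m f K sr mr; rewrite sm in h1; have {}h1 := h1 h3 hf hK.
have f2 : T b m (U n s m f) := U_T n sr mr hf.
have b1 := @U_32 n b s m f K sr mr; rewrite sm in b1; have {}b1 := b1 h3 hf hK.
have h2 := IH m t _ _ mr tr; rewrite mt in h2; have {}h2 := h2 _ _ h3 f2 b1.
have b2 := @U_32 n (~~ b) m t _ _ mr tr; rewrite mt in b2.
have {}b2 := b2 _ _ h3 (TB (D_T mr f2) (U_T n sr mr (D_T sr hf))) h1.
have -> : D t (U n m t (U n s m f)) - U n m t (U n s m (D s f)) =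
    (D t (U n m t (U n s m f)) - U n m t (D m (U n s m f)))
    + U n m t (D m (U n s m f) - U n s m (D s f)).
  by rewrite U_sub addrA subrK.
apply: bd_le (bdD h2 b2).
have X0 : 0 <= c * `|s - t| ^+ 2 * K * q ^+ n.
  by rewrite mulr_ge0 ?exprn_ge0 // mulr_ge0 // mulr_ge0 // exprn_ge0.
rewrite [leLHS](_ : _ = 3 / 4 * (c * `|s - t| ^+ 2 * K * q ^+ n)); last by field.
by apply: qstep => //; apply: le_trans q0; lra.
Qed.

(** Of the two errors of a quarter, one sits inside the outer half steps and is amplified twice by
    3/2. This gives 9/16 + 4/16 = 13/16, whence the lower bound on [q]. *)
Lemma U_inv n b s t f K : `|s| <= r -> `|t| <= r -> c * `|s - t| <= 3^-1 ->
  T b s f -> bd K f -> bd (c * `|s - t| ^+ 2 * K * q ^+ n) (U n t s (U n s t f) - f).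
Proof.
elim: n s t f K => [|n IH] s t f K sr tr hc hf hK.
  rewrite expr0 mulr1 -{2}(F_id sr hf); apply: F_F hf hK => //.
  by rewrite distrC.
have [h0 h3] := half_ok (normr_ge0 _) hc; have mr := mid_r sr tr.
have K0 := bd_ge0 hK; rewrite /= [t + s]addrC.
set m := (s + t) / 2 in mr *.
have sm : `|s - m| = `|s - t| / 2 by rewrite /m midl half_norm.
have mt : `|m - t| = `|s - t| / 2 by rewrite /m midr half_norm.
have h1 := IH s m f K sr mr; rewrite sm in h1; have {}h1 := h1 h3 hf hK.
have f2 : T b m (U n s m f) := U_T n sr mr hf.
have b1 := @U_32 n b s m f K sr mr; rewrite sm in b1; have {}b1 := b1 h3 hf hK.
have h2 := IH m t _ _ mr tr; rewrite mt in h2; have {}h2 := h2 _ _ h3 f2 b1.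
have b2 := @U_32 n b m s _ _ mr sr; rewrite distrC sm in b2.
have {}b2 := b2 _ _ h3 (TB (U_T n tr mr (U_T n mr tr f2)) f2) h2.
have -> : U n m s (U n t m (U n m t (U n s m f))) - f =
    U n m s (U n t m (U n m t (U n s m f)) - U n s m f) + (U n m s (U n s m f) - f).
  by rewrite U_sub addrA subrK.
apply: bd_le (bdD b2 h1).
have X0 : 0 <= c * `|s - t| ^+ 2 * K * q ^+ n.
  by rewrite mulr_ge0 ?exprn_ge0 // mulr_ge0 // mulr_ge0 // exprn_ge0.
rewrite [leLHS](_ : _ = 13 / 16 * (c * `|s - t| ^+ 2 * K * q ^+ n)); last by field.
exact: qstep.
Qed.

Let small (u : nat -> E) := exists B, forall n, bd (B * q ^+ n) (u n).

Let smallD u v : small u -> small v -> small (fun n => u n + v n).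
Proof.
by move=> [B hB] [B' hB']; exists (B + B') => n; rewrite mulrDl; exact: bdD.
Qed.
Let smallN u : small u -> small (fun n => - u n).
Proof. by move=> [B hB]; exists B => n; exact: bdN. Qed.
Let small_null b s f : T b s f -> small (fun=> f) -> f = 0.
Proof. by move=> hf [B hB]; exact: T_null hf hB. Qed.
Let small_ext u v : (forall n, u n = v n) -> small u -> small v.
Proof. by move=> uv [B hB]; exists B => n; rewrite -uv. Qed.

Let small_D s u : `|s| <= r -> small u -> small (fun n => D s (u n)).
Proof.
by move=> sr [B hB]; exists (cD * B) => n; rewrite -mulrA; exact: D_bd.
Qed.

Let small_U b s t u : `|s| <= r -> `|t| <= r -> c * `|s - t| <= 3^-1 ->
  (forall n, T b s (u n)) -> small u -> small (fun n => U n s t (u n)).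
Proof.
move=> sr tr hc hu [B hB]; exists (3 / 2 * B) => n; rewrite -(mulrA (3 / 2)).
exact: (U_32 n sr tr hc (hu n) (hB n)).
Qed.

Let lim_ex s t : `|s| <= r -> `|t| <= r -> c * `|s - t| <= 3^-1 ->
  forall p : bool * E, exists l, T p.1 s p.2 ->
    T p.1 t l /\ small (fun n => l - U n s t p.2).
Proof.
move=> sr tr hc [b f]; have [hf|nf] := pselect (T b s f); last by exists 0.
have [K hK] := bd_ex f.
have [l [h1 h2]] := @T_complete b t (fun n => U n s t f) (c * `|s - t| ^+ 2 * K) tr
  (fun n => U_T n sr tr hf) (fun n => U_step n sr tr hc hf hK).
by exists l.
Qed.

Hypothesis bdZu : forall a, exists cZ, forall f K, bd K f -> bd (cZ * K) (a *: f).

(** The isomorphisms are the limits of [U n] from 0 to t and from t to 0. By [U_inv] they are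
    inverse to each other and by [U_D] they commute with [D]: each identity holds up to a
    geometrically small error, hence exactly by [T_null]. *)
Theorem sewing : exists e, 0 < e <= r /\ forall t, `|t| <= e ->
  exists Phi Psi : bool -> E -> E, forall b,
  [/\ forall f, T b 0 f -> T b t (Phi b f) /\ Psi b (Phi b f) = f,
      forall g, T b t g -> T b 0 (Psi b g) /\ Phi b (Psi b g) = g,
      forall a f g, T b 0 f -> T b 0 g -> Phi b (a *: f + g) = a *: Phi b f + Phi b g &
      forall f, T b 0 f -> D t (Phi b f) = Phi (~~ b) (D 0 f)].
Proof.
(* This gives [c * |t| <= 1/3], the range in which [G] is at most 3/2. *)
pose e := Num.min r (3 * (c + 1))^-1.
have c1 : 0 < c + 1 by rewrite ltr_wpDl.
have e0 : 0 < e by rewrite lt_min r0 invr_gt0 mulr_gt0.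
have er : e <= r by rewrite ge_min lexx.
exists e; split; first by rewrite e0.
move=> t te; have tr := le_trans te er.
have zr : `|0 : R| <= r by rewrite normr0 ltW.
have hc : c * `|0 - t| <= 3^-1.
  rewrite sub0r normrN; apply: le_trans (_ : (c + 1) * (3 * (c + 1))^-1 <= _).
    apply: ler_pM => //; first by rewrite lerDl.
    by apply: (le_trans te); rewrite ge_min lexx orbT.
  by rewrite invfM mulrCA divff ?mulr1 // gt_eqF.
have hc' : c * `|t - 0| <= 3^-1 by rewrite distrC.
have /choice[phi hphi] := lim_ex zr tr hc.
have /choice[psi hpsi] := lim_ex tr zr hc'.
exists (fun b f => phi (b, f)), (fun b f => psi (b, f)) => b.
have inv s s' (p p' : bool * E -> E) : `|s| <= r -> `|s'| <= r ->
    c * `|s - s'| <= 3^-1 ->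
    (forall x, T x.1 s x.2 -> T x.1 s' (p x) /\ small (fun n => p x - U n s s' x.2)) ->
    (forall x, T x.1 s' x.2 -> T x.1 s (p' x) /\ small (fun n => p' x - U n s' s x.2)) ->
    forall f, T b s f -> T b s' (p (b, f)) /\ p' (b, p (b, f)) = f.
  move=> sr sr' hss hp hp' f hf; have [h1 h2] := hp (b, f) hf.
  have [h3 h4] := hp' (b, p (b, f)) h1; split=> //.
  apply/eqP; rewrite -subr_eq0; apply/eqP; apply: (small_null (TB h3 hf)).
  have [K hK] := bd_ex f.
  have hss' : c * `|s' - s| <= 3^-1 by rewrite distrC.
  have h5 : small (fun n => U n s' s (U n s s' f) - f).
    by exists (c * `|s - s'| ^+ 2 * K) => n; exact: U_inv hf hK.
  have h6 := small_U sr' sr hss' (fun n => TB h1 (U_T n sr sr' hf)) h2.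
  apply: small_ext (smallD (smallD h4 h6) h5) => n /=.
  by rewrite U_sub !telescope2.
split.
- by move=> f hf; exact: (inv 0 t phi psi).
- by move=> f hf; exact: (inv t 0 psi phi).
- move=> a f g hf hg.
  have [f1 f2] := hphi (b, f) hf; have [g1 g2] := hphi (b, g) hg.
  have [h1 h2] := hphi (b, a *: f + g) (T_lin a hf hg).
  apply/eqP; rewrite -subr_eq0; apply/eqP; apply: (small_null (TB h1 (T_lin a f1 g1))).
  have [cZ hZ] := bdZu a.
  have f3 : small (fun n => a *: (phi (b, f) - U n 0 t f)).
    by case: f2 => B hB; exists (cZ * B) => n; rewrite -mulrA; exact: hZ.
  apply: small_ext (smallD h2 (smallN (smallD f3 g2))) => n /=.
  by rewrite U_lin scalerBr (addrACA (a *: _)) -opprD opprB telescope2.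
move=> f hf; have [h1 h2] := hphi (b, f) hf.
have [h3 h4] := hphi (~~ b, D 0 f) (D_T zr hf).
apply/eqP; rewrite -subr_eq0; apply/eqP; apply: (small_null (TB (D_T tr h1) h3)).
have [K hK] := bd_ex f.
have h5 : small (fun n => D t (U n 0 t f) - U n 0 t (D 0 f)).
  by exists (c * `|0 - t| ^+ 2 * K) => n; exact: U_D hf hK.
apply: small_ext (smallD (smallD (small_D tr h2) h5) (smallN h4)) => n /=.
by rewrite D_sub opprB !telescope2.
Qed.

End Sewing.

(** * Lipschitz families of bounded operators *)

Section LipschitzFamilies.
Variables (R : realType) (E : lmodType R[i]).
Variable bd : R -> E -> Prop.
Hypothesis bd_ge0 : forall K f, bd K f -> 0 <= K.
Hypothesis bd_le : forall K L f, K <= L -> bd K f -> bd L f.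
Hypothesis bdD : forall K L f g, bd K f -> bd L g -> bd (K + L) (f + g).
Hypothesis bdN : forall K f, bd K f -> bd K (- f).
Hypothesis bd0 : bd 0 0.
Variable r : R.

Definition opb c (X : E -> E) := forall K f, bd K f -> bd (c * K) (X f).

Definition lip_family (X : R -> E -> E) := exists2 c, 0 <= c &
  forall s t, `|s| <= r -> `|t| <= r ->
    opb c (X t) /\ opb (c * `|s - t|) (fun f => X s f - X t f).

Lemma opb_le c c' X : c <= c' -> opb c X -> opb c' X.
Proof.
by move=> cc hX K f hf; apply: bd_le (hX K f hf); rewrite ler_wpM2r ?(bd_ge0 hf).
Qed.

Lemma opb_comp c c' X Y : opb c X -> opb c' Y -> opb (c * c') (X \o Y).
Proof. by move=> hX hY K f hf; rewrite -mulrA; apply: hX; exact: hY. Qed.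

Lemma opbD c c' X Y : opb c X -> opb c' Y -> opb (c + c') (fun f => X f + Y f).
Proof. by move=> hX hY K f hf; rewrite mulrDl; apply: bdD; [exact: hX|exact: hY]. Qed.

Lemma opbN c X : opb c X -> opb c (fun f => - X f).
Proof. by move=> hX K f hf; apply: bdN; exact: hX. Qed.

Lemma opb_ext c X Y : (forall f, X f = Y f) -> opb c X -> opb c Y.
Proof. by move=> h hX K f hf; rewrite -h; exact: hX. Qed.

Lemma lip_family_const c X : 0 <= c -> opb c X -> lip_family (fun=> X).
Proof.
move=> c0 hX; exists c => // s t sr tr; split=> // K f hf; rewrite subrr.
by apply: bd_le bd0; rewrite !mulr_ge0 ?(bd_ge0 hf).
Qed.

Lemma lip_family_id : lip_family (fun=> id).
Proof. by apply: (@lip_family_const 1) => // K f; rewrite mul1r. Qed.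

Lemma lip_familyD X Y : lip_family X -> lip_family Y -> lip_family (fun t f => X t f + Y t f).
Proof.
move=> [c c0 hX] [c' c'0 hY]; exists (c + c'); first exact: addr_ge0.
move=> s t sr tr; have [x1 x2] := hX s t sr tr; have [y1 y2] := hY s t sr tr.
split; first exact: opbD.
rewrite mulrDl; apply: opb_ext (opbD x2 y2) => f.
by rewrite opprD addrACA.
Qed.

Lemma lip_familyN X : lip_family X -> lip_family (fun t f => - X t f).
Proof.
move=> [c c0 hX]; exists c => // s t sr tr; have [x1 x2] := hX s t sr tr.
split; first exact: opbN.
by apply: opb_ext (opbN x2) => f; rewrite opprD.
Qed.

Lemma lip_familyB X Y : lip_family X -> lip_family Y -> lip_family (fun t f => X t f - Y t f).
Proof. by move=> hX hY; apply: lip_familyD => //; exact: lip_familyN. Qed.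

Lemma lip_family_comp X Y : (forall t f g, X t (f - g) = X t f - X t g) ->
  lip_family X -> lip_family Y -> lip_family (fun t => X t \o Y t).
Proof.
move=> Xl [c c0 hX] [c' c'0 hY]; exists (2 * (c * c')); first by rewrite !mulr_ge0.
have cc0 : 0 <= c * c' by exact: mulr_ge0.
move=> s t sr tr; have [x1 x2] := hX s t sr tr; have [y1 y2] := hY s t sr tr.
have [y3 _] := hY t s tr sr.
split; first by apply: opb_le (opb_comp x1 y1); move: (c * c') cc0 => x x0; lra.
have := opbD (opb_comp x2 y3) (opb_comp x1 y2).
have -> : c * `|s - t| * c' + c * (c' * `|s - t|) = 2 * (c * c') * `|s - t| by ring.
by apply: opb_ext => f /=; rewrite Xl addrA subrK.
Qed.

End LipschitzFamilies.

(** * Transport between truncated complexes, in abstract form *)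

Section Truncation.
Variables (R : realType) (E : lmodType R[i]).
Local Notation C := R[i].
Variable bd : R -> E -> Prop.
Hypothesis bd_ge0 : forall K f, bd K f -> 0 <= K.
Hypothesis bd_le : forall K L f, K <= L -> bd K f -> bd L f.
Hypothesis bdD : forall K L f g, bd K f -> bd L g -> bd (K + L) (f + g).
Hypothesis bdN : forall K f, bd K f -> bd K (- f).
Hypothesis bd0 : bd 0 0.
Hypothesis bdZ : forall a, exists cZ, forall f K, bd K f -> bd (cZ * K) (a *: f).
Hypothesis bd_ex : forall f, exists K, bd K f.
Variables (r q : R) (L : nat).
Hypotheses (r0 : 0 < r) (q1 : q < 1) (q0 : 13 / 16 <= q).
Variables (be ga : R -> E -> E) (Bc : E -> E) (H : R -> R -> E -> E).
Variables (dg : nat -> E -> Prop) (par : bool -> E -> Prop).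
Let lin (X : E -> E) := forall a f g, X (a *: f + g) = a *: X f + X g.
Let closed (P : E -> Prop) := forall a f g, P f -> P g -> P (a *: f + g).
Let D t f := be t f + Bc f.
Hypotheses (be_lin : forall t, lin (be t)) (ga_lin : forall t, lin (ga t)) (Bc_lin : lin Bc)
  (H_lin : forall s t, lin (H s t)) (dg_lin : forall m, closed (dg m))
  (par_lin : forall b, closed (par b)).
Hypothesis dg_le : forall m k f, (m <= k)%N -> dg m f -> dg k f.
Hypotheses (be_dg : forall t m f, dg m f -> dg m.+1 (be t f))
  (Bc_dg : forall m f, dg m f -> dg m.-1 (Bc f))
  (ga_dg : forall t m f, dg m f -> dg m.-1 (ga t f))
  (H_dg : forall s t m f, dg m f -> dg m.+2 (H s t f)).
Hypotheses (be_par : forall t b f, par b f -> par (~~ b) (be t f))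
  (Bc_par : forall b f, par b f -> par (~~ b) (Bc f))
  (ga_par : forall t b f, par b f -> par (~~ b) (ga t f))
  (H_par : forall s t b f, par b f -> par b (H s t f)).
Hypothesis ga_low : forall t f, dg L f -> ga t f = 0.
Hypothesis DD : forall t f, `|t| <= r -> D t (D t f) = 0.
Let h t f := ga t (f - ga t (be t f)).
Hypothesis homotopy : forall t m f, `|t| <= r -> (m <= L.+3)%N -> dg m f ->
  dg L (f - (be t (h t f) + h t (be t f))).
Hypotheses (be_lip : lip_family bd r be) (ga_lip : lip_family bd r ga)
  (Bc_lip : lip_family bd r (fun=> Bc)).
Variable cH : R.
Hypothesis cH0 : 0 <= cH.
Hypothesis H_bd : forall s t, `|s| <= r -> `|t| <= r -> opb bd (cH * `|s - t|) (H s t).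
Hypothesis H_id : forall s f, H s s f = 0.
Hypothesis H_H : forall s t u, `|s| <= r -> `|t| <= r -> `|u| <= r ->
  opb bd (cH * `|s - t| * `|t - u|) (fun f => H t u f + H s t f - H s u f).
Hypothesis H_D : forall s t, `|s| <= r -> `|t| <= r ->
  opb bd (cH * `|s - t| ^+ 2)
    (fun f => D t (f + H s t f) - (D s f + H s t (D s f))).
(** The condition on [D s f] makes the truncation a complex; it depends on [s], so the spaces to be
    identified move with the parameter. *)
Let T b s f := [/\ par b f, dg L f & dg L (D s f)].
Hypothesis T_complete : forall b s (u : nat -> E) B, `|s| <= r -> (forall n, T b s (u n)) ->
  (forall n, bd (B * q ^+ n) (u n.+1 - u n)) ->
  exists l, T b s l /\ exists B', forall n, bd (B' * q ^+ n) (l - u n).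
Hypothesis T_null : forall b s f B, T b s f -> (forall n, bd (B * q ^+ n) f) -> f = 0.

Let lin0 X : lin X -> X 0 = 0.
Proof. by move=> l; have := l (-1) 0 0; rewrite scaler0 addr0 scaleN1r addNr. Qed.
Let linB X : lin X -> forall f g, X (f - g) = X f - X g.
Proof. by move=> l f g; rewrite addrC -scaleN1r l scaleN1r addrC. Qed.
Let linD X : lin X -> forall f g, X (f + g) = X f + X g.
Proof. by move=> l f g; have := l 1 f g; rewrite !scale1r. Qed.
Let linZ X : lin X -> forall a f, X (a *: f) = a *: X f.
Proof. by move=> l a f; have := l a f 0; rewrite !addr0 (lin0 l) addr0. Qed.
Let lin_comp X Y : lin X -> lin Y -> lin (X \o Y).
Proof. by move=> lX lY a f g /=; rewrite lY lX. Qed.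
Let lin_add X Y : lin X -> lin Y -> lin (fun f => X f + Y f).
Proof. by move=> lX lY a f g; rewrite lX lY scalerDr addrACA. Qed.
Let lin_opp X : lin X -> lin (fun f => - X f).
Proof. by move=> lX a f g; rewrite lX opprD scalerN. Qed.
Let lin_sub X Y : lin X -> lin Y -> lin (fun f => X f - Y f).
Proof. by move=> lX lY; apply: lin_add => //; exact: lin_opp. Qed.
Let lin_id : lin id. Proof. by []. Qed.

Let cl0 (P : E -> Prop) f : closed P -> P f -> P 0.
Proof. by move=> c p; have := c (-1) _ _ p p; rewrite scaleN1r addNr. Qed.
Let clD (P : E -> Prop) f g : closed P -> P f -> P g -> P (f + g).
Proof. by move=> c p p'; have := c 1 _ _ p p'; rewrite scale1r. Qed.
Let clB (P : E -> Prop) f g : closed P -> P f -> P g -> P (f - g).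
Proof. by move=> c p p'; have := c (-1) _ _ p' p; rewrite scaleN1r addrC. Qed.

Let D_lin t : lin (D t). Proof. exact: lin_add. Qed.
Let h_lin t : lin (h t).
Proof.
apply: (lin_comp (ga_lin t)); apply: (lin_sub lin_id).
exact: (lin_comp (ga_lin t) (be_lin t)).
Qed.
Let D_lip : lip_family bd r D. Proof. exact: (lip_familyD bdD be_lip Bc_lip). Qed.
Let lip_comp X Y : (forall t, lin (X t)) -> lip_family bd r X -> lip_family bd r Y ->
  lip_family bd r (fun t f => X t (Y t f)).
Proof.
move=> lX hX hY; apply: (lip_family_comp bd_ge0 bd_le bdD _ hX hY) => t.
exact: linB.
Qed.
Let lip_sub := lip_familyB bdD bdN.
Let lip_add := lip_familyD bdD.
Let lip_id := lip_family_id bd_ge0 bd_le bd0.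
Let h_lip : lip_family bd r h.
Proof.
apply: (lip_comp ga_lin ga_lip); apply: (lip_sub (lip_id r)).
exact: (lip_comp ga_lin ga_lip be_lip).
Qed.

(** [P t] is a chain map homotopic to the identity. By [homotopy] the part of it that leaves degree
    [L] is the commutator of [Bc] with [h], which lowers the degree by two. Two applications
    therefore bring degree [L.+3] down to [L], and [p] is the square of [P]. *)
Let P t f := f - (D t (h t f) + h t (D t f)).
Let p t f := P t (P t f).
Let P_lin t : lin (P t).
Proof.
apply: (lin_sub lin_id); apply: lin_add.
  exact: (lin_comp (D_lin t) (h_lin t)).
exact: (lin_comp (h_lin t) (D_lin t)).
Qed.
Let p_lin t : lin (p t). Proof. exact: (lin_comp (P_lin t) (P_lin t)). Qed.
Let P_lip : lip_family bd r P.
Proof.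
apply: (lip_sub (lip_id r)); apply: lip_add.
  exact: (lip_comp D_lin D_lip h_lip).
exact: (lip_comp h_lin h_lip D_lip).
Qed.
Let p_lip : lip_family bd r p.
Proof. exact: (lip_comp P_lin P_lip P_lip). Qed.

Let D_par t b f : par b f -> par (~~ b) (D t f).
Proof. by move=> hf; apply: (clD (@par_lin _)); [exact: be_par|exact: Bc_par]. Qed.
Let h_par t b f : par b f -> par (~~ b) (h t f).
Proof.
move=> hf; apply: ga_par; apply: (clB (@par_lin b) hf); rewrite -[b]negbK.
by apply: ga_par; exact: be_par.
Qed.
Let P_par t b f : par b f -> par b (P t f).
Proof.
move=> hf; apply: (clB (@par_lin b) hf); apply: (clD (@par_lin b)); rewrite -[b]negbK.
  by apply: D_par; exact: h_par.
by apply: h_par; exact: D_par.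
Qed.
Let p_par t b f : par b f -> par b (p t f).
Proof. by move=> hf; do 2!apply: P_par. Qed.

Let h_dg t m f : dg m f -> dg m.-1 (h t f).
Proof.
move=> hf; apply: ga_dg; apply: (clB (@dg_lin m) hf).
exact: (ga_dg t (be_dg t hf)).
Qed.

Let P_dg t m f : `|t| <= r -> (m <= L.+3)%N -> dg m f -> dg (maxn L m.-2) (P t f).
Proof.
move=> tr mL hf.
have -> : P t f = (f - (be t (h t f) + h t (be t f))) - (Bc (h t f) + h t (Bc f)).
  by rewrite /P /D (linD (@h_lin t)) addrACA opprD addrA.
apply: (clB (@dg_lin _)); first by apply: dg_le (homotopy tr mL hf); exact: leq_maxl.
apply: (@dg_le m.-2); first exact: leq_maxr.
apply: (clD (@dg_lin _)); [exact/Bc_dg/h_dg|exact/h_dg/Bc_dg].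
Qed.

Let p_dg t f : `|t| <= r -> dg L.+3 f -> dg L (p t f).
Proof.
move=> tr hf; have h1 := P_dg tr (leqnn _) hf.
have h2 : (maxn L L.+3.-2 <= L.+3)%N by lia.
by apply: dg_le (P_dg tr h2 h1); lia.
Qed.

Let PD t f : `|t| <= r -> D t (P t f) = P t (D t f).
Proof.
move=> tr; rewrite /P (linB (@D_lin t)) (linD (@D_lin t)) !DD // add0r.
by rewrite (lin0 (@h_lin t)) addr0.
Qed.
Let pD t f : `|t| <= r -> D t (p t f) = p t (D t f).
Proof. by move=> tr; rewrite /p !PD. Qed.

Let h_low t f : dg L f -> h t f = 0.
Proof.
move=> hf; apply: ga_low; apply: (clB (@dg_lin L) hf).
exact: (ga_dg t (be_dg t hf)).
Qed.
(** On [T] both f and D f have degree at most [L], where [h] vanishes, so the correction terms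
    disappear. *)
Let P_id b t f : T b t f -> P t f = f.
Proof.
by case=> _ h1 h2; rewrite /P (h_low _ h1) (h_low _ h2) (lin0 (@D_lin t)) addr0 subr0.
Qed.
Let p_id b t f : T b t f -> p t f = f.
Proof. by move=> hf; rewrite /p !(P_id hf). Qed.

Let D_dg t m f : dg m f -> dg m.+1 (D t f).
Proof.
move=> hf; apply: (clD (@dg_lin _)); first exact: be_dg.
by apply: dg_le (Bc_dg hf); rewrite (leq_trans (leq_pred _)).
Qed.

(** The degree [L.+2] is what 1 + [H] can reach from degree [L]; one more is allowed for [D], which
    is why [p] must reach down from [L.+3]. *)
Let p_T b t f : `|t| <= r -> par b f -> dg L.+2 f -> T b t (p t f).
Proof.
move=> tr hb hf; split; first exact: p_par.
  by apply: p_dg => //; exact: dg_le hf.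
by rewrite pD //; apply: p_dg => //; exact: D_dg.
Qed.

Let I s t f := f + H s t f.
Let I_lin s t : lin (I s t). Proof. exact: lin_add. Qed.
Let F s t f := p t (I s t f).

Let I_ok b s t f : T b s f -> par b (I s t f) /\ dg L.+2 (I s t f).
Proof.
case=> h1 h2 _; split; first exact: (clD (@par_lin b) h1 (H_par s t h1)).
apply: (clD (@dg_lin _)); last exact: H_dg.
by apply: dg_le h2; rewrite !leqW.
Qed.

Let F_T b s t f : `|s| <= r -> `|t| <= r -> T b s f -> T b t (F s t f).
Proof. by move=> sr tr /(I_ok t)[h1 h2]; exact: p_T. Qed.

Let T_D b s f : `|s| <= r -> T b s f -> T (~~ b) s (D s f).
Proof.
move=> sr [h1 h2 h3]; split => //; first exact: D_par.
by rewrite DD //; exact: cl0 h2.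
Qed.

Let T_lin b s : closed (T b s).
Proof.
move=> a f g [f1 f2 f3] [g1 g2 g3]; split; first exact: par_lin.
  exact: dg_lin.
by rewrite (@D_lin s); exact: dg_lin.
Qed.

Let F_lin s t : lin (F s t). Proof. exact: (lin_comp (@p_lin t) (@I_lin s t)). Qed.

(* [p_t - 1] is small on the image of [I s t] because [p_s] is the identity on [T b s]. *)
Let defect cp : 0 <= cp -> (forall s t, `|s| <= r -> `|t| <= r ->
    opb bd cp (p t) /\ opb bd (cp * `|s - t|) (fun f => p s f - p t f)) ->
  forall b s t f K, `|s| <= r -> `|t| <= r -> T b s f -> bd K f ->
    bd ((cp + cp * cH + cH) * `|s - t| * K) (F s t f - I s t f).
Proof.
move=> cp0 hp b s t f K sr tr hf hK.
have [p1 p2] := hp s t sr tr.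
have h1 := bdN (p2 K f hK); have h2 := H_bd sr tr hK.
have h3 := p1 _ _ h2; have := bdD (bdD h1 h3) (bdN h2).
have -> : F s t f - I s t f = - (p s f - p t f) + p t (H s t f) - H s t f.
  by rewrite (p_id hf) opprB /F /I (linD (@p_lin t)) opprD addrACA addrA.
by apply: bd_le; rewrite le_eqVlt; apply/orP; left; apply/eqP; ring.
Qed.

Theorem truncated_isomorphisms : exists e, 0 < e <= r /\ forall t, `|t| <= e ->
  exists Phi Psi : bool -> E -> E, forall b,
  [/\ forall f, T b 0 f -> T b t (Phi b f) /\ Psi b (Phi b f) = f,
      forall g, T b t g -> T b 0 (Psi b g) /\ Phi b (Psi b g) = g,
      forall a f g, T b 0 f -> T b 0 g -> Phi b (a *: f + g) = a *: Phi b f + Phi b g &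
      forall f, T b 0 f -> D t (Phi b f) = Phi (~~ b) (D 0 f)].
Proof.
have [cD cD0 hD] := D_lip; have [cp cp0 hp] := p_lip.
have hdef := defect cp0 hp; move: (cp + cp * cH + cH) (addr_ge0 (addr_ge0 cp0
  (mulr_ge0 cp0 cH0)) cH0) hdef => cy cy0 hdef.
pose c1 := cH + cy; pose c2 := cp * (cH + cH * cH) + (cp * cH * cy + cp * cy).
pose c3 := cp * cH.
have c10 : 0 <= c1 by exact: addr_ge0.
have c20 : 0 <= c2 by rewrite !(addr_ge0, mulr_ge0) //.
have c30 : 0 <= c3 by exact: mulr_ge0.
apply: (@sewing R E bd bd_ge0 bd_le bdD bdN bd_ex T F D r (c1 + c2 + c3) cD q) => //.
- exact: addr_ge0 (addr_ge0 c10 c20) c30.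
- by move=> b s f sr hf; rewrite /F /I H_id addr0 (p_id hf).
- move=> b s t f K sr tr hf hK.
  have := bdD (bdD hK (H_bd sr tr hK)) (hdef b s t f K sr tr hf hK).
  have -> : f + H s t f + (F s t f - I s t f) = F s t f by rewrite addrC subrK.
  apply: bd_le.
  rewrite [leLHS](_ : _ = (1 + c1 * `|s - t|) * K); last by rewrite /c1; ring.
  rewrite ler_wpM2r ?(bd_ge0 hK) // lerD2l ler_wpM2r // -addrA lerDl.
  exact: addr_ge0.
- move=> b s t u h' f K sr tr ur h1 h2 hf hK.
  set y := F s t f - I s t f.
  have hy : bd (cy * `|s - t| * K) y := hdef b s t f K sr tr hf hK.
  (* [y] is the part removed by [p t]. As [p t y = 0], the term [p u y] equals [p u y - p t y] and
     gains a second small factor. *)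
  have py : p t y = 0.
    by rewrite (linB (@p_lin t)) (p_id (F_T sr tr hf)) subrr.
  have -> : F t u (F s t f) - F s u f =
      p u ((H t u f + H s t f - H s u f) + H t u (H s t f))
      + (p u (H t u y) + (p u y - p t y)).
    rewrite py subr0 /F -!(linD (@p_lin u)) -(linB (@p_lin u)); congr (p u _).
    have -> : p t (I s t f) = I s t f + y by rewrite addrC subrK.
    rewrite {1}/I (linD (@H_lin t u)) /I (linD (@H_lin t u)).
    clearbody y; rewrite opprD !addrA [LHS](ACl (1*7*4*2*8*5*6*3))%AC /= subrr add0r; reflexivity.
  have K0 := bd_ge0 hK.
  have e1 := (hp u u ur ur).1 _ _ (bdD (H_H sr tr ur hK) (H_bd tr ur (H_bd sr tr hK))).
  have e2 := (hp u u ur ur).1 _ _ (H_bd tr ur hy).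
  have e3 := (hp u t ur tr).2 _ _ hy.
  apply: bd_le (bdD e1 (bdD e2 e3)).
  rewrite [`|u - t|]distrC [leLHS](_ : _ = c2 * (`|s - t| * `|t - u|) * K); last first.
    by rewrite /c2; ring.
  have ab : `|s - t| * `|t - u| <= h' ^+ 2 by rewrite expr2 ler_pM.
  have cc : c2 <= c1 + c2 + c3 by rewrite addrAC lerDr; exact: addr_ge0.
  apply: (ler_wpM2r K0); exact: (ler_pM c20 (mulr_ge0 (normr_ge0 _) (normr_ge0 _)) cc ab).
(* [p t] is a chain map, so the defect of [F] is [p t] applied to that of 1 + [H]. *)
- move=> b s t f K sr tr hf hK; rewrite /F pD // -(linB (@p_lin t)).
  apply: bd_le ((hp t t tr tr).1 _ _ (H_D sr tr hK)).
  rewrite !mulrA ler_wpM2r ?(bd_ge0 hK) // ler_wpM2r //.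
  by rewrite ler_wpM2r // -/c3 lerDr; exact: addr_ge0.
- by move=> s f K sr hK; exact: (hD s s sr sr).1.
Qed.

End Truncation.

(** * Bounded forms on words and their norms up to a given length *)

Section WordForms.
Variables (R : realType) (X : completeNormedModType R[i]).
Local Notation C := R[i].
Implicit Types (K B : R) (f g : seq X -> C) (w : seq X) (d e mu : X -> X -> X).

Definition wform f := mlin f /\
  forall n, exists K : R, forall w, size w = n -> cn (f w) <= K * wt w.

Lemma wform_ge0 f n : wform f ->
  exists2 K : R, 0 <= K & forall w, size w = n -> cn (f w) <= K * wt w.
Proof.
move=> [_ /(_ n)[K hK]]; exists (Num.max K 0); first by rewrite le_max lexx orbT.
move=> w wn; apply: le_trans (hK w wn) _.
by rewrite ler_wpM2r ?wt_ge0 // le_max lexx.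
Qed.

Lemma wform_ext f g : (forall w, f w = g w) -> wform f -> wform g.
Proof. by move=> /funext ->. Qed.

Lemma wform_size (G : nat -> seq X -> C) : (forall k, wform (G k)) ->
  wform (fun w => G (size w) w).
Proof.
move=> h; split=> [s1 s2 a x y|n].
  by have [l _] := h (size s1 + (size s2).+1)%N; rewrite !size_cat /= l.
by have [_ /(_ n)[K hK]] := h n; exists K => w wn; rewrite wn hK.
Qed.

Lemma wform0 : wform (fun=> 0).
Proof.
by split=> [s1 s2 a x y|n]; [rewrite mulr0 addr0|exists 0 => w _; rewrite cn0 mul0r].
Qed.

Lemma wformZ a f : wform f -> wform (fun w => a * f w).
Proof.
move=> [l hf]; split=> [s1 s2 b x y|n]; first by rewrite l; ring.
have [K hK] := hf n; exists (cn a * K) => w wn.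
by rewrite cnM -mulrA ler_wpM2l ?cn_ge0 // hK.
Qed.

Lemma wformN f : wform f -> wform (fun w => - f w).
Proof.
by move=> /(wformZ (-1)); apply: wform_ext => w; rewrite mulN1r.
Qed.

Lemma wformD f g : wform f -> wform g -> wform (fun w => f w + g w).
Proof.
move=> [l hf] [l' hg]; split=> [s1 s2 b x y|n]; first by rewrite l l'; ring.
have [K hK] := hf n; have [K' hK'] := hg n; exists (K + K') => w wn.
by apply: le_trans (cnD _ _) _; rewrite mulrDl lerD ?hK ?hK'.
Qed.

Lemma wformB f g : wform f -> wform g -> wform (fun w => f w - g w).
Proof. by move=> hf /wformN; exact: wformD. Qed.

Lemma wform_sum m n (F : nat -> seq X -> C) : (forall i, wform (F i)) ->
  wform (fun w => \sum_(m <= i < n) F i w).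
Proof.
move=> h; elim: n => [|n IH].
  by apply: wform_ext wform0 => w; rewrite big_geq.
have [mn|nm] := leqP m n.
  by apply: wform_ext (wformD IH (h n)) => w; rewrite big_nat_recr.
by apply: wform_ext wform0 => w; rewrite big_geq.
Qed.

Lemma wform_La f : wform f -> wform (La f).
Proof.
move=> [l hf]; apply: (@wform_size (fun n w => (-1) ^+ n.-1 * f (rotr 1 w))) => k.
apply: wformZ; split=> [s1 s2 a x y|n].
  case/lastP: s2 => [|s2 z].
    by rewrite !cats1 !rotr1_rcons (l [::]).
  by rewrite -!rcons_cons -!rcons_cat !rotr1_rcons -!cat_cons l.
have [K hK] := hf n; exists K => w wn.
by rewrite -(wt_rotr 1 w) hK // size_rotr.
Qed.

Lemma wform_iter k f : wform f -> wform (iter k La f).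
Proof. by move=> h; elim: k => //= k IH; exact: wform_La. Qed.

Lemma wform_dd mu k i f : 0 <= k -> bilin mu -> bmul mu k -> wform f -> wform (dd mu i f).
Proof.
move=> k0 lmu hk hf; split; first by apply: mlin_dd => //; case: hf.
move=> n; rewrite /dd.
have [K K0 hK] := wform_ge0 n.-1 hf; have [K' K'0 hK'] := wform_ge0 n hf.
exists (K * k + K') => w wn; have [iw|wi] := ltnP i.+1 (size w).
  apply: le_trans (hK _ _) _; first by rewrite size_mrg // wn.
  apply: le_trans (_ : K * (k * wt w) <= _).
    by rewrite ler_wpM2l // wt_mrg.
  by rewrite mulrA ler_wpM2r ?wt_ge0 // lerDl.
rewrite mrg_out //; apply: le_trans (hK' _ wn) _.
by rewrite ler_wpM2r ?wt_ge0 // lerDr mulr_ge0.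
Qed.

Lemma wform_Na f : wform f -> wform (Na f).
Proof.
move=> hf; apply: (@wform_size (fun n w => \sum_(k < n) iter k La f w)) => n.
by apply: wform_ext (wform_sum 0 n (fun k => wform_iter k hf)) => w; rewrite big_mkord.
Qed.

Section Homotopies.
Variables (d e : X -> X -> X) (kd ke : R).
Hypotheses (kd0 : 0 <= kd) (ke0 : 0 <= ke) (dl : bilin d) (el : bilin e).
Hypotheses (dk : bmul d kd) (ek : bmul e ke).

Lemma wform_H11 f : wform f -> wform (H11 d e f).
Proof.
move=> hf; apply: (@wform_size (fun n w => if (2 < n)%N then - dd e 1 (dd d 0 f) w else 0)).
move=> n; case: (2 < n)%N; last exact: wform0.
by apply: wformN; apply: (wform_dd 1 ke0 el ek); exact: (wform_dd 0 kd0 dl dk).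
Qed.

Lemma wform_H12 f : wform f -> wform (H12 e f).
Proof.
move=> hf; apply: (@wform_size (fun n w => if (1 < n)%N then - dd e 0 f w else 0)).
move=> n; case: (1 < n)%N; last exact: wform0.
by apply: wformN; exact: (wform_dd 0 ke0 el ek).
Qed.

Lemma wform_H21 f : wform f -> wform (H21 e f).
Proof.
move=> hf; apply: (@wform_size (fun n w => \sum_(0 <= i < n.-1) \sum_(0 <= k < i)
             (-1) ^+ i * iter k La (dd e i f) w)) => n.
apply: wform_sum => i; apply: wform_sum => k; apply: wformZ; apply: wform_iter.
exact: (wform_dd i ke0 el ek).
Qed.

End Homotopies.

Section Bounds.
Variable W : nat.

Definition wbnd f (K : R) := forall w, (size w <= W)%N -> cn (f w) <= K * wt w.

Lemma wbnd_le f K K' : K <= K' -> wbnd f K -> wbnd f K'.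
Proof.
by move=> KK h w wW; apply: le_trans (h w wW) _; rewrite ler_wpM2r ?wt_ge0.
Qed.

Lemma wbndD f g K K' : wbnd f K -> wbnd g K' -> wbnd (fun w => f w + g w) (K + K').
Proof.
move=> h h' w wW; apply: le_trans (cnD _ _) _; rewrite mulrDl.
by rewrite lerD ?h ?h'.
Qed.

Lemma wbndN f K : wbnd f K -> wbnd (fun w => - f w) K.
Proof. by move=> h w wW; rewrite cnN h. Qed.

Lemma wbndB f g K K' : wbnd f K -> wbnd g K' -> wbnd (fun w => f w - g w) (K + K').
Proof. by move=> h /wbndN; exact: wbndD. Qed.

Lemma wbndZ a f K : wbnd f K -> wbnd (fun w => a * f w) (cn a * K).
Proof. by move=> h w wW; rewrite cnM -mulrA ler_wpM2l ?cn_ge0 ?h. Qed.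

Lemma wbnd_ext f g K : (forall w, f w = g w) -> wbnd f K -> wbnd g K.
Proof. by move=> /funext ->. Qed.

Lemma iter_La_bnd k f B n w : (forall w, size w = n -> cn (f w) <= B * wt w) ->
  size w = n -> cn (iter k La f w) <= B * wt w.
Proof.
move=> hf; elim: k w => [|k IH] w wn /=; first exact: hf.
by rewrite /La cn_signM -(wt_rotr 1 w) IH // size_rotr.
Qed.

Lemma wbnd_La f K : wbnd f K -> wbnd (La f) K.
Proof. by move=> h w wW; rewrite /La cn_signM -(wt_rotr 1 w) h // size_rotr. Qed.

Lemma wbnd_mrg f K mu k i w : 0 <= K -> bmul mu k -> wbnd f K ->
  (i.+1 < size w)%N -> (size w <= W)%N -> cn (f (mrg mu i w)) <= k * K * wt w.
Proof.
move=> K0 hk h iw wW; apply: le_trans (h _ _) _.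
  by rewrite size_mrg // (leq_trans (leq_pred _)).
by rewrite [k * K]mulrC -mulrA ler_wpM2l // wt_mrg.
Qed.

Lemma sum_bnd n (F : nat -> C) B : 0 <= B -> (n <= W)%N ->
  (forall i, (i < n)%N -> cn (F i) <= B) -> cn (\sum_(0 <= i < n) F i) <= W%:R * B.
Proof.
move=> B0 nW h; rewrite big_mkord; apply: le_trans (cn_sum_le h) _.
by rewrite ler_wpM2r // ler_nat.
Qed.

Lemma wbnd_Na f K : 0 <= K -> wbnd f K -> wbnd (Na f) (W%:R * K).
Proof.
move=> K0 h w wW; rewrite /Na -(big_mkord xpredT (fun k => iter k La f w)) -mulrA.
apply: sum_bnd => // [|k _]; first by rewrite mulr_ge0 ?wt_ge0.
by apply: (@iter_La_bnd k f K (size w)) => // w' w'w; apply: h; rewrite w'w.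
Qed.

Lemma double_sum_bnd n (F : nat -> nat -> C) B : 0 <= B -> (n <= W)%N ->
  (forall i k, (k < i)%N -> (i < n)%N -> cn (F i k) <= B) ->
  cn (\sum_(0 <= i < n) \sum_(0 <= k < i) F i k) <= W%:R * (W%:R * B).
Proof.
move=> B0 nW h; apply: sum_bnd => // [|i iN]; first by rewrite mulr_ge0.
apply: sum_bnd => // [|j ji]; first by lia.
exact: h.
Qed.

Section Mul.
Variables (mu : X -> X -> X) (k : R).
Hypotheses (k0 : 0 <= k) (hk : bmul mu k).

Lemma wbnd_bp f K : 0 <= K -> wbnd f K -> wbnd (bp mu f) (W%:R * (k * K)).
Proof.
move=> K0 h w wW; rewrite /bp -(big_mkord xpredT (fun i => (-1) ^+ i * f (mrg mu i w))) -mulrA.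
apply: sum_bnd => [||i iw]; first by rewrite !mulr_ge0 ?wt_ge0.
  exact: leq_trans (leq_pred _) wW.
by rewrite cn_signM (wbnd_mrg K0 hk h) // -ltn_predRL.
Qed.

Lemma wbnd_bs f K : 0 <= K -> wbnd f K -> wbnd (bs mu f) ((W%:R + 1) * (k * K)).
Proof.
move=> K0 h; rewrite mulrDl mul1r; apply: wbndD; first exact: wbnd_bp.
move=> w wW; case: ifP => w1; last first.
  by rewrite cn0 !mulr_ge0 ?wt_ge0.
by rewrite /La cn_signM -(wt_rotr 1 w) (wbnd_mrg K0 hk h) ?size_rotr.
Qed.

Lemma wbnd_H12 f K : 0 <= K -> wbnd f K -> wbnd (H12 mu f) (k * K).
Proof.
move=> K0 h w wW; rewrite /H12; case: ifP => w1.
  by rewrite cnN (wbnd_mrg K0 hk h).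
by rewrite cn0 !mulr_ge0 ?wt_ge0.
Qed.

Lemma wbnd_H21 f K : 0 <= K -> wbnd f K -> wbnd (H21 mu f) (W%:R * (W%:R * (k * K))).
Proof.
move=> K0 h w wW; rewrite /H21.
have -> : W%:R * (W%:R * (k * K)) * wt w = W%:R * (W%:R * (k * K * wt w)) by ring.
apply: double_sum_bnd => [||i j ji iw]; first by rewrite !mulr_ge0 ?wt_ge0.
  exact: leq_trans (leq_pred _) wW.
rewrite cn_signM; apply: (@iter_La_bnd j _ _ (size w)) => // w' w'w.
by apply: (wbnd_mrg K0 hk h); rewrite w'w // -ltn_predRL.
Qed.

End Mul.

Lemma wbnd_H11 f K d e kd ke : 0 <= kd -> 0 <= ke -> bmul d kd -> bmul e ke ->
  0 <= K -> wbnd f K -> wbnd (H11 d e f) (kd * (ke * K)).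
Proof.
move=> kd0 ke0 hd he K0 h w wW; rewrite /H11; case: ifP => w2; last first.
  by rewrite cn0 !mulr_ge0 ?wt_ge0.
have s1 : size (mrg e 1 w) = (size w).-1 by rewrite size_mrg.
have s2 : (1 < size (mrg e 1 w))%N by rewrite s1 ltn_predRL.
have s3 : (size (mrg e 1 w) <= W)%N by rewrite s1 (leq_trans (leq_pred _)).
rewrite cnN; apply: (le_trans (wbnd_mrg K0 hd h s2 s3)).
have := ler_wpM2l (mulr_ge0 kd0 K0) (wt_mrg (i := 1) he w2).
by move/le_trans; apply; rewrite le_eqVlt; apply/orP; left; apply/eqP; ring.
Qed.

Lemma rr_bnd f K e ke i w : 0 <= ke -> bmul e ke -> 0 <= K -> wbnd f K ->
  (i.+2 < size w)%N -> (size w <= W)%N -> cn (rr e i f w) <= 2 * (ke * (ke * K)) * wt w.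
Proof.
move=> ke0 he K0 h iw wW; rewrite /rr.
have key j : (j < i.+2)%N -> (i.+1 < size (mrg e j w))%N ->
    cn (f (mrg e i (mrg e j w))) <= ke * (ke * K) * wt w.
  move=> ji sj; have jw : (j.+1 < size w)%N by exact: leq_ltn_trans iw.
  have sW : (size (mrg e j w) <= W)%N by rewrite size_mrg // (leq_trans (leq_pred _)).
  apply: (le_trans (wbnd_mrg K0 he h sj sW)).
  have := ler_wpM2l (mulr_ge0 ke0 K0) (wt_mrg he jw).
  by move/le_trans; apply; rewrite le_eqVlt; apply/orP; left; apply/eqP; ring.
apply: le_trans (cnB _ _) _.
have -> : 2 * (ke * (ke * K)) * wt w = ke * (ke * K) * wt w + ke * (ke * K) * wt w by ring.
by apply: lerD; apply: key; rewrite ?size_mrg ?ltn_predRL // ltnW.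
Qed.

End Bounds.

End WordForms.

(** * The complex with differential b + B in components *)

Section Mixed.
Variables (R : realType) (X : completeNormedModType R[i]).
Local Notation C := R[i].
Local Notation P := (aplus X).
Local Notation E := (HC X P).
Implicit Types (psi phi : E) (f : seq X -> C) (w v : seq X) (m : P).

(** [p1] and [p2] restrict the coefficient to the algebra and to the adjoined unit. In [p1] the
    coefficient becomes the first letter of the word, so that the cyclic operators can act on it. *)
Definition p1 psi v : C := if v is x :: w then val psi w (x, 0) else 0.
Definition p2 psi w : C := val psi w (0, 1).

Lemma pE psi w m : val psi w m = p1 psi (m.1 :: w) + m.2 * p2 psi w.
Proof.
case: m => x c /=; rewrite /p2 -HC_modZ -HC_modD; congr (val psi w _).
congr pair; first by rewrite /= scaler0 addr0.
by rewrite /= add0r; symmetry; exact: mulr1.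
Qed.

Lemma p_ext psi phi : (forall v, p1 psi v = p1 phi v) -> (forall w, p2 psi w = p2 phi w) ->
  psi = phi.
Proof. by move=> h1 h2; apply: HC_ext => w m; rewrite !pE h1 h2. Qed.

Lemma p1_lin a psi phi v : p1 (a *: psi + phi) v = a * p1 psi v + p1 phi v.
Proof. by case: v => [|x w]; [rewrite /= mulr0 addr0|exact: HCE]. Qed.
Lemma p2_lin a psi phi w : p2 (a *: psi + phi) w = a * p2 psi w + p2 phi w.
Proof. exact: HCE. Qed.
Lemma p1D psi phi v : p1 (psi + phi) v = p1 psi v + p1 phi v.
Proof. by have := p1_lin 1 psi phi v; rewrite scale1r mul1r. Qed.
Lemma p2D psi phi v : p2 (psi + phi) v = p2 psi v + p2 phi v.
Proof. exact: HCD. Qed.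
Lemma p1B psi phi v : p1 (psi - phi) v = p1 psi v - p1 phi v.
Proof. by case: v => [|x w]; [rewrite /= subr0|exact: HCB]. Qed.
Lemma p2B psi phi v : p2 (psi - phi) v = p2 psi v - p2 phi v.
Proof. exact: HCB. Qed.
Lemma p1_0 v : p1 0 v = 0. Proof. by case: v => [//|x w]; exact: HC0. Qed.
Lemma p2_0 v : p2 0 v = 0. Proof. exact: HC0. Qed.

Lemma p2_wform psi : wform (p2 psi).
Proof.
have [l _ hb] := HCP psi; split=> [s1 s2 a x y|n]; first exact: l.
have [K hK] := hb n; exists (K * nrm ((0, 1) : P)) => w wn.
by apply: le_trans (hK w _ wn) _; rewrite mulrA mulrAC.
Qed.

Lemma inl_norm (x : X) : nrm ((x, 0) : P) = nrm x.
Proof. by rewrite /nrm aplus_inl_norm. Qed.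

Lemma inl_lin a (x y : X) : ((a *: x + y, 0) : P) = a *: ((x, 0) : P) + (y, 0).
Proof. by congr pair; rewrite /= scaler0 addr0. Qed.

Lemma p1_wform psi : wform (p1 psi).
Proof.
have [l lm hb] := HCP psi; split=> [[|z s1] s2 a x y|[|n]] /=.
- by rewrite inl_lin lm.
- exact: l.
- by exists 0 => -[] // _; rewrite /= cn0 mul0r.
have [K hK] := hb n; exists K => -[//|x w] [wn] /=.
by apply: le_trans (hK w _ wn) _; rewrite inl_norm wt_cons [nrm x * _]mulrC.
Qed.

Definition mixed_fun (f1 f2 : seq X -> C) w m : C^o := f1 (m.1 :: w) + m.2 * f2 w.

Lemma mixed_good f1 f2 : wform f1 -> wform f2 -> good (mixed_fun f1 f2).
Proof.
move=> h1 h2; have [l1 _] := h1; have [l2 _] := h2; split=> [m s1 s2 a x y|w a m m'|n].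
- by rewrite /mixed_fun -!cat_cons l1 l2; ring.
- rewrite /mixed_fun /= (l1 [::]) /=.
  by have -> : a *: m.2 + m'.2 = a * m.2 + m'.2 by []; ring.
have [K1 K10 hK1] := wform_ge0 n.+1 h1; have [K2 K20 hK2] := wform_ge0 n h2.
exists (K1 + K2) => w m wn; rewrite /mixed_fun mulrDl.
have n1 : nrm m.1 <= nrm m by have := aplus_norm1 m; rewrite !nrmE lecR.
have n2 : cn m.2 <= nrm m by have := aplus_norm2 m; rewrite !nrmE lecR.
apply: le_trans (cnD _ _) _; apply: lerD.
  apply: le_trans (hK1 _ _) _; first by rewrite /= wn.
  by rewrite wt_cons mulrC [leRHS]mulrC ler_wpM2r // mulrC ler_wpM2l ?wt_ge0.
rewrite cnM mulrC [leRHS]mulrA; apply: ler_pM; rewrite ?cn_ge0 //.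
exact: hK2.
Qed.

Definition mixed f1 f2 (h1 : wform f1) (h2 : wform f2) : E := mkHC (mixed_good h1 h2).

Lemma wform_cons0 f w : wform f -> f (0 :: w) = 0.
Proof.
move=> [l _]; have := l [::] w (-1) 0 0; rewrite scaler0 addr0 /= => ->.
by rewrite mulN1r addNr.
Qed.

Lemma p1_mixed f1 f2 (h1 : wform f1) (h2 : wform f2) v : (0 < size v)%N ->
  p1 (mixed h1 h2) v = f1 v.
Proof. by case: v => // x w _; rewrite /= /mixed_fun /= mul0r addr0. Qed.

Lemma p2_mixed f1 f2 (h1 : wform f1) (h2 : wform f2) w : p2 (mixed h1 h2) w = f2 w.
Proof. by rewrite /p2 /= /mixed_fun /= wform_cons0 // add0r mul1r. Qed.

(** Connes' operator B: the norm N of the unit component, and 0 at the unit. *)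
Definition cycB psi : E := mixed (wform_Na (p2_wform psi)) (wform0 X).

Lemma p1_cycB psi v : p1 (cycB psi) v = Na (p2 psi) v.
Proof.
by case: v => [|x w]; [rewrite /Na big_ord0|exact: p1_mixed].
Qed.
Lemma p2_cycB psi w : p2 (cycB psi) w = 0.
Proof. exact: p2_mixed. Qed.

Lemma Na_lin a f g w : Na (fun w => a * f w + g w) w = a * Na f w + Na g w.
Proof.
rewrite /Na mulr_sumr -big_split; apply: eq_bigr => k _ /=.
by rewrite (iter_LaD k (fun w => a * f w)) iter_LaZ.
Qed.

Lemma Na_ext f g w : (forall v, f v = g v) -> Na f w = Na g w.
Proof. by move=> /funext ->. Qed.

Lemma bsD mu f g w : bs mu (fun w => f w + g w) w = bs mu f w + bs mu g w.
Proof.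
rewrite /bs /bp addrACA -big_split; congr (_ + _).
  by apply: eq_bigr => i _; rewrite mulrDr.
by case: ifP => _; rewrite ?addr0 // /La /dd mulrDr.
Qed.

Lemma LaD f g w : La (fun w => f w + g w) w = La f w + La g w.
Proof. exact: mulrDr. Qed.

Lemma cycB_linear : linear cycB.
Proof.
move=> a psi phi; apply: p_ext => v.
  rewrite p1_lin !p1_cycB -Na_lin; apply: Na_ext => u; exact: p2_lin.
by rewrite p2_lin !p2_cycB mulr0 addr0.
Qed.
HB.instance Definition _ := GRing.isLinear.Build C E E *:%R cycB cycB_linear.

Section Algebra.
Variable A : algebra X.
Local Notation B := (aplus_bimodule A).

Let aface0 psi a w m : fpsi B (val psi) 0 (a :: w) m = p1 psi (plus_mulr A m a :: w).
Proof. by []. Qed.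
Let aface_last psi w z m : fpsi B (val psi) (size w).+1 (rcons w z) m =
  p1 psi (plus_mull A z m :: w).
Proof. by rewrite /fpsi (face_last B z m erefl). Qed.
Let aface_mid psi j w m : (j.+1 < size w)%N ->
  fpsi B (val psi) j.+1 w m = val psi (mrg A j w) m.
Proof. by move=> h; rewrite /fpsi face_mid. Qed.

Let adelta psi a w z s m : a :: w = rcons s z -> val (delta B psi) (a :: w) m =
  p1 psi (plus_mulr A m a :: w)
  - \sum_(i < size w) (-1) ^+ i * val psi (mrg A i (a :: w)) m
  - (-1) ^+ size w * p1 psi (plus_mull A z m :: s).
Proof.
move=> e; have es : size w = size s by have := congr1 size e; rewrite size_rcons => -[].
have el : fpsi B (val psi) (size w).+1 (a :: w) m = p1 psi (plus_mull A z m :: s).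
  by rewrite e es aface_last.
rewrite deltaE /delta_fun [size (a :: w)](_ : _ = (size w).+1) //.
rewrite big_nat_recl // big_nat_recr //; move: (fpsi _ _) el (aface0 psi a w m) (aface_mid psi).
move=> F el f0 fm; rewrite expr0 mul1r f0 el exprS mulN1r mulNr -[RHS]addrA; congr (_ + (_ + _)).
rewrite big_mkord -sumrN; apply: eq_bigr => i _.
by rewrite fm ?ltnS // exprS mulN1r mulNr.
Qed.

Lemma p1_delta psi v : p1 (delta B psi) v = bs A (p1 psi) v.
Proof.
case: v => [|x [|a w]]; first by rewrite /bs /bp /= big_ord0 addr0.
  by rewrite /bs /bp /= big_ord0 addr0.
have [s [z e]] : exists s z, a :: w = rcons s z by exists (belast a w), (last a w); exact: lastI.
have es : size w = size s by have := congr1 size e; rewrite size_rcons => -[].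
rewrite [LHS](adelta _ _ e) /bs /bp /= big_ord_recl expr0 mul1r.
rewrite /plus_mulr /plus_mull /= !scale0r !addr0 -addrA -addrA; congr (_ + _).
rewrite -sumrN; congr (_ + _).
  by apply: eq_bigr => i _; rewrite /= /bump add1n exprS mulN1r mulNr.
by rewrite /La /dd /= e -rcons_cons rotr1_rcons /= es exprS mulN1r mulNr.
Qed.

Lemma p2_delta psi w : p2 (delta B psi) w = p1 psi w - La (p1 psi) w - bp A (p2 psi) w.
Proof.
case: w => [|a w].
  by rewrite /p2 deltaE /La /bp /= big_ord0 !(subr0, mulr0).
have [s [z e]] : exists s z, a :: w = rcons s z by exists (belast a w), (last a w); exact: lastI.
have es : size w = size s by have := congr1 size e; rewrite size_rcons => -[].
rewrite [LHS](adelta _ _ e) /plus_mulr /plus_mull /= alg0l alg0r !scale1r !add0r.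
have er : rotr 1 (a :: w) = z :: s by rewrite e rotr1_rcons.
by rewrite addrAC /La /bp er /=.
Qed.

(** The differential b + B. In components it is the matrix of the cyclic bicomplex, with entries b,
    N, 1 - λ and -b'. *)
Definition mixedD psi : E := delta B psi + cycB psi.

Lemma p1_mixedD psi v : p1 (mixedD psi) v = bs A (p1 psi) v + Na (p2 psi) v.
Proof. by rewrite p1D p1_delta p1_cycB. Qed.
Lemma p2_mixedD psi w : p2 (mixedD psi) w = p1 psi w - La (p1 psi) w - bp A (p2 psi) w.
Proof. by rewrite p2D p2_delta p2_cycB addr0. Qed.

(** Besides δ δ = 0 this needs b N = N b' and that N is annihilated by 1 - λ on both sides. *)
Lemma mixedDD psi : mixedD (mixedD psi) = 0.
Proof.
have p1d : p1 (delta B psi) = bs A (p1 psi) by apply/funext => u; exact: p1_delta.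
have p2d' : p2 (delta B psi) =
    fun w => -1 * bp A (p2 psi) w + (-1 * La (p1 psi) w + p1 psi w).
  by apply/funext => u; rewrite p2_delta; ring.
have p1D' : p1 (mixedD psi) = fun v => bs A (p1 psi) v + Na (p2 psi) v.
  by apply/funext => u; exact: p1_mixedD.
have p2D' : p2 (mixedD psi) = p2 (delta B psi).
  by apply/funext => u; rewrite p2_mixedD p2_delta.
apply: p_ext => v.
  have := p1_delta (delta B psi) v; rewrite delta_delta p1_0 p1d => h0.
  rewrite p1_mixedD p1D' p2D' bsD -h0. rewrite add0r.
  case: v {h0} => [|x w]; first by rewrite /bs /bp /Na /= !big_ord0 !addr0.
  rewrite bs_Na // p2d'.
  by rewrite !Na_lin Na_La; ring.
have := p2_delta (delta B psi) v; rewrite delta_delta p2_0 p1d => h0.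
move: h0; rewrite p2_mixedD p1D' p2D' (LaD (bs A (p1 psi)) (Na (p2 psi))) La_Na => h0; rewrite [RHS]h0; ring.
Qed.

End Algebra.

End Mixed.

(** * Degrees of cochains, and contraction along a difference of products *)

Section Supports.
Variables (R : realType) (X : completeNormedModType R[i]).
Local Notation C := R[i].
Local Notation P := (aplus X).
Local Notation E := (HC X P).
Implicit Types (psi phi : E) (f : seq X -> C) (w v : seq X) (S T : nat -> bool).

Lemma delta_ext (A : algebra X) (M : normedModType C) (B : bimodule A M)
    (psi phi : HC X M) w m :
  (forall w' (m' : M), (size w').+1 = size w -> val psi w' m' = val phi w' m') ->
  val (delta B psi) w m = val (delta B phi) w m.
Proof.
move=> h; rewrite !deltaE /delta_fun; case e : (size w) => [//|n].
apply: eq_big_nat => j /andP[_ jn]; rewrite /fpsi h // size_face //= e //.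
Qed.

Lemma delta_null (A : algebra X) (M : normedModType C) (B : bimodule A M)
    (psi : HC X M) w m :
  (forall w' (m' : M), (size w').+1 = size w -> val psi w' m' = 0) -> val (delta B psi) w m = 0.
Proof.
move=> h; by rewrite (@delta_ext A M B psi 0) ?linear0 ?HC0 // => w' m' e; rewrite HC0 h.
Qed.

(** The set [S] of degrees is arbitrary so that one notion covers degree bounds and parity. *)
Definition supp S psi := forall w m, ~~ S (size w) -> val psi w m = 0.

Lemma supp_p1 S psi v : supp S psi -> ~~ S (size v).-1 -> p1 psi v = 0.
Proof. by move=> h; case: v => [//|x w]; exact: h. Qed.

Lemma supp_p2 S psi w : supp S psi -> ~~ S (size w) -> p2 psi w = 0.
Proof. by move=> h; exact: h. Qed.

Lemma supp_of_p S psi : (forall x w, ~~ S (size w) -> p1 psi (x :: w) = 0) ->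
  (forall w, ~~ S (size w) -> p2 psi w = 0) -> supp S psi.
Proof. by move=> h1 h2 w m h; rewrite pE h1 // h2 // mulr0 addr0. Qed.

Lemma supp_lin S a psi phi : supp S psi -> supp S phi -> supp S (a *: psi + phi).
Proof. by move=> h h' w m Sw; rewrite HCE h // h' // mulr0 addr0. Qed.

Lemma supp_sub S T psi : (forall k, S k -> T k) -> supp S psi -> supp T psi.
Proof. by move=> ST h w m Tw; apply: h; apply: contra Tw; exact: ST. Qed.

Lemma supp_delta (A : algebra X) S T psi : (forall k, S k -> T k.+1) ->
  supp S psi -> supp T (delta (aplus_bimodule A) psi).
Proof.
move=> ST h w m Tw; apply: delta_null => w' m' e; apply: h.
by apply: contra Tw => /ST; rewrite e.
Qed.

Lemma Na_null f v : (forall w, size w = size v -> f w = 0) -> Na f v = 0.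
Proof.
move=> h; rewrite /Na big1 // => k _.
rewrite (@iter_La_ext _ _ (size v) k f (fun=> 0 * f [::])) //; last first.
  by move=> w e; rewrite mul0r h.
by rewrite (iter_LaZ k 0 (fun=> f [::])) mul0r.
Qed.

Lemma supp_cycB S T psi : (forall k, S k.+1 -> T k) -> supp S psi -> supp T (cycB psi).
Proof.
move=> ST h; apply: supp_of_p => [x w Tw|w Tw]; last exact: p2_cycB.
rewrite p1_cycB; apply: Na_null => v e; apply: h.
by apply: contra Tw => Sv; apply: ST; rewrite e in Sv.
Qed.

Section Step.
Variables A A' : algebra X.

Definition mul_diff a b := A' a b - A a b.

Lemma mul_diff_bilin : bilin mul_diff.
Proof.
move=> a x y z; have [l1 l2] := alg_bilin A a x y z; have [l1' l2'] := alg_bilin A' a x y z.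
by split; rewrite /mul_diff ?l1 ?l2 ?l1' ?l2' opprD addrACA -scalerBr.
Qed.

Lemma bmulB mu nu (k l : R) : bmul mu k -> bmul nu l ->
  bmul (fun a b : X => mu a b - nu a b : X) (k + l).
Proof.
move=> hm hn a b; apply: le_trans (nrmB _ _) _.
by rewrite mulrDl lerD.
Qed.

Lemma step_wform1 psi :
  wform (fun w => H11 A mul_diff (p1 psi) w + H21 mul_diff (p2 psi) w).
Proof.
have [k k0 hk] := bilinear_nrm (amulP A); have [l l0 hl] := bilinear_nrm (amulP A').
have hd := bmulB hl hk; have d0 := addr_ge0 l0 k0.
apply: wformD.
  exact: (wform_H11 k0 d0 (alg_bilin A) mul_diff_bilin hk hd (p1_wform psi)).
exact: (wform_H21 d0 mul_diff_bilin hd (p2_wform psi)).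
Qed.

Lemma step_wform2 psi : wform (H12 mul_diff (p1 psi)).
Proof.
have [k k0 hk] := bilinear_nrm (amulP A); have [l l0 hl] := bilinear_nrm (amulP A').
have hd := bmulB hl hk; have d0 := addr_ge0 l0 k0.
exact: (wform_H12 d0 mul_diff_bilin hd (p1_wform psi)).
Qed.

(* The contraction along [A' - A]: [1 + step] is a chain map from the complex of [A]
   to the complex of [A'] up to terms of second order in [A' - A]. *)
Definition step psi : E := mixed (step_wform1 psi) (step_wform2 psi).

Lemma p1_step psi v :
  p1 (step psi) v = H11 A mul_diff (p1 psi) v + H21 mul_diff (p2 psi) v.
Proof.
case: v => [|x w]; last exact: p1_mixed.
by rewrite /H11 /H21 /= big_geq // addr0.
Qed.

Lemma p2_step psi w : p2 (step psi) w = H12 mul_diff (p1 psi) w.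
Proof. exact: p2_mixed. Qed.

Lemma H11_lin d e a f g w :
  H11 d e (fun v => a * f v + g v : C) w = a * H11 d e f w + H11 d e g w.
Proof. by rewrite /H11; case: ifP => _; ring. Qed.

Lemma H12_lin e a f g (w : seq X) :
  H12 e (fun v => a * f v + g v : C) w = a * H12 e f w + H12 e g w.
Proof. by rewrite /H12; case: ifP => _; ring. Qed.

Lemma H21_lin e a f g (w : seq X) :
  H21 e (fun v => a * f v + g v : C) w = a * H21 e f w + H21 e g w.
Proof.
rewrite /H21 mulr_sumr -big_split; apply: eq_bigr => i _ /=.
rewrite mulr_sumr -big_split; apply: eq_bigr => k _ /=.
by rewrite /dd (iter_LaD k (fun w => a * f (mrg e i w))) iter_LaZ; ring.
Qed.

Lemma step_linear : linear step.
Proof.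
move=> a psi phi; apply: p_ext => v.
  rewrite p1_lin !p1_step.
  have -> : p1 (a *: psi + phi) = fun v => a * p1 psi v + p1 phi v.
    by apply/funext => u; exact: p1_lin.
  have -> : p2 (a *: psi + phi) = fun v => a * p2 psi v + p2 phi v.
    by apply/funext => u; exact: p2_lin.
  by rewrite H11_lin H21_lin; ring.
rewrite p2_lin !p2_step.
have -> : p1 (a *: psi + phi) = fun v => a * p1 psi v + p1 phi v.
  by apply/funext => u; exact: p1_lin.
exact: H12_lin.
Qed.

(** [H21] keeps the degree, while [H11] and [H12] raise it by two. *)
Lemma supp_step S T psi : (forall k, S k -> T k) -> (forall k, S k -> T k.+2) ->
  supp S psi -> supp T (step psi).
Proof.
move=> ST ST2 h; apply: supp_of_p => [x w Tw|w Tw].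
  have -> : p1 (step psi) (x :: w) = H11 A mul_diff (p1 psi) (x :: w) +
      H21 mul_diff (p2 psi) (x :: w) by exact: p1_step.
  have -> : H21 mul_diff (p2 psi) (x :: w) = 0.
    rewrite /H21 big1_seq // => i /andP[_]; rewrite mem_index_iota => /andP[_ iw].
    rewrite big1 // => k _; rewrite (@iter_La_ext _ _ (size w).+1 k _ (fun=> 0 * 0)) //.
      by rewrite (iter_LaZ k 0 (fun=> 0)) mul0r mulr0.
    move=> v e; rewrite mul0r /dd; apply: (supp_p2 h).
    by rewrite size_mrg e //; apply: contra Tw => /ST.
  rewrite addr0 /H11; case: ifP => // w2; rewrite (supp_p1 h) ?oppr0 //.
  have s1 : size (mrg mul_diff 1 (x :: w)) = size w by rewrite size_mrg.
  rewrite size_mrg s1 // {s1}.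
  by apply: contra Tw => /ST2; move: w2 => /=; case: (size w) => [|[|k]].
rewrite p2_step /H12; case: ifP => // w1; rewrite (supp_p1 h) ?oppr0 //.
rewrite size_mrg //; apply: contra Tw => /ST2.
by case: (size w) w1 => [|[|k]].
Qed.

End Step.

End Supports.

(** * Lipschitz estimates for b, B and the contraction *)

Section Estimates.
Variables (R : realType) (X : completeNormedModType R[i]).
Local Notation C := R[i].
Local Notation P := (aplus X).
Local Notation E := (HC X P).
Implicit Types (K B : R) (psi phi : E) (f g : seq X -> C) (w v : seq X).
Implicit Types (mu nu d e : X -> X -> X).
Variable W : nat.

(** The bound runs over words of length at most [W], hence over [p1] in degrees below [W] and over
    [p2] in degrees up to [W]. This asymmetry makes B bounded although it lowers the degree, for N
    relates words of equal length. *)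
Definition pbd K psi := [/\ 0 <= K, wbnd W (p1 psi) K & wbnd W (p2 psi) K].

Lemma pbd_ge0 K psi : pbd K psi -> 0 <= K. Proof. by case. Qed.

Lemma pbd_le K K' psi : K <= K' -> pbd K psi -> pbd K' psi.
Proof.
move=> KK [h h1 h2]; split; first exact: le_trans KK.
  exact: wbnd_le h1.
exact: wbnd_le h2.
Qed.

Lemma pbdD K K' psi phi : pbd K psi -> pbd K' phi -> pbd (K + K') (psi + phi).
Proof.
move=> [h h1 h2] [k k1 k2]; split; first exact: addr_ge0.
  by apply: wbnd_ext (wbndD h1 k1) => v; rewrite p1D.
by apply: wbnd_ext (wbndD h2 k2) => v; rewrite p2D.
Qed.

Lemma p1N psi v : p1 (- psi) v = - p1 psi v.
Proof. by rewrite -[- psi]add0r p1B p1_0 add0r. Qed.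
Lemma p2N psi v : p2 (- psi) v = - p2 psi v.
Proof. exact: HCN. Qed.

Lemma pbdN K psi : pbd K psi -> pbd K (- psi).
Proof.
move=> [h h1 h2]; split=> //.
  by apply: wbnd_ext (wbndN h1) => v; rewrite p1N.
by apply: wbnd_ext (wbndN h2) => v; rewrite p2N.
Qed.

Lemma pbd0 : pbd 0 0.
Proof. by split=> // v _; rewrite ?p1_0 ?p2_0 cn0 mul0r. Qed.

Lemma pbdZ a : exists cZ, forall psi K, pbd K psi -> pbd (cZ * K) (a *: psi).
Proof.
exists (cn a) => psi K [h h1 h2]; split; first by rewrite mulr_ge0 ?cn_ge0.
  apply: wbnd_ext (wbndZ a h1) => v.
  by rewrite -[a *: psi]addr0 p1_lin p1_0 addr0.
by apply: wbnd_ext (wbndZ a h2) => v; rewrite -[a *: psi]addr0 p2_lin p2_0 addr0.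
Qed.

Lemma wbnd_ex f n : wform f -> exists2 K : R, 0 <= K & wbnd n f K.
Proof.
move=> hf; elim: n => [|n [K K0 hK]].
  have [K K0 hK] := wform_ge0 0 hf; exists K => // w; rewrite leqn0 => /eqP; exact: hK.
have [K' K'0 hK'] := wform_ge0 n.+1 hf; exists (K + K'); first exact: addr_ge0.
move=> w; rewrite leq_eqVlt => /orP[/eqP wn|wn].
  by apply: le_trans (hK' w wn) _; rewrite ler_wpM2r ?wt_ge0 // lerDr.
by apply: le_trans (hK w wn) _; rewrite ler_wpM2r ?wt_ge0 // lerDl.
Qed.

Lemma pbd_ex psi : exists K, pbd K psi.
Proof.
have [K K0 hK] := wbnd_ex W (p1_wform psi); have [L L0 hL] := wbnd_ex W (p2_wform psi).
exists (K + L); split; first exact: addr_ge0.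
  by apply: wbnd_le hK; rewrite lerDl.
by apply: wbnd_le hL; rewrite lerDr.
Qed.

Lemma unit_norm : nrm ((0, 1) : P) <= 1.
Proof.
by rewrite -lecR -nrmE prod_normE num_ge_max /= normr0 normr1 lexx ler01.
Qed.

Lemma bnd_of_pbd K psi j : (j < W)%N -> pbd K psi -> bnd (val psi) j (2 * K).
Proof.
move=> jW [K0 h1 h2] w m wj; rewrite pE.
have n1 : nrm m.1 <= nrm m by have := aplus_norm1 m; rewrite !nrmE lecR.
have n2 : cn m.2 <= nrm m by have := aplus_norm2 m; rewrite !nrmE lecR.
apply: le_trans (cnD _ _) _.
have -> : 2 * K * (wt w * nrm m) = K * (wt w * nrm m) + K * (wt w * nrm m) by ring.
apply: lerD.
  apply: le_trans (h1 _ _) _; first by rewrite /= wj.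
  by rewrite wt_cons ler_wpM2l // mulrC ler_wpM2l ?wt_ge0.
rewrite cnM; apply: le_trans (ler_wpM2l (cn_ge0 _) (h2 w _)) _; first by rewrite wj ltnW.
by rewrite mulrC -mulrA ler_wpM2l // ler_wpM2l ?wt_ge0.
Qed.

Lemma pbd_of_bnd K psi : 0 <= K -> (forall j, (j <= W)%N -> bnd (val psi) j K) -> pbd K psi.
Proof.
move=> K0 h; split=> // [[|x w] wW|w wW].
- by rewrite cn0 mulr_ge0 ?wt_ge0.
- apply: le_trans (h (size w) (ltnW wW) w _ erefl) _.
  by rewrite inl_norm wt_cons [nrm x * _]mulrC.
apply: le_trans (h (size w) wW w _ erefl) _.
by rewrite ler_wpM2l // ler_piMr ?wt_ge0 // unit_norm.
Qed.

Lemma mulB_norm mu nu (k : R) : bmul (fun a b => mu a b - nu a b) k ->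
  bmul (fun a b => nu a b - mu a b) k.
Proof. by move=> h a b; rewrite nrmBC. Qed.

Lemma bp_mulB mu nu f w : mlin f ->
  bp mu f w - bp nu f w = bp (fun a b => mu a b - nu a b) f w.
Proof.
move=> lf; rewrite /bp -sumrB; apply: eq_bigr => i _.
by rewrite -mulrBr mlin_mrgB // -ltn_predRL.
Qed.

Lemma bs_mulB mu nu f w : mlin f ->
  bs mu f w - bs nu f w = bs (fun a b => mu a b - nu a b) f w.
Proof.
move=> lf; rewrite /bs opprD addrACA bp_mulB //; congr (_ + _).
case: ifP => w1; last by rewrite subr0.
by rewrite /La /dd -mulrBr mlin_mrgB // size_rotr.
Qed.

Section Families.
Variables (A_ : R -> algebra X) (r kA c : R).
Hypotheses (kA0 : 0 <= kA) (c0 : 0 <= c).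
Hypothesis HA : forall t, `|t| <= r -> bmul (A_ t) kA.
Hypothesis HL : forall s t, `|s| <= r -> `|t| <= r ->
  bmul (fun a b => A_ s a b - A_ t a b) (c * `|s - t|).
Local Notation B t := (aplus_bimodule (A_ t)).
Local Notation e s t := (mul_diff (A_ s) (A_ t)).
Local Notation H s t := (step (A_ s) (A_ t)).

Let W0 : 0 <= W%:R :> R. Proof. exact: ler0n. Qed.

Let eL s t : `|s| <= r -> `|t| <= r -> bmul (e s t) (c * `|s - t|).
Proof. by move=> sr tr; apply: mulB_norm; exact: HL. Qed.

Lemma delta_lip : lip_family pbd r (fun t => delta (B t)).
Proof.
pose C1 := (W%:R + 1) * (kA + c) + 2.
have C10 : 0 <= C1 by rewrite addr_ge0 // mulr_ge0 // addr_ge0.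
exists C1 => // s t sr tr; split=> K psi [K0 h1 h2].
  split; first exact: mulr_ge0.
    apply: wbnd_ext (wbnd_le _ (wbnd_bs kA0 (HA tr) K0 h1)) => [v|]; first by rewrite p1_delta.
    by rewrite mulrA ler_wpM2r // /C1 mulrDr -addrA lerDl addr_ge0 // mulr_ge0 // addr_ge0.
  apply: wbnd_ext (wbnd_le _ (wbndB (wbndB h1 (wbnd_La h1)) (wbnd_bp kA0 (HA tr) K0 h2))) => [v|].
    by rewrite p2_delta.
  have -> : C1 * K = K + K + W%:R * (kA * K) + (W%:R * c + kA + c) * K by rewrite /C1; ring.
  by rewrite lerDl mulr_ge0 // !addr_ge0 // mulr_ge0.
have h0 : 0 <= c * `|s - t| by rewrite mulr_ge0.
have C1c : c * (W%:R + 1) <= C1.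
  have -> : C1 = c * (W%:R + 1) + ((W%:R + 1) * kA + 2) by rewrite /C1; ring.
  by rewrite lerDl addr_ge0 // mulr_ge0 // addr_ge0.
have key : (W%:R + 1) * (c * `|s - t| * K) <= C1 * `|s - t| * K.
  have -> : (W%:R + 1) * (c * `|s - t| * K) = c * (W%:R + 1) * `|s - t| * K by ring.
  by rewrite !ler_wpM2r.
split; first by rewrite !mulr_ge0.
  apply: wbnd_ext (wbnd_le key (wbnd_bs h0 (HL sr tr) K0 h1)) => v.
  rewrite p1B !p1_delta bs_mulB //; by case: (p1_wform psi).
apply: wbnd_ext (wbnd_le _ (wbndN (wbnd_bp h0 (HL sr tr) K0 h2))) => [v|].
  rewrite p2B !p2_delta -bp_mulB; last by case: (p2_wform psi).
  by ring.
apply: le_trans key; rewrite ler_wpM2r ?mulr_ge0 //.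
by rewrite lerDl.
Qed.

Lemma cycB_lip : lip_family pbd r (fun=> @cycB R X).
Proof.
apply: (lip_family_const pbd_ge0 pbd_le pbd0 _ (c := W%:R)) => // K psi [K0 h1 h2]; split.
- exact: mulr_ge0.
- by apply: wbnd_ext (wbnd_Na K0 h2) => v; rewrite p1_cycB.
by move=> v _; rewrite p2_cycB cn0 !mulr_ge0 ?wt_ge0.
Qed.

Let cH := kA * c + W%:R * W%:R * c + c.
Let cH0 : 0 <= cH. Proof. by rewrite !addr_ge0 // !mulr_ge0. Qed.

Lemma step_bound s t : `|s| <= r -> `|t| <= r -> opb pbd (cH * `|s - t|) (H s t).
Proof.
move=> sr tr K psi [K0 h1 h2]; set a := `|s - t|.
have a0 : 0 <= a by exact: normr_ge0.
have e0 : 0 <= c * a by exact: mulr_ge0.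
have he := eL sr tr.
split; first by rewrite !mulr_ge0.
  have b1 := wbnd_H11 kA0 e0 (HA sr) he K0 h1; have b2 := wbnd_H21 e0 he K0 h2.
  apply: wbnd_ext (wbnd_le _ (wbndD b1 b2)) => [v|]; first by rewrite p1_step.
  have -> : cH * a * K = kA * (c * a * K) + W%:R * (W%:R * (c * a * K)) + c * a * K.
    by rewrite /cH; ring.
  by rewrite lerDl mulr_ge0.
apply: wbnd_ext (wbnd_le _ (wbnd_H12 e0 he K0 h1)) => [v|]; first by rewrite p2_step.
have -> : cH * a * K = (kA * c + W%:R * W%:R * c) * a * K + c * a * K by rewrite /cH; ring.
by rewrite lerDr !mulr_ge0 // addr_ge0 // !mulr_ge0.
Qed.

Lemma step_id s psi : H s s psi = 0.
Proof.
have z : e s s = fun _ _ => 0 by apply/funext => a; apply/funext => b; rewrite /mul_diff subrr.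
have dd0 f i w : mlin f -> (i.+1 < size w)%N -> f (mrg (e s s) i w) = 0.
  by move=> lf iw; rewrite -(mlin_mrgB (A_ s) (A_ s)) // subrr.
have [l1 _] := p1_wform psi; have [l2 _] := p2_wform psi.
apply: p_ext => v; rewrite ?p1_0 ?p2_0.
  rewrite p1_step /H11 [X in _ + X](_ : _ = 0); last first.
    rewrite /H21 big1_seq // => i /andP[_]; rewrite mem_index_iota => /andP[_ iv].
    rewrite big1 // => k _; rewrite (@iter_La_ext _ _ (size v) k _ (fun=> 0 * 0)) //.
      by rewrite (iter_LaZ k 0 (fun=> 0)) mul0r mulr0.
    by move=> u uv; rewrite mul0r /dd dd0 // uv -ltn_predRL.
  rewrite addr0; case: ifP => // v2.
  have := dd0 _ 1%N v (mlin_dd 0%N (alg_bilin (A_ s)) l1) v2.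
  by rewrite /dd => ->; rewrite oppr0.
by rewrite p2_step /H12; case: ifP => // v1; rewrite dd0 ?oppr0.
Qed.

Lemma H21_mulB e1 e2 e3 f w : mlin f -> (forall a b, e3 a b = e1 a b - e2 a b) ->
  H21 e3 f w = H21 e1 f w - H21 e2 f w.
Proof.
move=> lf h; have -> : e3 = fun a b => e1 a b - e2 a b.
  by apply/funext => a; apply/funext => b.
rewrite /H21 -sumrB; apply: eq_big_nat => i /andP[_ iw].
rewrite -sumrB; apply: eq_bigr => k _; rewrite -mulrBr; congr (_ * _).
rewrite -iter_LaN -iter_LaD; apply: (@iter_La_ext _ _ (size w)) => // v vw.
by rewrite /dd -mlin_mrgB // vw -ltn_predRL.
Qed.

Lemma step_cocycle s t u : `|s| <= r -> `|t| <= r -> `|u| <= r ->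
  opb pbd (c * c * `|s - t| * `|t - u|) (fun psi => H t u psi + H s t psi - H s u psi).
Proof.
move=> sr tr ur K psi [K0 h1 h2].
have [l1 _] := p1_wform psi; have [l2 _] := p2_wform psi.
have a0 : 0 <= c * `|s - t| by rewrite mulr_ge0.
have b0 : 0 <= c * `|t - u| by rewrite mulr_ge0.
have ee a b : e t u a b = e s u a b - e s t a b.
  by rewrite /mul_diff opprB addrA subrK.
have eef : e t u = fun a b => e s u a b - e s t a b.
  by apply/funext => a; apply/funext => b.
split; first by rewrite !mulr_ge0.
  have hb := wbnd_H11 a0 b0 (eL sr tr) (eL tr ur) K0 h1.
  have -> : c * c * `|s - t| * `|t - u| * K = c * `|s - t| * (c * `|t - u| * K) by ring.
  apply: wbnd_ext hb => v; rewrite p1B p1D !p1_step.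
  rewrite (H21_mulB v l2 ee).
  have regroup (x y z a b z' : C) : z' = a + b - x -> z' = a + (y - z) + (b + z) - (x + y).
    by move=> ->; ring.
  apply: regroup.
  rewrite /H11; case: ifP => v2; last by rewrite addr0 subrr.
  have := mlin_mrgB (e s u) (e s t) (mlin_dd 0%N (alg_bilin (A_ s)) l1) v2.
  rewrite -eef /dd => h.
  have s1 : (1 < size (mrg (e t u) 1 v))%N by rewrite size_mrg // ltn_predRL.
  have := mlin_mrgB (A_ t) (A_ s) l1 s1; rewrite -/(e s t) => <-; rewrite -h.
  by ring.
have -> : p2 (H t u psi + H s t psi - H s u psi) = fun=> 0.
  apply/funext => v; rewrite p2B p2D !p2_step /H12; case: ifP => v1; last by ring.
  by have := mlin_mrgB (e s u) (e s t) l1 v1; rewrite -eef => <-; ring.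
by move=> v _; rewrite cn0 !mulr_ge0 ?wt_ge0.
Qed.

End Families.
End Estimates.

(** * Contraction is a chain map up to second order *)

Section ChainDefect.
Variables (R : realType) (X : completeNormedModType R[i]).
Local Notation C := R[i].
Local Notation P := (aplus X).
Local Notation E := (HC X P).
Implicit Types (psi phi : E) (f g : seq X -> C) (w v : seq X).
Implicit Types (mu nu : X -> X -> X).
Variables A A' : algebra X.
Local Notation e := (mul_diff A A').
Local Notation H := (step A A').

(** Subtracting associativity of [A] from that of [A'] gives the Maurer-Cartan equation for the
    difference. *)
Lemma mul_diff_cocycle a b x : let e := e in let m := A : X -> X -> X in
  e (m a b) x - e a (m b x) + m (e a b) x - m a (e b x) = e a (e b x) - e (e a b) x.
Proof.
have abel (al be ga de p q : X) : (al - p) - (be - p) + (ga - p) - (de - p) =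
    ((q - be) - (de - p)) - ((q - al) - (ga - p)).
  have tel (u v w : X) : (u - v) + (v - w) = u - w by rewrite addrA subrK.
  rewrite !opprB tel -(addrA (al - be)) tel [in RHS](addrC (ga - p)) [RHS]addrACA.
  by rewrite [in RHS](addrC (q - be)) [in RHS](addrC (p - de)) !tel.
have Bl (B : algebra X) (u v w : X) : B (u - v) w = B u w - B v w.
  by rewrite -scaleN1r addrC (alg_bilin B _ _ _ _).1 scaleN1r addrC.
have Br (B : algebra X) (u v w : X) : B w (u - v) = B w u - B w v.
  by rewrite -scaleN1r addrC (alg_bilin B _ _ _ _).2 scaleN1r addrC.
move=> e' m; rewrite /e' /m /mul_diff !Bl !Br !amulA.
exact: abel.
Qed.

Lemma bpD mu f g w : bp mu (fun v => f v + g v) w = bp mu f w + bp mu g w.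
Proof. by rewrite /bp -big_split; apply: eq_bigr => i _; rewrite mulrDr. Qed.

(** In every term the difference of the products occurs twice, either inside [rr] or once in the
    outer operator and once in [H]. *)
Definition rem1 psi v : C :=
  bs e (p1 (H psi)) v
  - (if (3 < size v)%N then rr e 1 (dd A 0 (p1 psi)) v else 0)
  - \sum_(0 <= i < (size v).-2) \sum_(0 <= k < i) iter k La (rr e i (p2 psi)) v.

Definition rem2 psi v : C :=
  - (if (2 < size v)%N then rr e 0 (p1 psi) v else 0)
  - bp e (p2 (H psi)) v.

Let mul_split : (fun a b => A' a b - A a b) = e. Proof. by []. Qed.

(** By the Cartan formulas the commutator of [H] with the differential of [A] is the difference of
    the two differentials up to [rr]. The first-order terms thus cancel, and the difference of the
    differentials applied to [H] remains. *)
Lemma step_defect1 psi v :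
  p1 (mixedD A' (psi + H psi) - (mixedD A psi + H (mixedD A psi))) v = rem1 psi v.
Proof.
have [l1 _] := p1_wform psi; have [l2 _] := p2_wform psi; have [lh _] := p1_wform (H psi).
have hc := mul_diff_cocycle.
have c1 := @cartan11_split _ X e (p1 psi) v.
have c2 := cartan11_comm (amulA A) (alg_bilin A) hc v l1.
have c3 := cartan21 hc v l2.
have b1 := bs_mulB A' A v l1; have b2 := bs_mulB A' A v lh.
rewrite mul_split in b1 b2.
rewrite p1B p1D !p1_mixedD p1_step.
have E1 : p1 (psi + H psi) = fun w => p1 psi w + p1 (H psi) w.
  by apply/funext => w; exact: p1D.
have E2 : p2 (psi + H psi) = fun w => 1 * p2 psi w + H12 e (p1 psi) w.
  by apply/funext => w; rewrite p2D p2_step mul1r.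
have E3 : p1 (mixedD A psi) = fun w => 1 * bs A (p1 psi) w + Na (p2 psi) w.
  by apply/funext => w; rewrite p1_mixedD mul1r.
have E4 : p2 (mixedD A psi) = fun w => -1 * bp A (p2 psi) w + (p1 psi w - La (p1 psi) w).
  by apply/funext => w; rewrite p2_mixedD mulN1r addrC.
have E5 : bs A (p1 (H psi)) v =
    bs A (H11 A e (p1 psi)) v + bs A (H21 e (p2 psi)) v.
  by rewrite -bsD; congr bs; apply/funext => w; exact: p1_step.
rewrite E1 E2 E3 E4 bsD Na_lin H11_lin H21_lin !mul1r !mulN1r /rem1.
rewrite -c2 -c3 -b2 E5; move: c1; rewrite -b1.
have regroup (x1 x2 x3 x4 x5 x6 x7 x8 x9 x10 x11 : C) : x9 - x4 = x1 - x5 ->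
    x1 + x2 + (x3 + x4) - (x5 + x3 + (x6 + x7 + (- x8 + x9))) =
    x2 - (x10 + x11) - (x6 - x10) - (x7 - x8 - x11).
  move=> h; have -> : x9 = x1 - x5 + x4 by rewrite -h subrK.
  by ring.
exact: regroup.
Qed.

Lemma step_defect2 psi v :
  p2 (mixedD A' (psi + H psi) - (mixedD A psi + H (mixedD A psi))) v = rem2 psi v.
Proof.
have [l1 _] := p1_wform psi; have [l2 _] := p2_wform psi; have [lh _] := p2_wform (H psi).
have c1 := @cartan22 _ X e (p2 psi) v.
have c2 := cartan12 mul_diff_cocycle v l1.
have b1 := bp_mulB A' A v l2; have b2 := bp_mulB A' A v lh.
rewrite mul_split in b1 b2.
have E1 : p1 (psi + H psi) = fun w => p1 psi w +
    (H11 A e (p1 psi) w + H21 e (p2 psi) w).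
  by apply/funext => w; rewrite p1D p1_step.
have E2 : p2 (psi + H psi) = fun w => p2 psi w + p2 (H psi) w.
  by apply/funext => w; rewrite p2D.
have E2' : p2 (H psi) = H12 e (p1 psi) by apply/funext => w; exact: p2_step.
have E3 : p1 (mixedD A psi) = fun w => 1 * bs A (p1 psi) w + Na (p2 psi) w.
  by apply/funext => w; rewrite p1_mixedD mul1r.
rewrite p2B p2D !p2_mixedD p2_step E1 E2 E3 bpD H12_lin mul1r.
rewrite (LaD (p1 psi)) (LaD (H11 A e (p1 psi))) /rem2 -c2 -b2 E2'; move: c1.
rewrite -b1; move: (La _ v) (La _ v) (La _ v); clear.
have regroup (x1 x2 x3 x4 x5 x6 x7 x8 x9 x10 x11 x12 : C) : x12 - (x3 - x6) = - (x7 - x9) ->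
    x1 + (x2 + x3) - (x4 + (x5 + x6)) - (x7 + x8) - (x1 - x4 - x9 + (x10 + x12)) =
    - (x10 - (x2 - x5) + x11) - (x8 - x11).
  move=> h; have -> : x12 = - (x7 - x9) + (x3 - x6) by rewrite -h subrK.
  by ring.
by move=> *; exact: regroup.
Qed.

End ChainDefect.

Section ChainBound.
Variables (R : realType) (X : completeNormedModType R[i]).
Local Notation C := R[i].
Implicit Types (K : R) (psi : HC X (aplus X)).
Variable W : nat.
Variables (A_ : R -> algebra X) (r kA c : R).
Hypotheses (kA0 : 0 <= kA) (c0 : 0 <= c).
Hypothesis HA : forall t, `|t| <= r -> bmul (A_ t) kA.
Hypothesis HL : forall s t, `|s| <= r -> `|t| <= r ->
  bmul (fun a b => A_ s a b - A_ t a b) (c * `|s - t|).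
Local Notation H s t := (step (A_ s) (A_ t)).
Local Notation DD t := (mixedD (A_ t)).

Lemma step_chain : exists2 cD, 0 <= cD & forall s t, `|s| <= r -> `|t| <= r ->
  opb (pbd W) (cD * `|s - t| ^+ 2)
    (fun psi => DD t (psi + H s t psi) - (DD s psi + H s t (DD s psi))).
Proof.
pose V : R := W%:R; have V0 : 0 <= V by exact: ler0n.
pose cH := kA * c + V * V * c + c.
have cH0 : 0 <= cH by rewrite !addr_ge0 // !mulr_ge0.
pose cD := (V + 1) * c * cH + 2 * c * c * (kA + 1) + V * V * 2 * c * c.
have cD0 : 0 <= cD by rewrite !addr_ge0 // !mulr_ge0 // !addr_ge0.
pose cE := 2 * c * c + V * c * cH.
have cE0 : 0 <= cE by rewrite !addr_ge0 // !mulr_ge0.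
exists (cD + cE); first exact: addr_ge0.
move=> s t sr tr K psi hpsi; have [K0 h1 h2] := hpsi; set a := `|s - t|.
have a0 : 0 <= a by exact: normr_ge0.
have ek : bmul (mul_diff (A_ s) (A_ t)) (c * a) by apply: mulB_norm; exact: HL.
have e0 : 0 <= c * a by exact: mulr_ge0.
have [_ g1 g2] := step_bound kA0 c0 HA HL sr tr hpsi.
rewrite -/cH -/a in g1 g2.
have gK0 : 0 <= cH * a * K by rewrite !mulr_ge0.
have aK : 0 <= a ^+ 2 * K := mulr_ge0 (exprn_ge0 2 a0) K0.
split; first by rewrite -mulrA; exact: mulr_ge0 (addr_ge0 cD0 cE0) aK.
  have -> : p1 (DD t (psi + H s t psi) - (DD s psi + H s t (DD s psi))) =
      rem1 (A_ s) (A_ t) psi by apply/funext => v; exact: step_defect1.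
  apply: (@wbnd_le _ _ _ _ (cD * a ^+ 2 * K)).
    by rewrite -mulrA -[leRHS]mulrA (ler_wpM2r aK) // lerDl.
  have -> : cD * a ^+ 2 * K = (V + 1) * (c * a * (cH * a * K)) +
      2 * (c * a * (c * a * ((kA + 1) * K))) + V * (V * (2 * (c * a * (c * a * K)))).
    by rewrite /cD; ring.
  apply: wbndB; first apply: wbndB.
  - exact: wbnd_bs.
  - move=> v vW; case: ifP => v3.
      apply: (rr_bnd e0 ek _ _ v3 vW); first by rewrite mulr_ge0 // addr_ge0.
      move=> w wW; rewrite /dd mulrDl mul1r mulrDl.
      have [w1|w1] := ltnP 1 (size w).
        by apply: le_trans (wbnd_mrg K0 (HA sr) h1 w1 wW) _; rewrite lerDl mulr_ge0 ?wt_ge0.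
      by rewrite mrg_out //; apply: le_trans (h1 w wW) _; rewrite lerDr !mulr_ge0 ?wt_ge0.
    by rewrite cn0 !mulr_ge0 ?wt_ge0 // addr_ge0.
  move=> v vW.
  have -> : V * (V * (2 * (c * a * (c * a * K)))) * wt v =
      V * (V * (2 * (c * a * (c * a * K)) * wt v)) by ring.
  apply: double_sum_bnd => [||i j ji iv]; first by rewrite !mulr_ge0 ?wt_ge0.
    by apply: leq_trans vW; exact: leq_trans (leq_pred _) (leq_pred _).
  apply: (@iter_La_bnd _ _ j _ _ (size v)) => // w wv.
  by apply: (rr_bnd e0 ek K0 h2); rewrite wv // -!ltn_predRL.
have -> : p2 (DD t (psi + H s t psi) - (DD s psi + H s t (DD s psi))) =
    rem2 (A_ s) (A_ t) psi by apply/funext => v; exact: step_defect2.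
apply: (@wbnd_le _ _ _ _ (cE * a ^+ 2 * K)).
  by rewrite -mulrA -[leRHS]mulrA (ler_wpM2r aK) // lerDr.
have -> : cE * a ^+ 2 * K = 2 * (c * a * (c * a * K)) + V * (c * a * (cH * a * K)).
  by rewrite /cE; ring.
apply: wbndB; last exact: wbnd_bp.
apply: wbndN => v vW; case: ifP => v2; first exact: (rr_bnd e0 ek K0 h1).
by rewrite cn0 !mulr_ge0 ?wt_ge0.
Qed.

End ChainBound.

(** * Truncated cochains and the contraction restricted to finitely many degrees *)

(** In degree 0 the chains are the algebra without adjoined unit, so the value at the unit on the
    empty word must vanish. *)
Definition parity_cochain (R : realType) (X : completeNormedModType R[i]) (b : bool)
    (psi : HC X (aplus X)) :=
  supp (fun k => odd k == b) psi /\ val psi [::] (0, 1) = 0.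

Definition truncated (R : realType) (X : completeNormedModType R[i]) (L : nat)
    (A : algebra X) (b : bool) (psi : HC X (aplus X)) :=
  [/\ parity_cochain b psi, supp (fun k => k <= L)%N psi &
      supp (fun k => k <= L)%N (mixedD A psi)].

Section Contraction.
Variables (R : realType) (X : completeNormedModType R[i]).
Local Notation C := R[i].
Local Notation P := (aplus X).
Local Notation E := (HC X P).
Implicit Types (K : R) (psi phi f g : E) (w v : seq X).
Variable N : nat.
Local Notation n := N.+1.
Local Notation V := (FL X P n).
Local Notation dg L := (supp (fun k => k <= L)%N).

Section Guard.
Variables l u : nat.

Lemma guard_good psi :
  good (fun w m => if (l <= size w <= u)%N then val psi w m else 0 : C^o).
Proof.
have [h1 h2 h3] := HCP psi; split=> [m s1 s2 a x y|w a m m'|j].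
- by rewrite !size_cat /=; case: ifP => _; [exact: h1|rewrite mulr0 addr0].
- by case: ifP => _; [exact: h2|rewrite mulr0 addr0].
have [K /bnd_ge0[K' K0 hK]] := h3 j; exists K' => w m wj.
by case: ifP => _; [exact: hK|rewrite cn0 mulr_ge0 // mulr_ge0 ?wt_ge0 ?nrm_ge0].
Qed.

Definition guard psi : E := mkHC (guard_good psi).

Lemma guardE psi w m : val (guard psi) w m = if (l <= size w <= u)%N then val psi w m else 0.
Proof. by []. Qed.

Lemma guard_lin a psi phi : guard (a *: psi + phi) = a *: guard psi + guard phi.
Proof.
apply: HC_ext => w m; rewrite HCE !guardE HCE.
by case: ifP => _ //; rewrite mulr0 addr0.
Qed.

End Guard.

Lemma gop_ext (D : HC X V) (A : algebra X) (M : normedModType C) (B : bimodule A M)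
    (psi phi : HC X M) w m : (N <= size w)%N ->
  (forall w' m', size w' = (size w).+1 -> val psi w' m' = val phi w' m') ->
  val (gop D B psi) w m = val (gop D B phi) w m.
Proof.
move=> Nw h; rewrite !gopE; congr (val D _ _); apply: FL_ext => y x yn.
rewrite (PhiE B psi _ _ _ yn) (PhiE B phi _ _ _ yn) h //.
by rewrite size_cat size_drop yn addSn subnKC.
Qed.

Lemma gop_null (D : HC X V) (A : algebra X) (M : normedModType C) (B : bimodule A M)
    (psi : HC X M) w m : (N <= size w)%N ->
  (forall w' m', size w' = (size w).+1 -> val psi w' m' = 0) -> val (gop D B psi) w m = 0.
Proof.
move=> Nw h; have -> : val (gop D B psi) w m = val (gop D B 0) w m.
  by apply: gop_ext => // w' m' e; rewrite HC0 h.
by rewrite linear0 HC0.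
Qed.

Section Gamma.
Variables (A_ : R -> algebra X) (r kA c LD : R) (D_ : R -> HC X V).
Hypotheses (r0 : 0 < r) (kA0 : 0 <= kA) (c0 : 0 <= c) (LD0 : 0 <= LD).
Hypothesis HA : forall t, `|t| <= r -> bmul (A_ t) kA.
Hypothesis HL : forall s t, `|s| <= r -> `|t| <= r ->
  bmul (fun a b => A_ s a b - A_ t a b) (c * `|s - t|).
Hypothesis hD : forall t, `|t| <= r -> forall w (v : V), size w = n ->
  val (delta (univ_bimodule (A_ t) n) (D_ t)) w v = ev v w (unit_e X).
Hypothesis D_bnd : forall t, `|t| <= r -> bnd (val (D_ t)) N LD.
Hypothesis D_close : forall s t, `|s| <= r -> `|t| <= r ->
  bnd (val (D_ s - D_ t)) N (LD * `|s - t|).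
Local Notation B t := (aplus_bimodule (A_ t)).
Local Notation be t := (delta (B t)).

(** The lower cut makes [gamma] vanish on degrees up to [n]. The upper cut keeps it bounded for a
    seminorm that sees finitely many degrees; [n.+4] is the highest degree in which the homotopy
    formula below needs it. *)
Definition gamma t psi : E := guard n n.+4 (gop (D_ t) (B t) psi).

Lemma gamma_lin t a psi phi : gamma t (a *: psi + phi) = a *: gamma t psi + gamma t phi.
Proof. by rewrite /gamma linearP guard_lin. Qed.

Lemma supp_gamma (S T : nat -> bool) t psi : (forall k, S k.+1 -> T k) -> supp S psi -> supp T (gamma t psi).
Proof.
move=> ST h w m Tw; rewrite guardE; case: ifP => // /andP[lw _].
apply: gop_null => [|w' m' e]; first exact: ltnW.
by rewrite h // e; apply: contra Tw; exact: ST.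
Qed.

Lemma gamma_low t psi : dg n psi -> gamma t psi = 0.
Proof.
move=> h; apply: HC_ext => w m; rewrite HC0 guardE; case: ifP => // /andP[lw _].
apply: gop_null => [|w' m' e]; first exact: ltnW.
by rewrite h // e -ltnNge.
Qed.

(** In degrees from [n.+1] to [n.+3] the cuts have no effect and the formula is [delta_hop]; above
    [n.+3] every term vanishes. *)
Lemma gamma_homotopy t m psi : `|t| <= r -> (m <= n.+3)%N -> dg m psi ->
  let h f := gamma t (f - gamma t (be t f)) in
  dg n (psi - (be t (h psi) + h (be t psi))).
Proof.
move=> tr mn hpsi h w x; rewrite -ltnNge => nw; rewrite HCB HCD.
have dB f g k : dg k f -> dg k g -> dg k (f - g).
  move=> hf hg; have := supp_lin (-1) hg hf.
  by rewrite scaleN1r addrC.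
have dbe f k : dg k f -> dg k.+1 (be t f) by apply: supp_delta => j; rewrite ltnS.
have dga f k : dg k f -> dg k.-1 (gamma t f) by apply: supp_gamma => -[|j] //; case: k.
have [wn|wn] := ltnP n.+3 (size w).
  have h1 : dg m.-1 (h psi) :=  (dga _ _ (dB _ _ _ hpsi (dga _ m.+1 (dbe _ _ hpsi)))).
  have h2 : dg m (h (be t psi)).
    exact: (dga _ m.+1 (dB _ _ _ (dbe _ _ hpsi) (dga _ m.+2 (dbe _ _ (dbe _ _ hpsi))))).
  rewrite [val psi w x]hpsi; last by rewrite -ltnNge; exact: leq_ltn_trans wn.
  rewrite [val (h _) w x]h2; last by rewrite -ltnNge; exact: leq_ltn_trans wn.
  rewrite delta_null ?addr0 ?subr0 // => w' m' e; apply: h1.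
  rewrite -ltnNge; move: (size w') (size w) e wn; clear -mn => k l; lia.
have nw' : (N < size w)%N by exact: ltnW.
have E1 : val (be t (h psi)) w x = val (be t (hop (D_ t) (B t) psi)) w x.
  apply: delta_ext => w' m' e; rewrite guardE.
  have -> : (n <= size w' <= n.+4)%N by rewrite -ltnS e nw -ltnS e; exact: leqW (leqW wn).
  apply: gop_ext => [|w2 m2 e2]; first by rewrite -ltnS e ltnW.
  rewrite !HCB guardE e2 e (ltnW nw) /=.
  by rewrite (leqW wn).
have E2 : val (h (be t psi)) w x = val (hop (D_ t) (B t) (be t psi)) w x.
  rewrite guardE (ltnW nw) (leqW wn) /=.
  apply: gop_ext => [|w2 m2 e2]; first exact: ltnW.
  by rewrite !HCB guardE e2 (leqW (ltnW nw)) ltnS wn.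
by rewrite E1 E2 -HCD (delta_hop (B t) (hD tr)) // subrr.
Qed.

Local Notation W := (n.+4).+2.

(** In degree [n.+4] the operator reads its argument in degree [n.+5], which is still below [W];
    this fixes the choice of [W]. *)
Lemma gamma_lip : lip_family (pbd W) r gamma.
Proof.
have g_range psi K j : (n <= j <= n.+4)%N -> pbd W K psi -> bnd (val psi) j.+1 (2 * K).
  by move=> /andP[_ jn]; apply: bnd_of_pbd.
pose C1 := LD * (kA + 1 + 1) * 2; pose C2 := (LD * (kA + 1 + 1) + LD * c) * 2.
have C10 : 0 <= C1 by rewrite !mulr_ge0 // !addr_ge0.
have C20 : 0 <= C2 by rewrite mulr_ge0 // addr_ge0 ?mulr_ge0 ?addr_ge0.
exists (C1 + C2); first exact: addr_ge0.
move=> s t sr tr; have hk := aplus_bound kA0 (HA tr); have hks := aplus_bound kA0 (HA sr).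
have hc : bimod_close (B s) (B t) (c * `|s - t|).
  by apply: aplus_close (HL sr tr); rewrite mulr_ge0.
split=> K psi hpsi; have K0 := pbd_ge0 hpsi.
  apply: (@pbd_le _ _ _ (C1 * K)); first by rewrite ler_wpM2r // lerDl.
  apply: pbd_of_bnd => [|j jW w m wj]; first exact: mulr_ge0 C10 K0.
  rewrite guardE wj; case: ifP => jn; last first.
    by rewrite cn0; exact: mulr_ge0 (mulr_ge0 C10 K0) (mulr_ge0 (wt_ge0 _) (nrm_ge0 _)).
  have jN : (N <= j)%N by case/andP: jn => + _; exact: ltnW.
  have hb := g_range psi K j jn hpsi.
  have e : (n + (j - N) = j.+1)%N by rewrite addSn subnKC.
  rewrite -e in hb.
  have hDb : bnd (val (D_ t)) (minn N j) LD by rewrite (minn_idPl jN); exact: D_bnd.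
  have := g_bnd hk LD0 hDb (mulr_ge0 (ler0n _ 2) K0) hb m wj.
  by congr (_ <= _ * _); rewrite /C1; ring.
apply: (@pbd_le _ _ _ (C2 * `|s - t| * K)); first by rewrite !ler_wpM2r // lerDr.
apply: pbd_of_bnd => [|j jW w m wj]; first exact: mulr_ge0 (mulr_ge0 C20 (normr_ge0 _)) K0.
rewrite HCB !guardE wj; case: ifP => jn; last first.
  rewrite subrr cn0; apply: mulr_ge0 (mulr_ge0 (wt_ge0 _) (nrm_ge0 _)).
  exact: mulr_ge0 (mulr_ge0 C20 (normr_ge0 _)) K0.
have jN : (N <= j)%N by case/andP: jn => + _; exact: ltnW.
have hb := g_range psi K j jn hpsi.
have := g_close hks hc LD0 (D_bnd tr) (mulr_ge0 LD0 (normr_ge0 _)) (D_close sr tr)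
  (mulr_ge0 (ler0n _ 2) K0) hb jN m wj.
by rewrite HCB; congr (_ <= _ * _); rewrite /C2; ring.
Qed.

End Gamma.

End Contraction.

(** * Isomorphisms of the truncated complexes *)

Section TruncatedComplexes.
Variables (R : realType) (X : completeNormedModType R[i]).
Local Notation C := R[i].
Local Notation P := (aplus X).
Local Notation E := (HC X P).
Implicit Types (K : R) (psi phi : E) (w v : seq X).
Variable N : nat.
Local Notation n := N.+1.
Local Notation W := (n.+4).+2.
Local Notation V := (FL X P n).
Local Notation dg L := (supp (fun k => k <= L)%N).

Lemma parity_lin b a psi phi : parity_cochain b psi -> parity_cochain b phi ->
  parity_cochain b (a *: psi + phi).
Proof.
move=> [s1 z1] [s2 z2]; split; first exact: supp_lin.
by rewrite HCE z1 z2 mulr0 addr0.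
Qed.

Lemma truncated_lin L A b a psi phi : truncated L A b psi -> truncated L A b phi ->
  truncated L A b (a *: psi + phi).
Proof.
move=> [h1 h2 h3] [k1 k2 k3]; split; first exact: parity_lin.
  exact: supp_lin.
have -> : mixedD A (a *: psi + phi) = a *: mixedD A psi + mixedD A phi.
  by rewrite /mixedD !linearP addrACA -scalerDr.
exact: supp_lin.
Qed.

Lemma parity_delta A b psi : parity_cochain b psi ->
  parity_cochain (~~ b) (delta (aplus_bimodule A) psi).
Proof.
move=> [s1 _]; split; last by rewrite deltaE.
by apply: supp_delta s1 => k /eqP <-.
Qed.

Lemma parity_cycB b psi : parity_cochain b psi -> parity_cochain (~~ b) (cycB psi).
Proof.
move=> [s1 _]; split; last exact: p2_cycB.
by apply: supp_cycB s1 => k /= /eqP <-; rewrite negbK.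
Qed.

Lemma parity_step A A' b psi : parity_cochain b psi -> parity_cochain b (step A A' psi).
Proof.
move=> [s1 _]; split; first by apply: supp_step s1 => k //=; rewrite negbK.
by rewrite -[LHS]/(p2 _ _) p2_step.
Qed.

Let W1 k : (k <= n.+1 -> k < W)%N. Proof. lia. Qed.

Variable q : R.
Hypotheses (q1 : q < 1) (q0 : 13 / 16 <= q).
Let hq : 0 <= q < 1. Proof. by rewrite q1 andbT; apply: le_trans q0; rewrite divr_ge0. Qed.

Lemma truncated_null A b psi B : truncated n A b psi ->
  (forall k, pbd W (B * q ^+ k) psi) -> psi = 0.
Proof.
move=> [_ h2 _] h; apply: HC_ext => w m; rewrite HC0.
have [wn|wn] := leqP (size w) n; last by apply: h2; rewrite -ltnNge.
apply: cn0_eq0; apply/eqP; rewrite eq_le cn_ge0 andbT.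
apply: (le0_geometric (q := q) (B := 2 * B * (wt w * nrm m))) => // k.
have := bnd_of_pbd (W1 (leqW wn)) (h k) m erefl; congr (_ <= _); ring.
Qed.

(** The limit exists degree by degree up to [n]. The conditions on parity and on the boundary pass
    to it because evaluation and the differential are bounded for [pbd]. *)
Lemma truncated_complete A b (u : nat -> E) B : (forall k, truncated n A b (u k)) ->
  (forall k, pbd W (B * q ^+ k) (u k.+1 - u k)) ->
  exists l, truncated n A b l /\ exists B', forall k, pbd W (B' * q ^+ k) (l - u k).
Proof.
move=> hu hB.
have B0 : 0 <= B by have := pbd_ge0 (hB 0%N); rewrite expr0 mulr1.
have [|l [l1 l2]] := @good_limit R X P q (2 * B) u (fun k => k <= n)%N hq.
  move=> k w m wn; rewrite -HCB.
  have := bnd_of_pbd (W1 (leqW wn)) (hB k) m erefl.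
  by congr (_ <= _); ring.
have dl : dg n l by move=> w m; exact: l1.
pose B1 := 2 * (2 * B) / (1 - q).
have B10 : 0 <= B1 by rewrite divr_ge0 ?mulr_ge0 // subr_ge0 ltW.
have q_ge0 : 0 <= q by case/andP: hq.
have lu k : pbd W (B1 * q ^+ k) (l - u k).
  apply: pbd_of_bnd => [|j jW w m wj]; first exact: mulr_ge0 B10 (exprn_ge0 k q_ge0).
  rewrite HCB; have [wn|wn] := leqP (size w) n.
    by have := l2 k w m wn; rewrite -/B1; congr (_ <= _); ring.
  have [_ uk _] := hu k.
  rewrite dl -?ltnNge // uk -?ltnNge // subrr cn0.
  exact: mulr_ge0 (mulr_ge0 B10 (exprn_ge0 k q_ge0)) (mulr_ge0 (wt_ge0 _) (nrm_ge0 _)).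
have lim0 f (v : nat -> E) w m B' : (size w < W)%N -> (forall k, val (v k) w m = 0) ->
    (forall k, pbd W (B' * q ^+ k) (f - v k)) -> val f w m = 0.
  move=> wW v0 hf; apply: cn0_eq0; apply/eqP; rewrite eq_le cn_ge0 andbT.
  apply: (le0_geometric (q := q) (B := 2 * B' * (wt w * nrm m))) => // k.
  have := bnd_of_pbd wW (hf k) m erefl; rewrite HCB v0 subr0.
  by congr (_ <= _); ring.
exists l; split; last by exists B1.
split=> //.
  split=> [w m wb|].
    have [wn|wn] := leqP (size w) n; last by rewrite dl // -ltnNge.
    apply: (lim0 l u w m B1 (W1 (leqW wn)) _ lu) => k.
    by have [[uk _] _ _] := hu k; exact: uk.
  apply: (lim0 l u [::] (0, 1) B1 (W1 (leq0n _)) _ lu) => // k.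
  by have [[_ uk] _ _] := hu k.
have [kA kA0 hA] := bilinear_nrm (amulP A).
(* The bound on the differential of a single algebra comes from the constant family on the interval
   of radius 0. *)
have HA0 (t : R) : `|t| <= 0 -> bmul ((fun=> A) t) kA by [].
have HL0 (s t : R) : `|s| <= 0 -> `|t| <= 0 ->
    bmul (fun a b => (fun=> A) s a b - (fun=> A) t a b) (0 * `|s - t|).
  by move=> _ _ x y; rewrite subrr nrm0 !mul0r.
have [c1 c10 h1] := delta_lip W kA0 (lexx 0) HA0 HL0.
have [c2 c20 h2] := @cycB_lip R X W 0.
have z0 : `|0 : R| <= 0 by rewrite normr0.
have hD f K : pbd W K f -> pbd W ((c1 + c2) * K) (mixedD A f).
  move=> hf; rewrite mulrDl; apply: pbdD; first exact: (h1 0 0 z0 z0).1.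
  exact: (h2 0 0 z0 z0).1.
move=> w m; rewrite -ltnNge => nw.
have [wn|wn] := leqP (size w) n.+1; last first.
  have dD : dg n.+1 (mixedD A l).
    rewrite /mixedD -[delta _ _]scale1r; apply: supp_lin.
      by apply: supp_delta dl => k.
    by apply: supp_cycB dl => k /ltnW /leqW.
  by apply: dD; rewrite -ltnNge.
apply: (lim0 (mixedD A l) (fun k => mixedD A (u k)) w m ((c1 + c2) * B1) (W1 wn)) => k.
  by have [_ _ uk] := hu k; apply: uk; rewrite -ltnNge.
have -> : mixedD A l - mixedD A (u k) = mixedD A (l - u k).
  by rewrite /mixedD !linearB opprD addrACA.
by rewrite -mulrA; exact: hD.
Qed.

Section Families.
Variables (A_ : R -> algebra X) (r kA c LD : R) (D_ : R -> HC X V).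
Hypotheses (r0 : 0 < r) (kA0 : 0 <= kA) (c0 : 0 <= c) (LD0 : 0 <= LD).
Hypothesis HA : forall t, `|t| <= r -> bmul (A_ t) kA.
Hypothesis HL : forall s t, `|s| <= r -> `|t| <= r ->
  bmul (fun a b => A_ s a b - A_ t a b) (c * `|s - t|).
Hypothesis hD : forall t, `|t| <= r -> forall w (v : V), size w = n ->
  val (delta (univ_bimodule (A_ t) n) (D_ t)) w v = ev v w (unit_e X).
Hypothesis D_bnd : forall t, `|t| <= r -> bnd (val (D_ t)) N LD.
Hypothesis D_close : forall s t, `|s| <= r -> `|t| <= r ->
  bnd (val (D_ s - D_ t)) N (LD * `|s - t|).

(** The abstract transport with [gamma] as contraction and [step] as [H]; a single constant [cH]
    majorises the size of [step], its cocycle defect and its chain defect. *)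
Theorem truncated_complexes : exists e, 0 < e <= r /\ forall t, `|t| <= e ->
  exists Phi Psi : bool -> E -> E, forall b,
  [/\ forall f, truncated n (A_ 0) b f -> truncated n (A_ t) b (Phi b f) /\ Psi b (Phi b f) = f,
      forall g, truncated n (A_ t) b g -> truncated n (A_ 0) b (Psi b g) /\ Phi b (Psi b g) = g,
      forall a f g, truncated n (A_ 0) b f -> truncated n (A_ 0) b g ->
        Phi b (a *: f + g) = a *: Phi b f + Phi b g &
      forall f, truncated n (A_ 0) b f ->
        mixedD (A_ t) (Phi b f) = Phi (~~ b) (mixedD (A_ 0) f)].
Proof.
have [cD cD0 hcD] := step_chain W kA0 c0 HA HL.
pose cS := kA * c + W%:R * W%:R * c + c.
have cS0 : 0 <= cS by rewrite !addr_ge0 // !mulr_ge0.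
pose cH := cS + c * c + cD.
have cc0 : 0 <= c * c by exact: mulr_ge0.
have cH0 : 0 <= cH := addr_ge0 (addr_ge0 cS0 cc0) cD0.
have k1 : cS <= cH by rewrite /cH -addrA lerDl; exact: addr_ge0.
have k2 : c * c <= cH by rewrite /cH addrAC lerDr; exact: addr_ge0.
have k3 : cD <= cH by rewrite /cH lerDr; exact: addr_ge0.
have ge0 := @pbd_ge0 R X W.
apply: (@truncated_isomorphisms R E (pbd W) ge0 (@pbd_le R X W) (@pbdD R X W) (@pbdN R X W)
  (@pbd0 R X W) (@pbdZ R X W) (@pbd_ex R X W) r q n r0 q1 q0
  (fun t => delta (aplus_bimodule (A_ t))) (gamma A_ D_) (@cycB R X)
  (fun s t => step (A_ s) (A_ t)) (fun m => dg m) (@parity_cochain R X) _ _ _ _ _ _ _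
  _ _ _ _ _ _ _ _ _ _ _ _ _ _ cH cH0).
- by move=> t a f g; exact: linearP.
- exact: gamma_lin.
- by move=> a f g; exact: linearP.
- by move=> s t a f g; exact: step_linear.
- by move=> m a f g; exact: supp_lin.
- by move=> b a f g; exact: parity_lin.
- by move=> m k f mk; apply: supp_sub => j jm; exact: leq_trans mk.
- by move=> t m f; apply: supp_delta => j.
- by move=> m f; apply: supp_cycB => j; case: m.
- by move=> t m f; apply: supp_gamma => j; case: m.
- by move=> s t m f; apply: supp_step => j jm //; exact: leqW (leqW jm).
- by move=> t b f; exact: parity_delta.
- exact: parity_cycB.
- move=> t b f [s1 _]; split; last by rewrite guardE.
  by apply: supp_gamma s1 => k /= /eqP <-; rewrite negbK.
- by move=> s t b f; exact: parity_step.
- exact: gamma_low.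
- by move=> t f _; exact: mixedDD.
- move=> t m f tr mn hf; exact: (gamma_homotopy hD tr mn hf).
- exact: delta_lip kA0 c0 HA HL.
- exact: (gamma_lip kA0 c0 LD0 HA HL D_bnd D_close).
- exact: cycB_lip.
- move=> s t sr tr; apply: (opb_le ge0 (@pbd_le R X W) _ (step_bound kA0 c0 HA HL sr tr)).
  by rewrite ler_wpM2r.
- by move=> s f; exact: step_id.
- move=> s t u sr tr ur; apply: (opb_le ge0 (@pbd_le R X W) _ (step_cocycle c0 HL sr tr ur)).
  by rewrite !ler_wpM2r.
- move=> s t sr tr; apply: (opb_le ge0 (@pbd_le R X W) _ (hcD s t sr tr)).
  by rewrite ler_wpM2r // exprn_ge0.
- by move=> b s u B _; exact: truncated_complete.
- by move=> b s f B; exact: truncated_null.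
Qed.

End Families.

End TruncatedComplexes.

(** * Every finite cocycle is cohomologous to a truncated one *)

Section Reduction.
Variables (R : realType) (X : completeNormedModType R[i]).
Local Notation C := R[i].
Local Notation P := (aplus X).
Local Notation E := (HC X P).
Implicit Types (psi phi : E) (w v : seq X).
Variables (A : algebra X) (N : nat).
Local Notation n := N.+1.
Local Notation V := (FL X P n).
Local Notation B := (aplus_bimodule A).
Local Notation dg L := (supp (fun k => k <= L)%N).
Variable D : HC X V.
Hypothesis hD : forall w (v : V), size w = n ->
  val (delta (univ_bimodule A n) D) w v = ev v w (unit_e X).

Definition finite_cochain b psi := parity_cochain b psi /\ exists m, dg m psi.

Lemma truncated_finite L b psi : truncated L A b psi -> finite_cochain b psi.
Proof. by case=> h1 h2 _; split=> //; exists L. Qed.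

Lemma parity_mixedD b psi : parity_cochain b psi -> parity_cochain (~~ b) (mixedD A psi).
Proof.
move=> h; have := parity_lin 1 (parity_delta A h) (parity_cycB h).
by rewrite scale1r.
Qed.

Lemma dg_mixedD m psi : dg m psi -> dg m.+1 (mixedD A psi).
Proof.
move=> h; rewrite /mixedD -[delta _ _]scale1r; apply: supp_lin.
  by apply: supp_delta h => k.
by apply: supp_cycB h => k /ltnW /leqW.
Qed.

Lemma finite_mixedD b psi : finite_cochain b psi -> finite_cochain (~~ b) (mixedD A psi).
Proof.
by move=> [h [m hm]]; split; [exact: parity_mixedD|exists m.+1; exact: dg_mixedD].
Qed.

Lemma finite_lin b a psi phi : finite_cochain b psi -> finite_cochain b phi ->
  finite_cochain b (a *: psi + phi).
Proof.
move=> [h [m hm]] [k [l kl]]; split; first exact: parity_lin.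
exists (maxn m l); apply: supp_lin; first by apply: supp_sub hm => j jm; rewrite leq_max jm.
by apply: supp_sub kl => j jm; rewrite leq_max jm orbT.
Qed.

Lemma finiteB b psi phi : finite_cochain b psi -> finite_cochain b phi ->
  finite_cochain b (psi - phi).
Proof. by move=> h k; rewrite addrC -scaleN1r; exact: finite_lin. Qed.

(** B lowers the degree, so the top component of [psi], in degree [m.+1], is a Hochschild cocycle,
    and [gop] gives a primitive of it. Subtracting the boundary of this primitive, cut down to
    degree [m], removes the top component, while its image under B lies in lower degrees. *)
Lemma top_reduction b m psi : (n <= m)%N -> parity_cochain b psi -> dg m.+1 psi ->
  dg n (mixedD A psi) ->
  exists phi, [/\ finite_cochain (~~ b) phi, parity_cochain b (psi - mixedD A phi) &
    dg m (psi - mixedD A phi)].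
Proof.
move=> nm hp hm hn; pose phi := guard m m (gop D B psi); exists phi.
have Nm : (N <= m)%N by exact: ltnW.
have phi_dg : dg m phi.
  by move=> w x; rewrite -ltnNge guardE => mw; rewrite (leqNgt (size w)) mw andbF.
have phi_par : parity_cochain (~~ b) phi.
  have [s1 _] := hp; split=> [w x wb|]; rewrite guardE /=; last first.
    by case: ifP => //; case: m nm {hm phi phi_dg Nm}.
  case: ifP => // /andP[mw _]; apply: gop_null => [|w' x' e]; first exact: leq_trans Nm mw.
  by apply: s1; rewrite e /=; move: wb; case: odd; case: (b).
have fphi : finite_cochain (~~ b) phi by split=> //; exists m.
split=> //.
  rewrite addrC -scaleN1r; apply: parity_lin => //; rewrite -[b]negbK.
  exact: parity_mixedD.
move=> w x; rewrite -ltnNge => mw; rewrite HCB.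
have hB k f : dg k f -> (k <= size w)%N -> val (cycB f) w x = 0.
  move=> hf kw; have := @supp_cycB _ _ _ (fun j => j.+1 <= k)%N f (fun j => id) hf.
  by apply; rewrite -leqNgt.
rewrite HCD (hB _ _ phi_dg (ltnW mw)) addr0.
have [wm|wm] := leqP (size w) m.+1; last first.
  rewrite hm -?ltnNge // delta_null ?subrr // => w' x' e; apply: phi_dg.
  by rewrite -ltnNge -ltnS e.
have ew : size w = m.+1 by apply/eqP; rewrite eqn_leq wm.
have -> : val (delta B phi) w x = val (delta B (gop D B psi)) w x.
  apply: delta_ext => w' x' e; rewrite guardE.
  have -> : size w' = m by apply/eqP; rewrite -eqSS e ew.
  by rewrite leqnn.
suff h0 w' x' : size w' = m.+2 -> val (delta B psi) w' x' = 0.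
  by rewrite (delta_gop hD x h0 ew (leqW nm)) subrr.
move=> e; have := hn w' x'; rewrite -ltnNge e ltnS (leq_trans nm) // => /(_ isT).
rewrite HCD.
have := @supp_cycB _ _ _ (fun j => j.+1 <= m.+1)%N psi (fun j => id) hm w' x'.
by rewrite -leqNgt e ltnS leqnSn => -> //; rewrite addr0.
Qed.

Lemma reduction b psi : finite_cochain b psi -> dg n (mixedD A psi) ->
  exists2 phi, finite_cochain (~~ b) phi & truncated n A b (psi - mixedD A phi).
Proof.
move=> [hp [m hm]] hn.
have : dg (n + m) psi by apply: supp_sub hm => k km; rewrite (leq_trans km) // leq_addl.
elim: m psi hp {hm} hn => [|m IH] psi hp hn hm.
  exists 0.
    split; last by exists 0%N => w x _; rewrite HC0.
    by split=> [w x _|]; rewrite HC0.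
  by rewrite /mixedD !linear0 addr0 subr0; split=> //; rewrite addn0 in hm.
rewrite addnS in hm; have [phi [h1 h2 h3]] := top_reduction (leq_addr _ _) hp hm hn.
have DB f g : mixedD A (f - g) = mixedD A f - mixedD A g.
  by rewrite /mixedD !linearB opprD addrACA.
have [|phi' k1 k2] := IH _ h2 _ h3; first by rewrite DB mixedDD subr0.
exists (1 *: phi + phi'); first exact: finite_lin.
rewrite scale1r; have -> : mixedD A (phi + phi') = mixedD A phi + mixedD A phi'.
  by rewrite /mixedD !linearD addrACA.
by rewrite opprD addrA.
Qed.

End Reduction.

(** * Forms on words against the cochains that define HP *)

Section Correspondence.
Variables (R : realType) (X : completeNormedModType R[i]).
Local Notation C := R[i].
Local Notation P := (aplus X).
Local Notation E := (HC X P).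
Implicit Types (psi : E) (w v : seq X).

Definition in_lead n : lead X n -> P :=
  match n with 0%N => fun x => (x, 0) | _.+1 => id end.

Lemma in_lead_linear n : linear (@in_lead n).
Proof. by case: n => [|n] // a x y; exact: inl_lin. Qed.

Lemma in_lead_norm n x : `|@in_lead n x| = `|x|.
Proof. by case: n x => [|n] x //; exact: aplus_inl_norm. Qed.

Lemma to_leadK n x : to_lead n (@in_lead n x) = x.
Proof. by case: n x. Qed.

Lemma in_lead1 n x : (@in_lead n x).1 = from_lead x.
Proof. by case: n x. Qed.

Lemma in_lead_inl n (y : X) : in_lead (to_lead n ((y, 0) : P)) = (y, 0).
Proof. by case: n. Qed.

Lemma in_leadK n (x : P) : (0 < n)%N -> in_lead (to_lead n x) = x.
Proof. by case: n. Qed.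

Definition toC_fun n psi (x : lead X n) (a : 'I_n -> X) : C^o :=
  val psi (codom a) (in_lead x).

Lemma toC_subproof n psi :
  toC_fun (n := n) psi \in submodule_pred (Submodule (@bounded_cochain_closed C X n)).
Proof.
rewrite inE; have [h1 h2 h3] := HCP psi; split=> [a c x y|x a i c y z|].
- by rewrite /toC_fun in_lead_linear h2.
- by rewrite /toC_fun !codom_upd h1.
have [K hK] := h3 n; exists K%:C => x a.
have := hK (codom a) (in_lead x) (size_codomI a).
rewrite -in_lead_norm prod_codom /toC_fun cnE !nrmE -!rmorphM lecR.
by rewrite [wt _ * _]mulrC mulrA.
Qed.

Definition toC n psi : cochain X n := subm_mk (toC_subproof n psi).

Lemma toCE n psi x a : val (toC n psi) x a = val psi (codom a) (in_lead x).
Proof. by []. Qed.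

Lemma cochain_ext n (f g : cochain X n) : (forall x a, val f x a = val g x a) -> f = g.
Proof. by move=> h; apply: val_inj; apply/funext => x; apply/funext => a. Qed.

Lemma toC_lin n a psi phi : toC n (a *: psi + phi) = a *: toC n psi + toC n phi.
Proof. by apply: cochain_ext => x u; rewrite cochain_valP !toCE HCE. Qed.

Lemma toC_null n psi : (forall w m, size w = n -> val psi w m = 0) -> toC n psi = 0.
Proof.
by move=> h; apply: cochain_ext => x a; rewrite toCE h ?size_codomI.
Qed.

Lemma toC_delta (A : algebra X) n psi :
  toC n.+1 (delta (aplus_bimodule A) psi) = cyc_b A n (toC n psi).
Proof.
apply: cochain_ext => x a; rewrite toCE deltaE /delta_fun size_codomI.
have -> : val (cyc_b A n (toC n psi)) x a = b_fun A (val (toC n psi)) x a.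
  exact: b_valE.
rewrite /b_fun !toCE !in_lead_inl -[in_lead x]/x.
rewrite big_nat_recr //= big_nat_recl //= big_mkord expr0 mul1r.
congr (_ + _ + _).
- rewrite /fpsi /face /= -codom_lift0; congr (val psi _ (aract A x _)).
  by rewrite -nth0 -[0%N]/(val (@ord0 n)) nth_codom.
- apply: eq_bigr => j _; congr (_ * _).
  rewrite /fpsi face_mid ?size_codomI ?ltnS ?ltn_ord //.
  rewrite -[RHS]/(val psi (codom (mul_at A j a)) (in_lead (to_lead n x))) codom_mul_at.
  by rewrite in_leadK // (leq_ltn_trans _ (ltn_ord j)).
congr (_ * _).
rewrite /fpsi /face /= size_codomI eqxx /= -codom_lift_max.
congr (val psi _ (alact A _ x)).
by rewrite -nth_last size_codomI -[n.+1.-1]/(val (@ord_max n)) nth_codom.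
Qed.

Lemma codom_rot n (j : 'I_n.+1) (a : 'I_n.+1 -> X) :
  codom (rot_arg j a) = rot j (codom a).
Proof.
apply: codom_ext => [|i]; first by rewrite size_rot size_codomI.
rewrite /rot_arg -(nth_codom a (i + j)) /= /rot nth_cat size_drop size_codomI.
have [hi hj] := (ltn_ord i, ltn_ord j); case: ltnP => h.
  by rewrite nth_drop modn_small ?[(j + i)%N]addnC //; lia.
rewrite nth_take; last by lia.
congr nth; have -> : (i + j = (i - (n.+1 - j)) + n.+1)%N by lia.
by rewrite modnDr modn_small //; lia.
Qed.

Lemma iter_rotr k w : (k <= size w)%N -> iter k (rotr 1) w = rot (size w - k) w.
Proof.
move=> kw; have rotE j (s : seq X) : (j <= size s)%N -> iter j (rot 1) s = rot j s.
  elim: j => [_|j IH h]; first by rewrite rot0.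
  by rewrite iterS IH ?(ltnW h) // -rotS.
have su j (s : seq X) : size (iter j (rotr 1) s) = size s.
  by elim: j => //= j IH; rewrite size_rotr.
have rotrK1 j (s : seq X) : iter j (rot 1) (iter j (rotr 1) s) = s.
  by elim: j s => // j IH s; rewrite iterSr [X in rot 1 X]iterS rotrK.
by have := rotrK1 k w; rewrite rotE ?su // => h; rewrite -[LHS](rotK k) h /rotr.
Qed.

Lemma codom_cons n (y : X) (a : 'I_n -> X) : codom (cons_arg y a) = y :: codom a.
Proof.
apply: codom_ext => [|i]; first by rewrite /= size_codomI.
rewrite /cons_arg; have [j ->|->] := unliftP ord0 i; last by [].
by rewrite /= nth_codom.
Qed.

Lemma toC_cycB n psi : toC n (cycB psi) = cyc_B X n (toC n.+1 psi).
Proof.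
apply: cochain_ext => x a; rewrite toCE.
have -> : val (cyc_B X n (toC n.+1 psi)) x a = B_fun (val (toC n.+1 psi)) x a.
  exact: B_valE.
have -> : B_fun (val (toC n.+1 psi)) x a =
    \sum_(k < n.+1) (-1) ^+ (k * n) * p2 psi (rot k (from_lead x :: codom a)).
  by apply: eq_bigr => k _; rewrite -codom_cons -codom_rot.
rewrite pE p2_cycB mulr0 addr0 p1_cycB in_lead1 /Na [size _]/= size_codomI.
(* Powers of λ rotate to the right and [rot_arg] rotates to the left; the index is negated modulo
   [n.+1]. *)
rewrite [RHS](reindex_inj (@oppr_inj _)); apply: eq_bigr => k _.
rewrite iter_La_rot [size _]/= size_codomI.
have kn : (k <= size (from_lead x :: codom a))%N by rewrite /= size_codomI ltnW.
rewrite iter_rotr // [size _]/= size_codomI.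
have [->|k0] := eqVneq k ord0; first by rewrite oppr0 /= rot0 rot_oversize //= size_codomI.
have kv : (0 < k)%N by rewrite lt0n; apply: contraNneq k0 => e; apply/eqP/val_inj.
have ev : nat_of_ord (- k) = (n.+1 - k)%N.
  by rewrite /= modn_small // ltn_subrL kv.
rewrite ev; congr (_ * _); rewrite -[LHS]signr_odd -[RHS]signr_odd !oddM oddB ?(ltnW (ltn_ord k)) //=.
by case: (odd n); case: (odd k).
Qed.

Section Families.
(** [e] enumerates the degrees of parity [b]: it will be [double] or its successor. *)
Variables (e : nat -> nat) (b : bool).
Hypotheses (eb : forall k, odd (e k) = b) (ek : forall k, odd k = b -> e k./2 = k)
  (eh : forall k, (e k)./2 = k) (e_ge : forall k, (k <= e k)%N).
Local Notation CP := (dsum (fun k => cochain X (e k))).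
Implicit Types phi : CP.

Definition corresponds phi psi := forall k, val phi k = toC (e k) psi.

Lemma corresponds_lin a phi psi phi' psi' : corresponds phi psi -> corresponds phi' psi' ->
  corresponds (a *: phi + phi') (a *: psi + psi').
Proof. by move=> h h' k; rewrite subm_dprodP h h' toC_lin. Qed.

(** Parity disposes of the words of the other lengths, and the normalisation in degree 0 of the
    value at the unit, which a cochain on the algebra does not see. *)
Lemma corresponds_null psi : parity_cochain b psi -> corresponds 0 psi -> psi = 0.
Proof.
move=> [h1 h2] h; apply: HC_ext => w [x c]; rewrite HC0.
have [wb|wb] := boolP (odd (size w) == b); last exact: h1.
have hz : toC (e (size w)./2) psi = 0 by rewrite -h.
rewrite (ek (eqP wb)) in hz.
have hv (y : lead X (size w)) : val psi w (in_lead y) = 0.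
  have := congr1 (fun f : cochain X (size w) => val f y (fun i => nth 0 w i)) hz.
  by rewrite toCE codom_nth // raddf0.
have [w0|w0] := posnP (size w); last by rewrite -(in_leadK ((x, c) : P) w0) hv.
have {}hv (y : X) : val psi [::] ((y, 0) : P) = 0.
  by move: hv; rewrite (size0nil w0) => hv; exact: hv.
rewrite (size0nil w0).
have -> : ((x, c) : P) = c *: ((0, 1) : P) + (x, 0).
  by congr pair; rewrite /= ?scaler0 ?add0r // addr0; symmetry; exact: mulr1.
by rewrite HC_modD HC_modZ h2 mulr0 add0r hv.
Qed.

Lemma finite_corresponds psi : finite_cochain b psi -> exists phi, corresponds phi psi.
Proof.
move=> [_ [m hm]].
have hf : (fun k => toC (e k) psi : cochain X (e k)) \in
    submodule_pred (Submodule (finsupp_closed (fun k => cochain X (e k)))).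
  rewrite inE; exists m.+1 => k mk; apply: toC_null => w x we; apply: hm.
  by rewrite -ltnNge we (leq_trans mk).
by exists (subm_mk hf).
Qed.

Definition word_fun n (c : cochain X n) w (m : P) : C^o :=
  if size w == n then val c (to_lead n m) (fun i : 'I_n => nth 0 w i) else 0.

Lemma word_good n (c : cochain X n) : good (word_fun c).
Proof.
have [h1 h2 _] := cochainP c; have [K K0 hK] := bounded_cochain_bound (cochainP c).
split=> [m s1 s2 a x y|w a m m'|j].
- rewrite /word_fun !size_cat /=; case: eqP => [en|]; last by rewrite mulr0 addr0.
  have [d [j hj]] := nth_upd en; rewrite !hj.
  exact: h2.
- rewrite /word_fun; case: ifP => _; last by rewrite mulr0 addr0.
  by rewrite to_lead_linear h1.
exists (cn K) => w m wj; rewrite /word_fun; case: eqP => wn; last first.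
  by rewrite cn0 !mulr_ge0 ?cn_ge0 ?wt_ge0 ?nrm_ge0.
have := hK (to_lead n m) (fun i => nth 0 w i); rewrite prod_codom (codom_nth wn) => h.
rewrite -lecR -cnE; apply: le_trans h _.
rewrite !rmorphM /= -cnE (ger0_norm K0) -nrmE ler_wpM2l // mulrC.
by rewrite ler_wpM2l ?to_lead_norm // -[0]/(0%:C) lecR wt_ge0.
Qed.

Lemma word_unit n (c : cochain X n) : n = 0%N -> word_fun c [::] (0, 1) = 0.
Proof.
move=> n0; subst n; rewrite /word_fun eqxx; have [h1 _ _] := cochainP c.
have := h1 (fun i => nth 0 [::] i) (-1) 0 0.
by rewrite scaler0 addr0 scaleN1r addNr.
Qed.

Definition words_fun (c : forall k, cochain X (e k)) w m : C^o :=
  if odd (size w) == b then word_fun (c (size w)./2) w m else 0.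

Lemma words_good c : good (words_fun c).
Proof.
split=> [m s1 s2 a x y|w a m m'|j].
- rewrite /words_fun !size_cat /=; case: ifP => _; last by rewrite mulr0 addr0.
  by have [h _ _] := word_good (c (size s1 + (size s2).+1)./2); exact: h.
- rewrite /words_fun; case: ifP => _; last by rewrite mulr0 addr0.
  by have [_ h _] := word_good (c (size w)./2); exact: h.
have [_ _ /(_ j)[K /bnd_ge0[L L0 hL]]] := word_good (c j./2); exists L => w m wj.
rewrite /words_fun wj; case: ifP => _; first exact: hL.
by rewrite cn0 !mulr_ge0 ?wt_ge0 ?nrm_ge0.
Qed.

Lemma corresponds_finite phi : exists2 psi, finite_cochain b psi & corresponds phi psi.
Proof.
exists (mkHC (words_good (val phi))).
  split; first split => [w m wb|].
  - by rewrite -[LHS]/(words_fun _ _ _) /words_fun (negPf wb).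
  - rewrite -[LHS]/(words_fun (val phi) [::] (0, 1)) /words_fun; case: ifP => // b0.
    exact: (@word_unit (e 0) (val phi 0%N) (@ek 0%N (eqP b0))).
  have := valP phi; rewrite inE => -[N hN]; exists N.*2.+1 => w m; rewrite -ltnNge => Nw.
  rewrite -[LHS]/(words_fun _ _ _) /words_fun hN; last first.
    by rewrite -(doubleK N); apply: half_leq; exact: ltnW (ltnW Nw).
  by rewrite /word_fun; case: ifP => // _; case: ifP.
move=> k; apply: cochain_ext => x a.
rewrite toCE -[RHS]/(words_fun _ _ _) /words_fun size_codomI eb eqxx eh /word_fun.
rewrite size_codomI eqxx to_leadK; congr (val _ x _); apply/funext => i.
by rewrite nth_codom.
Qed.

End Families.

Section Cyclic.
Variable A : algebra X.

Lemma corresponds_d0 (phi : CP0 X) psi :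
  @corresponds double phi psi -> @corresponds (fun k => k.*2.+1) (d0 A phi) (mixedD A psi).
Proof.
move=> h k; rewrite -[LHS]/(cyc_b A k.*2 (val phi k) + cyc_B X k.*2.+1 (val phi k.+1)).
rewrite !h -toC_delta -toC_cycB /mixedD.
by rewrite -[delta _ psi]scale1r toC_lin !scale1r.
Qed.

Lemma corresponds_d1 (phi : CP1 X) psi :
  @corresponds (fun k => k.*2.+1) phi psi -> @corresponds double (d1 A phi) (mixedD A psi).
Proof.
move=> h [|k].
  rewrite -[LHS]/(cyc_B X 0 (val phi 0%N)) h -toC_cycB.
  apply: cochain_ext => x a; rewrite !toCE HCD delta_null ?add0r // => w m.
  by rewrite size_codomI.
rewrite -[LHS]/(cyc_b A k.*2.+1 (val phi k) + cyc_B X k.*2.+2 (val phi k.+1)).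
rewrite !h -toC_delta -toC_cycB /mixedD.
by rewrite -[delta _ psi]scale1r toC_lin !scale1r.
Qed.

End Cyclic.

End Correspondence.

(** * Isomorphisms of cohomology induced by linear relations *)

Section RelationIso.
Variables (K : fieldType) (U V W U' V' W' : lmodType K).
Variables (f : {linear U -> V}) (g : {linear V -> W}).
Variables (f' : {linear U' -> V'}) (g' : {linear V' -> W'}).
Hypotheses (gf : forall u, g (f u) = 0) (gf' : forall u, g' (f' u) = 0).
Variable Rl : V -> V' -> Prop.
Hypothesis Rl_lin : forall a x y x' y', Rl x x' -> Rl y y' -> Rl (a *: x + y) (a *: x' + y').
Hypothesis Rl_left : forall x, g x = 0 ->
  exists u x', [/\ Rl (x - f u) x' & g' x' = 0].
Hypothesis Rl_right : forall x', g' x' = 0 ->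
  exists u' x, [/\ Rl x (x' - f' u') & g x = 0].
Hypothesis Rl_bound : forall x x', Rl x x' -> (exists u, x = f u) <-> (exists u', x' = f' u').

Let H := cohomology f g.
Let H' := cohomology f' g'.
Let Q (c : H) (c' : H') := exists (x : subm (kerm g)) (x' : subm (kerm g')),
  [/\ c = qpi (imm f g) x, c' = qpi (imm f' g') x' & Rl (val x) (val x')].

Let qpi_lin (K0 : fieldType) (V0 : lmodType K0) (S : submodule V0) a x y :
  qpi S (a *: x + y) = a *: qpi S x + qpi S y.
Proof.
by rewrite -[RHS]/(qadd (qscale a (qpi S x)) (qpi S y)) qpiZ qpiD.
Qed.

Let ker_mk x : g x = 0 -> x \in submodule_pred (kerm g).
Proof. by move=> gx; rewrite inE gx. Qed.
Let ker_mk' x : g' x = 0 -> x \in submodule_pred (kerm g').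
Proof. by move=> gx; rewrite inE gx. Qed.
Let ker_val (x : subm (kerm g)) : g (val x) = 0.
Proof. by have := valP x; rewrite inE => /eqP. Qed.
Let ker_val' (x : subm (kerm g')) : g' (val x) = 0.
Proof. by have := valP x; rewrite inE => /eqP. Qed.

Let Q_lin a c d c' d' : Q c c' -> Q d d' -> Q (a *: c + d) (a *: c' + d').
Proof.
move=> [x [x' [-> -> h]]] [y [y' [-> -> k]]]; exists (a *: x + y), (a *: x' + y').
rewrite !qpi_lin; split=> //.
have -> : val (a *: x + y) = a *: val x + val y by [].
have -> : val (a *: x' + y') = a *: val x' + val y' by [].
exact: Rl_lin.
Qed.

Let Q_left c : exists c', Q c c'.
Proof.
have [x ->] := qpi_surj c.
have [u [x' [h k]]] := Rl_left (ker_val x).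
have gx : g (val x - f u) = 0 by rewrite linearB ker_val gf subrr.
exists (qpi _ (subm_mk (ker_mk' k))), (subm_mk (ker_mk gx)), (subm_mk (ker_mk' k)).
split=> //; apply/qpiP; rewrite inE; exists u.
have -> : val (x - subm_mk (ker_mk gx)) = val x - (val x - f u) by [].
by rewrite opprB addrC subrK.
Qed.

Let Q_right c' : exists c, Q c c'.
Proof.
have [x' ->] := qpi_surj c'.
have [u [x [h k]]] := Rl_right (ker_val' x').
have gx : g' (val x' - f' u) = 0 by rewrite linearB ker_val' gf' subrr.
exists (qpi _ (subm_mk (ker_mk k))), (subm_mk (ker_mk k)), (subm_mk (ker_mk' gx)).
split=> //; apply/qpiP; rewrite inE; exists u.
have -> : val (x' - subm_mk (ker_mk' gx)) = val x' - (val x' - f' u) by [].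
by rewrite opprB addrC subrK.
Qed.

Let qpi0P (K0 : fieldType) (V0 : lmodType K0) (S : submodule V0) x :
  qpi S x = 0 <-> x \in submodule_pred S.
Proof. by rewrite -[0]/(qpi S 0) qpiP subr0. Qed.

Let Q_zero c c' : Q c c' -> c = 0 <-> c' = 0.
Proof.
move=> [x [x' [-> -> h]]]; rewrite !qpi0P !inE.
by have [h1 h2] := Rl_bound h; split.
Qed.

(** The relation descends to classes. Totality up to coboundaries on both sides makes it total
    there, and since coboundaries are related only to coboundaries it is single-valued in both
    directions, hence the graph of an isomorphism. *)
Lemma lin_iso_of_relation : lin_iso (cohomology f g) (cohomology f' g').
Proof.
have Q_fun c c1 c2 : Q c c1 -> Q c c2 -> c1 = c2.
  move=> h1 h2; apply/eqP; rewrite -subr_eq0; apply/eqP.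
  have := Q_lin (-1) h2 h1; rewrite !scaleN1r addNr addrC => h.
  exact/(Q_zero h).
have Q_inj c1 c2 c' : Q c1 c' -> Q c2 c' -> c1 = c2.
  move=> h1 h2; apply/eqP; rewrite -subr_eq0; apply/eqP.
  have := Q_lin (-1) h2 h1; rewrite !scaleN1r addNr addrC => h.
  exact/(Q_zero h).
have /choice[F hF] := Q_left; have /choice[G hG] := Q_right.
have F_lin : linear F by move=> a c d; apply: Q_fun (hF _) (Q_lin a (hF c) (hF d)).
pose Fl := GRing.isLinear.Build K H H' *:%R F F_lin.
pose FL : {linear H -> H'} := HB.pack F Fl.
exists FL; exists G => c; first exact: Q_inj (hG _) (hF c).
exact: Q_fun (hF _) (hG c).
Qed.

End RelationIso.

(** * From truncated complexes to HP *)

Section HPiso.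
Variables (R : realType) (X : completeNormedModType R[i]).
Local Notation C := R[i].
Local Notation P := (aplus X).
Local Notation E := (HC X P).
Implicit Types (psi om : E).
Variables (A A' : algebra X) (N : nat).
Local Notation n := N.+1.
Local Notation V := (FL X P n).
Variables D D' : HC X V.
Hypothesis hD : forall w (v : V), size w = n ->
  val (delta (univ_bimodule A n) D) w v = ev v w (unit_e X).
Hypothesis hD' : forall w (v : V), size w = n ->
  val (delta (univ_bimodule A' n) D') w v = ev v w (unit_e X).
Variables Phi Psi : bool -> E -> E.
Hypothesis hPhi : forall b,
  [/\ forall f, truncated n A b f -> truncated n A' b (Phi b f) /\ Psi b (Phi b f) = f,
      forall g, truncated n A' b g -> truncated n A b (Psi b g) /\ Phi b (Psi b g) = g,
      forall a f g, truncated n A b f -> truncated n A b g ->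
        Phi b (a *: f + g) = a *: Phi b f + Phi b g &
      forall f, truncated n A b f -> mixedD A' (Phi b f) = Phi (~~ b) (mixedD A f)].

Let Phi_T b f : truncated n A b f -> truncated n A' b (Phi b f).
Proof. by have [h _ _ _] := hPhi b => /h[]. Qed.
Let PhiK b f : truncated n A b f -> Psi b (Phi b f) = f.
Proof. by have [h _ _ _] := hPhi b => /h[]. Qed.
Let Psi_T b f : truncated n A' b f -> truncated n A b (Psi b f).
Proof. by have [_ h _ _] := hPhi b => /h[]. Qed.
Let PsiK b f : truncated n A' b f -> Phi b (Psi b f) = f.
Proof. by have [_ h _ _] := hPhi b => /h[]. Qed.
Let Phi_D b f : truncated n A b f -> mixedD A' (Phi b f) = Phi (~~ b) (mixedD A f).
Proof. by have [_ _ _ h] := hPhi b => /h. Qed.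

Let T0 (B : algebra X) b : truncated n B b 0.
Proof.
have z w m : val (0 : E) w m = 0 by exact: HC0.
split=> [|w m _|w m _]; last by rewrite /mixedD !linear0 addr0 z.
  by split=> [w m _|]; exact: z.
exact: z.
Qed.
Let Phi0 b : Phi b 0 = 0.
Proof.
have [_ _ h _] := hPhi b; have := h (-1) 0 0 (T0 A b) (T0 A b).
by rewrite scaler0 addr0 scaleN1r addNr.
Qed.
Let DB (B : algebra X) f g : mixedD B (f - g) = mixedD B f - mixedD B g.
Proof. by rewrite /mixedD !linearB opprD addrACA. Qed.
Let T_D (B : algebra X) b f : truncated n B b f -> truncated n B (~~ b) (mixedD B f).
Proof.
move=> [h1 h2 h3]; split=> //; first exact: parity_mixedD.
by rewrite mixedDD => w m _; rewrite HC0.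
Qed.

Section OneParity.
Variables (e e' : nat -> nat) (b : bool).
Hypotheses (eb : forall k, odd (e k) = b) (ek : forall k, odd k = b -> e k./2 = k)
  (eh : forall k, (e k)./2 = k) (e_ge : forall k, (k <= e k)%N).
Hypotheses (eb' : forall k, odd (e' k) = ~~ b) (ek' : forall k, odd k = ~~ b -> e' k./2 = k)
  (eh' : forall k, (e' k)./2 = k) (e_ge' : forall k, (k <= e' k)%N).
Local Notation CP := (dsum (fun k => cochain X (e k))).
Local Notation CP' := (dsum (fun k => cochain X (e' k))).
Variables (dB dB' : {linear CP' -> CP}) (dF dF' : {linear CP -> CP'}).
Hypotheses
  (hB : forall phi psi, corresponds phi psi -> corresponds (dB phi) (mixedD A psi))
  (hB' : forall phi psi, corresponds phi psi -> corresponds (dB' phi) (mixedD A' psi))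
  (hF : forall phi psi, corresponds phi psi -> corresponds (dF phi) (mixedD A psi))
  (hF' : forall phi psi, corresponds phi psi -> corresponds (dF' phi) (mixedD A' psi)).

Let c_fun (i : nat -> nat) (phi phi' : dsum (fun k => cochain X (i k))) psi :
  corresponds phi psi -> corresponds phi' psi -> phi = phi'.
Proof.
move=> h h'; apply: val_inj; apply: functional_extensionality_dep => k.
by rewrite h h'.
Qed.

Let c0 (i : nat -> nat) : corresponds (0 : dsum (fun k => cochain X (i k))) 0.
Proof. by move=> k; rewrite toC_null // => w m _; rewrite HC0. Qed.

Let cB (i : nat -> nat) (phi phi' : dsum (fun k => cochain X (i k))) psi psi' :
  corresponds phi psi -> corresponds phi' psi' -> corresponds (phi - phi') (psi - psi').
Proof.
by move=> h h'; rewrite addrC -scaleN1r [psi - _]addrC -scaleN1r; exact: corresponds_lin.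
Qed.

Let c_inj (phi : CP) psi psi' : parity_cochain b psi -> parity_cochain b psi' ->
  corresponds phi psi -> corresponds phi psi' -> psi = psi'.
Proof.
move=> h h' c c'; apply/eqP; rewrite -subr_eq0; apply/eqP.
apply: (corresponds_null ek); last by rewrite -(subrr phi); exact: cB.
by rewrite addrC -scaleN1r; exact: parity_lin.
Qed.

(** Two cochains are related if a truncated form represents the first and its transport represents
    the second. *)
Let Rl (x x' : CP) := exists psi, [/\ truncated n A b psi, corresponds x psi &
  corresponds x' (Phi b psi)].

Let gf0 (B : algebra X) (d1' : {linear CP' -> CP}) (d0' : {linear CP -> CP'}) :
  (forall phi psi, corresponds phi psi -> corresponds (d1' phi) (mixedD B psi)) ->
  (forall phi psi, corresponds phi psi -> corresponds (d0' phi) (mixedD B psi)) ->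
  forall u, d0' (d1' u) = 0.
Proof.
move=> h1 h0 u; have [om _ cu] := corresponds_finite eb' ek' eh' u.
by have := h0 _ _ (h1 _ _ cu); rewrite mixedDD => /c_fun; apply.
Qed.

Let closed_of (B : algebra X) (d0' : {linear CP -> CP'}) x psi :
  (forall phi psi, corresponds phi psi -> corresponds (d0' phi) (mixedD B psi)) ->
  finite_cochain b psi -> corresponds x psi -> d0' x = 0 -> mixedD B psi = 0.
Proof.
move=> h [fp _] c dx; apply: (corresponds_null ek'); first exact: parity_mixedD.
by rewrite -dx; exact: h.
Qed.

Let dg0 : supp (fun k => k <= n)%N (0 : E).
Proof. by move=> w m _; rewrite HC0. Qed.

(** [reduction] replaces a cocycle by a truncated one, so the relation is total up to coboundaries;
    transport commutes with the differentials, so it matches cocycles with cocycles and coboundaries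
    with coboundaries. *)
Lemma cohomology_iso : lin_iso (cohomology dB dF) (cohomology dB' dF').
Proof.
apply: (@lin_iso_of_relation _ _ _ _ _ _ _ dB dF dB' dF' (gf0 hB hF) (gf0 hB' hF') Rl).
- move=> a x y x' y' [p [tp c1 c2]] [p' [tp' c1' c2']]; exists (a *: p + p').
  have [_ _ h _] := hPhi b; rewrite h //; split; first exact: truncated_lin.
    exact: corresponds_lin.
  exact: corresponds_lin.
- move=> x dx; have [psi fp c] := corresponds_finite eb ek eh x.
  have Dp := closed_of hF fp c dx.
  have [|om fo tp] := reduction hD fp; first by rewrite Dp.
  have [u cu] := finite_corresponds e_ge' fo.
  have [x' cx'] := finite_corresponds e_ge (truncated_finite (Phi_T tp)).
  exists u, x'; split.
    by exists (psi - mixedD A om); split=> //; apply: cB c _; exact: hB.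
  have := hF' cx'; rewrite Phi_D // DB Dp mixedDD subr0 Phi0 => /c_fun.
  by apply.
- move=> x dx; have [psi fp c] := corresponds_finite eb ek eh x.
  have Dp := closed_of hF' fp c dx.
  have [|om fo tp] := reduction hD' fp; first by rewrite Dp.
  have [u cu] := finite_corresponds e_ge' fo.
  have tq := Psi_T tp.
  have [x' cx'] := finite_corresponds e_ge (truncated_finite tq).
  exists u, x'; split.
    exists (Psi b (psi - mixedD A' om)); split=> //; rewrite PsiK //.
    by apply: cB c _; exact: hB'.
  have := hF cx'.
  have -> : mixedD A (Psi b (psi - mixedD A' om)) = 0.
    rewrite -(PhiK (T_D tq)) -Phi_D // PsiK // DB Dp mixedDD subr0.
    by have := PhiK (T0 A (~~ b)); rewrite Phi0.
  by move=> /c_fun; apply.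
move=> x x' [psi [tp c c']]; have [par_p dgp _] := tp.
have [par_q dgq _] := Phi_T tp; split.
- move=> [u xu]; have [om fo co] := corresponds_finite eb' ek' eh' u.
  have po : parity_cochain b (mixedD A om).
    by have [po _] := fo; have := parity_mixedD A po; rewrite negbK.
  have ep : psi = mixedD A om.
    by apply: (c_inj par_p po c); rewrite xu; exact: hB.
  (* The primitive [om] may have high degree, but its boundary [psi] is truncated; so
     [om - mixedD A chi] is a truncated primitive of the same [psi] and can be transported. *)
  have [|chi _ t1] := reduction hD fo; first by rewrite -ep.
  have [u' cu'] := finite_corresponds e_ge' (truncated_finite (Phi_T t1)).
  exists u'; apply: (c_fun c').
  have := hB' cu'; rewrite Phi_D // DB mixedDD subr0 -ep negbK.
  exact.
move=> [u xu]; have [om fo co] := corresponds_finite eb' ek' eh' u.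
have po : parity_cochain b (mixedD A' om).
  by have [po _] := fo; have := parity_mixedD A' po; rewrite negbK.
have ep : Phi b psi = mixedD A' om.
  by apply: (c_inj par_q po c'); rewrite xu; exact: hB'.
have [|chi _ t1] := reduction hD' fo; first by rewrite -ep.
have t2 := Psi_T t1.
have [u' cu'] := finite_corresponds e_ge' (truncated_finite t2).
exists u'; apply: (c_fun c); have := hB cu'.
have td : truncated n A b (mixedD A (Psi (~~ b) (om - mixedD A' chi))).
  by have := T_D t2; rewrite negbK.
have e1 : Phi b (mixedD A (Psi (~~ b) (om - mixedD A' chi))) = Phi b psi.
  by have := Phi_D t2; rewrite negbK PsiK // => <-; rewrite DB mixedDD subr0 ep.
by rewrite -(PhiK td) e1 (PhiK tp).
Qed.

End OneParity.

Let double_ge k : (k <= k.*2)%N. Proof. by rewrite -addnn leq_addr. Qed.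
Let half_even k : odd k = false -> k./2.*2 = k.
Proof. by move=> h; rewrite -[RHS]odd_double_half h. Qed.
Let half_odd k : odd k = true -> k./2.*2.+1 = k.
Proof. by move=> h; rewrite -[RHS]odd_double_half h. Qed.
Let halfS k : (k.*2.+1)./2 = k. Proof. exact: uphalf_double. Qed.
Let oddS k : odd k.*2.+1 = true. Proof. by rewrite /= odd_double. Qed.

Theorem HP_iso_of_truncated : HP_iso A' A.
Proof.
have sym (K : fieldType) (U W : lmodType K) : lin_iso U W -> lin_iso W U.
  move=> [f [g gK fK]]; have gl : linear g.
    by move=> a x y; rewrite -[LHS](gK) -{1}(fK x) -{1}(fK y) -linearP !gK.
  pose Fl := GRing.isLinear.Build K W U *:%R g gl.
  by exists (HB.pack g Fl : {linear W -> U}), f.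
split; apply: sym.
  apply: (@cohomology_iso double (fun k => k.*2.+1) false odd_double half_even doubleK double_ge
    oddS half_odd halfS (fun k => leqW (double_ge k)) (d1 A) (d1 A') (d0 A) (d0 A')).
  - exact: corresponds_d1.
  - exact: corresponds_d1.
  - exact: corresponds_d0.
  - exact: corresponds_d0.
apply: (@cohomology_iso (fun k => k.*2.+1) double true oddS half_odd halfS
  (fun k => leqW (double_ge k)) odd_double half_even doubleK double_ge
  (d0 A) (d0 A') (d1 A) (d1 A')).
- exact: corresponds_d0.
- exact: corresponds_d0.
- exact: corresponds_d1.
- exact: corresponds_d1.
Qed.

End HPiso.

(** * From smoothness to Lipschitz bounds on the products *)

Section MeanValue.
Variables (R : realType) (Y : normedModType R[i]).
Local Notation C := R[i].

Lemma diff_quotient_near (f : R -> Y) (l : Y) u e : 0 < e ->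
  diff_quotient f u h @[h --> 0^'] --> l ->
  exists2 d : R, 0 < d & forall y, `|y - u| < d -> nrm (f y - f u) <= (nrm l + e) * `|y - u|.
Proof.
move=> e0 /cvgrPdist_lt /(_ e%:C).
rewrite -[0]/(0%:C) ltcR => /(_ e0).
rewrite near_withinE => /nbhs_ballP[d /= d0 h]; exists d => // y yd.
have [->|yu] := eqVneq y u; first by rewrite !subrr nrm0 normr0 mulr0.
have yu0 : y - u != 0 by rewrite subr_eq0.
have := h (y - u); rewrite /ball /= sub0r normrN => /(_ yd yu0).
rewrite /diff_quotient [u + _]addrC subrK nrmE ltcR => hlt; rewrite nrmBC in hlt.
have n0 : 0 < `|y - u| by rewrite normr_gt0.
rewrite -ler_pdivrMr //.
have -> : nrm (f y - f u) / `|y - u| = nrm (((y - u)^-1)%:C *: (f y - f u)).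
  by rewrite nrmZ cn_real normfV mulrC.
set z := _ *: _ in hlt *; have -> : z = (z - l) + l by rewrite subrK.
by apply: le_trans (nrmD _ _) _; rewrite addrC lerD2l ltW.
Qed.

(** Continuous induction with the slope relaxed to [M + e]: let u be the supremum of the points up
    to which the estimate holds. It holds at u, and the derivative at u extends it beyond u unless u
    = b. *)
Lemma mean_value (f : R -> Y) a b M : a <= b ->
  (forall u, a <= u <= b -> exists2 l, nrm l <= M & diff_quotient f u h @[h --> 0^'] --> l) ->
  nrm (f b - f a) <= M * (b - a).
Proof.
move=> ab hf; apply/ler_addgt0Pr => e0' e0'0.
(* The summand 1 keeps the quotient meaningful when a = b and still gives [e * (b - a) <= e0']. *)
pose e := e0' / (b - a + 1).
have ba0 : 0 < b - a + 1 by rewrite ltr_wpDl // subr_ge0.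
have e0 : 0 < e by rewrite divr_gt0.
apply: (@le_trans _ _ ((M + e) * (b - a))); last first.
  rewrite mulrDl lerD2l /e mulrAC ler_pdivrMr // ler_pM2l //; lra.
have M0 : 0 <= M.
  by have [|l lM _] := hf a; [rewrite lexx|exact: le_trans (nrm_ge0 _) lM].
have loc u : a <= u <= b -> exists2 d : R, 0 < d &
    forall y, `|y - u| < d -> nrm (f y - f u) <= (M + e) * `|y - u|.
  move=> hu; have [l lM hl] := hf u hu; have [d d0 hd] := diff_quotient_near e0 hl.
  exists d => // y yd; apply: le_trans (hd y yd) _.
  by rewrite ler_wpM2r // lerD2r.
pose S := [set x | a <= x <= b /\ forall y, a <= y <= x -> nrm (f y - f a) <= (M + e) * (y - a)].
have Sa : S a.
  split=> [|y /andP[ay ya]]; first by rewrite lexx.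
  by rewrite (@le_anti _ _ y a) ?ay ?ya // !subrr nrm0 mulr0.
have Sb : has_sup S by split; [exists a|exists b => x [/andP[_ xb] _]].
have [ub_S _] := Sb; set u := sup S.
have au : a <= u by apply: sup_ubound => //; case: Sb.
have ub : u <= b by apply: ge_sup => // x [/andP[_ xb] _].
have ab_u : a <= u <= b by rewrite au ub.
have [d d0 hd] := loc u ab_u.
have below y : a <= y -> y < u -> nrm (f y - f a) <= (M + e) * (y - a).
  move=> ay yu; have yu0 : 0 < u - y by rewrite subr_gt0.
  have [x [_ Sx]] := sup_adherent yu0 Sb; rewrite -/u opprB addrC subrK => yx.
  by apply: Sx; rewrite ay ltW.
have at_u : nrm (f u - f a) <= (M + e) * (u - a).
  have [x [/andP[ax xb] Sx]] := sup_adherent d0 Sb; rewrite -/u => ux.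
  have xu : x <= u by apply: sup_ubound; [case: Sb|split; rewrite ?ax].
  have -> : f u - f a = (f u - f x) + (f x - f a) by rewrite addrA subrK.
  apply: le_trans (nrmD _ _) _.
  have h1 := Sx x; rewrite ax lexx in h1.
  have h2 := hd x; rewrite distrC ger0_norm ?subr_ge0 // in h2.
  have {}h1 := h1 isT; have {}h2 : nrm (f x - f u) <= (M + e) * (u - x) by apply: h2; lra.
  by rewrite nrmBC; apply: le_trans (lerD h2 h1) _; rewrite -mulrDr; lra.
pose z := Num.min b (u + d / 2).
have uz : u <= z by rewrite le_min ub lerDl divr_ge0 // ltW.
have Sz : S z.
  split=> [|y /andP[ay yz]]; first by rewrite (le_trans au uz) ge_min lexx.
  have [yu|uy] := ltP y u; first exact: below.
  have -> : f y - f a = (f y - f u) + (f u - f a) by rewrite addrA subrK.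
  apply: le_trans (nrmD _ _) _.
  have yd : y <= u + d / 2 by apply: le_trans yz _; rewrite ge_min lexx orbT.
  have h2 := hd y; rewrite ger0_norm ?subr_ge0 // in h2.
  have {}h2 : nrm (f y - f u) <= (M + e) * (y - u) by apply: h2; lra.
  by apply: le_trans (lerD h2 at_u) _; rewrite -mulrDr; lra.
have zu : z <= u by apply: sup_ubound => //; case: Sb.
have bu : b = u.
  apply/eqP; rewrite eq_le ub andbT; move: zu; rewrite /z ge_min => /orP[//|].
  by rewrite gerDl leNgt divr_gt0.
by rewrite bu.
Qed.

End MeanValue.

Section Lipschitz.
Variables (R : realType) (X : completeNormedModType R[i]).
Local Notation C := R[i].

(** Both arguments are rescaled to norm [d / 2], strictly inside the ball, and bilinearity undoes
    the scaling. *)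
Lemma bmul_of_local (G : X -> X -> X) (d M : R) : bilin G -> 0 < d -> 0 <= M ->
  (forall a b, nrm a < d -> nrm b < d -> nrm (G a b) <= M) -> bmul G ((2 / d) ^+ 2 * M).
Proof.
move=> lG d0 M0 h a b.
have G0l z : G 0 z = 0.
  by have := (lG (-1) 0 0 z).1; rewrite scaler0 addr0 scaleN1r addNr.
have G0r z : G z 0 = 0.
  by have := (lG (-1) 0 0 z).2; rewrite scaler0 addr0 scaleN1r addNr.
have GZl x y z : G (x *: y) z = x *: G y z.
  by have := (lG x y 0 z).1; rewrite !addr0 G0l addr0.
have GZr x y z : G z (x *: y) = x *: G z y.
  by have := (lG x y 0 z).2; rewrite !addr0 G0r addr0.
have [->|a0] := eqVneq a 0; first by rewrite G0l nrm0 mul0r mulr0.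
have [->|b0] := eqVneq b 0; first by rewrite G0r nrm0 !mulr0.
have pos (x : X) : x != 0 -> 0 < nrm x.
  by move=> x0; rewrite lt_def nrm_ge0 andbT; apply: contraNneq x0 => /nrm0_eq0 ->.
have na := pos a a0; have nb := pos b b0.
pose sa := d / 2 / nrm a; pose sb := d / 2 / nrm b.
have sa0 : 0 < sa by rewrite !divr_gt0. have sb0 : 0 < sb by rewrite !divr_gt0.
have small (x : X) : 0 < nrm x -> nrm ((d / 2 / nrm x)%:C *: x) < d.
  move=> nx; rewrite nrmZ cn_real ger0_norm ?divr_ge0 ?ltW ?divr_gt0 //.
  by rewrite divfK ?gt_eqF //; lra.
have := h _ _ (small a na) (small b nb).
rewrite GZl GZr !nrmZ !cn_real -/sa -/sb (ger0_norm (ltW sa0)) (ger0_norm (ltW sb0)) => hM.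
have -> : (2 / d) ^+ 2 * M * (nrm a * nrm b) = M / (sa * sb).
  by rewrite /sa /sb; field; rewrite ?gt_eqF.
by rewrite (ler_pdivlMr _ _ (mulr_gt0 sa0 sb0)) mulrC -mulrA.
Qed.

End Lipschitz.

Section Smooth.
Variables (R : realType) (X : completeNormedModType R[i]).
Variables (J : set R) (A_ : R -> algebra X).
Hypothesis hA : smooth_deformation J A_.

(** Continuity at the origin of the map from pairs to their curves of products, for uniform
    convergence of the [k]-th derivative on [K], tested with the ball of radius 1. *)
Lemma smooth_uniform k (K : set R) : compact K -> K `<=` J ->
  exists2 d : R, 0 < d & forall a b t, nrm a < d -> nrm b < d -> K t ->
    nrm (iter k (@rderive R X) (fun s => A_ s a b) t -
         iter k (@rderive R X) (fun s => A_ s 0 0) t) <= 1.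
Proof.
move=> cK KJ; have [_ /(_ k) hc] := hA.
pose fam := fun K : set R => compact K /\ K `<=` J.
pose g : {family fam, R -> X} := iter k (@rderive R X) (fun s => A_ s 0 0).
have e1 : entourage [set xy : X * X | ball xy.1 (1 : R[i]) xy.2].
  exact: (@entourage_ball _ X (PosNum ltr01)).
have hfam : fam K by [].
have := hc (0, 0) _ (fam_nbhs g e1 hfam); case=> -[U V] /= [] .
move=> /nbhs_ballP[d1 d10 hU] /nbhs_ballP[d2 d20 hV] hUV.
have real_pos (z : R[i]) : 0 < z -> exists2 d : R, 0 < d & d%:C <= z.
  move=> z0; exists (complex.Re z); last by rewrite RRe_real // gtr0_real.
  by rewrite -ltcR RRe_real ?gtr0_real.
have [e1' e10 he1] := real_pos _ d10; have [e2' e20 he2] := real_pos _ d20.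
exists (Num.min e1' e2'); first by rewrite lt_min e10.
move=> a b t; rewrite !lt_min => /andP[a1 _] /andP[_ b2] Kt.
have h1 : `|a| < d1 by apply: lt_le_trans he1; rewrite nrmE ltcR.
have h2 : `|b| < d2 by apply: lt_le_trans he2; rewrite nrmE ltcR.
have := hUV (a, b); rewrite /= => /(_ (conj (hU a _) (hV b _)) t Kt).
rewrite -!ball_normE /= !sub0r !normrN => /(_ h1 h2).
by rewrite nrmE -[1]/(1%:C) ltcR nrmBC => /ltW.
Qed.

(** The case [k = 0] of [smooth_uniform] bounds the products for small arguments, the case [k = 1]
    their derivatives in t. The mean value inequality turns the latter into a Lipschitz estimate,
    and scaling extends both to all arguments. *)
Lemma smooth_bounds (r : R) : (forall t, `|t| <= r -> J t) ->
  exists kA c : R, [/\ 0 <= kA, 0 <= c, forall t, `|t| <= r -> bmul (A_ t) kA &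
    forall s t, `|s| <= r -> `|t| <= r ->
      bmul (fun a b => A_ s a b - A_ t a b) (c * `|s - t|)].
Proof.
move=> rJ.
have KE t : `[- r, r]%classic t = (`|t| <= r) :> Prop.
  by rewrite /= in_itv /= ler_norml.
have KJ : `[- r, r]%classic `<=` J by move=> t; rewrite KE; exact: rJ.
have [d0 d00 h0] := smooth_uniform 0 (@segment_compact _ (- r) r) KJ.
have [d1 d10 h1] := smooth_uniform 1 (@segment_compact _ (- r) r) KJ.
exists ((2 / d0) ^+ 2 * 1), ((2 / d1) ^+ 2); split.
- by rewrite mulr_ge0 // exprn_ge0 // divr_ge0 // ltW.
- by rewrite exprn_ge0 // divr_ge0 // ltW.
- move=> t tr; apply: bmul_of_local => //; first exact: alg_bilin.
  move=> a b ad bd; have := h0 a b t ad bd; rewrite KE => /(_ tr) /=.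
  by rewrite alg0l subr0.
have der0 t : rderive (fun s => A_ s 0 0) t = 0.
  have -> : (fun s => A_ s 0 0) = fun=> 0 by apply/funext => s; rewrite alg0l.
  rewrite /rderive; have -> : diff_quotient (fun=> 0 : X) t = fun=> 0.
    by apply/funext => h; rewrite /diff_quotient subrr scaler0.
  apply: cvg_lim; [exact: norm_hausdorff|exact: cvg_cst].
have mv a b s t : nrm a < d1 -> nrm b < d1 -> `|s| <= r -> `|t| <= r -> s <= t ->
    nrm (A_ t a b - A_ s a b) <= `|s - t|.
  move=> ad bd sr tr st; rewrite distrC ger0_norm ?subr_ge0 // -[leRHS]mul1r.
  apply: (mean_value (f := fun s => A_ s a b) st) => u /andP[su ut].
  have ur : `|u| <= r.
    move: sr tr; rewrite !ler_norml => /andP[s1 _] /andP[_ t1].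
    by rewrite (le_trans s1 su) (le_trans ut t1).
  exists (rderive (fun s => A_ s a b) u).
    by have := h1 a b u ad bd; rewrite KE => /(_ ur) /=; rewrite der0 subr0.
  exact: (hA.1 (a, b) 0%N u (rJ u ur)).
move=> s t sr tr; apply: bmul_of_local => //.
  exact: (mul_diff_bilin (A_ t) (A_ s)).
move=> a b ad bd; have [st|/ltW ts] := leP s t.
  by rewrite nrmBC; exact: mv.
by rewrite distrC; exact: mv.
Qed.

End Smooth.

(** * Assembly of the proof *)

Lemma algebra_ext (R : realType) (X : completeNormedModType R[i]) (A B : algebra X) :
  (forall a b, A a b = B a b) -> A = B.
Proof.
case: A B => [m1 p1 a1] [m2 p2 a2] /= h.
have e : m1 = m2 by apply/funext => a; apply/funext => b; exact: h.
by subst m2; congr Algebra; exact: Prop_irrelevance.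
Qed.

Theorem theorem8p6 (R : realType) (X : completeNormedModType R[i])
    (A : algebra X) (hA : banach_algebra A)
    (hdb : (weak_bidim A < +oo)%E) :
  HP_rigid A.
Proof.
(* The ratio that [sewing] requires for the convergence of the products. *)
have hq : 13 / 16 < 1 :> R by rewrite ltr_pdivrMr // mul1r ltr_nat.
move=> J A_ [oJ _] J0 hdef /algebra_ext h0; subst A.
(* An infimum below infinity provides some [N] for which the cohomology in degree [N + 1] vanishes
   for all dual coefficients. *)
have /ereal_inf_lt[_ [N /= hN <-] _] := hdb.
have [r0 /= r00 hr0] : \forall t \near (0 : R), J t by exact: oJ.
pose r := r0 / 2; have r_gt0 : 0 < r by rewrite divr_gt0.
have rJ t : `|t| <= r -> J t.
  move=> tr; apply: hr0; rewrite /= sub0r normrN (le_lt_trans tr) //.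
  by rewrite /r; lra.
have [kA [c [kA0 c0 HA HL]]] := smooth_bounds hdef rJ.
(* The vanishing is used once, for the dual of the universal bimodule of [A_ 0] in degree [N.+1];
   this bimodule is complete, hence admissible. *)
have [D0 hD0] : exists D0 : HC X (FL X (aplus X) N.+1), forall w v, size w = N.+1 ->
    val (delta (univ_bimodule (A_ 0) N.+1) D0) w v = ev v w (unit_e X).
  apply: (exact_words (hN _ (univ_bimodule (A_ 0) N.+1)) (psi := univ X N.+1)).
  exact: delta_univ.
have [e1 [LD [D_ [/andP[e10 e1r] LD0 hD]]]] :=
  universal_primitive r_gt0 kA0 c0 HA HL hD0.
have tr (t : R) : `|t| <= e1 -> `|t| <= r by move=> h; exact: le_trans e1r.
(* From here on the radius is [e1], on which the primitives [D_ t] exist; the earlier bounds are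
   restricted to it. *)
have [e [/andP[e0 ee1] he]] := truncated_complexes hq (lexx _) e10 kA0 c0 LD0
  (fun t h => HA t (tr t h)) (fun s t h h' => HL s t (tr s h) (tr t h'))
  (fun t h => let: And3 x _ _ := hD t h in x)
  (fun t h => let: And3 _ x _ := hD t h in x)
  (fun s t h h' => let: And3 _ _ x := hD t h' in x s h).
exists `]- e, e[%classic; split.
- by split; [exact: interval_open|exact: interval_is_interval].
- by rewrite /= in_itv /= oppr_lt0 e0.
- move=> t; rewrite /= in_itv /= => te; apply/rJ/tr/(le_trans _ ee1)/ltW.
  by rewrite ltr_norml.
move=> t; rewrite /= in_itv /= -ltr_norml => /ltW te.
have [Phi [Psi hPhi]] := he t te.
have z1 : `|0 : R| <= e1 by rewrite normr0 ltW.
have [hDz _ _] := hD 0 z1; have [hDt _ _] := hD t (le_trans te ee1).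
exact: (HP_iso_of_truncated hDz hDt hPhi).
Qed.
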